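(* Two families of systems in prenormal form, $(x^2-\epsilon)y_i'=(\Lambda(\epsilon,x)+(x^2-\epsilon)R_i(\epsilon,x))y_i$, $i=1,2$, with the same model system $(x^2-\epsilon)z'=\Lambda(\epsilon,x)z$ (and $r$, then $\rho$, sufficiently small and common to both) are analytically equivalent if and only if their unfolded Stokes collections are equivalent. In particular, a family in prenormal form is analytically equivalent to its model if and only if its unfolded Stokes matrices are the identity.
   Context: Systems. A family in prenormal form is a family $(x^2-\epsilon)y'=B(\epsilon,x)y$, $y\in\mathbb{C}^n$, $n\ge2$, $'=d/dx$, with $B=\Lambda(\epsilon,x)+(x^2-\epsilon)R(\epsilon,x)$, $\Lambda(\epsilon,x)=\mathrm{diag}\{\lambda_1(\epsilon,x),\dots,\lambda_n(\epsilon,x)\}=\Lambda_0(\epsilon)+\Lambda_1(\epsilon)x$, $\Lambda_0,\Lambda_1$ diagonal and analytic in $\epsilon$ near $0$, $R$ a matrix of germs of analytic functions of $(\epsilon,x)$ at the origin, and $\Re(\lambda_q(0,0)-\lambda_j(0,0))>0$ for $q<j$. Model system: $(x^2-\epsilon)z'=\Lambda(\epsilon,x)z$. Parameter sector. Let $\theta_0$ be the largest angle (supremum) in $(0,\frac\pi2)$ with $\Re(e^{\pm i\theta_0}(\lambda_q(0,0)-\lambda_j(0,0)))\ge0$ for $q<j$. Fix $\gamma>0$ with $\gamma(1+\frac{2\gamma}{\pi})<\theta_0$ and let $S=\{\hat\epsilon:0<|\hat\epsilon|<\rho,\ \arg\hat\epsilon\in(\pi-2\gamma,3\pi+2\gamma)\}$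 (on the universal covering of $\mathbb{C}^*$; $\epsilon$ is the projection of $\hat\epsilon$). Put $\arg\sqrt{\hat\epsilon}=\frac12\arg\hat\epsilon$, $\hat x_L=\sqrt{\hat\epsilon}$, $\hat x_R=-\sqrt{\hat\epsilon}$. The radius $\rho>0$ is small, in particular so that for some $C>0$, $\Re(e^{\pm i\gamma(1+2\gamma/\pi)}(\lambda_q(\epsilon,\hat x_l)-\lambda_j(\epsilon,\hat x_l)))>C$ for $q<j$, $l=L,R$, $\hat\epsilon\in S$. $S_\cap$ is the auto-intersection of $S$: it consists of the pairs $\bar\epsilon$, $\tilde\epsilon=\bar\epsilon e^{2\pi i}$ both in $S$. A bar (resp. tilde) denotes the value at $\bar\epsilon$ (resp. $\tilde\epsilon$) of a quantity depending on $\hat\epsilon$. Sectorial domains. Fix $r>0$ small, $\mathbb{D}_r=\{|x|<r\}$, $\delta>0$ small, $\Omega_D=\{|x|<r,\,-(\pi+\delta)<\arg x<\delta\}$, $\Omega_U=\{|x|<r,\,-\delta<\arg x<\pi+\delta\}$, such that the closure of $\Omega_D$ (resp. $\Omega_U$) contains no ray $\Re((\lambda_q(0,0)-\lambda_j(0,0))/x)=0$, $q\ne j$, of the upper (resp. lower) half-plane. Use the time $t$ of $\dot x=x^2-\epsilon$: $x(t)=-\sqrt{\hat\epsilon}\coth(\sqrt{\hat\epsilon}\,t)$ if $\epsilon\neq0$ (period $\pi i/\sqrt{\hat\epsilon}$), $x(t)=-1/t$ if $\epsilon=0$. Fix small constants $c_0>0$, $h\in(0,1/r)$, $\kappa\in(0,\frac12)$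 independent of $\hat\epsilon$. Let $N_{\hat\epsilon}$ be the connected component containing $t=0$ of $\{t:|x(t)|\ge r\}$, $P=-\pi i/\sqrt{\hat\epsilon}$, $\hat\theta=\frac{2\gamma}{\pi}(\pi-\arg\sqrt{\hat\epsilon})$, and $\sigma(u)=0$ if $|u|\le c_0/\sqrt{|\epsilon|}$, $\sigma(u)=(u-\mathrm{sgn}(u)c_0/\sqrt{|\epsilon|})\tan\hat\theta$ otherwise. $\Gamma_D^{\hat\epsilon}$ is the set of $t\notin N_{\hat\epsilon}$ with $\Im t<h+\sigma(\Re t)$ lying above the line $-(\frac12+\kappa)P+\mathbb{R}e^{i\hat\theta}$; $\Gamma_U^{\hat\epsilon}$ is the set of $t\notin N_{\hat\epsilon}$ with $\Im t>-h+\sigma(\Re t)$ lying below the line $(\frac12+\kappa)P+\mathbb{R}e^{i\hat\theta}$. $\Omega_s^{\hat\epsilon}=x(\Gamma_s^{\hat\epsilon})$, $s=D,U$. $\Omega_D^{\hat\epsilon}\cap\Omega_U^{\hat\epsilon}$ has three connected components $\Omega_L^{\hat\epsilon},\Omega_R^{\hat\epsilon},\Omega_C^{\hat\epsilon}$, images of the right and left components of $\Gamma_D^{\hat\epsilon}\cap\Gamma_U^{\hat\epsilon}$ and of $\Gamma_D^{\hat\epsilon}\cap(\Gamma_U^{\hat\epsilon}-P)$; their closures contain respectively $\hat x_L$, $\hat x_R$, and both; $0\in\Omega_C^{\hat\epsilon}$. Model solutions. For $l=L,R$, $\mathcal U_l=\frac1{2\hat x_l}\Lambda(\epsilon,\hat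 x_l)$. $F(\epsilon,x)=(x-\hat x_R)^{\mathcal U_R}(x-\hat x_L)^{\mathcal U_L}$ is a fundamental matrix of the model. $F_D(\hat\epsilon,\cdot)$ is its branch on $\Omega_D^{\hat\epsilon}$ (namely $e^{t\Lambda_0}(x^2-\epsilon)^{\Lambda_1/2}$ with $x=x(t)$, $t\in\Gamma_D^{\hat\epsilon}$, converging as $\hat\epsilon\to0$ to $x^{\Lambda_1(0)}e^{-\Lambda_0(0)/x}$ with $-(\pi+\delta)<\arg x<\delta$), and $F_U(\hat\epsilon,\cdot)$ is the analytic continuation of $F_D$ to $\Omega_U^{\hat\epsilon}$ through $\Omega_R^{\hat\epsilon}$. Unfolded Stokes matrices. $H_s(\hat\epsilon,x)$, $s=D,U$, are matrices, analytic for $\hat\epsilon\in S$, $x\in\Omega_s^{\hat\epsilon}$, such that $W_s=H_sF_s$ is a fundamental matrix of solutions of the family on $\Omega_s^{\hat\epsilon}$; $\lim_{x\to\hat x_l,x\in\Omega_s^{\hat\epsilon}}H_s(\hat\epsilon,x)$ ($l=L,R$) is an invertible diagonal matrix independent of $s$, analytic in $\hat\epsilon\in S$ with nonsingular limit at $\epsilon=0$; $|H_s(\bar\epsilon,0)-H_s(\tilde\epsilon,0)|\le c|\bar\epsilon|$ on $S_\cap$ for some $c\ge0$; and $|H_s(\hat\epsilon,0)|$, $|H_s(\hat\epsilon,0)^{-1}|$ are bounded on $S_\cap$ (such matrices exist). The unfolded Stokes matrices $\hat C_R$ (upper triangular unipotent) and $\hat C_L$ (lower triangular unipotent) are defined by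 $H_D^{-1}H_U=F_D\hat C_RF_D^{-1}$ on $\Omega_R^{\hat\epsilon}$, $H_D^{-1}H_U=F_D\hat C_LF_D^{-1}$ on $\Omega_L^{\hat\epsilon}$ (and $H_D^{-1}H_U=I$ on $\Omega_C^{\hat\epsilon}$); $\{\hat C_R,\hat C_L\}$ is an unfolded Stokes collection of the family. Equivalence of collections. $\{\hat C_R,\hat C_L\}$ and $\{\hat C_R',\hat C_L'\}$ are equivalent if $\hat C_l'=\hat K\hat C_l\hat K^{-1}$, $l=L,R$, for some nonsingular diagonal matrix $\hat K$ depending analytically on $\hat\epsilon\in S$, with a nonsingular limit at $\epsilon=0$, and such that $|\bar K-\tilde K|\le c|\bar\epsilon|$ over $S_\cap$ for some $c\in\mathbb{R}_+$. Two families are (locally) analytically equivalent if an invertible matrix $P_1(\epsilon,x)$ of germs of analytic functions of $(\epsilon,x)$ at the origin exists such that $y=P_1(\epsilon,x)z$ transforms one into the other. *)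

(* Defs.v *)
From HB Require Import structures.
From mathcomp Require Import all_boot all_order all_algebra complex.
From mathcomp Require Import all_classical all_reals.
From mathcomp Require Import topology normedtype sequences derive exp trigo.

Set Implicit Arguments.
Unset Strict Implicit.
Unset Printing Implicit Defensive.

Import Order.TTheory GRing.Theory Num.Theory.
Import numFieldNormedType.Exports.

Local Open Scope classical_set_scope.
Local Open Scope ring_scope.
Local Open Scope complex_scope.

(* The library puts its norm topology on abstract closed fields and on the
   alias [R[i]^o]; it is transferred here to [R[i]] itself.  Matrices over
   [R[i]] and pairs then inherit their normed-module structures. *)
HB.instance Definition _ (R : realType) := NormedModule.copy R[i] R[i]^o.

Section ComplexAnalysis.
Variable R : realType.
Local Notation C := R[i].

Definition cexp (z : C) : C :=
  (expR (complex.Re z) * cos (complex.Im z))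
  +i* (expR (complex.Re z) * sin (complex.Im z)).

Definition ccosh (z : C) : C := (cexp z + cexp (- z)) / 2.
Definition csinh (z : C) : C := (cexp z - cexp (- z)) / 2.

Definition polar (m a : R) : C := (m * cos a) +i* (m * sin a).

(* Analyticity of functions of one or several complex variables:
   [differentiable] is Frechet differentiability over the field R[i]. *)
Definition analytic_at (V W : normedModType C) (f : V -> W) (p : V) : Prop :=
  \forall q \near p, differentiable f q.

Definition analytic_on (V W : normedModType C) (U : set V) (f : V -> W) : Prop :=
  forall p, U p -> analytic_at f p.

Definition analytic_germ2 (W : normedModType C) (f : C -> C -> W) : Prop :=
  analytic_at (fun p : C * C => f p.1 p.2) ((0, 0) : C * C).

End ComplexAnalysis.

Section Systems.
Variables (R : realType) (n : nat).
Local Notation C := R[i].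

(* A system (x^2 - eps) y' = B(eps, x) y is represented by B.  The functions
   [L0], [L1] give the diagonals of Lambda_0(eps), Lambda_1(eps). *)
Definition lam (L0 L1 : C -> 'rV[C]_n) (e x : C) : 'rV[C]_n := L0 e + x *: L1 e.

Definition model_system (L0 L1 : C -> 'rV[C]_n) (e x : C) : 'M[C]_n :=
  diag_mx (lam L0 L1 e x).

Definition prenormal (L0 L1 : C -> 'rV[C]_n) (Rm : C -> C -> 'M[C]_n) (e x : C) :
    'M[C]_n :=
  model_system L0 L1 e x + (x ^+ 2 - e) *: Rm e x.

(* lambda_q(0,0) - lambda_j(0,0) *)
Definition gap0 (L0 L1 : C -> 'rV[C]_n) (q j : 'I_n) : C :=
  lam L0 L1 0 0 ord0 q - lam L0 L1 0 0 ord0 j.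

Definition prenormal_model (L0 L1 : C -> 'rV[C]_n) : Prop :=
  [/\ analytic_at L0 0, analytic_at L1 0 &
      forall q j : 'I_n, (q < j)%N -> 0 < complex.Re (gap0 L0 L1 q j)].

(* y = P z carries (x^2 - e) z' = B z into the system with matrix
   (x^2 - e) P' P^-1 + P B P^-1. *)
Definition gauge (P B : C -> C -> 'M[C]_n) (e x : C) : 'M[C]_n :=
  ((x ^+ 2 - e) *: 'D_1 (P e) x + P e x *m B e x) *m invmx (P e x).

(* Invertibility over the ring of germs is invertibility at the origin. *)
Definition analytically_equivalent (B1 B2 : C -> C -> 'M[C]_n) : Prop :=
  exists P : C -> C -> 'M[C]_n,
    [/\ analytic_germ2 P, P 0 0 \in unitmx &
        \forall p \near ((0, 0) : C * C), gauge P B1 p.1 p.2 = B2 p.1 p.2].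

Definition fundamental_on (U : set C) (B : C -> C -> 'M[C]_n) (e : C)
    (W : C -> 'M[C]_n) : Prop :=
  forall x, U x -> [/\ W x \in unitmx, derivable W x 1 &
                       (x ^+ 2 - e) *: 'D_1 W x = B e x *m W x].

End Systems.

Inductive side := Down | Up.
Inductive node := Left | Right.

(* [rho] and [delta] are the radius of S and the overlap angle of the sectors
   Omega_D, Omega_U; [c0], [h], [kappa] enter the domains Gamma_s. *)
Record geometry (R : realType) := Geometry {
  gamma : R; rad : R; delta : R; kappa : R; c0 : R; h : R; rho : R }.

Section Geometry.
Variables (R : realType) (G : geometry R).
Local Notation C := R[i].

(* The universal covering of C^* is exp : C -> C^*.  A point of the covering
   is given by its logarithm w : |eps| = e^(Re w), arg eps = Im w, and
   analyticity in eps-hat is analyticity in w. *)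
Definition eps (w : C) : C := cexp w.
Definition abs_eps (w : C) : R := expR (complex.Re w).
Definition arg_eps (w : C) : R := complex.Im w.
Definition sqrt_eps (w : C) : C := cexp (w / 2).
Definition arg_sqrt_eps (w : C) : R := arg_eps w / 2.

Definition xhat (l : node) (w : C) : C :=
  if l is Left then sqrt_eps w else - sqrt_eps w.

Definition param_sector : set C :=
  [set w | abs_eps w < rho G /\
           pi - 2 * gamma G < arg_eps w < 3 * pi + 2 * gamma G].

Definition tilde (w : C) : C := w + (0 +i* (2 * pi)).

(* The points w = bar-eps, with [tilde w] the other element of the pair. *)
Definition S_cap : set C := [set w | param_sector w /\ param_sector (tilde w)].

(* eps-hat -> 0 within S *)
Definition S_to0 : set_system C :=
  filter_from [set d : R | 0 < d]
              (fun d => [set w | param_sector w /\ abs_eps w < d]).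

(* Only meaningful off the poles, where csinh vanishes. *)
Definition xt (w t : C) : C :=
  - sqrt_eps w * (ccosh (sqrt_eps w * t) / csinh (sqrt_eps w * t)).

(* The poles of x(t), where |x(t)| is infinite, are added explicitly because
   division by 0 yields 0 in [xt]. *)
Definition hole (w : C) : set C :=
  connected_component
    [set t | csinh (sqrt_eps w * t) = 0 \/ (rad G)%:C <= `|xt w t|] 0.

Definition period (w : C) : C := - (0 +i* pi) / sqrt_eps w.

Definition theta_hat (w : C) : R :=
  2 * gamma G / pi * (pi - arg_sqrt_eps w).

Definition sigma (w : C) (u : R) : R :=
  let b := c0 G / Num.sqrt (abs_eps w) in
  if `|u| <= b then 0 else (u - Num.sg u * b) * tan (theta_hat w).

(* Position relative to the line p + R e^(i theta_hat), which is not vertical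
   since |theta_hat| < pi/2. *)
Definition above (w p t : C) : Prop :=
  tan (theta_hat w) * complex.Re (t - p) < complex.Im (t - p).
Definition below (w p t : C) : Prop :=
  complex.Im (t - p) < tan (theta_hat w) * complex.Re (t - p).

Definition Gamma (s : side) (w : C) : set C :=
  let q := (2^-1 + kappa G)%:C * period w in
  match s with
  | Down => [set t | [/\ ~ hole w t,
      complex.Im t < h G + sigma w (complex.Re t) & above w (- q) t]]
  | Up => [set t | [/\ ~ hole w t,
      - h G + sigma w (complex.Re t) < complex.Im t & below w q t]]
  end.

Definition Omega (s : side) (w : C) : set C := xt w @` Gamma s w.

(* Omega_L (resp. Omega_R) comes from the right (resp. left) component of
   Gamma_D `&` Gamma_U.  Since h < 1/r, the part of the strip near Re t = 0
   lies in [hole], so the sign of Re t separates the two components. *)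
Definition Omega_node (l : node) (w : C) : set C :=
  xt w @` (Gamma Down w `&` Gamma Up w `&`
    [set t | if l is Left then 0 < complex.Re t else complex.Re t < 0]).

Definition Omega_center (w : C) : set C :=
  xt w @` (Gamma Down w `&` [set t | Gamma Up w (t + period w)]).

Definition sector (r a b : R) : set C :=
  [set x | exists m t : R, [/\ 0 < m < r, a < t < b & x = polar m t]].

(* [l w t] is the branch of 1/2 log (x(t)^2 - eps) on Gamma_D, which tends to
   log x, x = -1/t, with -(pi + delta) < arg x < delta, as eps-hat -> 0;
   at eps = 0, Gamma_D is given by |t| > 1/r and Im t < h. *)
Definition log_branch (l : C -> C -> C) : Prop :=
  [/\ {within [set p : C * C | param_sector p.1 /\ Gamma Down p.1 p.2],
         continuous (fun p : C * C => l p.1 p.2)},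
      (forall w t, param_sector w -> Gamma Down w t ->
         cexp (2 * l w t) = xt w t ^+ 2 - eps w) &
      (forall m a : R, 0 < m < rad G -> - (pi + delta G) < a < delta G ->
         complex.Im (- (polar m a)^-1) < h G ->
         l w (- (polar m a)^-1) @[w --> S_to0] --> (ln m +i* a : C))].

End Geometry.

Section Stokes.
Variables (R : realType) (n : nat) (G : geometry R).
Local Notation C := R[i].

(* F_D = e^(t Lambda_0) (x^2 - eps)^(Lambda_1 / 2), and F_U is its analytic
   continuation through Omega_R. *)
Definition model_solutions (L0 L1 : C -> 'rV[C]_n)
    (F : side -> C -> C -> 'M[C]_n) : Prop :=
  exists l : C -> C -> C,
  [/\ log_branch G l,
      (forall w t, param_sector G w -> Gamma G Down w t ->
         F Down w (xt w t) =
           diag_mx (\row_j cexp (t * L0 (eps w) ord0 j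
                                 + l w t * L1 (eps w) ord0 j))) &
      (forall w, param_sector G w ->
         analytic_on (Omega G Up w) (F Up w) /\
         forall x, Omega_node G Right w x -> F Up w x = F Down w x)].

Definition nonsingular_diag (d : C -> 'rV[C]_n) : Prop :=
  [/\ analytic_on (param_sector G) d,
      (forall w, param_sector G w -> diag_mx (d w) \in unitmx) &
      exists2 d0 : 'rV[C]_n, diag_mx d0 \in unitmx & d w @[w --> S_to0 G] --> d0].

Definition normalized (B : C -> C -> 'M[C]_n)
    (F H : side -> C -> C -> 'M[C]_n) : Prop :=
  [/\ (forall s, analytic_on
         [set p : C * C | param_sector G p.1 /\ Omega G s p.1 p.2]
         (fun p : C * C => H s p.1 p.2)),
      (forall s w, param_sector G w ->
         fundamental_on (Omega G s w) B (eps w) (fun x => H s w x *m F s w x)),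
      (forall l : node, exists2 d : C -> 'rV[C]_n, nonsingular_diag d &
         forall s w, param_sector G w ->
           H s w x @[x --> within (Omega G s w) (nbhs (xhat l w))]
             --> diag_mx (d w)),
      (forall s, exists2 c : R, 0 <= c & forall w, S_cap G w ->
         `|H s w 0 - H s (tilde w) 0| <= (c * abs_eps w)%:C) &
      (forall s, exists M : R, forall w v, S_cap G w -> v = w \/ v = tilde w ->
         H s v 0 \in unitmx /\
         (`|H s v 0| <= M%:C /\ `|invmx (H s v 0)| <= M%:C))].

Definition unipotent (l : node) (A : 'M[C]_n) : Prop :=
  (forall i, A i i = 1) /\
  (forall i j : 'I_n, (if l is Right then (j < i)%N else (i < j)%N) ->
     A i j = 0).

(* [Cst Right], [Cst Left] are the unfolded Stokes matrices C_R, C_L. *)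
Definition stokes_collection (B : C -> C -> 'M[C]_n)
    (F : side -> C -> C -> 'M[C]_n) (Cst : node -> C -> 'M[C]_n) : Prop :=
  exists2 H : side -> C -> C -> 'M[C]_n, normalized B F H &
  forall w, param_sector G w ->
  [/\ (forall l, unipotent l (Cst l w)),
      (forall l x, Omega_node G l w x ->
         invmx (H Down w x) *m H Up w x =
           F Down w x *m Cst l w *m invmx (F Down w x)) &
      (forall x, Omega_center G w x -> invmx (H Down w x) *m H Up w x = 1%:M)].

Definition equivalent_collections (C1 C2 : node -> C -> 'M[C]_n) : Prop :=
  exists k : C -> 'rV[C]_n,
  [/\ nonsingular_diag k,
      (exists2 c : R, 0 <= c & forall w, S_cap G w ->
         `|diag_mx (k w) - diag_mx (k (tilde w))| <= (c * abs_eps w)%:C) &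
      (forall l w, param_sector G w ->
         C2 l w = diag_mx (k w) *m C1 l w *m invmx (diag_mx (k w)))].

End Stokes.

Section Smallness.
Variables (R : realType) (n : nat) (L0 L1 : R[i] -> 'rV[R[i]]_n).
Local Notation C := R[i].

Definition theta0 : R :=
  sup [set a | 0 < a < pi / 2 /\ forall q j : 'I_n, (q < j)%N ->
    0 <= complex.Re (polar 1 a * gap0 L0 L1 q j) /\
    0 <= complex.Re (polar 1 (- a) * gap0 L0 L1 q j)].

(* No ray Re ((lambda_q(0,0) - lambda_j(0,0)) / x) = 0 of the upper (lower)
   half-plane meets the closure of Omega_D (of Omega_U). *)
Definition narrow_sectors (r d : R) : Prop :=
  forall q j : 'I_n, q != j -> forall x : C,
    complex.Re (gap0 L0 L1 q j / x) = 0 ->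
    (0 < complex.Im x -> ~ closure (sector r (- (pi + d)) d) x) /\
    (complex.Im x < 0 -> ~ closure (sector r (- d) (pi + d)) x).

Definition separated (G : geometry R) : Prop :=
  let a := gamma G * (1 + 2 * gamma G / pi) in
  let gap l w q j := lam L0 L1 (eps w) (xhat l w) ord0 q
                     - lam L0 L1 (eps w) (xhat l w) ord0 j in
  exists2 c : R, 0 < c & forall w, param_sector G w ->
  forall l (q j : 'I_n), (q < j)%N ->
    c < complex.Re (polar 1 a * gap l w q j) /\
    c < complex.Re (polar 1 (- a) * gap l w q j).

(* [Phi] holds when r, then c0 and then rho are small enough. *)
Definition for_small_constants (g : R) (Phi : geometry R -> Prop) : Prop :=
  exists2 r0 : R, 0 < r0 & forall r, 0 < r < r0 ->
  forall d, 0 < d -> narrow_sectors r d ->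
  forall k, 0 < k < 2^-1 ->
  exists2 c1 : R, 0 < c1 & forall c, 0 < c < c1 ->
  forall h, 0 < h < r^-1 ->
  exists2 rho0 : R, 0 < rho0 & forall rho, 0 < rho < rho0 ->
  let G := Geometry g r d k c h rho in
  separated G -> Phi G.

End Smallness.

(* Main.v *)
Require Import Defs.
From HB Require Import structures.
From mathcomp Require Import all_boot all_order all_algebra complex.
From mathcomp Require Import all_classical all_reals.
From mathcomp Require Import topology normedtype sequences landau derive exp trigo.
From mathcomp Require Import perm ring lra zify.
Set Implicit Arguments.
Unset Strict Implicit.
Unset Printing Implicit Defensive.
Import Order.TTheory GRing.Theory Num.Theory.
Import numFieldNormedType.Exports.
Local Open Scope classical_set_scope.
Local Open Scope ring_scope.
Local Open Scope complex_scope.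

(* Let P transform the first family into the second and let W_i = H_i F be the solutions over Omega_D.
   W_2^-1 P W_1 is constant along the line of Gamma_D halfway between two rows of poles of x(t), on which
   x(t) runs from x_R to x_L.  Each off-diagonal entry of this constant is a bounded function times a ratio of
   model solutions that decays at one of the ends, so the constant is a diagonal matrix K, and
   P H_1 = H_2 K.  Continuing this identity by half a period of t, downwards and upwards, into the components
   over Omega_L and Omega_R gives C' = K C K^-1; K is read off from the limits at x_L and from the values at 0.

   Conversely, when arg eps = 2 pi the matrix H_2 K H_1^-1 is single-valued and extends to the nodes, so that it
   transforms the first system into the second on a fixed disc, for every small eps > 0.  Its Taylor coefficients
   in x satisfy a linear recursion that determines all but finitely many of them by a contraction; the
   remaining equations form a finite linear system whose coefficients are holomorphic at eps = 0.  Row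
   reduction over the discrete valuation ring of germs turns the bounded solutions along a sequence eps -> 0 into
   a solution holomorphic at eps = 0 whose value there is still invertible. *)

(** * Complex derivatives *)

(** In the converse the obstacle is analyticity at eps = 0: [H_2 K H_1^-1] is controlled only over a
    sector of the covering. It is therefore not followed around the sector but sampled where
    [sqrt_eps] is real and the period of x(t) imaginary, so that the sheets glue by inspection. A
    sample carries no analytic dependence on eps; it serves only as a bounded solution of linear
    equations with germs as coefficients. What must survive its replacement is invertibility: at x_L
    the sample is diagonal and close to a fixed invertible matrix, the recursion bounds it by its
    value at x = 0, and these two values differ by O(sqrt eps).

    In the direct implication, |theta_hat| <= gamma (1 + 2 gamma / pi) on the sector, which is the
    angle up to which [separated] controls the eigenvalue gaps; hence ratios of model solutions
    decay along the line. Entries above the diagonal are killed at x_L, those below it at x_R.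
    Smallness of c_0 keeps the line inside [Gamma]; smallness of rho keeps |x(t)| < r along it. *)

Section Modulus.
Variable R : realType.
Local Notation C := R[i].

(** The norm of [C] takes its values in [C]; this real copy is what [lra] and [nra] can handle. *)
Definition cm (z : C) : R := Normc.normc z.

Lemma normE (z : C) : `|z| = (cm z)%:C.
Proof. by []. Qed.

Lemma cm_ge0 z : 0 <= cm z.
Proof. by case: z => a b; rewrite /cm /= sqrtr_ge0. Qed.

Lemma cm0 : cm 0 = 0.
Proof. by apply: complexI; rewrite -normE normr0. Qed.

Lemma cm1 : cm 1 = 1.
Proof. by apply: complexI; rewrite -normE normr1. Qed.

Lemma cmM z u : cm (z * u) = cm z * cm u.
Proof. exact: Normc.normcM. Qed.

Lemma cmV z : cm z^-1 = (cm z)^-1.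
Proof. exact: Normc.normcV. Qed.

Lemma cmN z : cm (- z) = cm z.
Proof. by apply: complexI; rewrite -!normE normrN. Qed.

Lemma cmBC z u : cm (z - u) = cm (u - z).
Proof. by rewrite -cmN opprB. Qed.

Lemma cmD z u : cm (z + u) <= cm z + cm u.
Proof. by rewrite -lecR rmorphD /= -!normE ler_normD. Qed.

Lemma cmB z u : cm (z - u) <= cm z + cm u.
Proof. by rewrite -(cmN u) cmD. Qed.

Lemma cm_eq0 z : (cm z == 0) = (z == 0).
Proof. by rewrite -(inj_eq (@complexI _)) -normE normr_eq0. Qed.

Lemma cm_gt0 z : (0 < cm z) = (z != 0).
Proof. by rewrite lt_def cm_ge0 andbT cm_eq0. Qed.

Lemma cmX z n : cm (z ^+ n) = cm z ^+ n.
Proof. by elim: n => [|n IH]; rewrite ?cm1 // !exprS cmM IH. Qed.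

Lemma cmR (x : R) : cm x%:C = `|x|.
Proof. by rewrite /cm /= expr0n addr0 sqrtr_sqr. Qed.

Lemma cm_nat n : cm n%:R = n%:R.
Proof. by rewrite -(rmorph_nat (real_complex R)) cmR ger0_norm. Qed.

Lemma cm_sub z u : cm z - cm u <= cm (z - u).
Proof. by rewrite lerBlDr -{1}(subrK u z) cmD. Qed.

Lemma Re_le_cm z : `|complex.Re z| <= cm z.
Proof.
case: z => a b; rewrite /cm /= -(sqrtr_sqr a) ler_sqrt ?addr_ge0 ?sqr_ge0 //.
by rewrite lerDl sqr_ge0.
Qed.

Lemma Im_le_cm z : `|complex.Im z| <= cm z.
Proof.
case: z => a b; rewrite /cm /= -(sqrtr_sqr b) ler_sqrt ?addr_ge0 ?sqr_ge0 //.
by rewrite lerDr sqr_ge0.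
Qed.

Lemma cmi : cm 'i = 1.
Proof. by rewrite /cm /= expr0n add0r expr1n sqrtr1. Qed.

Lemma cm_le_ReIm z : cm z <= `|complex.Re z| + `|complex.Im z|.
Proof.
rewrite {1}(complexE z); apply: le_trans (cmD _ _) _.
by rewrite cmM cmi mul1r !cmR.
Qed.

Lemma cm_sum (I : Type) (s : seq I) (P : pred I) (F : I -> C) :
  cm (\sum_(i <- s | P i) F i) <= \sum_(i <- s | P i) cm (F i).
Proof.
elim/big_rec2: _ => [|i x y _ h]; first by rewrite cm0.
by apply: le_trans (cmD _ _) _; rewrite lerD2l.
Qed.

Lemma cm_le0 z : (forall e, 0 < e -> cm z <= e) -> z = 0.
Proof.
move=> h; apply/eqP; rewrite -cm_eq0 eq_le cm_ge0 andbT.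
by apply/ler_addgt0Pr => e e0; rewrite add0r h.
Qed.

Lemma cm_eq z u : (forall e, 0 < e -> cm (z - u) <= e) -> z = u.
Proof. by move=> /cm_le0 /eqP; rewrite subr_eq0 => /eqP. Qed.

Lemma gt0_realC (e : C) : 0 < e -> exists2 d : R, 0 < d & e = d%:C.
Proof.
case: e => a b; rewrite ltcE /= => /andP[/eqP -> a0].
by exists a.
Qed.

Lemma nbhsCP (V : normedModType C) (p : V) (P : set V) :
  nbhs p P <-> exists2 d : R, 0 < d & forall q, `|q - p| < d%:C -> P q.
Proof.
split.
- move=> /nbhs_normP [e /= /gt0_realC [d d0 ->]] h; exists d => // q hq.
  by apply: h => /=; rewrite distrC.
- move=> [d d0 h]; apply/nbhs_normP; exists d%:C; rewrite /= ?ltcR // => q /= hq.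
  by apply: h; rewrite distrC.
Qed.

Lemma nbhs_cmP (p : C) (P : set C) :
  nbhs p P <-> exists2 d : R, 0 < d & forall q, cm (q - p) < d -> P q.
Proof.
rewrite nbhsCP; split=> -[d d0 h]; exists d => // q hq; apply: h.
  by rewrite normE ltcR.
by move: hq; rewrite normE ltcR.
Qed.

(** Multiplying by the increment instead of dividing by it makes [h = 0] harmless and reduces each
    rule to an inequality between reals; [hasdP] is the link to [is_derive]. *)
Definition hasd (f : C -> C) (a b : C) : Prop :=
  forall e : R, 0 < e -> exists2 d : R, 0 < d &
    forall h, cm h < d -> cm (f (a + h) - f a - b * h) <= e * cm h.

Lemma hasdP (f : C -> C) (a b : C) : hasd f a b <-> is_derive a 1 f b.
Proof.
split.
- move=> H.
  suff cv : (fun h : C => h^-1 *: (f (h *: (1 : C) + a) - f a)) @ 0^' --> b.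
    split; first by apply/cvg_ex; exists b.
    by rewrite /derive; apply/cvg_lim.
  apply/cvgrPdist_lt => _ /gt0_realC [e e0 ->].
  apply/nbhs_cmP.
  have [d d0 hd] := H (e / 2) ltac:(by rewrite divr_gt0).
  exists d => // h; rewrite subr0 => hh /= h0.
  rewrite normE ltcR scaler1 -[_ *: _]/(_ * _) cmBC.
  have -> : h^-1 * (f (h + a) - f a) - b = h^-1 * (f (a + h) - f a - b * h).
    by rewrite (addrC h a) [in RHS]mulrBr [b * h]mulrC mulKf.
  rewrite cmM cmV; have ch : 0 < cm h by rewrite cm_gt0.
  rewrite mulrC ltr_pdivrMr //; apply: le_lt_trans (hd _ hh) _.
  by rewrite ltr_pM2r // ltr_pdivrMr // ltr_pMr // ltr1n.
- move=> [dr dv].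
  have cv : (fun h : C => h^-1 *: (f (h *: (1 : C) + a) - f a)) @ 0^' --> b.
    by rewrite -dv /derive; apply: dr.
  move=> e e0; move/cvgrPdist_lt : cv => /(_ e%:C ltac:(by rewrite ltcR)).
  move=> /nbhs_cmP [d d0 hd]; exists d => // h hh.
  have [->|h0] := eqVneq h 0; first by rewrite addr0 mulr0 subrr subr0 cm0 mulr0.
  move: (hd h); rewrite subr0 => /(_ hh h0).
  rewrite normE ltcR scaler1 -[_ *: _]/(_ * _) cmBC.
  have -> : h^-1 * (f (h + a) - f a) - b = h^-1 * (f (a + h) - f a - b * h).
    by rewrite (addrC h a) [in RHS]mulrBr [b * h]mulrC mulKf.
  have ch : 0 < cm h by rewrite cm_gt0.
  by rewrite cmM cmV mulrC ltr_pdivrMr // => /ltW.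
Qed.

Lemma hasd_derivable f a b : hasd f a b -> derivable f a (1 : C).
Proof. by move=> /hasdP []. Qed.

Lemma derivable_hasd f a : derivable f a (1 : C) -> hasd f a ('D_(1 : C) f a).
Proof. by move=> h; apply/hasdP; apply/derivableP. Qed.

Lemma hasd_eq f a b b' : hasd f a b -> b = b' -> hasd f a b'.
Proof. by move=> h <-. Qed.

Lemma hasd_uniq f a b b' : hasd f a b -> hasd f a b' -> b = b'.
Proof. by move=> /hasdP h /hasdP h'; rewrite -(@derive_val _ _ _ _ _ _ _ h) (@derive_val _ _ _ _ _ _ _ h'). Qed.

Lemma hasd_near f g a b : (exists2 d : R, 0 < d & forall q : C, cm (q - a) < d -> f q = g q) ->
  hasd f a b -> hasd g a b.
Proof.
move=> [d d0 fg] hf e e0; have [d' d0' h] := hf e e0.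
exists (Num.min d d'); first by rewrite lt_min d0.
move=> k; rewrite lt_min => /andP[k1 k2].
rewrite -fg; last by rewrite addrC addKr.
by rewrite -fg ?subrr ?cm0 // h.
Qed.

Lemma hasd_cst c a : hasd (fun=> c) a 0.
Proof. by apply/hasdP; apply: is_derive_cst. Qed.

Lemma hasd_id a : hasd (fun z => z) a 1.
Proof. by apply/hasdP; apply: is_derive_id. Qed.

Lemma hasdD f g a b c : hasd f a b -> hasd g a c -> hasd (fun z => f z + g z) a (b + c).
Proof. by move=> /hasdP hf /hasdP hg; apply/hasdP; apply: is_deriveD. Qed.

Lemma hasdN f a b : hasd f a b -> hasd (fun z => - f z) a (- b).
Proof. by move=> /hasdP hf; apply/hasdP; apply: is_deriveN. Qed.

Lemma hasdB f g a b c : hasd f a b -> hasd g a c -> hasd (fun z => f z - g z) a (b - c).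
Proof. by move=> hf hg; apply: hasdD => //; apply: hasdN. Qed.

Lemma hasdM f g a b c : hasd f a b -> hasd g a c ->
  hasd (fun z => f z * g z) a (b * g a + f a * c).
Proof.
move=> /hasdP hf /hasdP hg.
have hM := is_deriveM hf hg.
have hM' : is_derive a (1 : C) (f * g) (f a * c + g a * b) := hM.
have -> : b * g a + f a * c = f a * c + g a * b by rewrite addrC [b * _]mulrC.
by apply/hasdP.
Qed.

Lemma hasdZ k f a b : hasd f a b -> hasd (fun z => k * f z) a (k * b).
Proof.
by move=> hf; apply: hasd_eq (hasdM (hasd_cst k a) hf) _; rewrite mul0r add0r.
Qed.

Lemma hasdV f a b : f a != 0 -> hasd f a b -> hasd (fun z => (f z)^-1) a (- b / f a ^+ 2).
Proof.
move=> fa /hasdP hf; apply/hasdP; split.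
  by apply: derivableV => //; case: hf.
rewrite (deriveV fa (@ex_derive _ _ _ _ _ _ _ hf)).
by rewrite (@derive_val _ _ _ _ _ _ _ hf); change (- f a ^- 2 * b = - b / f a ^+ 2); ring.
Qed.

Lemma hasd_sum (I : Type) (s : seq I) (P : pred I) (F : I -> C -> C) (D : I -> C) a :
  (forall i, P i -> hasd (F i) a (D i)) ->
  hasd (fun z => \sum_(i <- s | P i) F i z) a (\sum_(i <- s | P i) D i).
Proof.
move=> h; elim: s => [|i s IH].
  rewrite big_nil; apply: hasd_near (hasd_cst 0 a).
  by exists 1 => // q _; rewrite big_nil.
rewrite big_cons; case: ifP => Pi.
  apply: hasd_near (hasdD (h i Pi) IH); exists 1 => // q _; by rewrite big_cons Pi.
by apply: hasd_near IH; exists 1 => // q _; rewrite big_cons Pi.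
Qed.

Lemma hasd_lip f a b : hasd f a b ->
  exists2 d : R, 0 < d & forall h, cm h < d -> cm (f (a + h) - f a) <= (1 + cm b) * cm h.
Proof.
move=> /(_ 1 ltr01) [d d0 h]; exists d => // k kd; move: (h k kd).
set x := _ - f a => hx; rewrite -(subrK (b * k) x).
by apply: le_trans (cmD _ _) _; rewrite cmM mulrDl lerD.
Qed.

Definition cts (f : C -> C) (a : C) : Prop :=
  forall e : R, 0 < e -> exists2 d : R, 0 < d &
    forall h, cm h < d -> cm (f (a + h) - f a) < e.

Lemma hasd_cts f a b : hasd f a b -> cts f a.
Proof.
move=> /hasd_lip [d d0 h] e e0; have c0 := cm_ge0 b.
exists (Num.min d (e / (1 + cm b))); first by rewrite lt_min d0 divr_gt0 //; lra.
move=> k; rewrite lt_min => /andP[kd ke].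
apply: le_lt_trans (h k kd) _.
by rewrite mulrC -ltr_pdivlMr //; lra.
Qed.

Lemma hasd_comp f g a b c : hasd g a b -> hasd f (g a) c -> hasd (fun z => f (g z)) a (c * b).
Proof.
move=> hg hf e e0.
have [d1 d10 h1] := hasd_lip hg.
have c0 := cm_ge0 c; have b0 := cm_ge0 b.
have [d2 d20 h2] := hf (e / 2 / (1 + cm b)) ltac:(by rewrite !divr_gt0 //; lra).
have [d3 d30 h3] := hg (e / 2 / (1 + cm c)) ltac:(by rewrite !divr_gt0 //; lra).
have [d4 d40 h4] := hasd_cts hg d20.
exists (Num.min (Num.min d1 d3) d4); first by rewrite !lt_min d10 d30 d40.
move=> k; rewrite !lt_min => /andP[/andP[k1 k3] k4].
set u := g (a + k) - g a.
have -> : f (g (a + k)) - f (g a) - c * b * k =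
   (f (g a + u) - f (g a) - c * u) + c * (u - b * k).
  by rewrite [g a + u]addrC subrK; ring.
apply: le_trans (cmD _ _) _; rewrite cmM.
have e1 : cm (f (g a + u) - f (g a) - c * u) <= e / 2 * cm k.
  apply: le_trans (h2 u (h4 k k4)) _.
  apply: (@le_trans _ _ (e / 2 / (1 + cm b) * ((1 + cm b) * cm k))).
    by rewrite ler_wpM2l ?h1 // !divr_ge0 ?ltW //; lra.
  by rewrite mulrA divfK //; apply/eqP; lra.
have e2 : cm c * cm (u - b * k) <= e / 2 * cm k.
  apply: (@le_trans _ _ ((1 + cm c) * (e / 2 / (1 + cm c) * cm k))).
    by apply: ler_pM; rewrite ?cm_ge0 ?h3 //; lra.
  by rewrite mulrA [_ * (_ / _)]mulrC divfK //; apply/eqP; lra.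
by rewrite [leRHS](_ : _ = e / 2 * cm k + e / 2 * cm k) ?lerD //; lra.
Qed.

Lemma hasdX f a b n : hasd f a b -> hasd (fun z => f z ^+ n) a (n%:R * f a ^+ n.-1 * b).
Proof.
move=> hf; elim: n => [|n IH].
  by rewrite !mul0r; apply: hasd_near (hasd_cst 1 a); exists 1.
apply: hasd_eq (hasd_near _ (hasdM hf IH)) _; first by exists 1 => // q _; rewrite exprS.
by case: n {IH} => [|n] /=; rewrite ?expr0 ?exprS -?natr1; ring.
Qed.

Lemma cvg_cmP (T : Type) (F : set_system T) {FF : Filter F} (f : T -> C) (l : C) :
  f @ F --> l <-> forall e : R, 0 < e -> F [set x | cm (f x - l) < e].
Proof.
split.
  move=> /cvgrPdist_lt h e e0; move: (h e%:C); rewrite ltcR => /(_ e0) hh.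
  by apply: filterS hh => x /=; rewrite cmBC normE ltcR.
move=> h; apply/cvgrPdist_lt => _ /gt0_realC [e e0 ->].
have := h e e0; apply: filterS => x /=; by rewrite cmBC normE ltcR.
Qed.

End Modulus.

(** * Dyadic contour integrals and Cauchy's formula *)

Section UltraLimit.
Variable R : realType.
Local Notation C := R[i].

Definition ultra_oo : set_system nat := sval (cid (ultraFilterLemma eventually_filter)).

Lemma ultra_ooP : UltraFilter ultra_oo.
Proof. by rewrite /ultra_oo; case: cid => F /= []. Qed.

Lemma ultra_oo_ev n0 (P : set nat) : (forall n, (n0 <= n)%N -> P n) -> ultra_oo P.
Proof.
rewrite /ultra_oo; case: cid => F /= [_ sF] h; apply: sF.
by exists n0 => // n /=; apply: h.
Qed.

(** The default 0 occurs only if no limit exists, which [ulimP] excludes for bounded sequences;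
    linearity then asks for boundedness only. *)
Definition ulim (u : nat -> C) : C :=
  xget 0 [set l | forall e : R, 0 < e -> ultra_oo [set n | cm (u n - l) < e]].

(** The limit is the supremum of the [x] lying below [v n] for almost all [n] in the sense of the
    ultrafilter; its dichotomy turns the failure of [sup A + e / 2 <= v n] into the upper
    estimate. *)
Lemma ultra_bounded (v : nat -> R) B n0 : (forall n, (n0 <= n)%N -> `|v n| <= B) ->
  exists l : R, forall e, 0 < e -> ultra_oo [set n | `|v n - l| < e].
Proof.
move=> h; have UF := ultra_ooP.
pose A := [set x : R | ultra_oo [set n | x <= v n]].
have A0 : A (- B).
  by apply: (@ultra_oo_ev n0) => n /h; rewrite ler_norml => /andP[].
have ubA : ubound A B.
  move=> x Ax; rewrite leNgt; apply/negP => Bx.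
  have : ultra_oo set0.
    have AB : ultra_oo [set n | `|v n| <= B] by apply: (@ultra_oo_ev n0).
    apply: filterS (filterI Ax AB) => n [/= h1]; rewrite ler_norml => /andP[_ h2]; lra.
  exact: filter_not_empty.
have hs : has_sup A by split; [exists (- B) | exists B].
exists (sup A) => e e0.
have [x Ax xs] := sup_adherent e0 hs.
have [Ay|nAy] := in_ultra_setVsetC [set n | sup A + e / 2 <= v n] UF.
  have := sup_upper_bound hs Ay; lra.
apply: filterS (filterI Ax nAy) => n [/= h1 /negP]; rewrite -ltNge ltr_norml => h2.
by apply/andP; split; lra.
Qed.

Lemma ulimP (u : nat -> C) B n0 : (forall n, (n0 <= n)%N -> cm (u n) <= B) ->
  forall e : R, 0 < e -> ultra_oo [set n | cm (u n - ulim u) < e].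
Proof.
move=> h; have UF := ultra_ooP; rewrite /ulim; case: xgetP => [l -> //|no].
have [a ha] : exists l, forall e, 0 < e -> ultra_oo [set n | `|complex.Re (u n) - l| < e].
  by apply: (@ultra_bounded _ B n0) => n /h; apply: le_trans; rewrite Re_le_cm.
have [b hb] : exists l, forall e, 0 < e -> ultra_oo [set n | `|complex.Im (u n) - l| < e].
  by apply: (@ultra_bounded _ B n0) => n /h; apply: le_trans; rewrite Im_le_cm.
case: (no (a +i* b)) => e e0.
have e2 : 0 < e / 2 by lra.
apply: filterS (filterI (ha _ e2) (hb _ e2)) => n [/= h1 h2].
apply: le_lt_trans (cm_le_ReIm _) _; case: (u n) h1 h2 => x y /= h1 h2; lra.
Qed.

Lemma ulim_le (u : nat -> C) a B n0 :
  (forall n, (n0 <= n)%N -> cm (u n - a) <= B) -> cm (ulim u - a) <= B.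
Proof.
move=> h; have UF := ultra_ooP.
have hb : forall n, (n0 <= n)%N -> cm (u n) <= B + cm a.
  by move=> n /h h1; rewrite -(subrK a (u n)); apply: le_trans (cmD _ _) _; rewrite lerD2r.
apply/ler_addgt0Pr => e e0.
have hn : ultra_oo [set n | (n0 <= n)%N] by apply: (@ultra_oo_ev n0).
have [n [/= h1 h2]] := filter_ex (filterI (ulimP hb e0) hn).
rewrite (_ : _ - a = (u n - a) - (u n - ulim u)); last by ring.
by apply: le_trans (cmB _ _) _; rewrite lerD ?h ?ltW.
Qed.

Lemma ulim_eq (u : nat -> C) a :
  (forall e : R, 0 < e -> exists n0, forall n, (n0 <= n)%N -> cm (u n - a) <= e) -> ulim u = a.
Proof.
by move=> h; apply: cm_eq => e /h [n0 hn]; apply: ulim_le hn.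
Qed.

Lemma ulim_cst c : ulim (fun=> c) = c.
Proof. by apply: ulim_eq => e e0; exists 0%N => n _; rewrite subrr cm0 ltW. Qed.

Lemma ulim_ext n0 (u v : nat -> C) : (forall n, (n0 <= n)%N -> u n = v n) -> ulim u = ulim v.
Proof.
move=> h; rewrite /ulim; congr xget; have UF := ultra_ooP.
have hn : ultra_oo [set n | (n0 <= n)%N] by apply: (@ultra_oo_ev n0).
by apply/seteqP; split => l /= hl e e0;
  apply: filterS (filterI (hl e e0) hn) => n [/= h1 h2]; rewrite ?h // -h.
Qed.

Definition evbnd (u : nat -> C) := exists n0 B, forall n, (n0 <= n)%N -> cm (u n) <= B.

Lemma ulimD u v : evbnd u -> evbnd v -> ulim (fun n => u n + v n) = ulim u + ulim v.
Proof.
move=> [n1 [B1 h1]] [n2 [B2 h2]]; have UF := ultra_ooP.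
have h3 : forall n, (maxn n1 n2 <= n)%N -> cm (u n + v n) <= B1 + B2.
  move=> n; rewrite geq_max => /andP[/h1 a /h2 b].
  by apply: le_trans (cmD _ _) _; rewrite lerD.
apply: cm_eq => e e0; have e3 : 0 < e / 3 by lra.
have [n [[/= a b] c]] := filter_ex (filterI (filterI (ulimP h1 e3) (ulimP h2 e3)) (ulimP h3 e3)).
rewrite (_ : _ - _ = (u n - ulim u) + (v n - ulim v) - (u n + v n - ulim (fun n => u n + v n))); last by ring.
apply: le_trans (cmB _ _) _; have := cmD (u n - ulim u) (v n - ulim v); lra.
Qed.

Lemma ulimZ c u : evbnd u -> ulim (fun n => c * u n) = c * ulim u.
Proof.
move=> [n1 [B1 h1]]; have UF := ultra_ooP.
have c0 := cm_ge0 c.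
have h3 : forall n, (n1 <= n)%N -> cm (c * u n) <= cm c * B1.
  by move=> n /h1 a; rewrite cmM ler_wpM2l.
apply: cm_eq => e e0; have e3 : 0 < e / 2 by lra.
have e4 : 0 < e / 2 / (1 + cm c) by rewrite divr_gt0 //; lra.
have [n [/= a b]] := filter_ex (filterI (ulimP h1 e4) (ulimP h3 e3)).
rewrite (_ : _ - _ = c * (u n - ulim u) - (c * u n - ulim (fun n => c * u n))); last by ring.
apply: le_trans (cmB _ _) _; rewrite cmM.
have : cm c * cm (u n - ulim u) <= (1 + cm c) * (e / 2 / (1 + cm c)).
  by apply: ler_pM; rewrite ?cm_ge0 ?ltW //; lra.
by rewrite [(1 + cm c) * _]mulrC divfK; [lra|apply/eqP; lra].
Qed.

End UltraLimit.

(** * Riemann sums and integrals over dyadic intervals *)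

Section DyadicIntegral.
Variable R : realType.
Local Notation C := R[i].

Definition dy (n i : nat) : R := i%:R / 2 ^+ n.

Definition dyI (n i : nat) (t : R) := dy n i <= t <= dy n i.+1.

(** Left Riemann sum of mesh [2 ^- K] over [dyI n i]. It has this meaning for [n <= K]; the
    truncated exponent for smaller [K] does not affect the limit. *)
Definition dsum (g : R -> C) (n i K : nat) : C :=
  \sum_(0 <= l < 2 ^ (K - n)) (2 ^- K)%:C * g (dy K (i * 2 ^ (K - n) + l)).

(* An ultrafilter limit exists for every bounded [g], so no integrability has to be proved. *)
Definition dint (g : R -> C) (n i : nat) : C := ulim (dsum g n i).

Definition dbnd (g : R -> C) n i := exists B : R, forall t, dyI n i t -> cm (g t) <= B.

Lemma two_gt0 n : 0 < 2 ^+ n :> R.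
Proof. by rewrite exprn_gt0. Qed.
#[local] Hint Resolve two_gt0 : core.

Lemma dyK n i K l : (n <= K)%N -> dy K (i * 2 ^ (K - n) + l) = dy n i + l%:R / 2 ^+ K.
Proof.
move=> nK; rewrite /dy natrD mulrDl natrM natrX; congr (_ + _).
by rewrite -{2}(subnKC nK) exprD invfM mulrACA -mulrA divff ?mulr1 // gt_eqF.
Qed.

Lemma dy0 n : dy n 0 = 0. Proof. by rewrite /dy mul0r. Qed.

Lemma dyS n i : dy n i.+1 = dy n i + 2 ^- n.
Proof. by rewrite /dy -natr1 mulrDl mul1r. Qed.

Lemma dy_double n i : dy n.+1 (i.*2) = dy n i.
Proof. by rewrite /dy -muln2 natrM exprSr; field; rewrite gt_eqF. Qed.

Lemma dsum_pt n i K l : (n <= K)%N -> (l < 2 ^ (K - n))%N ->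
  dyI n i (dy K (i * 2 ^ (K - n) + l)).
Proof.
move=> nK lK; rewrite /dyI dyK // dyS lerDl lerD2l; apply/andP; split.
  by rewrite divr_ge0 // ltW.
rewrite ler_pdivrMr // -[X in X * _]mul1r.
have -> : (1 / 2 ^+ n) * 2 ^+ K = 2 ^+ (K - n) :> R.
  by rewrite -{1}(subnKC nK) exprD mul1r mulrA mulVf ?mul1r // gt_eqF.
by rewrite -natrX ler_nat ltnW.
Qed.

Lemma dsum_le g n i K B : 0 <= B -> (n <= K)%N -> (forall t, dyI n i t -> cm (g t) <= B) ->
  cm (dsum g n i K) <= B / 2 ^+ n.
Proof.
move=> B0 nK h; apply: le_trans (cm_sum _ _ _) _.
apply: (@le_trans _ _ (\sum_(0 <= l < 2 ^ (K - n)) 2 ^- K * B)).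
  rewrite big_nat_cond [leRHS]big_nat_cond; apply: ler_sum => l /andP[/andP[_ lK] _].
  have k0 : 0 <= 2 ^- K :> R by rewrite invr_ge0 ltW.
  by rewrite cmM cmR ger0_norm // ler_wpM2l // h // dsum_pt.
rewrite sumr_const_nat subn0 -[leLHS]mulr_natl natrX.
rewrite -{2}(subnKC nK) exprD invfM [in leRHS]mulrC mulrA [X in X * B]mulrCA.
by rewrite divff ?mulr1 // gt_eqF.
Qed.

Lemma dyI_nonempty n i : dyI n i (dy n i).
Proof. by rewrite /dyI lexx dyS lerDl invr_ge0 ltW. Qed.

Lemma dint_le g n i B : (forall t, dyI n i t -> cm (g t) <= B) -> cm (dint g n i) <= B / 2 ^+ n.
Proof.
move=> h; have B0 : 0 <= B := le_trans (cm_ge0 _) (h _ (dyI_nonempty n i)).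
rewrite -[dint g n i]subr0; apply: (@ulim_le _ _ _ _ n) => K nK.
by rewrite subr0 dsum_le.
Qed.

Lemma dbnd_ev g n i : dbnd g n i -> evbnd (dsum g n i).
Proof.
move=> [B h]; have B0 : 0 <= B := le_trans (cm_ge0 _) (h _ (dyI_nonempty n i)).
by exists n, (B / 2 ^+ n) => K nK; rewrite dsum_le.
Qed.

Lemma dint_ext f g n i : (forall t, dyI n i t -> f t = g t) -> dint f n i = dint g n i.
Proof.
move=> h; apply: (@ulim_ext _ n) => K nK.
by apply: eq_big_nat => l /andP[_ lK]; rewrite h // dsum_pt.
Qed.

Lemma dintD f g n i : dbnd f n i -> dbnd g n i ->
  dint (fun t => f t + g t) n i = dint f n i + dint g n i.
Proof.
move=> /dbnd_ev hf /dbnd_ev hg; rewrite -ulimD //; apply: (@ulim_ext _ 0) => K _.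
by rewrite -big_split /=; apply: eq_bigr => l _; rewrite mulrDr.
Qed.

Lemma dintZ c f n i : dbnd f n i -> dint (fun t => c * f t) n i = c * dint f n i.
Proof.
move=> /dbnd_ev hf; rewrite -ulimZ //; apply: (@ulim_ext _ 0) => K _.
by rewrite big_distrr; apply: eq_bigr => l _; rewrite mulrCA.
Qed.

Lemma dbndZ c f n i : dbnd f n i -> dbnd (fun t => c * f t) n i.
Proof.
move=> [B h]; exists (cm c * B) => t /h ht; by rewrite cmM ler_wpM2l ?cm_ge0.
Qed.

Lemma dintB f g n i : dbnd f n i -> dbnd g n i ->
  dint (fun t => f t - g t) n i = dint f n i - dint g n i.
Proof.
move=> hf hg; rewrite (@dint_ext _ (fun t => f t + (-1) * g t)); last by move=> t _; rewrite mulN1r.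
by rewrite dintD ?dintZ ?mulN1r //; apply: dbndZ.
Qed.

Lemma dint_split g n i : dbnd g n i ->
  dint g n i = dint g n.+1 i.*2 + dint g n.+1 i.*2.+1.
Proof.
move=> [B h]; rewrite -ulimD; first last.
- apply: dbnd_ev; exists B => t /andP[t1 t2]; apply: h; apply/andP; split.
    rewrite -dy_double (le_trans _ t1) // /dy ler_wpM2r //; first by rewrite invr_ge0 ltW.
    by rewrite ler_nat.
  by rewrite -dy_double doubleS.
- apply: dbnd_ev; exists B => t /andP[t1 t2]; apply: h; apply/andP; split.
    by rewrite -dy_double.
  rewrite -dy_double (le_trans t2) // /dy ler_wpM2r //; first by rewrite invr_ge0 ltW.
  by rewrite ler_nat doubleS.
apply: (@ulim_ext _ n.+1) => K nK; rewrite /dsum.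
have e : (2 ^ (K - n) = 2 ^ (K - n.+1) + 2 ^ (K - n.+1))%N.
  by rewrite -(subnSK nK) expnS mul2n addnn.
rewrite e (@big_cat_nat _ _ _ (2 ^ (K - n.+1))) ?leq_addr //=; congr (_ + _).
  by apply: eq_bigr => l _; congr (_ * g (dy K (_ + _))); lia.
rewrite -{1}[(2 ^ (K - n.+1))%N]add0n big_addn addnK.
by apply: eq_bigr => l _; congr (_ * g (dy K _)); lia.
Qed.

(** The increments of [G] telescope. Each of the [2 ^ (K - n)] steps has an error of at most
    [c * (2 ^- K) ^+ 2], so the total error is [O(2 ^- K)]. *)
Lemma dint_FTC (G : R -> C) g n i (c : R) :
  (forall t h, dyI n i t -> 0 <= h -> dyI n i (t + h) ->
     cm (G (t + h) - G t - h%:C * g t) <= c * h ^+ 2) ->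
  dint g n i = G (dy n i.+1) - G (dy n i).
Proof.
move=> hG.
have c0 : 0 <= c.
  have := hG (dy n i) (2 ^- n) (dyI_nonempty n i) ltac:(by rewrite invr_ge0 ltW).
  rewrite -dyS => /(_ _) h; have {h}h := le_trans (cm_ge0 _) (h ltac:(by rewrite /dyI lexx dyS lerDl invr_ge0 ltW)).
  by move: h; rewrite pmulr_lge0 // exprn_gt0 // invr_gt0.
apply: ulim_eq => e e0.
pose N := Num.bound (c / e).
exists (n + N)%N => K; set D := (2 ^ (K - n))%N => nK.
have nK' : (n <= K)%N by apply: leq_trans nK; rewrite leq_addr.
have -> : G (dy n i.+1) - G (dy n i) = \sum_(0 <= l < D) (G (dy K (i * D + l.+1)) - G (dy K (i * D + l))).
  rewrite (@telescope_sumr _ 0 D (fun l => G (dy K (i * D + l)))) //; congr (G _ - G _).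
    by rewrite -mulSnr -[(i.+1 * _)%N]addn0 dyK // mul0r addr0.
  by rewrite dyK // mul0r addr0.
rewrite /dsum -sumrB; apply: le_trans (cm_sum _ _ _) _.
apply: (@le_trans _ _ (\sum_(0 <= l < D) c * (2 ^- K) ^+ 2)).
  rewrite big_nat_cond [leRHS]big_nat_cond; apply: ler_sum => l /andP[/andP[_ lK] _].
  rewrite cmBC addnS dyS; apply: hG; first exact: dsum_pt.
    by rewrite invr_ge0 ltW.
  rewrite -dyS -addnS.
  case: (ltnP l.+1 D) => [h|h]; first exact: dsum_pt.
  have -> : l.+1 = D by apply/eqP; rewrite eqn_leq h lK.
  by rewrite -mulSnr -[(i.+1 * _)%N]addn0 dyK // mul0r addr0 /dyI lexx dyS lerDl invr_ge0 ltW.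
rewrite sumr_const_nat subn0 -[leLHS]mulr_natl natrX expr2.
apply: (@le_trans _ _ (c * 2 ^- K)).
  have k0 : 0 <= 2 ^- K :> R by rewrite invr_ge0 ltW.
  rewrite [leLHS](_ : _ = (2 ^+ (K - n) / 2 ^+ K) * (c / 2 ^+ K)); last by ring.
  rewrite ler_piMl //; first exact: mulr_ge0.
  by rewrite ler_pdivrMr // mul1r ler_weXn2l ?ler1n // leq_subr.
rewrite ler_pdivrMr // mulrC -ler_pdivrMr //.
apply: ltW; apply: lt_le_trans (_ : N%:R <= _).
  by apply: archi_boundP; rewrite divr_ge0 // ltW.
rewrite -natrX ler_nat; apply: leq_trans (ltnW (ltn_expl N (ltnSn 1))) _.
by rewrite leq_pexp2l // (leq_trans _ nK) // leq_addl.
Qed.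

End DyadicIntegral.

(** * Bisection of the unit interval and the unit square *)

Section DyadicInduction.
Variable R : realType.

Lemma dyadic_point (s : nat -> nat) : s 0%N = 0%N ->
  (forall n, (s n).*2 <= s n.+1 <= (s n).*2.+1)%N ->
  exists2 u : R, 0 <= u <= 1 & forall n, dyI n (s n) u.
Proof.
move=> s0 hs.
have lo n : dy R n (s n) <= dy R n.+1 (s n.+1).
  have /andP[h _] := hs n; rewrite -dy_double /dy ler_wpM2r ?ler_nat //.
  by rewrite invr_ge0 exprn_ge0.
have hi n : dy R n.+1 (s n.+1).+1 <= dy R n (s n).+1.
  have /andP[_ h] := hs n; rewrite -[leRHS]dy_double /dy ler_wpM2r ?ler_nat ?doubleS //.
  by rewrite invr_ge0 exprn_ge0.
have lohi n : dy R n (s n) <= dy R n (s n).+1.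
  by rewrite dyS lerDl invr_ge0 exprn_ge0.
have lo' n k : dy R n (s n) <= dy R (n + k) (s (n + k)%N).
  by elim: k => [|k IH]; rewrite ?addn0 // addnS; apply: le_trans IH _.
have hi' n k : dy R (n + k) (s (n + k)%N).+1 <= dy R n (s n).+1.
  by elim: k => [|k IH]; rewrite ?addn0 // addnS; apply: le_trans (hi _) IH.
have cross m n : dy R m (s m) <= dy R n (s n).+1.
  apply: le_trans (lo' m n) _; apply: le_trans (lohi _) _.
  by rewrite addnC hi'.
pose A := [set x : R | exists n, x = dy R n (s n)].
have hA : has_sup A.
  split; first by exists (dy R 0 (s 0%N)), 0%N.
  by exists (dy R 0 (s 0%N).+1) => _ [n ->]; apply: cross.
have in_n n : dyI n (s n) (sup A).
  apply/andP; split; first by apply: sup_upper_bound => //; exists n.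
  by apply: ge_sup => [|_ [m ->]]; [case: hA|apply: cross].
exists (sup A) => //; have := in_n 0%N; rewrite /dyI s0 dy0 dyS dy0.
by rewrite expr0 invr1 add0r.
Qed.

(** If [Pr] failed on the unit square, it would fail on a quarter of it, on a quarter of that, and
    so on; these squares shrink to a point [(u, v)], where the second hypothesis is contradicted.
    This takes the place of compactness. *)
Lemma dyadic_square_induction (Pr : nat -> nat -> nat -> Prop) :
  (forall n i j, Pr n.+1 i.*2 j.*2 -> Pr n.+1 i.*2 j.*2.+1 ->
     Pr n.+1 i.*2.+1 j.*2 -> Pr n.+1 i.*2.+1 j.*2.+1 -> Pr n i j) ->
  (forall u v : R, 0 <= u <= 1 -> 0 <= v <= 1 ->
     exists n0, forall n i j, (n0 <= n)%N -> dyI n i u -> dyI n j v -> Pr n i j) ->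
  Pr 0%N 0%N 0%N.
Proof.
move=> split4 loc; apply: contrapT => no.
have step n (p : nat * nat) : exists q : nat * nat,
    [/\ (p.1.*2 <= q.1 <= p.1.*2.+1)%N, (p.2.*2 <= q.2 <= p.2.*2.+1)%N &
        ~ Pr n p.1 p.2 -> ~ Pr n.+1 q.1 q.2].
  case: p => i j /=.
  have t1 k : (k.*2 <= k.*2 <= k.*2.+1)%N by lia.
  have t2 k : (k.*2 <= k.*2.+1 <= k.*2.+1)%N by lia.
  have [h1|h1] := pselect (Pr n.+1 i.*2 j.*2); last by exists (i.*2, j.*2).
  have [h2|h2] := pselect (Pr n.+1 i.*2 j.*2.+1); last by exists (i.*2, j.*2.+1).
  have [h3|h3] := pselect (Pr n.+1 i.*2.+1 j.*2); last by exists (i.*2.+1, j.*2).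
  exists (i.*2.+1, j.*2.+1); split => //= nP h4; exact: nP (split4 _ _ _ h1 h2 h3 h4).
have [next hnext] : exists next : nat -> nat * nat -> nat * nat, forall n p,
    [/\ (p.1.*2 <= (next n p).1 <= p.1.*2.+1)%N,
        (p.2.*2 <= (next n p).2 <= p.2.*2.+1)%N &
        ~ Pr n p.1 p.2 -> ~ Pr n.+1 (next n p).1 (next n p).2].
  exists (fun n p => sval (cid (step n p))) => n p; by case: cid.
pose fix s n := if n is m.+1 then next m (s m) else (0, 0)%N.
have [u u01 hu] : exists2 u : R, 0 <= u <= 1 & forall n, dyI n (s n).1 u.
  by apply: dyadic_point => // n; case: (hnext n (s n)).
have [v v01 hv] : exists2 v : R, 0 <= v <= 1 & forall n, dyI n (s n).2 v.
  by apply: dyadic_point => // n; case: (hnext n (s n)).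
have nP n : ~ Pr n (s n).1 (s n).2.
  by elim: n => //= n IH; case: (hnext n (s n)) => _ _; apply.
have [n0 h] := loc u v u01 v01; exact: nP (h n0 _ _ (leqnn _) (hu _) (hv _)).
Qed.

End DyadicInduction.

(** * The exponential function and the unit circle *)

Section Exponential.
Variable R : realType.
Local Notation C := R[i].

Lemma MVT_all (f df : R -> R) : (forall x : R, is_derive x (1 : R) f (df x)) ->
  forall x y : R, exists2 c : R, `|c - x| <= `|y - x| & f y - f x = df c * (y - x).
Proof.
move=> h x y.
have cf : continuous f.
  by move=> z; apply: differentiable_continuous; apply/derivable1_diffP; case: (h z).
have [xy|yx] := leP x y.
  have [c cxy e] := MVT_segment xy (fun z _ => h z) (continuous_subspaceT cf).
  exists c => //; move: cxy; rewrite in_itv /= => /andP[h1 h2].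
  by rewrite !ger0_norm ?subr_ge0 // lerD2r.
have [c cxy e] := MVT_segment (ltW yx) (fun z _ => h z) (continuous_subspaceT cf).
exists c; last by rewrite -opprB e -mulrN opprB.
move: cxy; rewrite in_itv /= => /andP[h1 h2].
by rewrite !ler0_norm ?subr_le0 ?(ltW yx) // lerN2 lerD2r.
Qed.

Lemma sin_le (x : R) : `|sin x| <= `|x|.
Proof.
have [c _ e] := MVT_all (@is_derive_sin R) 0 x; move: e; rewrite sin0 !subr0 => ->.
by rewrite normrM ler_piMl // cos_max.
Qed.

Lemma cos_sub1_le (x : R) : `|cos x - 1| <= x ^+ 2.
Proof.
have [c h e] := MVT_all (@is_derive_cos R) 0 x; move: e; rewrite cos0 !subr0 => ->.
rewrite normrM normrN -[x ^+ 2]ger0_norm ?sqr_ge0 // expr2 normrM ler_wpM2r //.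
by apply: le_trans (sin_le _) _; rewrite !subr0 in h.
Qed.

Lemma sin_subx_le (x : R) : `|x| <= 1 -> `|sin x - x| <= x ^+ 2.
Proof.
move=> x1.
have h (z : R) : is_derive z (1 : R) (fun y => sin y - y) (cos z - 1 : R) by apply: is_deriveB.
have [c hc e] := MVT_all h 0 x; move: e; rewrite sin0 !subr0 => ->.
rewrite normrM -[x ^+ 2]ger0_norm ?sqr_ge0 // expr2 normrM ler_wpM2r //.
apply: le_trans (cos_sub1_le _) _; rewrite !subr0 in hc.
rewrite -[_ ^+ 2]ger0_norm ?sqr_ge0 // normrX expr2.
apply: le_trans (hc); rewrite ler_piMl //; exact: le_trans hc x1.
Qed.

Lemma expR_sub_le (x : R) : `|x| <= 2^-1 -> `|expR x - 1 - x| <= 2 * x ^+ 2.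
Proof.
rewrite ler_norml => /andP[h1 h2].
have g1 := expR_ge1Dx x; have g2 := expR_ge1Dx (- x).
have p := expR_gt0 x; have q : expR x * expR (- x) = 1 by rewrite expRN divff // gt_eqF.
rewrite ger0_norm; last lra.
have : expR x * (1 - x) <= 1 by rewrite -[leRHS]q ler_wpM2l // ltW.
nra.
Qed.

Lemma cexpD (z u : C) : cexp (z + u) = cexp z * cexp u.
Proof.
case: z => a b; case: u => c d; rewrite /cexp /= expRD cosD sinD.
by apply/eqP; rewrite eq_complex /=; apply/andP; split; apply/eqP; ring.
Qed.

Lemma cexp0 : cexp (0 : C) = 1.
Proof. by rewrite /cexp /= expR0 cos0 sin0 mulr0 mulr1. Qed.

Lemma cexpN (z : C) : cexp (- z) = (cexp z)^-1.
Proof.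
have h : cexp z * cexp (- z) = 1 by rewrite -cexpD subrr cexp0.
have nz : cexp z != 0.
  by apply/eqP => e; move/eqP: h; rewrite e mul0r eq_sym oner_eq0.
by rewrite -[LHS](mulKf nz) h mulr1.
Qed.

Lemma cexp_neq0 (z : C) : cexp z != 0.
Proof.
have h : cexp z * cexp (- z) = 1 by rewrite -cexpD subrr cexp0.
by apply/eqP => e; move/eqP: h; rewrite e mul0r eq_sym oner_eq0.
Qed.

Lemma cm_cexp (z : C) : cm (cexp z) = expR (complex.Re z).
Proof.
case: z => a b; rewrite /cexp /cm /= !exprMn -mulrDr cos2Dsin2 mulr1 sqrtr_sqr.
by rewrite ger0_norm // expR_ge0.
Qed.

Lemma cexpX (z : C) n : cexp z ^+ n = cexp (n%:R * z).
Proof.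
elim: n => [|n IH]; first by rewrite mul0r cexp0.
by rewrite exprS IH -cexpD -natr1 mulrDl mul1r addrC.
Qed.

Lemma cexp_sub_le (u : C) : cm u <= 2^-1 -> cm (cexp u - 1 - u) <= 12 * cm u ^+ 2.
Proof.
move=> hu; have ha := Re_le_cm u; have hb := Im_le_cm u.
apply: le_trans (cm_le_ReIm _) _.
have {}ha : `|complex.Re u| <= cm u by [].
case: u hu ha hb => a b; set m := cm _ => hm /= ha hb.
have ea := expR_sub_le (le_trans ha hm).
have c1 := cos_sub1_le b.
have s1 : `|sin b - b| <= b ^+ 2 by apply: sin_subx_le; lra.
have a2 : a ^+ 2 <= m ^+ 2 by rewrite -[X in X <= _]real_normK ?num_real // ler_pXn2r ?nnegrE // (le_trans _ ha).
have b2 : b ^+ 2 <= m ^+ 2 by rewrite -[X in X <= _]real_normK ?num_real // ler_pXn2r ?nnegrE // (le_trans _ hb).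
have E2 : `|expR a| <= 2.
  have := ler_normD (expR a - 1 - a) (1 + a).
  rewrite (_ : expR a - 1 - a + (1 + a) = expR a); last by ring.
  have := ler_normD 1 a; rewrite normr1.
  have : a ^+ 2 <= 2^-1 * 2^-1.
    by rewrite -[a ^+ 2]real_normK ?num_real // expr2 ler_pM //; apply: le_trans ha hm.
  lra.
have Ea : `|expR a - 1| <= 2 * m.
  have := ler_normD (expR a - 1 - a) a.
  rewrite (_ : expR a - 1 - a + a = expR a - 1); last by ring.
  have : a ^+ 2 <= 2^-1 * m.
    by rewrite -[a ^+ 2]real_normK ?num_real // expr2 ler_pM //; apply: le_trans ha hm.
  lra.
have r1 : `|expR a * cos b - 1 - a| <= 4 * m ^+ 2.
  rewrite (_ : _ - a = (expR a - 1 - a) + expR a * (cos b - 1)); last by ring.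
  apply: le_trans (ler_normD _ _) _; rewrite normrM.
  have := ler_pM (normr_ge0 _) (normr_ge0 _) E2 c1; lra.
have r2 : `|expR a * sin b - 0 - b| <= 4 * m ^+ 2.
  rewrite (_ : _ - b = (expR a - 1) * b + expR a * (sin b - b)); last by ring.
  apply: le_trans (ler_normD _ _) _; rewrite !normrM.
  have := ler_pM (normr_ge0 _) (normr_ge0 _) E2 s1.
  have := ler_pM (normr_ge0 _) (normr_ge0 _) Ea hb; lra.
have := sqr_ge0 m; move: r1 r2; rewrite ?subr0; lra.
Qed.

Lemma hasd_cexp (z : C) : hasd (@cexp R) z (cexp z).
Proof.
move=> e e0; have p : 0 < cm (cexp z) by rewrite cm_cexp expR_gt0.
exists (Num.min 2^-1 (e / (12 * cm (cexp z)))).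
  by rewrite lt_min invr_gt0 ltr0n /= divr_gt0 // mulr_gt0.
move=> h; rewrite lt_min => /andP[h1 h2].
rewrite cexpD (_ : _ - _ = cexp z * (cexp h - 1 - h)); last by ring.
rewrite cmM; apply: le_trans (ler_wpM2l (ltW p) (cexp_sub_le (ltW h1))) _.
rewrite (_ : _ * (_ * _) = cm h * (12 * cm (cexp z)) * cm h); last by ring.
by rewrite ler_wpM2r ?cm_ge0 // -ler_pdivlMr ?mulr_gt0 // ltW.
Qed.

Definition circ (t : R) : C := cexp (0 +i* (2 * pi * t)).

Lemma circD s t : circ (s + t) = circ s * circ t.
Proof.
rewrite /circ -cexpD; congr cexp; apply/eqP; rewrite eq_complex /= addr0 eqxx /=.
by apply/eqP; ring.
Qed.

Lemma cm_circ t : cm (circ t) = 1.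
Proof. by rewrite cm_cexp /= expR0. Qed.

Lemma circ_neq0 t : circ t != 0.
Proof. exact: cexp_neq0. Qed.

Lemma circ0 : circ 0 = 1.
Proof. by rewrite /circ mulr0 cexp0. Qed.

Lemma circ1 : circ 1 = 1.
Proof.
rewrite /circ mulr1 /cexp /= expR0 !mul1r.
by rewrite mulrC mulr_natr cos2pi sin2pi.
Qed.

Lemma circN t : circ (- t) = (circ t)^-1.
Proof.
apply: (mulfI (circ_neq0 t)); rewrite -circD subrr circ0 divff //.
exact: circ_neq0.
Qed.

Lemma circX t n : circ t ^+ n = circ (n%:R * t).
Proof.
elim: n => [|n IH]; first by rewrite mul0r circ0.
by rewrite exprS IH -circD -natr1 mulrDl mul1r addrC.
Qed.

Definition tpi : C := 0 +i* (2 * pi).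

(** The quadratic form of the error is the one [dint_FTC] asks for. Once [2 * pi * |h|] exceeds 1/2,
    the three terms are bounded separately. *)
Lemma circ_remainder : exists2 c : R, 0 <= c & forall t h : R,
  cm (circ (t + h) - circ t - h%:C * (tpi * circ t)) <= c * h ^+ 2.
Proof.
have p0 : 0 < pi :> R := pi_gt0 R.
exists (12 * (2 * pi) ^+ 2 + 4 * (2 * pi) ^+ 2 * 4) => [|t h].
  by have := sqr_ge0 (2 * pi : R); lra.
have -> : circ (t + h) - circ t - h%:C * (tpi * circ t) = circ t * (circ h - 1 - (0 +i* (2 * pi * h))).
  rewrite circD (_ : 0 +i* (2 * pi * h) = h%:C * tpi); last first.
    by apply/eqP; rewrite eq_complex /=; apply/andP; split; apply/eqP; ring.
  by ring.
rewrite cmM cm_circ mul1r.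
have e : cm (0 +i* (2 * pi * h)) = 2 * pi * `|h|.
  by rewrite /cm /= expr0n add0r sqrtr_sqr normrM ger0_norm // mulr_ge0 // ltW.
have [hh|hh] := leP (cm (0 +i* (2 * pi * h))) 2^-1.
  apply: le_trans (cexp_sub_le hh) _; rewrite e exprMn mulrA -normrX.
  rewrite [`|h ^+ 2|]ger0_norm ?sqr_ge0 // ler_wpM2r ?sqr_ge0 // lerDl.
  by have := sqr_ge0 (2 * pi : R); lra.
apply: le_trans (cmB _ _) _; apply: le_trans (lerD (cmB _ _) (lexx _)) _.
rewrite cm_circ cm1 e -[h ^+ 2]ger0_norm ?sqr_ge0 // normrX.
rewrite e in hh; set k := `|h| in hh *; set q := 2 * pi in hh *.
have k0 : 0 <= k := normr_ge0 h; have q0 : 0 < q by rewrite mulr_gt0.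
rewrite [leRHS](_ : _ = 28 * (q * k) ^+ 2); last by ring.
nra.
Qed.

End Exponential.

(** * Deformation of a circle towards an interior point *)

Section CauchyFormula.
Variable R : realType.
Local Notation C := R[i].

(** The antiderivative of [a + b * (w - w0)] that vanishes at [w0]. *)
Definition quad (a b w0 w : C) : C := a * (w - w0) + b / 2 * (w - w0) ^+ 2.

(* Contour integral of [g] along an edge where [g] is nearly affine: the affine
   part integrates exactly. *)
Lemma edge_integral (q q' : R -> C) (g : C -> C) (a b w0 : C) (c L E D : R) n i :
  0 <= c ->
  (forall t h, dyI n i t -> 0 <= h -> dyI n i (t + h) ->
     cm (q (t + h) - q t - h%:C * q' t) <= c * h ^+ 2) ->
  (forall t, dyI n i t -> cm (q' t) <= L) ->
  (forall t, dyI n i t -> cm (q t - w0) <= D) ->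
  (forall t, dyI n i t -> cm (g (q t) - (a + b * (q t - w0))) <= E) ->
  cm (dint (fun t => g (q t) * q' t) n i -
      (quad a b w0 (q (dy R n i.+1)) - quad a b w0 (q (dy R n i))))
    <= E * L / 2 ^+ n.
Proof.
move=> c0 hq hL hD hE; set G := quad a b w0.
have L0 : 0 <= L := le_trans (cm_ge0 _) (hL _ (dyI_nonempty _ n i)).
have D0 : 0 <= D := le_trans (cm_ge0 _) (hD _ (dyI_nonempty _ n i)).
have E0 : 0 <= E := le_trans (cm_ge0 _) (hE _ (dyI_nonempty _ n i)).
pose l t := (a + b * (q t - w0)) * q' t.
have hl t : dyI n i t -> cm (l t) <= (cm a + cm b * D) * L.
  move=> ht; rewrite /l cmM ler_pM ?cm_ge0 ?hL //.
  by apply: le_trans (cmD _ _) _; rewrite lerD2l cmM ler_wpM2l ?cm_ge0 ?hD.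
have <- : dint l n i = G (q (dy R n i.+1)) - G (q (dy R n i)).
  have X0 : 0 <= cm a + cm b * D by rewrite addr_ge0 ?mulr_ge0 ?cm_ge0.
  have b20 := cm_ge0 (b / 2).
  apply: (@dint_FTC _ (fun t => G (q t)) l n i
            ((cm a + cm b * D) * c + cm (b / 2) * (c + L + L) ^+ 2)) => t h ht h0 hth.
  set d := q (t + h) - q t.
  have -> : G (q (t + h)) - G (q t) - h%:C * l t =
      (a + b * (q t - w0)) * (d - h%:C * q' t) + b / 2 * d ^+ 2.
    rewrite /G /quad /l (_ : q (t + h) - w0 = d + (q t - w0)); last by rewrite /d; ring.
    by field.
  apply: le_trans (cmD _ _) _; rewrite !cmM mulrDl; apply: lerD.
    rewrite -mulrA ler_pM ?cm_ge0 ?hq //.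
    by apply: le_trans (cmD _ _) _; rewrite lerD2l cmM ler_wpM2l ?cm_ge0 ?hD.
  rewrite -(cmM b) -mulrA ler_wpM2l // -expr2 -exprMn ler_pXn2r ?nnegrE ?cm_ge0 //; last first.
    by rewrite mulr_ge0 // !addr_ge0.
  rewrite -(subrK (h%:C * q' t) d); apply: le_trans (cmD _ _) _.
  have h1 : h <= 1.
    move: ht hth; rewrite /dyI dyS => /andP[a1 _] /andP[_ a2].
    have : 2 ^- n <= 1 :> R by rewrite invf_le1 ?exprn_gt0 // exprn_ege1 ?ler1n.
    lra.
  rewrite cmM cmR ger0_norm //.
  have := hq t h ht h0 hth; have := hL t ht; rewrite -/d.
  have : c * h ^+ 2 <= c * h by rewrite ler_wpM2l // expr2 ler_piMl.
  have := ler_wpM2l h0 (hL t ht).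
  have := mulr_ge0 h0 L0; lra.
have bg : dbnd (fun t => g (q t) * q' t) n i.
  exists ((E + (cm a + cm b * D)) * L) => t ht; rewrite cmM ler_pM ?cm_ge0 ?hL //.
  rewrite -(subrK (a + b * (q t - w0)) (g (q t))); apply: le_trans (cmD _ _) _.
  rewrite lerD ?hE //; apply: le_trans (cmD _ _) _.
  by rewrite lerD2l cmM ler_wpM2l ?cm_ge0 ?hD.
rewrite -dintB //; last by exists ((cm a + cm b * D) * L) => t /hl.
apply: dint_le => t ht; rewrite /l -mulrBl cmM.
by rewrite ler_pM ?cm_ge0 ?hE ?hL.
Qed.

Lemma circ_lip : exists2 L : R, 0 < L & forall t h : R, `|h| <= 1 ->
  cm (circ (t + h) - circ t) <= L * `|h|.
Proof.
have [c c0 hc] := circ_remainder R.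
exists (c + cm (tpi R) + 1) => [|t h h1]; first by have := cm_ge0 (tpi R); lra.
rewrite -(subrK (h%:C * (tpi R * circ t)) (circ (t + h) - circ t)).
apply: le_trans (cmD _ _) _; rewrite !cmM cmR cm_circ mulr1.
have := hc t h; rewrite -real_normK ?num_real // expr2 mulrA.
have : c * `|h| * `|h| <= c * `|h| by rewrite ler_piMr // mulr_ge0.
have := normr_ge0 h; lra.
Qed.

Lemma dyI_dist n i (s t : R) : dyI n i s -> dyI n i t -> `|s - t| <= 2 ^- n.
Proof.
move=> /andP[s1 s2] /andP[t1 t2]; rewrite dyS in s2 t2.
by rewrite ler_norml; apply/andP; split; lra.
Qed.

Section Homotopy.
Variables (z : C) (rho tau0 : R) (h : C -> C).
Hypotheses (zr : cm z < rho) (t0 : 0 < tau0 < 1).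
Hypothesis hder : forall w, cm w <= rho -> w != z -> exists b, hasd h w b.

(** [p u] is the circle of radius [rho] contracted towards [z] by the factor [tau u], which grows
    from [tau0] to 1; it stays in the closed disc and avoids [z]. [pu] and [pv] are the partial
    derivatives of [p]. *)
Let tau (u : R) : R := tau0 + (1 - tau0) * u.
Let zeta (v : R) : C := rho%:C * circ v.
Let p (u v : R) : C := z + (tau u)%:C * (zeta v - z).
Let pu (v : R) : C := (1 - tau0)%:C * (zeta v - z).
Let pv (u v : R) : C := (tau u)%:C * (tpi R * zeta v).

Lemma rho_gt0 : 0 < rho. Proof. exact: le_lt_trans (cm_ge0 _) zr. Qed.

Lemma cm_zeta v : cm (zeta v) = rho.
Proof. by rewrite cmM cmR cm_circ mulr1 gtr0_norm // rho_gt0. Qed.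

Lemma tau01 u : 0 <= u <= 1 -> 0 < tau u <= 1.
Proof. by move: t0 => /andP[a b] /andP[c d]; rewrite /tau; apply/andP; split; nra. Qed.

Lemma zeta_z v : cm (zeta v - z) <= 2 * rho.
Proof. by apply: le_trans (cmB _ _) _; rewrite cm_zeta mulr2n mulrDl mul1r lerD2l ltW. Qed.

Lemma zeta_z0 v : zeta v - z != 0.
Proof. by rewrite -cm_gt0; apply: lt_le_trans (cm_sub _ _); rewrite cm_zeta subr_gt0. Qed.

Lemma p_in u v : 0 <= u <= 1 -> cm (p u v) <= rho.
Proof.
move=> /tau01 /andP[a b].
rewrite /p (_ : _ + _ = (1 - tau u)%:C * z + (tau u)%:C * zeta v); last first.
  by rewrite rmorphB /=; ring.
apply: le_trans (cmD _ _) _; rewrite cmM [cm (_ * zeta v)]cmM cm_zeta !cmR.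
rewrite (gtr0_norm a) (ger0_norm (_ : 0 <= 1 - tau u)) ?subr_ge0 //.
have : (1 - tau u) * cm z <= (1 - tau u) * rho by rewrite ler_wpM2l ?subr_ge0 // ltW.
by move: (_ * cm z) => x; rewrite mulrBl mul1r lerBrDr.
Qed.

Lemma p_neq u v : 0 <= u <= 1 -> p u v != z.
Proof.
move=> /tau01 /andP[a b]; rewrite /p -subr_eq0 addrC addKr mulf_neq0 ?zeta_z0 //.
by rewrite (inj_eq (@complexI _) _ 0) gt_eqF.
Qed.

Lemma unit_dyI n i (u : R) : (i < 2 ^ n)%N -> dyI n i u -> 0 <= u <= 1.
Proof.
move=> hi /andP[a b]; apply/andP; split.
  by apply: le_trans a; rewrite divr_ge0 // exprn_ge0.
by apply: le_trans b _; rewrite ler_pdivrMr ?exprn_gt0 // mul1r -natrX ler_nat.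
Qed.

Lemma p_lip : exists2 L : R, 0 < L & forall u v u' v' : R,
  0 <= u <= 1 -> `|u' - u| <= 1 -> `|v' - v| <= 1 ->
  cm (p u' v' - p u v) <= L * (`|u' - u| + `|v' - v|).
Proof.
have [L L0 hL] := circ_lip; have r0 := rho_gt0.
exists (2 * rho + 2 * rho * L) => [|u v u' v' hu hu' hv'].
  by rewrite addr_gt0 // !mulr_gt0.
have -> : p u' v' - p u v = (tau u' - tau u)%:C * (zeta v' - z) + (tau u)%:C * (zeta v' - zeta v).
  by rewrite /p rmorphB /=; ring.
apply: le_trans (cmD _ _) _; rewrite !cmM !cmR.
have -> : tau u' - tau u = (1 - tau0) * (u' - u) by rewrite /tau; ring.
have /andP[a b] := tau01 hu; rewrite (ger0_norm (ltW a)).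
have e1 : `|(1 - tau0) * (u' - u)| <= `|u' - u|.
  rewrite normrM ler_piMl // ger0_norm; move: t0 => /andP[]; lra.
have e2 : cm (zeta v' - zeta v) <= rho * (L * `|v' - v|).
  rewrite /zeta -mulrBr cmM cmR gtr0_norm // ler_pM2l //.
  by have := hL v (v' - v) hv'; rewrite [v + _]addrC subrK.
have e3 := ler_pM (normr_ge0 _) (cm_ge0 _) e1 (zeta_z v').
have e4 : tau u * cm (zeta v' - zeta v) <= rho * (L * `|v' - v|).
  by apply: le_trans e2; rewrite ler_piMl ?cm_ge0.
have := normr_ge0 (u' - u); have := normr_ge0 (v' - v).
have : 0 <= rho * L * `|v' - v| by rewrite !mulr_ge0 // ltW.
have : 0 <= rho * L * `|u' - u| by rewrite !mulr_ge0 // ltW.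
have : 0 <= rho * `|v' - v| by rewrite !mulr_ge0 // ltW.
nra.
Qed.

(** Continuity bounds [h] near each point of the image, and bisection makes the bound global. *)
Lemma hp_bounded : exists M : R, forall u v, 0 <= u <= 1 -> 0 <= v <= 1 -> cm (h (p u v)) <= M.
Proof.
have [M hM] : exists M : R, forall u v, dyI 0 0 u -> dyI 0 0 v -> cm (h (p u v)) <= M; last first.
  exists M => u v hu hv; apply: hM; by rewrite /dyI dyS dy0 expr0 invr1 add0r.
apply: (@dyadic_square_induction R
   (fun n i j => exists M : R, forall u v, dyI n i u -> dyI n j v -> cm (h (p u v)) <= M)).
- move=> n i j [M1 h1] [M2 h2] [M3 h3] [M4 h4].
  exists (Num.max (Num.max M1 M2) (Num.max M3 M4)) => u v hu hv.
  have sp k (t : R) : dyI n k t -> dyI n.+1 k.*2 t \/ dyI n.+1 k.*2.+1 t.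
    move=> /andP[a b]; have [c|c] := leP t (dy R n.+1 k.*2.+1).
      by left; rewrite /dyI dy_double a.
    by right; rewrite /dyI (ltW c) -doubleS dy_double.
  by case: (sp _ _ hu) => hu'; case: (sp _ _ hv) => hv'; rewrite !le_max;
    rewrite ?(h1 _ _ hu' hv') ?(h2 _ _ hu' hv') ?(h3 _ _ hu' hv') ?(h4 _ _ hu' hv') ?orbT.
move=> u v hu hv.
have [b hb] := hder (p_in v hu) (p_neq v hu).
have [d d0 hd] := hasd_cts hb (@ltr01 R).
have [L L0 hL] := p_lip.
pose N := Num.bound (2 * L / d).
exists N => n i j nN hi hj; exists (1 + cm (h (p u v))) => u' v' hu' hv'.
have k : 2 ^- n <= 1 :> R by rewrite invf_le1 ?exprn_gt0 // exprn_ege1 ?ler1n.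
have a1 := dyI_dist hu' hi; have a2 := dyI_dist hv' hj.
have a3 := hL u v u' v' hu (le_trans a1 k) (le_trans a2 k).
rewrite -(subrK (h (p u v)) (h (p u' v'))); apply: le_trans (cmD _ _) _; rewrite lerD2r.
have := hd (p u' v' - p u v); rewrite [p u v + _]addrC subrK => hh; apply/ltW/hh.
apply: le_lt_trans a3 _; apply: le_lt_trans (_ : _ <= L * (2 * 2 ^- n)) _.
  by rewrite ler_pM2l //; lra.
rewrite mulrCA mulrA ltr_pdivrMr ?exprn_gt0 // [d * _]mulrC -ltr_pdivrMr // ?(mulrC L).
apply: lt_le_trans (_ : N%:R <= _); first by apply: archi_boundP; rewrite divr_ge0 ?mulr_ge0 // ltW.
rewrite -natrX ler_nat; apply: leq_trans (ltnW (ltn_expl N (ltnSn 1))) _.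
by rewrite leq_pexp2l.
Qed.

Let Av (u : R) n j := dint (fun v => h (p u v) * pv u v) n j.
Let Bu (v : R) n i := dint (fun u => h (p u v) * pu v) n i.

(** [Phi] is the integral of [h] over the boundary of the image of a dyadic square. It is additive
    under quartering. Near a point where [h] is differentiable the affine part integrates to 0
    around the closed boundary, so [Phi] is small compared with the area; bisection then gives
    [Phi 0 0 0 = 0]. *)
Lemma goursat : Av 1 0 0 = Av 0 0 0.
Proof.
have r0 := rho_gt0; have [M hM] := hp_bounded.
have [c c0 hc] := circ_remainder R.
have [L L0 hL] := p_lip.
pose Phi n i j := Av (dy R n i.+1) n j - Av (dy R n i) n j
                  - Bu (dy R n j.+1) n i + Bu (dy R n j) n i.
have tp0 := cm_ge0 (tpi R).
have pvb u v : 0 <= u <= 1 -> cm (pv u v) <= cm (tpi R) * rho.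
  move=> /tau01 /andP[a b]; rewrite !cmM cmR cm_circ mulr1 cmR (gtr0_norm r0) gtr0_norm //.
  by rewrite ler_piMl // mulr_ge0 // ltW.
have pub v : cm (pu v) <= 2 * rho.
  rewrite cmM cmR; apply: le_trans (zeta_z v); rewrite ler_piMl ?cm_ge0 //.
  by rewrite ger0_norm; move: t0 => /andP[]; lra.
have dyu n i : (i <= 2 ^ n)%N -> 0 <= dy R n i <= 1.
  move=> hi; rewrite /dy divr_ge0 ?exprn_ge0 //= ler_pdivrMr ?exprn_gt0 // mul1r.
  by rewrite -natrX ler_nat.
have bA u n j : (j < 2 ^ n)%N -> 0 <= u <= 1 -> dbnd (fun v => h (p u v) * pv u v) n j.
  move=> hj hu; exists (M * (cm (tpi R) * rho)) => v /(unit_dyI hj) hv.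
  by rewrite cmM ler_pM ?cm_ge0 ?hM ?pvb.
have bB v n i : (i < 2 ^ n)%N -> 0 <= v <= 1 -> dbnd (fun u => h (p u v) * pu v) n i.
  move=> hi hv; exists (M * (2 * rho)) => u /(unit_dyI hi) hu.
  by rewrite cmM ler_pM ?cm_ge0 ?hM ?pub.
have lt1 n i : (i < 2 ^ n)%N -> (i.*2 < 2 ^ n.+1)%N by rewrite expnS; lia.
have lt2 n i : (i < 2 ^ n)%N -> (i.*2.+1 < 2 ^ n.+1)%N by rewrite expnS; lia.
have Phi4 n i j : (i < 2 ^ n)%N -> (j < 2 ^ n)%N -> Phi n i j =
   Phi n.+1 i.*2 j.*2 + Phi n.+1 i.*2 j.*2.+1 + Phi n.+1 i.*2.+1 j.*2 + Phi n.+1 i.*2.+1 j.*2.+1.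
  move=> hi hj; rewrite /Phi -!doubleS !dy_double.
  have ui := dyu n i (ltnW hi); have ui' := dyu n i.+1 hi.
  have uj := dyu n j (ltnW hj); have uj' := dyu n j.+1 hj.
  rewrite /Av /Bu (dint_split (bA _ _ _ hj ui)) (dint_split (bA _ _ _ hj ui')).
  rewrite (dint_split (bB _ _ _ hi uj)) (dint_split (bB _ _ _ hi uj')).
  by do 12! [move: (dint _ _ _) => ?]; ring.
have loc (u v : R) : 0 <= u <= 1 -> 0 <= v <= 1 -> forall k, 0 < k ->
    exists n0, forall n i j, (n0 <= n)%N -> (i < 2 ^ n)%N -> (j < 2 ^ n)%N ->
      dyI n i u -> dyI n j v -> cm (Phi n i j) <= k * (2 ^- n * 2 ^- n).
  move=> hu hv k k0; set w0 := p u v.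
  have [b hb] := hder (p_in v hu) (p_neq v hu).
  (* [X * 2 ^- n] bounds the total length of the four edges, and [2 * L * 2 ^- n] the distance from
     them to [w0]; [k'] is scaled so that the product of both with [k'] is [k] times the area. *)
  pose X := 2 * (cm (tpi R) * rho) + 2 * (2 * rho).
  have X0 : 0 < X by rewrite ltr_wpDl ?mulr_ge0 ?mulr_gt0 // ltW.
  pose k' := k / X / (2 * L).
  have k'0 : 0 < k' by rewrite !divr_gt0 // mulr_gt0.
  have [d d0 hd] := hb k' k'0.
  pose N := Num.bound (2 * L / d).
  exists N => n i j nN hi hj hui hvj.
  have k1 : 2 ^- n <= 1 :> R by rewrite invf_le1 ?exprn_gt0 // exprn_ege1 ?ler1n.
  have near u' v' : dyI n i u' -> dyI n j v' -> cm (p u' v' - w0) <= 2 * L * 2 ^- n.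
    move=> hu' hv'; have a1 := dyI_dist hu' hui; have a2 := dyI_dist hv' hvj.
    apply: le_trans (hL u v u' v' hu (le_trans a1 k1) (le_trans a2 k1)) _.
    by rewrite -mulrA mulrCA ler_pM2l //; lra.
  have small : 2 * L * 2 ^- n < d.
    rewrite ltr_pdivrMr ?exprn_gt0 // [d * _]mulrC -ltr_pdivrMr // ?(mulrC L).
    apply: lt_le_trans (_ : N%:R <= _); first by apply: archi_boundP; rewrite divr_ge0 ?mulr_ge0 // ltW.
    rewrite -natrX ler_nat; apply: leq_trans (ltnW (ltn_expl N (ltnSn 1))) _.
    by rewrite leq_pexp2l.
  have aff u' v' : dyI n i u' -> dyI n j v' ->
      cm (h (p u' v') - (h w0 + b * (p u' v' - w0))) <= k' * (2 * L * 2 ^- n).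
    move=> hu' hv'; have hn := near _ _ hu' hv'.
    have -> : h (p u' v') - (h w0 + b * (p u' v' - w0)) =
        h (p u v + (p u' v' - w0)) - h (p u v) - b * (p u' v' - w0).
      by rewrite [p u v + _]addrC subrK; move: (h (p u' v')) (b * _) => x y; rewrite /w0; ring.
    by apply: le_trans (hd _ (le_lt_trans hn small)) _; rewrite ler_pM2l.
  pose G := quad (h w0) b w0.
  have eA u' : dyI n i u' -> cm (Av u' n j - (G (p u' (dy R n j.+1)) - G (p u' (dy R n j))))
       <= k' * (2 * L * 2 ^- n) * (cm (tpi R) * rho) / 2 ^+ n.
    move=> hu'; have u'01 := unit_dyI hi hu'.
    apply: (@edge_integral (p u') (pv u') h (h w0) b w0 (rho * c) (cm (tpi R) * rho) _ (2 * L * 2 ^- n)).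
    - by rewrite mulr_ge0 // ltW.
    - move=> t s _ _ _; rewrite (_ : _ - _ = (tau u')%:C * (rho%:C * (circ (t + s) - circ t - s%:C * (tpi R * circ t)))); last first.
        by rewrite /p /pv /zeta; ring.
      have /andP[a1 a2] := tau01 u'01; rewrite !cmM !cmR (gtr0_norm r0) (gtr0_norm a1).
      apply: le_trans (ler_wpM2l (ltW a1) (ler_wpM2l (ltW r0) (hc t s))) _.
      have y0 : 0 <= c * s ^+ 2 by rewrite mulr_ge0 ?sqr_ge0.
      by rewrite -[rho * c * _]mulrA ler_piMl // mulr_ge0 // ltW.
    - by move=> t _; apply: pvb.
    - by move=> t ht; apply: near.
    - by move=> t ht; apply: aff.
  have eB v' : dyI n j v' -> cm (Bu v' n i - (G (p (dy R n i.+1) v') - G (p (dy R n i) v')))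
       <= k' * (2 * L * 2 ^- n) * (2 * rho) / 2 ^+ n.
    move=> hv'.
    apply: (@edge_integral (p^~ v') (fun=> pu v') h (h w0) b w0 0 (2 * rho) _ (2 * L * 2 ^- n)) => //.
    - move=> t s _ _ _; rewrite (_ : _ - _ = 0) ?cm0 ?mul0r //.
      by rewrite /p /pu /tau !rmorphD !rmorphM rmorphD /=; ring.
    - by move=> t ht; apply: near.
    - by move=> t ht; apply: aff.
  have d1 : dyI n i (dy R n i.+1) by rewrite /dyI lexx dyS lerDl invr_ge0 exprn_ge0.
  have d2 : dyI n i (dy R n i) := dyI_nonempty _ n i.
  have d3 : dyI n j (dy R n j.+1) by rewrite /dyI lexx dyS lerDl invr_ge0 exprn_ge0.
  have d4 : dyI n j (dy R n j) := dyI_nonempty _ n j.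
  have := eA _ d1; have := eA _ d2; have := eB _ d3; have := eB _ d4.
  set s1 := _ - (_ - _) => f1; set s2 := _ - (_ - _) => f2.
  set s3 := _ - (_ - _) => f3; set s4 := _ - (_ - _) => f4.
  have -> : Phi n i j = s4 - s3 - s2 + s1 by rewrite /s1 /s2 /s3 /s4 /Phi; ring.
  apply: le_trans (cmD _ _) _; apply: le_trans (lerD (cmB _ _) (lexx _)) _.
  have ee : k * (2 ^- n * 2 ^- n) =
     2 * (k' * (2 * L * 2 ^- n) * (cm (tpi R) * rho) / 2 ^+ n) +
     2 * (k' * (2 * L * 2 ^- n) * (2 * rho) / 2 ^+ n).
    rewrite -(_ : k' * (2 * L) * X = k); first by rewrite /X; ring.
    by rewrite /k' divfK ?divfK // gt_eqF // mulr_gt0.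
  have := cmB s4 s3; lra.
suff e : Phi 0%N 0%N 0%N = 0.
  move: e; rewrite /Phi !dyS !dy0 expr0 invr1 add0r.
  (* The two radial edges of the whole square coincide, because the circle closes up. *)
  have -> : Bu 1 0 0 = Bu 0 0 0.
    by apply: dint_ext => u _; rewrite /p /pu /zeta circ1 circ0.
  by rewrite subrK => /eqP; rewrite subr_eq0 => /eqP.
apply: cm_le0 => k k0.
suff : (0 < 2 ^ 0)%N -> (0 < 2 ^ 0)%N -> cm (Phi 0%N 0%N 0%N) <= k * (2 ^- 0 * 2 ^- 0).
  by rewrite expr0 invr1 mulr1 mulr1; apply.
apply: (@dyadic_square_induction R (fun n i j => (i < 2 ^ n)%N -> (j < 2 ^ n)%N ->
           cm (Phi n i j) <= k * (2 ^- n * 2 ^- n))).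
- move=> n i j h1 h2 h3 h4 hi hj; rewrite Phi4 //.
  have := h1 (lt1 _ _ hi) (lt1 _ _ hj); have := h2 (lt1 _ _ hi) (lt2 _ _ hj).
  have := h3 (lt2 _ _ hi) (lt1 _ _ hj); have := h4 (lt2 _ _ hi) (lt2 _ _ hj).
  move: (Phi _ _ _) (Phi _ _ _) (Phi _ _ _) (Phi _ _ _) => y4 y3 y2 y1 b4 b3 b2 b1.
  have := cmD (y4 + y3 + y2) y1; have := cmD (y4 + y3) y2; have := cmD y4 y3.
  have q4 : k * (2 ^- n.+1 / 2 ^+ n.+1) = k * (2 ^- n / 2 ^+ n) / 4.
    by rewrite exprSr; field; rewrite gt_eqF // exprn_gt0.
  rewrite q4 in b1 b2 b3 b4; lra.
- move=> u v hu hv; have [n0 hn0] := loc u v hu hv k k0.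
  by exists n0 => n i j nn hi hj h1 h2; apply: hn0.
Qed.

End Homotopy.

Lemma dint_circ (j : nat) : (0 < j)%N -> dint (fun t => circ (- (j%:R * t)) : C) 0 0 = 0.
Proof.
move=> j0; have [c c0 hc] := circ_remainder R.
have tp : tpi R != 0.
  by rewrite -cm_gt0 /cm /= expr0n add0r sqrtr_sqr normr_gt0 mulf_neq0 // gt_eqF // pi_gt0.
have jn : (j%:R : C) != 0 by rewrite pnatr_eq0 -lt0n.
pose k : C := (- (j%:R * tpi R))^-1.
have kn : - (j%:R * tpi R) != 0 by rewrite oppr_eq0 mulf_neq0.
rewrite (@dint_FTC _ (fun t => k * circ (- (j%:R * t))) _ 0 0 (cm k * (c * j%:R ^+ 2))).
  by rewrite dyS dy0 expr0 invr1 add0r mulr0 oppr0 circ0 circN -circX circ1 expr1n invr1 subrr.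
move=> t h _ _ _.
have -> : k * circ (- (j%:R * (t + h))) - k * circ (- (j%:R * t)) - h%:C * circ (- (j%:R * t)) =
   k * (circ (- (j%:R * t) + - (j%:R * h)) - circ (- (j%:R * t)) - (- (j%:R * h))%:C * (tpi R * circ (- (j%:R * t)))).
  rewrite mulrDr opprD !mulrBr; congr (_ - _).
  rewrite rmorphN rmorphM rmorph_nat /=.
  have -> : h%:C * circ (- (j%:R * t)) = k * (- (j%:R * tpi R)) * (h%:C * circ (- (j%:R * t))).
    by rewrite /k mulVf // mul1r.
  by ring.
rewrite cmM -mulrA ler_wpM2l ?cm_ge0 //; apply: le_trans (hc _ _) _.
by rewrite sqrrN exprMn mulrA.
Qed.

End CauchyFormula.

(** * The Cauchy transform of a bounded function on a circle *)

Section CauchyTransform.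
Variable R : realType.
Local Notation C := R[i].

Definition ctr (rho t : R) : C := rho%:C * circ t.
(** With zeta = [ctr rho t], this is the density in [t] of d zeta / (2 pi i (zeta - z)). *)
Definition cker (rho : R) (z : C) (t : R) : C := (1 - z / ctr rho t)^-1.
Definition cint (phi : R -> C) : C := dint phi 0 0.
Definition bnd01 (phi : R -> C) (M : R) := forall t : R, 0 <= t <= 1 -> cm (phi t) <= M.

Lemma dyI00 (t : R) : dyI 0 0 t = (0 <= t <= 1).
Proof. by rewrite /dyI dyS dy0 expr0 invr1 add0r. Qed.

Lemma bnd01_dbnd phi M : bnd01 phi M -> dbnd phi 0 0.
Proof. by move=> h; exists M => t; rewrite dyI00; apply: h. Qed.

Lemma bnd01_ge0 phi M : bnd01 phi M -> 0 <= M.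
Proof. by move=> /(_ 0) h; apply: le_trans (cm_ge0 _) (h _); rewrite lexx ler01. Qed.

Lemma cint_le phi M : bnd01 phi M -> cm (cint phi) <= M.
Proof.
move=> h; have := @dint_le R phi 0 0 M; rewrite expr0 divr1; apply=> t.
by rewrite dyI00; apply: h.
Qed.

Lemma cint_ext phi psi : (forall t, 0 <= t <= 1 -> phi t = psi t) -> cint phi = cint psi.
Proof. by move=> h; apply: dint_ext => t; rewrite dyI00; apply: h. Qed.

Lemma cintD phi psi M M' : bnd01 phi M -> bnd01 psi M' ->
  cint (fun t => phi t + psi t) = cint phi + cint psi.
Proof. by move=> h h'; apply: dintD; apply: bnd01_dbnd; eassumption. Qed.

Lemma cintB phi psi M M' : bnd01 phi M -> bnd01 psi M' ->
  cint (fun t => phi t - psi t) = cint phi - cint psi.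
Proof. by move=> h h'; apply: dintB; apply: bnd01_dbnd; eassumption. Qed.

Lemma cintZ c phi M : bnd01 phi M -> cint (fun t => c * phi t) = c * cint phi.
Proof. by move=> h; apply: dintZ; apply: bnd01_dbnd h. Qed.

Lemma bnd01M phi psi M M' : bnd01 phi M -> bnd01 psi M' ->
  bnd01 (fun t => phi t * psi t) (M * M').
Proof. by move=> h h' t ht; rewrite cmM ler_pM ?cm_ge0 ?h ?h'. Qed.

Lemma bnd01_sum (F : nat -> R -> C) (M : nat -> R) J : (forall j, (j < J)%N -> bnd01 (F j) (M j)) ->
  bnd01 (fun t => \sum_(j < J) F j t) (\sum_(j < J) M j).
Proof.
by move=> h t ht; apply: le_trans (cm_sum _ _ _) _; apply: ler_sum => j _; apply: h.
Qed.

Lemma cint_sum (F : nat -> R -> C) (M : nat -> R) J : (forall j, (j < J)%N -> bnd01 (F j) (M j)) ->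
  cint (fun t => \sum_(j < J) F j t) = \sum_(j < J) cint (F j).
Proof.
elim: J => [|J IH] h.
  rewrite big_ord0; apply: cm_le0 => e /ltW e0; apply: cint_le => t _.
  by rewrite big_ord0 cm0.
have hJ : forall j, (j < J)%N -> bnd01 (F j) (M j) by move=> j hj; apply: h; rewrite ltnS ltnW.
rewrite big_ord_recr /= -IH // -(cintD (bnd01_sum hJ) (h J (ltnSn J))).
by apply: cint_ext => t _; rewrite big_ord_recr.
Qed.

Section Kernel.
Variable rho : R.
Hypothesis rho0 : 0 < rho.

Lemma cm_ctr t : cm (ctr rho t) = rho.
Proof. by rewrite cmM cmR cm_circ mulr1 gtr0_norm. Qed.

Lemma ctr_neq0 t : ctr rho t != 0.
Proof. by rewrite -cm_gt0 cm_ctr. Qed.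

Lemma ratio_le z t s : cm z <= s -> cm (z / ctr rho t) <= s / rho.
Proof. by move=> h; rewrite cmM cmV cm_ctr ler_pM2r ?invr_gt0. Qed.

Lemma cker_den z t s : cm z <= s -> s < rho -> (1 - s / rho) <= cm (1 - z / ctr rho t).
Proof.
move=> zs sr; apply: le_trans (cm_sub _ _); rewrite cm1 lerD2l lerN2.
exact: ratio_le.
Qed.

Lemma cker_gt0 s : s < rho -> 0 < 1 - s / rho.
Proof. by move=> sr; rewrite subr_gt0 ltr_pdivrMr // mul1r. Qed.

Lemma cker_neq0 z t : cm z < rho -> 1 - z / ctr rho t != 0.
Proof.
by move=> zr; rewrite -cm_gt0; apply: lt_le_trans (cker_den t (lexx _) zr); apply: cker_gt0.
Qed.

Lemma cker_le z t s : cm z <= s -> s < rho -> cm (cker rho z t) <= (1 - s / rho)^-1.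
Proof.
move=> zs sr; rewrite /cker cmV lef_pV2 ?posrE; first exact: cker_den.
  by apply: lt_le_trans (cker_den t zs sr); apply: cker_gt0.
exact: cker_gt0.
Qed.

Lemma cker_geom z t J : cm z < rho ->
  cker rho z t = \sum_(j < J) (z / ctr rho t) ^+ j + (z / ctr rho t) ^+ J * cker rho z t.
Proof.
move=> zr; have nz := cker_neq0 t zr; rewrite /cker; set q := z / _ in nz *.
apply: (mulIf nz); rewrite mulVf // mulrDl mulfVK //.
by rewrite mulrC -opprB mulNr -subrX1 opprB subrK.
Qed.

Definition ctrans (phi : R -> C) (z : C) : C := cint (fun t => phi t * cker rho z t).
Definition ccoef (phi : R -> C) (j : nat) : C := cint (fun t => phi t * ctr rho t ^- j).
(** The kernel is the derivative of [cker] in [z]. *)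
Definition ctrans' (phi : R -> C) (z : C) : C :=
  cint (fun t => phi t * ((ctr rho t)^-1 * cker rho z t ^+ 2)).

Variables (phi : R -> C) (M : R).
Hypothesis hphi : bnd01 phi M.

Let M0 := bnd01_ge0 hphi.

Lemma ccoef_bnd j : bnd01 (fun t => phi t * ctr rho t ^- j) (M / rho ^+ j).
Proof. by apply: bnd01M => // t _; rewrite cmV cmX cm_ctr. Qed.

Lemma ccoef_le j : cm (ccoef phi j) <= M / rho ^+ j.
Proof. exact/cint_le/ccoef_bnd. Qed.

Lemma ctrans_bnd z s : cm z <= s -> s < rho ->
  bnd01 (fun t => phi t * cker rho z t) (M / (1 - s / rho)).
Proof. by move=> zs sr; apply: bnd01M => // t _; apply: cker_le. Qed.

Lemma ctrans_taylor z s J : cm z <= s -> s < rho ->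
  cm (ctrans phi z - \sum_(j < J) ccoef phi j * z ^+ j) <= M * (cm z / rho) ^+ J / (1 - s / rho).
Proof.
move=> zs sr.
pose F j t := z ^+ j * (phi t * ctr rho t ^- j).
have bF j : bnd01 (F j) (cm (z ^+ j) * (M / rho ^+ j)).
  by move=> t ht; rewrite /F (cmM (z ^+ j)) ler_wpM2l ?cm_ge0 // ccoef_bnd.
have -> : \sum_(j < J) ccoef phi j * z ^+ j = cint (fun t => \sum_(j < J) F j t).
  rewrite (@cint_sum F _ J (fun j _ => bF j)).
  by apply: eq_bigr => j _; rewrite (cintZ _ (ccoef_bnd j)) mulrC.
rewrite -(cintB (ctrans_bnd zs sr) (bnd01_sum (J := J) (fun j _ => bF j))).
apply: cint_le => t ht; rewrite {1}(cker_geom t J (le_lt_trans zs sr)).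
rewrite (_ : _ - _ = phi t * ((z / ctr rho t) ^+ J * cker rho z t)); last first.
  rewrite mulrDr addrAC -[RHS]add0r; congr (_ + _); apply/eqP; rewrite subr_eq0; apply/eqP.
  rewrite mulr_sumr; apply: eq_bigr => j _.
  by rewrite /F exprMn exprVn; ring.
rewrite !cmM -mulrA ler_pM ?hphi ?mulr_ge0 ?cm_ge0 // ler_pM ?cm_ge0 ?cker_le //.
by rewrite cmX cmM cmV cm_ctr.
Qed.

Lemma ctrans'_le z s : cm z <= s -> s < rho ->
  cm (ctrans' phi z) <= M * (rho^-1 * (1 - s / rho)^-1 ^+ 2).
Proof.
move=> zs sr; apply/cint_le/bnd01M => // t _.
rewrite cmM cmV cm_ctr ler_pM2l ?invr_gt0 // cmX.
by rewrite ler_pXn2r ?nnegrE ?cm_ge0 ?invr_ge0 ?(ltW (cker_gt0 sr)) // cker_le.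
Qed.

Lemma ctrans_diff z h s : cm z <= s -> cm (z + h) <= s -> s < rho ->
  cm (ctrans phi (z + h) - ctrans phi z - h * ctrans' phi z)
    <= M * (rho ^- 2 * (1 - s / rho)^-1 ^+ 3) * cm h ^+ 2.
Proof.
move=> zs zhs sr; have k0 := cker_gt0 sr.
have b' : bnd01 (fun t => phi t * ((ctr rho t)^-1 * cker rho z t ^+ 2)) (M * (rho^-1 * (1 - s / rho)^-1 ^+ 2)).
  apply/bnd01M => // t _; rewrite cmM cmV cm_ctr ler_pM2l ?invr_gt0 // cmX.
  by rewrite ler_pXn2r ?nnegrE ?cm_ge0 ?invr_ge0 ?(ltW k0) // cker_le.
rewrite /ctrans /ctrans' -(cintB (ctrans_bnd zhs sr) (ctrans_bnd zs sr)).
have b1 : bnd01 (fun t => phi t * cker rho (z + h) t - phi t * cker rho z t) (M / (1 - s / rho) + M / (1 - s / rho)).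
  move=> t ht; apply: le_trans (cmB _ _) _.
  by rewrite lerD // ?(ctrans_bnd zs sr) ?(ctrans_bnd zhs sr).
rewrite -(cintZ h b') -(cintB b1 (M' := cm h * (M * (rho^-1 * (1 - s / rho)^-1 ^+ 2)))); last first.
  by move=> t ht; rewrite cmM ler_wpM2l ?cm_ge0 // b'.
apply: cint_le => t ht.
have n1 := cker_neq0 t (le_lt_trans zs sr); have n2 := cker_neq0 t (le_lt_trans zhs sr).
have -> : phi t * cker rho (z + h) t - phi t * cker rho z t - h * (phi t * ((ctr rho t)^-1 * cker rho z t ^+ 2)) =
   phi t * ((ctr rho t) ^- 2 * (cker rho (z + h) t * cker rho z t ^+ 2)) * h ^+ 2.
  have n0 := ctr_neq0 t; rewrite /cker; move: n0 n1 n2; move: (ctr rho t) => x n0 n1 n2.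
  have m1 : x - z != 0 by move: n1; apply: contra => /eqP/subr0_eq <-; rewrite divff // subrr.
  have m2 : x - (z + h) != 0 by move: n2; apply: contra => /eqP/subr0_eq <-; rewrite divff // subrr.
  rewrite (_ : 1 - z / x = (x - z) / x); last by rewrite mulrBl divff.
  rewrite (_ : 1 - (z + h) / x = (x - (z + h)) / x); last by rewrite mulrBl divff.
  by field; rewrite n0 m1 opprD addrA in m2 *.
rewrite cmM cmX ler_wpM2r ?exprn_ge0 ?cm_ge0 // cmM ler_pM ?cm_ge0 ?hphi //.
rewrite cmM cmV cmX cm_ctr ler_pM2l ?invr_gt0 ?exprn_gt0 // [_ ^+ 3]exprS cmM cmX.
rewrite ler_pM ?exprn_ge0 ?cm_ge0 ?cker_le // ler_pXn2r ?nnegrE ?cm_ge0 ?invr_ge0 ?(ltW k0) //.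
exact: cker_le.
Qed.

Lemma ctrans_hasd z : cm z < rho -> hasd (ctrans phi) z (ctrans' phi z).
Proof.
move=> zr e e0; pose s := (cm z + rho) / 2.
have zs : cm z < s by rewrite /s; lra.
have sr : s < rho by rewrite /s; lra.
have k0 := cker_gt0 sr.
pose K := M * (rho ^- 2 * (1 - s / rho)^-1 ^+ 3).
have K0 : 0 <= K by rewrite mulr_ge0 // mulr_ge0 // ?invr_ge0 ?exprn_ge0 ?invr_ge0 // ltW.
exists (Num.min (s - cm z) (e / (1 + K))).
  by rewrite lt_min subr_gt0 zs divr_gt0 //; lra.
move=> h; rewrite lt_min => /andP[h1 h2].
have zhs : cm (z + h) <= s by apply: le_trans (cmD _ _) _; lra.
rewrite (mulrC _ h); apply: le_trans (ctrans_diff (ltW zs) zhs sr) _; rewrite -/K expr2 mulrA.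
rewrite ler_wpM2r ?cm_ge0 //; move: h2; rewrite ltr_pdivlMr; last by lra.
have := cm_ge0 h; nra.
Qed.

Lemma deriv_geom (q : C) J : 1 - q != 0 ->
  (1 - q) ^- 2 - \sum_(j < J) j.+1%:R * q ^+ j = q ^+ J * (J.+1%:R - J%:R * q) / (1 - q) ^+ 2.
Proof.
move=> nz; elim: J => [|J IH].
  by rewrite big_ord0 subr0 expr0 mul0r subr0 !mul1r.
rewrite big_ord_recr /= opprD addrA IH [q ^+ J.+1]exprS.
have -> : J.+2%:R = J%:R + 2 :> C by rewrite -addn2 natrD.
have -> : J.+1%:R = J%:R + 1 :> C by rewrite natr1.
by move: (J%:R) (q ^+ J) => x y; field.
Qed.

Lemma ctrans'_taylor z s J : cm z <= s -> s < rho ->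
  cm (ctrans' phi z - \sum_(j < J) j.+1%:R * ccoef phi j.+1 * z ^+ j) <=
    M * (rho^-1 * ((cm z / rho) ^+ J * (J.+1%:R + J%:R) * (1 - s / rho)^-1 ^+ 2)).
Proof.
move=> zs sr; have k0 := cker_gt0 sr.
pose F j t := (j.+1%:R * z ^+ j) * (phi t * ctr rho t ^- j.+1).
have bF j : bnd01 (F j) (cm (j.+1%:R * z ^+ j) * (M / rho ^+ j.+1)).
  by move=> t ht; rewrite /F (cmM (j.+1%:R * _)) ler_wpM2l ?cm_ge0 // ccoef_bnd.
have -> : \sum_(j < J) j.+1%:R * ccoef phi j.+1 * z ^+ j = cint (fun t => \sum_(j < J) F j t).
  rewrite (@cint_sum F _ J (fun j _ => bF j)).
  by apply: eq_bigr => j _; rewrite (cintZ _ (ccoef_bnd _)) mulrAC.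
have b' : bnd01 (fun t => phi t * ((ctr rho t)^-1 * cker rho z t ^+ 2)) (M * (rho^-1 * (1 - s / rho)^-1 ^+ 2)).
  apply/bnd01M => // t _; rewrite cmM cmV cm_ctr ler_pM2l ?invr_gt0 // cmX.
  by rewrite ler_pXn2r ?nnegrE ?cm_ge0 ?invr_ge0 ?(ltW k0) // cker_le.
rewrite -(cintB b' (bnd01_sum (J := J) (fun j _ => bF j))).
apply: cint_le => t ht; have n1 := cker_neq0 t (le_lt_trans zs sr).
rewrite (_ : _ - _ = phi t * ((ctr rho t)^-1 * ((z / ctr rho t) ^+ J * (J.+1%:R - J%:R * (z / ctr rho t)) * cker rho z t ^+ 2))); last first.
  rewrite /cker [(_^-1) ^+ 2]exprVn -(deriv_geom J n1) !mulrBr; congr (_ - _).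
  rewrite !mulr_sumr; apply: eq_bigr => j _; rewrite /F [(z / _) ^+ j]exprMn exprVn [_ ^+ j.+1]exprS invfM; ring.
rewrite cmM ler_pM ?hphi ?cm_ge0 // cmM cmV cm_ctr ler_pM2l ?invr_gt0 //.
rewrite cmM ler_pM ?cm_ge0 //.
  rewrite cmM ler_pM ?cm_ge0 // ?cmX ?cmM ?cmV ?cm_ctr //.
  apply: le_trans (cmB _ _) _; rewrite cm_nat lerD2l cmM cm_nat ler_piMr //.
  apply: le_trans (ratio_le t (lexx _)) _; rewrite ler_pdivrMr // mul1r.
  exact: le_trans zs (ltW sr).
by rewrite cmX ler_pXn2r ?nnegrE ?cm_ge0 ?invr_ge0 ?(ltW k0) // cker_le.
Qed.

End Kernel.

(** The kernel is a geometric series in [z / ctr rho t], of which only the constant term survives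
    integration by [dint_circ]; the remainder tends to 0. *)
Lemma cint_cker rho z : cm z < rho -> cint (cker rho z) = 1.
Proof.
move=> zr; have r0 : 0 < rho := le_lt_trans (cm_ge0 _) zr.
have b1 : bnd01 (fun=> 1) 1 by move=> t _; rewrite cm1.
have c0 : ccoef rho (fun=> 1) 0 = 1.
  have -> : ccoef rho (fun=> 1) 0 = cint (fun=> 1).
    by apply: cint_ext => t _; rewrite expr0 invr1 mulr1.
  apply: ulim_eq => e e0; exists 0%N => n _; rewrite /dsum.
  under eq_bigr do rewrite mulr1.
  rewrite sumr_const_nat !subn0 -[_ *+ (2 ^ _)]mulr_natl natrX.
  have -> : 2 ^+ n * (2 ^- n)%:C - 1 = 0 :> C.
    rewrite fmorphV rmorphXn rmorph_nat divff ?subrr // expf_neq0 //.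
    by rewrite pnatr_eq0.
  by rewrite cm0 ltW.
have cj j : ccoef rho (fun=> 1) j.+1 = 0.
  have -> : ccoef rho (fun=> 1) j.+1 = cint (fun t => rho%:C ^- j.+1 * circ (- (j.+1%:R * t))).
    by apply: cint_ext => t _; rewrite mul1r /ctr exprMn invfM circN circX.
  rewrite (@cintZ _ _ 1); first by rewrite /cint dint_circ // mulr0.
  by move=> t _; rewrite cm_circ.
have -> : cint (cker rho z) = ctrans rho (fun=> 1) z by apply: cint_ext => t _; rewrite mul1r.
have [z0|z0] := eqVneq z 0.
  have -> : ctrans rho (fun=> 1) z = ccoef rho (fun=> 1) 0; last by [].
  by apply: cint_ext => t _; rewrite /cker z0 mul0r subr0 expr0.
apply: cm_eq => e e0; set q := cm z / rho.
have q1 : `|q| < 1.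
  by rewrite ger0_norm ?divr_ge0 ?cm_ge0 ?(ltW r0) // ltr_pdivrMr // mul1r.
have k0 := cker_gt0 r0 zr.
have /cvgrPdist_lt /(_ _ (mulr_gt0 e0 k0)) [N _ hN] := cvg_expr q1.
have := ctrans_taylor r0 b1 N.+1 (lexx _) zr; rewrite big_ord_recl c0 expr0 mulr1.
rewrite big1 ?addr0 => [h|j _]; last by rewrite /bump /= cj mul0r.
apply: le_trans h _; rewrite mul1r ler_pdivrMr // -/q.
have := hN N.+1 (leqnSn N); rewrite /= sub0r normrN => /ltW; apply: le_trans.
exact: ler_norm.
Qed.

Definition hol (r : R) (f : C -> C) := forall z, cm z < r -> exists b, hasd f z b.

(** The circle is the outer end, [u = 1], of the deformation towards 0, on which [hp_bounded]
    applies. *)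
Lemma circle_bounded f rho : 0 < rho -> (forall z, cm z <= rho -> exists b, hasd f z b) ->
  exists M, bnd01 (fun t => f (ctr rho t)) M.
Proof.
move=> r0 hf.
have z0 : cm (0 : C) < rho by rewrite cm0.
have t0 : 0 < (2^-1 : R) < 1 by rewrite invr_gt0 ltr0n invf_lt1 ?ltr1n // ltr0n.
have [M hM] := @hp_bounded R 0 rho 2^-1 f z0 t0 (fun w hw _ => hf w hw).
exists M => t ht; have := hM 1 t; rewrite lexx ler01 => /(_ isT ht).
by rewrite add0r subr0 mulr1 [2^-1 + _]addrC subrK mul1r.
Qed.

(** The difference quotient [h] of [f] at [z] is bounded near [z]. By [goursat] its integral equals
    the one over an arbitrarily small circle around [z], hence is 0; separating [f z] with
    [cint_cker] leaves the formula. *)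
Theorem cauchy_formula f rho z : (forall z, cm z <= rho -> exists b, hasd f z b) ->
  cm z < rho -> f z = ctrans rho (fun t => f (ctr rho t)) z.
Proof.
move=> hf zr; have r0 : 0 < rho := le_lt_trans (cm_ge0 _) zr.
pose h w := (f w - f z) / (w - z).
have hder w : cm w <= rho -> w != z -> exists b, hasd h w b.
  move=> /hf [b hb] wz; eexists; apply: hasdM.
    by apply: hasdB hb (hasd_cst (f z) w).
  apply: hasdV; first by rewrite subr_eq0.
  by apply: hasdB (hasd_id w) (hasd_cst z w).
have [b /hasd_lip [d d0 hb]] := hf z (ltW zr).
have hbnd w : cm (w - z) < d -> cm (h w) <= 1 + cm b.
  move=> hw; have [->|wz] := eqVneq w z.
    by rewrite /h subrr mul0r cm0; have := cm_ge0 b; lra.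
  rewrite /h cmM cmV ler_pdivrMr ?cm_gt0 ?subr_eq0 //.
  by have := hb _ hw; rewrite [z + _]addrC subrK.
have [M hM] := circle_bounded r0 hf.
have zz t : cm (ctr rho t - z) >= rho - cm z by apply: le_trans (cm_sub _ _); rewrite cm_ctr.
have nz t : ctr rho t - z != 0 by rewrite -cm_gt0; apply: lt_le_trans (zz t); rewrite subr_gt0.
have tp0 := cm_ge0 (tpi R).
have zero : cint (fun t => h (ctr rho t) * (tpi R * ctr rho t)) = 0.
  apply: cm_le0 => e e0.
  pose K := (1 + cm b) * (cm (tpi R) * rho).
  have K0 : 0 <= K by rewrite !mulr_ge0 ?addr_ge0 ?cm_ge0 // ltW.
  (* Points of the circle have distance at most [2 * rho] from [z], so the second bound puts the
     contracted circle where [hbnd] holds; the third makes its integral at most [e]. *)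
  pose tau0 := Num.min 2^-1 (Num.min (d / (4 * rho)) (e / (1 + K))).
  have t1 : 0 < tau0.
    by rewrite !lt_min invr_gt0 ltr0n !divr_gt0 ?mulr_gt0 //; lra.
  have t2 : tau0 <= 2^-1 by rewrite ge_min lexx.
  have t3 : tau0 <= d / (4 * rho) by rewrite ge_min ge_min lexx orbT.
  have t4 : tau0 <= e / (1 + K) by rewrite !ge_min lexx !orbT.
  have t01 : 0 < tau0 < 1 by rewrite t1; lra.
  have := goursat zr t01 hder; rewrite mulr0 addr0 mulr1 (_ : tau0 + (1 - tau0) = 1); last by ring.
  have -> : (fun v : R => h (z + 1%:C * (rho%:C * circ v - z)) * (1%:C * (tpi R * (rho%:C * circ v)))) =
            (fun t => h (ctr rho t) * (tpi R * ctr rho t)).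
    by apply/funext => t; rewrite !mul1r [z + _]addrC subrK.
  rewrite /cint => ->; apply: (@cint_le _ e) => t _.
  have -> : cm (h (z + tau0%:C * (rho%:C * circ t - z)) * (tau0%:C * (tpi R * (rho%:C * circ t)))) =
      cm (h (z + tau0%:C * (rho%:C * circ t - z))) * (tau0 * (cm (tpi R) * rho)).
    rewrite (cmM (h _)); congr (_ * _).
    by rewrite !cmM cmR cm_circ mulr1 cmR (gtr0_norm r0) (gtr0_norm t1).
  have tz : cm (ctr rho t - z) <= 2 * rho.
    by apply: le_trans (cmB _ _) _; rewrite cm_ctr // mulr2n mulrDl mul1r lerD2l ltW.
  have hh : cm (h (z + tau0%:C * (rho%:C * circ t - z))) <= 1 + cm b.
    apply: hbnd; rewrite addrC addKr cmM cmR (gtr0_norm t1).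
    apply: le_lt_trans (ler_wpM2l (ltW t1) tz) _.
    move: t3; rewrite ler_pdivlMr ?mulr_gt0 //; nra.
  apply: le_trans (ler_wpM2r _ hh) _.
    by rewrite !mulr_ge0 // ltW.
  rewrite mulrCA -/K; move: t4; rewrite ler_pdivlMr; last lra.
  nra.
have ker0 t : cker rho z t = ctr rho t / (ctr rho t - z).
  rewrite /cker (_ : 1 - _ = (ctr rho t - z) / ctr rho t) ?invf_div //.
  by rewrite mulrBl divff // ctr_neq0.
have bk : bnd01 (cker rho z) (1 - cm z / rho)^-1 by move=> t _; apply: cker_le.
have e1 : cint (fun t => h (ctr rho t) * (tpi R * ctr rho t)) =
   tpi R * (ctrans rho (fun t => f (ctr rho t)) z - f z).
  have -> : ctrans rho (fun t => f (ctr rho t)) z - f z =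
      cint (fun t => f (ctr rho t) * cker rho z t - f z * cker rho z t).
    rewrite (cintB (ctrans_bnd r0 hM (lexx _) zr) (M' := cm (f z) * (1 - cm z / rho)^-1)).
      by rewrite (cintZ _ bk) cint_cker // mulr1.
    by move=> t ht; rewrite cmM ler_wpM2l ?cm_ge0 ?bk.
  rewrite -(@cintZ _ _ ((M + cm (f z)) * (1 - cm z / rho)^-1)).
    by apply: cint_ext => t _; rewrite -mulrBl ker0 /h; ring.
  move=> t ht; rewrite -mulrBl cmM ler_pM ?cm_ge0 ?bk //.
  by apply: le_trans (cmB _ _) _; rewrite lerD2r hM.
move: zero; rewrite e1 => /eqP; rewrite mulf_eq0 => /orP[/eqP tp|]; last first.
  by rewrite subr_eq0 => /eqP.
by move/eqP: tp; rewrite eq_complex /= eqxx mulf_eq0 pnatr_eq0 /= gt_eqF // pi_gt0.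
Qed.

End CauchyTransform.

(** * Holomorphic functions on a disc *)

Section Holomorphic.
Variable R : realType.
Local Notation C := R[i].
Implicit Types (f g : C -> C).

Lemma geom_small (q M e : R) : 0 <= q < 1 -> 0 < e ->
  exists N, forall J, (N <= J)%N -> M * q ^+ J <= e.
Proof.
move=> /andP[q0 q1] e0.
have q' : `|q| < 1 by rewrite ger0_norm.
have e1 : 0 < e / (`|M| + 1) by rewrite divr_gt0 // ltr_wpDl.
have /cvgrPdist_lt /(_ _ e1) [N _ hN] := cvg_expr q'.
exists N => J NJ; have := hN J NJ; rewrite /= sub0r normrN ger0_norm ?exprn_ge0 // => h.
have m0 := normr_ge0 M; have := ler_norm M.
move: h; rewrite ltr_pdivlMr; last by lra.
have := exprn_ge0 J q0; move: (q ^+ J) => x; nra.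
Qed.

Lemma hol_lt r s f : s < r -> hol r f -> forall z, cm z <= s -> exists b, hasd f z b.
Proof. by move=> sr h z zs; apply: h; apply: le_lt_trans zs sr. Qed.

Lemma hol_bound r s f : 0 <= s < r -> hol r f -> exists2 M, 0 <= M & forall z, cm z <= s -> cm (f z) <= M.
Proof.
move=> /andP[s0 sr] hf; pose rho := (s + r) / 2.
have r0 : 0 < rho by rewrite /rho; lra.
have rr : rho < r by rewrite /rho; lra.
have srho : s < rho by rewrite /rho; lra.
have hf' := hol_lt rr hf.
have [M hM] := circle_bounded r0 hf'; have M0 := bnd01_ge0 hM.
have k0 := cker_gt0 r0 srho.
exists (M / (1 - s / rho)); first by rewrite divr_ge0 // ltW.
move=> z zs; rewrite (cauchy_formula hf' (le_lt_trans zs srho)).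
exact/cint_le/ctrans_bnd.
Qed.

(** Cauchy's integral for a Taylor coefficient; for a holomorphic [f], [expands_uniq] makes it
    independent of the radius [s]. *)
Definition tcoef f (s : R) (j : nat) : C := ccoef s (fun t => f (ctr s t)) j.

Lemma hol_taylor r s f z J M : 0 < s < r -> hol r f -> bnd01 (fun t => f (ctr s t)) M ->
  cm z < s ->
  cm (f z - \sum_(j < J) tcoef f s j * z ^+ j) <= M * (cm z / s) ^+ J / (1 - cm z / s).
Proof.
move=> /andP[s0 sr] hf hM zs; rewrite (cauchy_formula (hol_lt sr hf) zs).
exact: ctrans_taylor.
Qed.

(** An asymptotic expansion to every order at 0. It says nothing about convergence, which keeps sums
    and products elementary, yet it determines the coefficients. *)
Definition expands f (a : nat -> C) := forall J : nat, exists d : R, exists K : R,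
  [/\ 0 < d, 0 <= K & forall z, cm z < d -> cm (f z - \sum_(j < J) a j * z ^+ j) <= K * cm z ^+ J].

Lemma hol_expands r s f : 0 < s < r -> hol r f -> expands f (tcoef f s).
Proof.
move=> sr hf J; have /andP[s0 sr'] := sr.
have [M hM] := circle_bounded s0 (hol_lt sr' hf); have M0 := bnd01_ge0 hM.
exists (s / 2), (M / s ^+ J * 2); split.
- by rewrite divr_gt0.
- by rewrite mulr_ge0 // divr_ge0 // exprn_ge0 // ltW.
move=> z zs; have z2 : cm z < s by lra.
apply: le_trans (hol_taylor _ sr hf hM z2) _.
rewrite expr_div_n [leRHS](_ : _ = M * (cm z ^+ J / s ^+ J) * 2); last by ring.
rewrite ler_wpM2l ?mulr_ge0 ?invr_ge0 ?exprn_ge0 ?cm_ge0 ?(ltW s0) //.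
have : cm z / s <= 2^-1 by rewrite ler_pdivrMr //; lra.
move: (cm z / s) => x x2; rewrite -[leRHS]invrK lef_pV2 ?posrE ?invr_gt0 //; lra.
Qed.

Lemma hol_expands' r s f f' : 0 < s < r -> (forall z, cm z < r -> hasd f z (f' z)) ->
  expands f' (fun j => j.+1%:R * tcoef f s j.+1).
Proof.
move=> /andP[s0 sr] hf' J.
have hf : hol r f by move=> z /hf'; exists (f' z).
have [M hM] := circle_bounded s0 (hol_lt sr hf); have M0 := bnd01_ge0 hM.
exists (s / 2), (M * (s^-1 * (s ^- J * (J.+1%:R + J%:R) * 2 ^+ 2))); split.
- by rewrite divr_gt0.
- by rewrite !mulr_ge0 ?invr_ge0 ?exprn_ge0 ?addr_ge0 // ltW.
move=> z zs; have z2 : cm z < s by lra.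
have -> : f' z = ctrans' s (fun t => f (ctr s t)) z.
  apply: (hasd_uniq (hf' _ (lt_trans z2 sr))).
  apply: hasd_near (ctrans_hasd s0 hM z2).
  exists (s - cm z); first by rewrite subr_gt0.
  move=> q hq; rewrite (cauchy_formula (hol_lt sr hf)) //.
  by rewrite -(subrK z q); apply: le_lt_trans (cmD _ _) _; lra.
apply: le_trans (ctrans'_taylor s0 hM _ (lexx _) z2) _.
rewrite expr_div_n [leRHS](_ : _ = M * (s^-1 * (cm z ^+ J / s ^+ J * (J.+1%:R + J%:R) * 2 ^+ 2))); last by ring.
do 2![rewrite ler_wpM2l ?invr_ge0 ?(ltW s0) //].
rewrite ler_wpM2l ?mulr_ge0 ?addr_ge0 ?invr_ge0 ?exprn_ge0 ?cm_ge0 ?(ltW s0) //.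
have q2 : cm z / s <= 2^-1 by rewrite ler_pdivrMr //; lra.
have q0 : 0 <= cm z / s by rewrite divr_ge0 ?cm_ge0 // ltW.
rewrite ler_pXn2r ?nnegrE ?invr_ge0 //; last by lra.
rewrite -[leRHS]invrK lef_pV2 ?posrE ?invr_gt0 //; lra.
Qed.

Lemma expands_ext f g a : (exists2 d : R, 0 < d & forall z, cm z < d -> f z = g z) -> expands f a -> expands g a.
Proof.
move=> [d d0 fg] hf J; have [d' [K [d'0 K0 h]]] := hf J.
exists (Num.min d d'), K; split => // [|z]; first by rewrite lt_min d0.
by rewrite lt_min => /andP[z1 z2]; rewrite -fg // h.
Qed.

Lemma expands_coef f a b : (forall j, a j = b j) -> expands f a -> expands f b.
Proof.
move=> ab hf J; have [d [K [d0 K0 h]]] := hf J; exists d, K; split => // z hz.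
by under eq_bigr do rewrite -ab; apply: h.
Qed.

Lemma expandsD f g a b : expands f a -> expands g b -> expands (fun z => f z + g z) (fun j => a j + b j).
Proof.
move=> hf hg J; have [d [K [d0 K0 h]]] := hf J; have [d' [K' [d'0 K'0 h']]] := hg J.
exists (Num.min d d'), (K + K'); split; rewrite ?addr_ge0 ?lt_min ?d0 // => z.
rewrite lt_min => /andP[z1 z2].
under eq_bigr do rewrite mulrDl.
rewrite big_split /= opprD addrACA mulrDl; apply: le_trans (cmD _ _) _.
by rewrite lerD ?h ?h'.
Qed.

Lemma expandsZ c f a : expands f a -> expands (fun z => c * f z) (fun j => c * a j).
Proof.
move=> hf J; have [d [K [d0 K0 h]]] := hf J.
exists d, (cm c * K); split; rewrite ?mulr_ge0 ?cm_ge0 // => z hz.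
under eq_bigr do rewrite -mulrA.
by rewrite -mulr_sumr -mulrBr cmM -mulrA ler_wpM2l ?cm_ge0 ?h.
Qed.

Lemma expandsN f a : expands f a -> expands (fun z => - f z) (fun j => - a j).
Proof.
move=> /(expandsZ (-1)) h; apply: expands_coef (expands_ext _ h) => [j|]; first by rewrite mulN1r.
by exists 1 => // z _; rewrite mulN1r.
Qed.

Lemma expands_cst c : expands (fun=> c) (fun j => if j == 0%N then c else 0).
Proof.
case=> [|J].
  exists 1, (cm c); split; rewrite ?cm_ge0 // => z _; by rewrite big_ord0 subr0 expr0 mulr1.
exists 1, 0; split => // z _; rewrite big_ord_recl /= big1 => [|i _]; last by rewrite mul0r.
by rewrite expr0 mulr1 addr0 subrr cm0 mul0r.
Qed.

Lemma expands_X f a : expands f a -> expands (fun z => z * f z) (fun j => if j is k.+1 then a k else 0).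
Proof.
move=> hf [|J].
  have [d [K [d0 K0 h]]] := hf 0%N; exists (Num.min d 1), K; split => // [|z].
    by rewrite lt_min d0 ltr01.
  rewrite lt_min => /andP[z1 z2]; have := h z z1; rewrite !big_ord0 !subr0 expr0 mulr1 cmM => h1.
  by apply: le_trans h1; rewrite ler_piMl ?cm_ge0 // ltW.
have [d [K [d0 K0 h]]] := hf J; exists d, K; split => // z hz.
rewrite big_ord_recl /= mul0r add0r.
under eq_bigr do rewrite /bump /= add1n exprS mulrCA.
by rewrite -mulr_sumr -mulrBr cmM exprS mulrCA ler_wpM2l ?cm_ge0 ?h.
Qed.

Lemma expands_tail f a J : expands f a -> exists d : R, exists K : R, exists g,
  [/\ 0 < d, 0 <= K, forall z, cm z < d -> f z = \sum_(j < J) a j * z ^+ j + g z * z ^+ J &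
      forall z, cm z < d -> cm (g z) <= K].
Proof.
move=> hf; have [d [K [d0 K0 h]]] := hf J.
have [d1 [K1 [d10 K10 h1]]] := hf J.+1.
exists (Num.min d d1), (Num.max K (cm (a J))).
exists (fun z => if z == 0 then a J else (f z - \sum_(j < J) a j * z ^+ j) / z ^+ J).
split; rewrite ?lt_min ?d0 ?le_max ?K0 // => z; rewrite lt_min => /andP[z1 z2].
  have [->|z0] := eqVneq z 0; last by rewrite divfK ?expf_neq0 // addrC subrK.
  have := h1 0; rewrite cm0 => /(_ d10); rewrite big_ord_recr /= exprS mul0r mulr0.
  by move=> hh; apply: cm_eq => e e0; rewrite (le_trans hh) // ltW.
case: eqVneq => [_|z0]; first by rewrite le_max lexx orbT.
by rewrite le_max cmM cmV cmX ler_pdivrMr ?exprn_gt0 ?cm_gt0 // h.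
Qed.

Definition conv (a b : nat -> C) (m : nat) : C := \sum_(i < m.+1) a i * b (m - i)%N.

Lemma poly_bound (p : {poly C}) : exists2 K : R, 0 <= K & forall z, cm z <= 1 -> cm p.[z] <= K.
Proof.
exists (\sum_(i < size p) cm p`_i); first by apply: sumr_ge0 => i _; apply: cm_ge0.
move=> z z1; rewrite horner_coef; apply: le_trans (cm_sum _ _ _) _; apply: ler_sum => i _.
by rewrite cmM cmX ler_piMr ?cm_ge0 // exprn_ile1 ?cm_ge0.
Qed.

Lemma expandsM f g a b : expands f a -> expands g b -> expands (fun z => f z * g z) (conv a b).
Proof.
move=> hf hg J.
have [d [K [u [d0 K0 fE uK]]]] := expands_tail J hf.
have [d' [K' [v [d'0 K'0 gE vK]]]] := expands_tail J hg.
pose p := \poly_(i < J) a i; pose q := \poly_(i < J) b i.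
pose s := \poly_(i < J) conv a b i.
have pE z : \sum_(j < J) a j * z ^+ j = p.[z] by rewrite horner_poly.
have qE z : \sum_(j < J) b j * z ^+ j = q.[z] by rewrite horner_poly.
have sE z : \sum_(j < J) conv a b j * z ^+ j = s.[z] by rewrite horner_poly.
(* The product of the truncations agrees with the truncated convolution below degree [J], so their
   difference is [t * 'X^J]. *)
pose t := drop_poly J (p * q - s).
have tE : p * q - s = t * 'X^J.
  rewrite -[LHS](poly_take_drop J) (_ : take_poly _ _ = 0) ?add0r //.
  apply/polyP => i; rewrite coef_take_poly coef0; case: ltnP => // iJ.
  rewrite coefB coefM coef_poly iJ; apply/eqP; rewrite subr_eq0; apply/eqP.
  apply: eq_bigr => k _; have kJ : (k < J)%N by apply: leq_ltn_trans iJ; rewrite -ltnS.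
  by rewrite !coef_poly kJ (leq_ltn_trans (leq_subr _ _) iJ).
have [Kp Kp0 hp] := poly_bound p; have [Kq Kq0 hq] := poly_bound q; have [Kt Kt0 ht] := poly_bound t.
exists (Num.min 1 (Num.min d d')), (Kt + (Kp * K' + K * Kq + K * K')); split.
- by rewrite !lt_min d0 ltr01.
- by rewrite !addr_ge0 // mulr_ge0.
move=> z; rewrite !lt_min => /and3P[z1 zd zd'].
have z1' := ltW z1.
rewrite fE // gE // pE qE sE.
have -> : (p.[z] + u z * z ^+ J) * (q.[z] + v z * z ^+ J) - s.[z] =
  (t.[z] + (p.[z] * v z + u z * q.[z] + u z * (v z * z ^+ J))) * z ^+ J.
  have : (p * q - s).[z] = t.[z] * z ^+ J by rewrite tE hornerM hornerXn.
  by rewrite hornerD hornerN hornerM => /(canRL (subrK _)) e; ring: e.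
rewrite cmM cmX ler_wpM2r ?exprn_ge0 ?cm_ge0 //.
apply: le_trans (cmD _ _) _; rewrite lerD ?ht //.
apply: le_trans (cmD _ _) _; rewrite lerD //.
  by apply: le_trans (cmD _ _) _; rewrite lerD // cmM ler_pM ?cm_ge0 ?hp ?hq ?uK ?vK.
rewrite cmM ler_pM ?cm_ge0 ?uK // cmM cmX -[K']mulr1.
by rewrite ler_pM ?cm_ge0 ?exprn_ge0 ?cm_ge0 ?vK // exprn_ile1 ?cm_ge0.
Qed.

Lemma expands_sum n (F : 'I_n -> C -> C) (A : 'I_n -> nat -> C) : (forall i, expands (F i) (A i)) ->
  expands (fun z => \sum_i F i z) (fun j => \sum_i A i j).
Proof.
move=> h.
suff : forall s : seq 'I_n, expands (fun z => \sum_(i <- s) F i z) (fun j => \sum_(i <- s) A i j).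
  by apply.
elim=> [|i s IH].
  apply: (@expands_coef _ (fun j => if j == 0%N then 0 else 0)) => [j|]; first by rewrite big_nil; case: ifP.
  by apply: expands_ext (expands_cst 0); exists 1 => // z _; rewrite big_nil.
apply: expands_coef (expands_ext _ (expandsD (h i) IH)) => [j|]; first by rewrite big_cons.
by exists 1 => // z _; rewrite big_cons.
Qed.

Lemma expands_uniq f a b : expands f a -> expands f b -> forall j, a j = b j.
Proof.
move=> ha hb; have h0 : expands (fun=> 0) (fun j => a j - b j).
  apply: expands_ext (expandsD ha (expandsN hb)); by exists 1 => // z _; rewrite subrr.
pose c j := a j - b j; suff cj : forall j, c j = 0.
  by move=> j; apply/eqP; rewrite -subr_eq0; apply/eqP; apply: cj.
elim/ltn_ind => J IH; have [d [K [d0 K0 h]]] := h0 J.+1.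
apply: cm_le0 => e e0.
pose x := Num.min (d / 2) (e / (1 + K)).
have x0 : 0 < x by rewrite lt_min !divr_gt0 //; lra.
have xd : x < d by apply: le_lt_trans (_ : _ <= d / 2) _; rewrite ?ge_min ?lexx //; lra.
have xe : x <= e / (1 + K) by rewrite ge_min lexx orbT.
have := h x%:C; rewrite cmR gtr0_norm // => /(_ xd).
rewrite big_ord_recr /= big1 => [|i _]; last by rewrite -/(c i) IH // mul0r.
rewrite -/(c J) add0r cmN add0r cmM cmX cmR gtr0_norm // exprS mulrA ler_pM2r ?exprn_gt0 //.
move: xe; rewrite ler_pdivlMr; last by lra.
nra.
Qed.

(** Uniqueness makes every [tcoef] zero, and the Taylor remainder of order [N] on a circle between
    [z] and radius [r] tends to 0. *)
Lemma hol_expands0 r f : hol r f -> expands f (fun=> 0) -> forall z, cm z < r -> f z = 0.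
Proof.
move=> hf h0 z zr; pose s := (cm z + r) / 2.
have s0 : 0 < s by rewrite /s; have := cm_ge0 z; lra.
have sr : s < r by rewrite /s; lra.
have zs : cm z < s by rewrite /s; lra.
have s0r : 0 < s < r by rewrite s0.
have c0 := expands_uniq (hol_expands s0r hf) h0.
have [M hM] := circle_bounded s0 (hol_lt sr hf); have M0 := bnd01_ge0 hM.
have k0 := cker_gt0 s0 zs.
apply: cm_le0 => e e0.
have q01 : 0 <= cm z / s < 1 by rewrite divr_ge0 ?cm_ge0 ?(ltW s0) //= ltr_pdivrMr // mul1r.
have [N hN] := geom_small M q01 (mulr_gt0 e0 k0).
have := hol_taylor N s0r hf hM zs; rewrite big1 => [|j _]; last by rewrite c0 mul0r.
rewrite subr0 => h; apply: le_trans h _; rewrite ler_pdivrMr //.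
exact: hN.
Qed.

Definition hol_at (r : R) f c := forall z, cm (z - c) < r -> exists b, hasd f z b.

Lemma hol_at_hol r f c : hol_at r f c -> hol r (fun z => f (c + z)).
Proof.
move=> h z zr; have [b hb] := h (c + z) ltac:(by rewrite addrC addKr).
exists (b * (0 + 1)); apply: (@hasd_comp _ f (fun z => c + z)) => //.
by apply: hasdD (hasd_cst c z) (hasd_id z).
Qed.

Definition zero_near f c := exists2 d : R, 0 < d & forall z, cm (z - c) < d -> f z = 0.

Lemma zero_near_ball r f c : hol_at r f c -> zero_near f c -> forall z, cm (z - c) < r -> f z = 0.
Proof.
move=> /hol_at_hol h [d d0 hd] z zr.
rewrite -[z](subrK c) addrC; apply: (hol_expands0 h) => //.
apply: (@expands_coef _ (fun j => if j == 0%N then 0 else 0)) => [j|]; first by case: ifP.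
apply: expands_ext (expands_cst 0); exists d => // w hw; rewrite hd //.
by rewrite addrC addKr.
Qed.

(** Continuation along the segment. Around the supremum [T] of the parameters reached so far, discs
    of one fixed radius overlap, so vanishing passes across [T], which forces [T = 1]. *)
Lemma identity_segment f (p q : C) :
  (forall t : R, 0 <= t <= 1 -> exists2 r : R, 0 < r & hol_at r f (p + t%:C * (q - p))) ->
  zero_near f p -> zero_near f q.
Proof.
move=> hf h0; pose ga (t : R) := p + t%:C * (q - p).
pose A := [set t : R | 0 <= t <= 1 /\ zero_near f (ga t)].
have A0 : A 0 by split; rewrite ?lexx ?ler01 // /ga mul0r addr0.
pose B := [set t : R | 0 <= t <= 1 /\ forall s, 0 <= s <= t -> zero_near f (ga s)].
have B0 : B 0.
  split; rewrite ?lexx ?ler01 // => s /andP[s1 s2]; have -> : s = 0 by apply/eqP; rewrite eq_le s1 s2.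
  by rewrite /ga mul0r addr0.
have hB : has_sup B by split; [exists 0 | exists 1 => t [/andP[]]].
have step t : 0 <= t <= 1 -> exists2 d : R, 0 < d & forall s s', `|s - t| < d -> `|s' - t| < d ->
     zero_near f (ga s) -> zero_near f (ga s').
  move=> /hf [r r0 hr]; have k0 := cm_ge0 (q - p).
  (* A point within [r / 8] of [ga s'] is within [3 * r / 8] of [ga s], and the disc of radius
     [r / 2] around [ga s] lies in the disc of radius [r] around [ga t]. *)
  exists (r / 8 / (1 + cm (q - p))); first by rewrite !divr_gt0 //; lra.
  have dist s : `|s - t| < r / 8 / (1 + cm (q - p)) -> cm (ga s - ga t) < r / 8.
    rewrite ltr_pdivlMr => [h|]; last by lra.
    rewrite (_ : _ - _ = (s - t)%:C * (q - p)); last by rewrite /ga rmorphB /=; ring.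
    rewrite cmM cmR; have := normr_ge0 (s - t); nra.
  move=> s s' /dist hs /dist hs' hz.
  have hs2 : hol_at (r / 2) f (ga s).
    move=> z zs; apply: hr; rewrite -(subrK (ga s) z) -addrA.
    by apply: le_lt_trans (cmD _ _) _; rewrite -/(ga t); lra.
  exists (r / 8); first by lra.
  move=> z zs; apply: (zero_near_ball hs2 hz).
  rewrite (_ : z - ga s = (z - ga s') + (ga s' - ga t) - (ga s - ga t)); last by ring.
  by apply: le_lt_trans (cmB _ _) _; have := cmD (z - ga s') (ga s' - ga t); lra.
have B1 : forall t, B t -> forall s, 0 <= s <= t -> B s.
  move=> t [/andP[t0 t1] ht] s /andP[s0 st]; split; first by rewrite s0 (le_trans st).
  by move=> u /andP[u0 us]; apply: ht; rewrite u0 (le_trans us).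
set T := sup B.
have T0 : 0 <= T by apply: sup_upper_bound.
have T1 : T <= 1 by apply: ge_sup => [|t [/andP[]]//]; exists 0.
have T01 : 0 <= T <= 1 by rewrite T0.
have [d d0 hd] := step T T01.
have [s Bs sT] := sup_adherent d0 hB.
have sT' : s <= T by apply: sup_upper_bound.
have [/andP[s0 s1] hs] := Bs.
have zs : zero_near f (ga s) by apply: hs; rewrite s0 lexx.
have sd : `|s - T| < d by rewrite ltr_norml; apply/andP; split; rewrite -/T in sT; lra.
have near t : `|t - T| < d -> zero_near f (ga t) by move=> ht; apply: hd sd ht zs.
have B2 t : s <= t -> `|t - T| < d -> t <= 1 -> B t.
  move=> st ht t1; split; first by rewrite (le_trans s0).
  move=> u /andP[u0 ut]; have [us|us] := leP u s; first by apply: hs; rewrite u0.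
  apply: near; move: ht; rewrite !ltr_norml => /andP[h1 h2]; apply/andP; split; last by lra.
  by move: sd; rewrite ltr_norml => /andP[]; lra.
have T1e : T = 1.
  apply/eqP; rewrite eq_le T1 leNgt; apply/negP => T1'.
  pose t := Num.min 1 (T + d / 2).
  have tT : T < t by rewrite lt_min T1' ltrDl divr_gt0.
  have Bt : B t.
    apply: B2; first by apply: le_trans sT' (ltW tT).
      rewrite gtr0_norm ?subr_gt0 //; apply: le_lt_trans (_ : _ <= d / 2) _; last by lra.
      by rewrite lerBlDl ge_min lexx orbT.
    by rewrite ge_min lexx.
  by have := sup_upper_bound hB Bt; rewrite -/T; lra.
have := near 1; rewrite T1e subrr normr0 => /(_ d0).
by rewrite /ga mul1r addrC subrK.
Qed.

(** Continuity of [f] at [c] makes [w * f (c + w)] differentiable at [w = 0] as well. Its expansion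
    has no constant term; dividing it by [w] gives value and derivative of [f] at [c]. *)
Lemma removable_singularity r f c : 0 < r ->
  (forall z, cm (z - c) < r -> z != c -> exists b, hasd f z b) -> cts f c -> exists b, hasd f c b.
Proof.
move=> r0 hf cf; pose g w := w * f (c + w).
have hg : hol r g.
  move=> w wr; have [->|w0] := eqVneq w 0.
    exists (f c) => e e0; have [d d0 hd] := cf e e0.
    exists d => // h hh; rewrite /g !add0r mul0r subr0 (mulrC _ h) -mulrBr cmM mulrC.
    by rewrite ler_wpM2r ?cm_ge0 // ltW // hd.
  have [b hb] : exists b, hasd f (c + w) b.
    apply: hf; first by rewrite addrC addKr.
    by rewrite -subr_eq0 addrC addKr.
  eexists; apply: hasdM (hasd_id w) _.
  by apply: hasd_comp (hasdD (hasd_cst c w) (hasd_id w)) hb.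
have s0r : 0 < r / 2 < r by apply/andP; split; lra.
have [d [K [d0 K0 h]]] := hol_expands s0r hg 3.
set a := tcoef g (r / 2) in h.
have a0 : a 0%N = 0.
  have := h 0; rewrite cm0 => /(_ d0); rewrite !big_ord_recr big_ord0 /= /g mul0r sub0r add0r.
  rewrite expr0 !exprS !mul0r !mulr0 !addr0 mulr1 => hh; apply: cm_le0 => e e0.
  by move: hh; rewrite cmN => /le_trans; apply; exact: ltW.
have hw w : cm w < d -> w != 0 -> cm (f (c + w) - a 1%N - a 2%N * w) <= K * cm w ^+ 2.
  move=> wd w0; have := h w wd; rewrite !big_ord_recr big_ord0 /= a0 /g.
  rewrite (_ : _ - _ = w * (f (c + w) - a 1%N - a 2%N * w)); last by ring.
  by rewrite cmM exprS mulrCA ler_pM2l ?cm_gt0.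
have fc : f c = a 1%N.
  apply: cm_eq => e e0; have [d1 d10 hd1] := cf (e / 3) ltac:(lra).
  have A0 := cm_ge0 (a 2%N).
  pose x := Num.min (Num.min (d / 2) (d1 / 2)) (Num.min (e / 3 / (1 + cm (a 2%N))) (Num.min 1 (e / 3 / (1 + K)))).
  have x0 : 0 < x by rewrite !lt_min ltr01 !divr_gt0 //; lra.
  have x1 : x <= d / 2 by rewrite !ge_min lexx.
  have x2 : x <= d1 / 2 by rewrite !ge_min lexx orbT.
  have x3 : x <= e / 3 / (1 + cm (a 2%N)) by rewrite !ge_min lexx !orbT.
  have x4 : x <= 1 by rewrite !ge_min lexx !orbT.
  have x5 : x <= e / 3 / (1 + K) by rewrite !ge_min lexx !orbT.
  have cx : cm x%:C = x by rewrite cmR gtr0_norm.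
  have xn : x%:C != 0 :> C by rewrite -cm_gt0 cx.
  have := hw x%:C; rewrite cx => /(_ _ xn) h1; have {}h1 := h1 ltac:(lra).
  have := hd1 x%:C; rewrite cx => h2; have {}h2 := h2 ltac:(lra).
  rewrite (_ : f c - a 1%N = (f (c + x%:C) - a 1%N - a 2%N * x%:C) + a 2%N * x%:C - (f (c + x%:C) - f c)); last by ring.
  apply: le_trans (cmB _ _) _; have := cmD (f (c + x%:C) - a 1%N - a 2%N * x%:C) (a 2%N * x%:C).
  rewrite [cm (a 2%N * _)]cmM cx.
  have y3 : x * (1 + cm (a 2%N)) <= e / 3 by rewrite -ler_pdivlMr //; lra.
  have y5 : x * (1 + K) <= e / 3 by rewrite -ler_pdivlMr //; lra.
  have : K * x ^+ 2 <= K * x by rewrite ler_wpM2l // expr2 ler_piMr // ltW.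
  nra.
exists (a 2%N) => e e0; exists (Num.min d (e / (1 + K))).
  by rewrite lt_min d0 divr_gt0 //; lra.
move=> w; rewrite lt_min => /andP[w1 w2].
have [->|w0] := eqVneq w 0; first by rewrite addr0 subrr mulr0 subr0 cm0 mulr0.
rewrite fc; apply: le_trans (hw w w1 w0) _; rewrite expr2 mulrA ler_wpM2r ?cm_ge0 //.
move: w2; rewrite ltr_pdivlMr; last by lra.
have := cm_ge0 w; nra.
Qed.

Lemma zero_derivative r f c : (forall z, cm (z - c) < r -> hasd f z 0) ->
  forall z, cm (z - c) < r -> f z = f c.
Proof.
move=> hf z zr; have r0 : 0 < r := le_lt_trans (cm_ge0 _) zr.
have hg : hol r (fun w => f (c + w)) by apply: hol_at_hol => w /hf; exists 0.
have s0r : 0 < r / 2 < r by apply/andP; split; lra.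
have h0 : forall w, cm w < r -> hasd (fun w => f (c + w)) w 0.
  move=> w wr; apply: hasd_eq (hasd_comp (hasdD (hasd_cst c w) (hasd_id w)) (hf _ _)) _.
    by rewrite addrC addKr.
  by rewrite mul0r.
have e' := hol_expands' s0r h0; set a := tcoef _ _ in e'.
have z' : expands (fun=> 0) (fun j => if j == 0%N then 0 else 0) := expands_cst 0.
have aj j : a j.+1 = 0.
  have := expands_uniq e' z' j; rewrite (if_same (j == 0%N)) => /eqP.
  by rewrite mulf_eq0 pnatr_eq0 /= => /eqP.
have e1 : expands (fun w => f (c + w)) a := hol_expands s0r hg.
have e2 : expands (fun w => f (c + w) - a 0%N) (fun=> 0).
  apply: expands_coef (expandsD e1 (expandsN (expands_cst (a 0%N)))) => -[|j] /=; first by rewrite subrr.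
  by rewrite aj oppr0 addr0.
have h2 : hol r (fun w => f (c + w) - a 0%N).
  by move=> w /hg [b hb]; exists (b - 0); apply: hasdB hb (hasd_cst _ _).
have k w : cm w < r -> f (c + w) = a 0%N.
  by move=> /(hol_expands0 h2 e2) /eqP; rewrite subr_eq0 => /eqP.
have := k 0; rewrite addr0 cm0 => -> //.
by have := k (z - c) zr; rewrite addrC subrK.
Qed.

(** Cauchy's formula passes to the uniform limit: [f] equals the transform of its own boundary
    values, which is differentiable for any bounded boundary function. *)
Lemma weierstrass r f :
  (forall e, 0 < e -> exists2 g, hol r g & forall z, cm z < r -> cm (g z - f z) <= e) -> hol r f.
Proof.
move=> hf z zr; pose s := (cm z + r) / 2.
have s0 : 0 < s by rewrite /s; have := cm_ge0 z; lra.
have sr : s < r by rewrite /s; lra.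
have zs : cm z < s by rewrite /s; lra.
have [M hM] : exists M, bnd01 (fun t => f (ctr s t)) M.
  have [g hg gf] := hf 1 ltr01; have [M hM] := circle_bounded s0 (hol_lt sr hg).
  exists (M + 1) => t ht; rewrite -(subrK (g (ctr s t)) (f (ctr s t))) addrC.
  by apply: le_trans (cmD _ _) _; rewrite lerD ?hM // cmBC gf // cm_ctr.
exists (ctrans' s (fun t => f (ctr s t)) z); apply: hasd_near (ctrans_hasd s0 hM zs).
exists (s - cm z); first by rewrite subr_gt0.
move=> w hw; have ws : cm w < s by rewrite -(subrK z w); apply: le_lt_trans (cmD _ _) _; lra.
have k0 := cker_gt0 s0 ws; apply: cm_eq => e e0.
pose e' := e / (1 + (1 - cm w / s)^-1).
have d0 : 0 < 1 + (1 - cm w / s)^-1 by rewrite ltr_wpDr // invr_ge0 ltW.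
have [g hg gf] := hf e' ltac:(by rewrite divr_gt0).
have [M' hM'] := circle_bounded s0 (hol_lt sr hg).
rewrite -(subrK (g w) (ctrans _ _ w)) -addrA; apply: le_trans (cmD _ _) _.
rewrite {1}(cauchy_formula (hol_lt sr hg) ws).
rewrite -(cintB (ctrans_bnd s0 hM (lexx _) ws) (ctrans_bnd s0 hM' (lexx _) ws)).
have -> : e = e' * (1 - cm w / s)^-1 + e'.
  by rewrite -[X in _ + X]mulr1 -mulrDr addrC divfK // gt_eqF.
rewrite lerD ?gf ?(lt_trans ws) //; apply: cint_le => t _; rewrite -mulrBl cmM.
by rewrite ler_pM ?cm_ge0 ?cker_le // cmBC gf // cm_ctr.
Qed.

(** Cauchy's estimates for the first two derivatives. The constant is chosen before [f], as needed
    for families depending on a parameter. *)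
Lemma hol_quadratic (r s : R) : 0 <= s < r -> exists2 K : R, 0 <= K &
  forall f M, hol r f -> (forall z, cm z < r -> cm (f z) <= M) -> exists f',
   (forall z, cm z <= s -> cm (f' z) <= K * M) /\
   (forall z h, cm z <= s -> cm (z + h) <= s -> cm (f (z + h) - f z - h * f' z) <= K * M * cm h ^+ 2).
Proof.
move=> /andP[s0 sr]; pose rho := (s + r) / 2.
have r0 : 0 < rho by rewrite /rho; lra.
have rr : rho < r by rewrite /rho; lra.
have srho : s < rho by rewrite /rho; lra.
have k0 := cker_gt0 r0 srho.
pose K1 := rho^-1 * (1 - s / rho)^-1 ^+ 2; pose K2 := rho ^- 2 * (1 - s / rho)^-1 ^+ 3.
have K10 : 0 <= K1 by rewrite mulr_ge0 ?invr_ge0 ?exprn_ge0 ?invr_ge0 // ltW.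
have K20 : 0 <= K2 by rewrite mulr_ge0 ?invr_ge0 ?exprn_ge0 ?invr_ge0 // ltW.
exists (K1 + K2); first by rewrite addr_ge0.
move=> f M hf fM; have hM : bnd01 (fun t => f (ctr rho t)) M.
  by move=> t _; apply: fM; rewrite cm_ctr.
have M0 := bnd01_ge0 hM.
exists (ctrans' rho (fun t => f (ctr rho t))); split=> [z zs|z h zs zhs].
  apply: le_trans (ctrans'_le r0 hM zs srho) _; rewrite -/K1 mulrC ler_wpM2r // lerDl //.
rewrite !(cauchy_formula (hol_lt rr hf)) ?(le_lt_trans _ srho) //.
apply: le_trans (ctrans_diff r0 hM zs zhs srho) _; rewrite -/K2 ler_wpM2r ?exprn_ge0 ?cm_ge0 //.
by rewrite mulrC ler_wpM2r // lerDr.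
Qed.

End Holomorphic.

(** * Recursion for the Taylor coefficients in x *)

Section MatrixBounds.
Variables (R : realType).
Local Notation C := R[i].

Definition mbnd m n (M : 'M[C]_(m, n)) (B : R) := forall i j, cm (M i j) <= B.

Lemma mbndD m n (M N : 'M[C]_(m, n)) B B' : mbnd M B -> mbnd N B' -> mbnd (M + N) (B + B').
Proof. by move=> h h' i j; rewrite mxE; apply: le_trans (cmD _ _) _; rewrite lerD. Qed.

Lemma mbndN m n (M : 'M[C]_(m, n)) B : mbnd M B -> mbnd (- M) B.
Proof. by move=> h i j; rewrite mxE cmN. Qed.

Lemma mbndB m n (M N : 'M[C]_(m, n)) B B' : mbnd M B -> mbnd N B' -> mbnd (M - N) (B + B').
Proof. by move=> h h'; apply: mbndD => //; apply: mbndN. Qed.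

Lemma mbndZ m n c (M : 'M[C]_(m, n)) B : mbnd M B -> mbnd (c *: M) (cm c * B).
Proof. by move=> h i j; rewrite mxE cmM ler_wpM2l ?cm_ge0. Qed.

Lemma mbndM m n p (M : 'M[C]_(m, n)) (N : 'M[C]_(n, p)) B B' :
  mbnd M B -> mbnd N B' -> mbnd (M *m N) (n%:R * (B * B')).
Proof.
move=> h h' i j; rewrite mxE; apply: le_trans (cm_sum _ _ _) _.
apply: le_trans (_ : _ <= \sum_(k < n) B * B') _.
  by apply: ler_sum => k _; rewrite cmM ler_pM ?cm_ge0.
by rewrite sumr_const card_ord mulr_natl.
Qed.

Lemma mbnd_le m n (M : 'M[C]_(m, n)) B B' : B <= B' -> mbnd M B -> mbnd M B'.
Proof. by move=> bb h i j; apply: le_trans (h i j) bb. Qed.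

Lemma mbnd0 m n B : 0 <= B -> mbnd (0 : 'M[C]_(m, n)) B.
Proof. by move=> h i j; rewrite mxE cm0. Qed.

Lemma mbnd_sum m n J (F : nat -> 'M[C]_(m, n)) (B : nat -> R) :
  (forall k, (k < J)%N -> mbnd (F k) (B k)) -> mbnd (\sum_(k < J) F k) (\sum_(k < J) B k).
Proof.
move=> h i j; rewrite summxE; apply: le_trans (cm_sum _ _ _) _.
by apply: ler_sum => k _; apply: h.
Qed.

Lemma mbnd_eq0 m n (M : 'M[C]_(m, n)) : (forall e, 0 < e -> mbnd M e) -> M = 0.
Proof. by move=> h; apply/matrixP => i j; rewrite mxE; apply: cm_le0 => e /h; apply. Qed.

Lemma mbnd_ex m n (M : 'M[C]_(m, n)) : exists2 B, 0 <= B & mbnd M B.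
Proof.
exists (\sum_i \sum_j cm (M i j)); first by apply: sumr_ge0 => i _; apply: sumr_ge0 => j _; apply: cm_ge0.
move=> i j; rewrite (bigD1 i) //= (bigD1 j) //= -addrA lerDl.
by rewrite addr_ge0 ?sumr_ge0 // => *; rewrite ?cm_ge0 // sumr_ge0 // => *; rewrite cm_ge0.
Qed.

Lemma holD r (f g : C -> C) : hol r f -> hol r g -> hol r (fun z => f z + g z).
Proof. by move=> h h' z zr; have [b hb] := h z zr; have [b' hb'] := h' z zr; exists (b + b'); apply: hasdD. Qed.

Lemma holM r (f g : C -> C) : hol r f -> hol r g -> hol r (fun z => f z * g z).
Proof. by move=> h h' z zr; have [b hb] := h z zr; have [b' hb'] := h' z zr; exists (b * g z + f z * b'); apply: hasdM. Qed.

Lemma holN r (f : C -> C) : hol r f -> hol r (fun z => - f z).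
Proof. by move=> h z zr; have [b hb] := h z zr; exists (- b); apply: hasdN. Qed.

Lemma hol_cst r c : hol r (fun=> c : C).
Proof. by move=> z _; exists 0; apply: hasd_cst. Qed.

Lemma hol_id r : hol r (fun z : C => z).
Proof. by move=> z _; exists 1; apply: hasd_id. Qed.

Lemma hol_sum r (I : Type) (s : seq I) (P : pred I) (F : I -> C -> C) :
  (forall i, P i -> hol r (F i)) -> hol r (fun z => \sum_(i <- s | P i) F i z).
Proof.
move=> h z zr; have hb i : exists b, P i -> hasd (F i) z b.
  case Pi : (P i); last by exists 0.
  by have [b hb] := h i Pi z zr; exists b.
have [D hD] := choice hb.
by exists (\sum_(i <- s | P i) D i); apply: hasd_sum.
Qed.

Lemma hol_ext r (f g : C -> C) : (forall z, cm z < r -> f z = g z) -> hol r f -> hol r g.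
Proof.
move=> fg h z zr; have [b hb] := h z zr; exists b; apply: hasd_near hb.
exists (r - cm z); first by rewrite subr_gt0.
by move=> q hq; apply: fg; rewrite -(subrK z q); apply: le_lt_trans (cmD _ _) _; lra.
Qed.

Lemma hol_le r s (f : C -> C) : s <= r -> hol r f -> hol s f.
Proof. by move=> sr h z zs; apply: h; apply: lt_le_trans zs sr. Qed.

Definition holmx m n (r : R) (M : C -> 'M[C]_(m, n)) := forall i j, hol r (fun e => M e i j).

Lemma holmxD m n r (M N : C -> 'M[C]_(m, n)) : holmx r M -> holmx r N -> holmx r (fun e => M e + N e).
Proof. by move=> h h' i j; apply: hol_ext (holD (h i j) (h' i j)) => z _; rewrite mxE. Qed.

Lemma holmxN m n r (M : C -> 'M[C]_(m, n)) : holmx r M -> holmx r (fun e => - M e).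
Proof. by move=> h i j; apply: hol_ext (holN (h i j)) => z _; rewrite mxE. Qed.

Lemma holmxZ m n r (f : C -> C) (M : C -> 'M[C]_(m, n)) :
  hol r f -> holmx r M -> holmx r (fun e => f e *: M e).
Proof. by move=> h h' i j; apply: hol_ext (holM h (h' i j)) => z _; rewrite mxE. Qed.

Lemma holmxM m n p r (M : C -> 'M[C]_(m, n)) (N : C -> 'M[C]_(n, p)) :
  holmx r M -> holmx r N -> holmx r (fun e => M e *m N e).
Proof.
move=> h h' i j; apply: (@hol_ext _ (fun e => \sum_k M e i k * N e k j)) => [z _|].
  by rewrite mxE.
by apply: hol_sum => k _; apply: holM.
Qed.

Lemma holmx_cst m n r (M : 'M[C]_(m, n)) : holmx r (fun=> M).
Proof. by move=> i j; apply: hol_cst. Qed.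

Lemma holmx_sum m n r J (F : 'I_J -> C -> 'M[C]_(m, n)) :
  (forall k, holmx r (F k)) -> holmx r (fun e => \sum_k F k e).
Proof.
move=> h i j; apply: (@hol_ext _ (fun e => \sum_k F k e i j)) => [z _|].
  by rewrite summxE.
by apply: hol_sum => k _; apply: h.
Qed.

Lemma holmx_diag n r (l : C -> 'rV[C]_n) : holmx r l -> holmx r (fun e => diag_mx (l e)).
Proof.
move=> h i j; apply: (@hol_ext _ (fun e => l e ord0 i *+ (i == j))) => [z _|]; first by rewrite mxE.
case: (i == j); first by apply: h.
exact: hol_cst.
Qed.

End MatrixBounds.

Section Recursion.
Variables (R : realType) (n : nat).
Local Notation C := R[i].

Definition adl (l : 'rV[C]_n) (X : 'M[C]_n) := diag_mx l *m X - X *m diag_mx l.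

Lemma adlE l X i j : adl l X i j = (l ord0 i - l ord0 j) * X i j.
Proof. by rewrite /adl mul_diag_mx mul_mx_diag !mxE mulrBl [X i j * _]mulrC. Qed.

Lemma adlB l X Y : adl l (X - Y) = adl l X - adl l Y.
Proof. by apply/matrixP => i j; rewrite !(adlE, mxE); ring. Qed.

(** Multiplication of a power series by [x]. *)
Definition sh (A : nat -> 'M[C]_n) m : 'M[C]_n := if m is k.+1 then A k else 0.

Section Fixed.
Variables (e : C) (l0 l1 : 'rV[C]_n) (r1 r2 : nat -> 'M[C]_n).

(** Coefficient of [x^m] in [R2 P - P R1]. *)
Definition conS (P : nat -> 'M[C]_n) m : 'M[C]_n :=
  \sum_(a < m.+1) (r2 a *m P (m - a)%N - P (m - a)%N *m r1 a).

(* Coefficient of [x^m] in [[Lambda, P] + (x^2 - e) (R2 P - P R1) - (x^2 - e) P']. *)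
Definition coefeq (P : nat -> 'M[C]_n) m : 'M[C]_n :=
  (e * m.+1%:R) *: P m.+1 + adl l0 (P m) + sh (fun k => adl l1 (P k) - k%:R *: P k) m
  + sh (sh (conS P)) m - e *: conS P m.

(** The term [x^2 P'] puts [q%:R *: P q] into the equation of index [q + 1], which is solved for it
    here. The factor [q^-1] makes the map a contraction on coefficients of large index, although
    [P q.+1] and [P q.+2] occur on the right. *)
Definition solved (P : nat -> 'M[C]_n) q : 'M[C]_n :=
  q%:R^-1 *: ((e * q.+2%:R) *: P q.+2 + adl l0 (P q.+1) + adl l1 (P q) + sh (conS P) q
              - e *: conS P q.+1).

Lemma coefeq_solved P q : (0 < q)%N -> coefeq P q.+1 = 0 <-> P q = solved P q.
Proof.
move=> q0; have qn : q%:R != 0 :> C by rewrite pnatr_eq0 -lt0n.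
rewrite /coefeq /solved /=.
move: (_ *: P q.+2) (adl l0 _) (adl l1 _) (sh _ _) (e *: _) => a b c d f.
have -> : a + b + (c - q%:R *: P q) + d - f = (a + b + c + d - f) - q%:R *: P q.
  by rewrite addrA [a + b + c - _ + d]addrAC [_ - _ - f]addrAC.
split=> [/eqP|->]; last by rewrite scalerA divff // scale1r subrr.
by rewrite subr_eq0 => /eqP ->; rewrite scalerA mulVf // scale1r.
Qed.

Lemma conSB P Q m : conS (fun k => P k - Q k) m = conS P m - conS Q m.
Proof.
rewrite /conS -sumrB; apply: eq_bigr => a _; rewrite mulmxBr mulmxBl.
by rewrite !opprB addrACA [RHS]addrACA; congr (_ + _); rewrite addrC.
Qed.

Lemma solvedB P Q q : solved (fun k => P k - Q k) q = solved P q - solved Q q.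
Proof.
rewrite /solved -scalerBr; congr (_ *: _).
rewrite !adlB (_ : sh (conS (fun k => P k - Q k)) q = sh (conS P) q - sh (conS Q) q); last first.
  by case: q => [|q] /=; rewrite ?subr0 // conSB.
rewrite conSB !scalerBr.
move: (_ *: P q.+2) (_ *: Q q.+2) (adl l0 (P _)) (adl l0 (Q _)) (adl l1 (P _)) (adl l1 (Q _)).
move: (sh (conS P) q) (sh (conS Q) q) (e *: conS P _) (e *: conS Q _).
by move=> a1 a2 a3 a4 a5 a6 a7 a8 a9 a10; apply/matrixP => i j; rewrite !mxE; ring.
Qed.

Variables (A s : R).
Hypotheses (A0 : 0 <= A) (s0 : 0 < s).
Hypotheses (hl0 : mbnd l0 A) (hl1 : mbnd l1 A).
Hypotheses (hr1 : forall a, mbnd (r1 a) (A / (2 * s) ^+ a)) (hr2 : forall a, mbnd (r2 a) (A / (2 * s) ^+ a)).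

(** The weighted supremum norm attached to the radius [s]. *)
Definition wbnd (P : nat -> 'M[C]_n) (B : R) := forall m, mbnd (P m) (B / s ^+ m).

Lemma adl_bnd l X B : mbnd l A -> mbnd X B -> mbnd (adl l X) (2 * A * B).
Proof.
move=> hl hX i j; rewrite adlE cmM ler_pM ?cm_ge0 //.
by apply: le_trans (cmB _ _) _; have := hl ord0 i; have := hl ord0 j; lra.
Qed.

Lemma geom_half_sum m : \sum_(a < m) (2 ^- a : R) <= 2.
Proof.
have -> : \sum_(a < m) (2 ^- a : R) = 2 - 2 / 2 ^+ m; last first.
  by rewrite lerBlDr lerDl divr_ge0 // exprn_ge0.
elim: m => [|m IH]; first by rewrite big_ord0 expr0 divr1 subrr.
rewrite big_ord_recr /= IH exprS; field.
by rewrite expf_neq0 // pnatr_eq0.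
Qed.

Lemma conS_bnd P B m : 0 <= B -> wbnd P B -> mbnd (conS P m) (4 * n%:R * A * B / s ^+ m).
Proof.
move=> B0 hP.
apply: mbnd_le (@mbnd_sum _ _ _ m.+1 (fun a => r2 a *m P (m - a)%N - P (m - a)%N *m r1 a)
  (fun a => 2 * n%:R * A * B / s ^+ m * 2 ^- a) _).
  rewrite -mulr_sumr; apply: le_trans (ler_wpM2l _ (geom_half_sum _)) _.
    by rewrite divr_ge0 ?exprn_ge0 ?(ltW s0) // !mulr_ge0.
  by rewrite le_eqVlt; apply/orP; left; apply/eqP; ring.
move=> a am.
have -> : 2 * n%:R * A * B / s ^+ m * 2 ^- a =
   n%:R * (A / (2 * s) ^+ a * (B / s ^+ (m - a))) + n%:R * (B / s ^+ (m - a) * (A / (2 * s) ^+ a)).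
  rewrite -{1}(subnKC (_ : a <= m)%N) // exprD exprMn; field.
  by rewrite !expf_neq0 // ?gt_eqF // pnatr_eq0.
by apply: mbndB; apply: mbndM.
Qed.

(** The term in [P q.+2] gains nothing from [q^-1], but [q + 2 <= 3 q] and [|e| <= s^2 / 12] leave
    it a quarter of [B]. All other terms have coefficients bounded independently of [q], and the
    lower bound on [q] leaves them another quarter. *)
Lemma solved_bnd P B q : cm e <= s ^+ 2 / 12 -> (0 < q)%N ->
  4 * (2 * A / s + 2 * A + 8 * n%:R * A * s) <= q%:R ->
  0 <= B -> wbnd P B -> mbnd (solved P q) (B / 2 / s ^+ q).
Proof.
move=> he q0 hq B0 hP.
have sq : 0 < s ^+ q by rewrite exprn_gt0.
have qr : 1 <= q%:R :> R by rewrite ler1n.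
have sn : s != 0 by rewrite gt_eqF.
pose b := B / s ^+ q.
have b0 : 0 <= b by rewrite divr_ge0 // ltW.
have h1 : mbnd ((e * q.+2%:R) *: P q.+2) (q%:R * (b / 4)).
  apply: mbnd_le (mbndZ _ (hP _)); rewrite cmM cm_nat.
  have -> : cm e * q.+2%:R * (B / s ^+ q.+2) = (cm e / s ^+ 2) * (q.+2%:R * b).
    by rewrite /b -addn2 exprD; field; rewrite sn gt_eqF.
  have : cm e / s ^+ 2 <= 12^-1 by rewrite ler_pdivrMr ?exprn_gt0 // mulrC.
  have : 0 <= cm e / s ^+ 2 by rewrite divr_ge0 ?cm_ge0 // exprn_ge0 // ltW.
  move: (cm e / s ^+ 2) => x x0 x1.
  have q3 : q.+2%:R <= 3 * q%:R :> R by rewrite -natrM ler_nat (_ : 3 = 2 + 1)%N // mulnDl mul1n -addn2 addnC leq_add2r leq_pmulr.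
  have : q.+2%:R * b <= 3 * q%:R * b by rewrite ler_wpM2r.
  have : 0 <= q.+2%:R * b by rewrite mulr_ge0.
  nra.
have h2 : mbnd (adl l0 (P q.+1)) (2 * A / s * b).
  apply: mbnd_le (adl_bnd hl0 (hP _)); rewrite exprS /b.
  by rewrite le_eqVlt; apply/orP; left; apply/eqP; field; rewrite sn gt_eqF.
have h3 : mbnd (adl l1 (P q)) (2 * A * b) by apply: adl_bnd.
have h4 : mbnd (sh (conS P) q) (4 * n%:R * A * s * b).
  rewrite /b; case: (q) q0 => // q' _ /=.
  apply: mbnd_le (conS_bnd q' B0 hP); rewrite exprS.
  by rewrite le_eqVlt; apply/orP; left; apply/eqP; field; rewrite sn expf_neq0.
have h5 : mbnd (e *: conS P q.+1) (4 * n%:R * A * s * b).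
  apply: mbnd_le (mbndZ _ (conS_bnd _ B0 hP)).
  have -> : cm e * (4 * n%:R * A * B / s ^+ q.+1) = (cm e / s ^+ 2) * (4 * n%:R * A * s * b).
    by rewrite /b exprS; field; rewrite sn gt_eqF.
  have k0 : 0 <= 4 * n%:R * A * s by rewrite !mulr_ge0 // ltW.
  rewrite ler_piMl //; first exact: mulr_ge0.
  by rewrite ler_pdivrMr ?exprn_gt0 //; have := exprn_gt0 2 s0; lra.
have := mbndZ q%:R^-1 (mbndB (mbndD (mbndD (mbndD h1 h2) h3) h4) h5).
apply: mbnd_le; rewrite cmV cm_nat mulrC ler_pdivrMr ?ltr0n //.
rewrite (_ : B / 2 / s ^+ q = b / 2); last by rewrite /b; ring.
have := ler_wpM2r b0 hq; nra.
Qed.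

Section Tail.
Variable N : nat.
Hypothesis he : cm e <= s ^+ 2 / 12.
Hypothesis hN : 4 * (2 * A / s + 2 * A + 8 * n%:R * A * s) <= N%:R.

Lemma solved_half P B q : (N < q)%N -> 0 <= B -> wbnd P B -> mbnd (solved P q) (B / 2 / s ^+ q).
Proof.
move=> Nq; apply: solved_bnd => //; first by apply: leq_ltn_trans Nq.
by apply: le_trans hN _; rewrite ler_nat ltnW.
Qed.

(** Some finite bound [B] is improved to [max b (B / 2^k)] by [k] applications of the contraction,
    so the bound on the first coefficients governs all of them. *)
Lemma tail_control P b B : 0 <= b -> 0 <= B -> wbnd P B ->
  (forall m, (m <= N)%N -> mbnd (P m) (b / s ^+ m)) ->
  (forall q, (N < q)%N -> P q = solved P q) -> wbnd P b.
Proof.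
move=> b0 B0 hB hlow htail.
have hk k : wbnd P (Num.max b (B / 2 ^+ k)).
  elim: k => [|k IH] m.
    by apply: mbnd_le (hB m); rewrite ler_pM2r ?invr_gt0 ?exprn_gt0 // expr0 divr1 le_max lexx orbT.
  case: (leqP m N) => mN.
    by apply: mbnd_le (hlow m mN); rewrite ler_pM2r ?invr_gt0 ?exprn_gt0 // le_max lexx.
  rewrite htail //; apply: mbnd_le (solved_half mN _ IH); last by rewrite le_max b0.
  rewrite ler_pM2r ?invr_gt0 ?exprn_gt0 //.
  rewrite ler_pdivrMr // maxr_pMl // ge_max !le_max; apply/andP; split; apply/orP.
    by left; lra.
  by right; rewrite exprSr invfM mulrA divfK // pnatr_eq0.
move=> m i j; apply/ler_addgt0Pr => d d0.
have sm : 0 < s ^+ m by rewrite exprn_gt0.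
have q01 : 0 <= (2^-1 : R) < 1 by rewrite invr_ge0 ler0n invf_lt1 ?ltr1n // ltr0n.
have [k hkk] := geom_small B q01 (mulr_gt0 d0 sm).
apply: le_trans (hk k m i j) _; rewrite ler_pdivrMr // mulrDl divfK ?gt_eqF //.
rewrite ge_max lerDl ltW ?mulr_gt0 //=; have := hkk k (leqnn _).
by rewrite exprVn => h; apply: le_trans h _; rewrite lerDr.
Qed.

Lemma tail_unique P Q B : 0 <= B -> wbnd P B -> wbnd Q B ->
  (forall m, (m <= N)%N -> P m = Q m) ->
  (forall q, (N < q)%N -> P q = solved P q) ->
  (forall q, (N < q)%N -> Q q = solved Q q) -> forall m, P m = Q m.
Proof.
move=> B0 hP hQ hlow tP tQ m; apply/eqP; rewrite -subr_eq0; apply/eqP; apply: mbnd_eq0 => d d0.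
have h : wbnd (fun k => P k - Q k) 0.
  have TC := @tail_control (fun k => P k - Q k) 0 (B + B).
  apply: TC; [exact: lexx|exact: addr_ge0| | |].
  - by move=> k; rewrite mulrDl; apply: mbndB.
  - by move=> k /hlow ->; rewrite subrr mul0r; apply: mbnd0.
  - by move=> q Nq; rewrite solvedB -tP // -tQ.
by apply: mbnd_le (h m); rewrite mul0r ltW.
Qed.

End Tail.
End Fixed.
End Recursion.

(** * Linear systems over the ring of germs *)

Section Tails.
Variables (R : realType) (n : nat).
Local Notation C := R[i].
Variables (l0 l1 : C -> 'rV[C]_n) (r1 r2 : nat -> C -> 'M[C]_n).
Variables (A s rho : R) (N : nat).
Hypotheses (A0 : 0 <= A) (s0 : 0 < s) (rhos : rho <= s ^+ 2 / 12).
Hypothesis hN : 4 * (2 * A / s + 2 * A + 8 * n%:R * A * s) <= N%:R.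
Hypotheses (hl0 : forall e, cm e < rho -> mbnd (l0 e) A) (hl1 : forall e, cm e < rho -> mbnd (l1 e) A).
Hypotheses (hr1 : forall e, cm e < rho -> forall a, mbnd (r1 a e) (A / (2 * s) ^+ a)).
Hypotheses (hr2 : forall e, cm e < rho -> forall a, mbnd (r2 a e) (A / (2 * s) ^+ a)).
Hypotheses (ol0 : holmx rho l0) (ol1 : holmx rho l1).
Hypotheses (or1 : forall a, holmx rho (r1 a)) (or2 : forall a, holmx rho (r2 a)).

Let coefs e := coefeq e (l0 e) (l1 e) (r1^~ e) (r2^~ e).
Let solve e := solved e (l0 e) (l1 e) (r1^~ e) (r2^~ e).

Let half e : cm e < rho -> forall P B q, (N < q)%N -> 0 <= B -> wbnd s P B ->
  mbnd (solve e P q) (B / 2 / s ^+ q).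
Proof.
move=> er; have he : cm e <= s ^+ 2 / 12 by apply: ltW; apply: lt_le_trans er rhos.
exact: (solved_half A0 s0 (hl0 er) (hl1 er) (hr1 er) (hr2 er) he hN).
Qed.

Lemma holmx_adl (l : C -> 'rV[C]_n) (X : C -> 'M[C]_n) :
  holmx rho l -> holmx rho X -> holmx rho (fun e => adl (l e) (X e)).
Proof.
move=> h h'; apply: holmxD; first by apply: holmxM => //; apply: holmx_diag.
by apply: holmxN; apply: holmxM => //; apply: holmx_diag.
Qed.

Lemma holmx_conS (P : C -> nat -> 'M[C]_n) m : (forall k, holmx rho (P^~ k)) ->
  holmx rho (fun e => conS (r1^~ e) (r2^~ e) (P e) m).
Proof.
move=> h; apply: holmx_sum => a; apply: holmxD; first by apply: holmxM.
by apply: holmxN; apply: holmxM.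
Qed.

Lemma holmx_sh (F : C -> nat -> 'M[C]_n) m : (forall k, holmx rho (F^~ k)) ->
  holmx rho (fun e => sh (F e) m).
Proof. by case: m => [|m] h //=; apply: holmx_cst. Qed.

Lemma hol_eps k : hol rho (fun e : C => e * k).
Proof. by apply: holM; [apply: hol_id|apply: hol_cst]. Qed.

Lemma holmx_coefs (P : C -> nat -> 'M[C]_n) m : (forall k, holmx rho (P^~ k)) ->
  holmx rho (fun e => coefs e (P e) m).
Proof.
move=> h; apply: holmxD; last first.
  by apply: holmxN; apply: holmxZ; [apply: hol_id|apply: holmx_conS].
apply: holmxD; last by apply: (holmx_sh (F := fun e => sh _)) => k; apply: (holmx_sh (F := fun e => conS _ _ _)) => k'; apply: holmx_conS.
apply: holmxD.
  by apply: holmxD; [apply: holmxZ => //; apply: hol_eps | apply: holmx_adl].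
apply: (holmx_sh (F := fun e k => adl (l1 e) (P e k) - k%:R *: P e k)) => k.
by apply: holmxD; [apply: holmx_adl | apply: holmxN; apply: holmxZ => //; apply: hol_cst].
Qed.

Lemma holmx_solve (P : C -> nat -> 'M[C]_n) m : (forall k, holmx rho (P^~ k)) ->
  holmx rho (fun e => solve e (P e) m).
Proof.
move=> h; apply: holmxZ; first exact: hol_cst.
apply: holmxD; last first.
  by apply: holmxN; apply: holmxZ; [apply: hol_id|apply: holmx_conS].
apply: holmxD; last by apply: (holmx_sh (F := fun e => conS _ _ _)) => k; apply: holmx_conS.
by apply: holmxD; [apply: holmxD; [apply: holmxZ => //; apply: hol_eps | apply: holmx_adl] | apply: holmx_adl].
Qed.

Variables (V : nat -> 'M[C]_n) (B : R).
Hypotheses (B0 : 0 <= B) (hV : forall m, (m <= N)%N -> mbnd (V m) (B / s ^+ m)).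

(** Successive approximations: the coefficients up to [N] stay equal to [V], the others start from
    0. *)
Fixpoint picard k (e : C) m : 'M[C]_n :=
  if (m <= N)%N then V m else if k is k'.+1 then solve e (picard k' e) m else 0.

Lemma picard_low k e m : (m <= N)%N -> picard k e m = V m.
Proof. by case: k => [|k] /= ->. Qed.

Lemma picard_bnd k e : cm e < rho -> wbnd s (picard k e) B.
Proof.
move=> er; elim: k => [|k IH] m /=; case: (leqP m N) => mN; try exact: hV.
  by apply: mbnd0; rewrite divr_ge0 // exprn_ge0 // ltW.
apply: mbnd_le (half er mN B0 IH); rewrite ler_pM2r ?invr_gt0 ?exprn_gt0 //.
by rewrite ler_piMr // invf_le1 ?ler1n.
Qed.

Lemma picard_high k e m : (N < m)%N -> picard k.+1 e m = solve e (picard k e) m.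
Proof. by move=> mN; rewrite /= leqNgt mN. Qed.

Lemma picard_step k e : cm e < rho ->
  wbnd s (fun m => picard k.+1 e m - picard k e m) (B / 2 ^+ k).
Proof.
move=> er; elim: k => [|k IH] m.
  rewrite expr0 divr1; case: (leqP m N) => mN.
    by rewrite !picard_low // subrr; apply: mbnd0; rewrite divr_ge0 // exprn_ge0 // ltW.
  have -> : picard 0 e m = 0 by rewrite /= leqNgt mN.
  by rewrite subr0; apply: picard_bnd.
case: (leqP m N) => mN.
  by rewrite !picard_low // subrr; apply: mbnd0; rewrite !divr_ge0 // exprn_ge0 // ltW.
rewrite !picard_high // -[X in mbnd X]solvedB.
have B2 : 0 <= B / 2 ^+ k by rewrite divr_ge0 // exprn_ge0.
by apply: mbnd_le (half er mN B2 IH); rewrite exprSr invfM mulrA.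
Qed.

Lemma picard_cauchy k j e : cm e < rho ->
  wbnd s (fun m => picard (k + j) e m - picard k e m) (2 * B / 2 ^+ k).
Proof.
move=> er.
suff h : wbnd s (fun m => picard (k + j) e m - picard k e m) (2 * B / 2 ^+ k - 2 * B / 2 ^+ (k + j)).
  move=> m; apply: mbnd_le (h m); rewrite ler_pM2r ?invr_gt0 ?exprn_gt0 //.
  by rewrite gerBl divr_ge0 ?mulr_ge0 // exprn_ge0.
elim: j => [|j IH] m.
  by rewrite addn0 !subrr mul0r; apply: mbnd0.
rewrite addnS -(subrK (picard (k + j) e m) (picard _ e m)) -addrA.
apply: mbnd_le (mbndD (@picard_step (k + j) e er m) (IH m)).
rewrite -mulrDl ler_pM2r ?invr_gt0 ?exprn_gt0 //.
rewrite exprS le_eqVlt; apply/orP; left; apply/eqP; field.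
by rewrite !expf_neq0 // pnatr_eq0.
Qed.

(** The iterates converge at the rate [2 ^- k] uniformly in [e], so [ulim] only names an ordinary
    limit, and [weierstrass] makes it holomorphic in [e]. *)
Definition tailsol (e : C) m : 'M[C]_n := \matrix_(i, j) ulim (fun k => picard k e m i j).

Lemma tailsol_picard k e : cm e < rho ->
  wbnd s (fun m => tailsol e m - picard k e m) (2 * B / 2 ^+ k).
Proof.
move=> er m i j; rewrite !mxE; apply: (@ulim_le _ _ _ _ k) => l kl.
by have := @picard_cauchy k (l - k) e er m i j; rewrite subnKC // !mxE.
Qed.

Lemma tailsol_low e m : (m <= N)%N -> tailsol e m = V m.
Proof.
move=> mN; apply/matrixP => i j; rewrite mxE -[RHS]ulim_cst.
by apply: (@ulim_ext _ 0) => k _; rewrite picard_low.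
Qed.

Lemma tailsol_bnd e : cm e < rho -> wbnd s (tailsol e) B.
Proof.
move=> er m i j; rewrite mxE -[ulim _]subr0; apply: (@ulim_le _ _ _ _ 0) => k _.
by rewrite subr0; apply: picard_bnd.
Qed.

Lemma half_pow_small (M d : R) : 0 < d -> exists k, M / 2 ^+ k <= d.
Proof.
move=> d0; have q01 : 0 <= (2^-1 : R) < 1 by rewrite invr_ge0 ler0n invf_lt1 ?ltr1n // ltr0n.
by have [k /(_ k (leqnn _))] := geom_small M q01 d0; rewrite exprVn; exists k.
Qed.

Lemma tailsol_solved e q : cm e < rho -> (N < q)%N -> tailsol e q = solve e (tailsol e) q.
Proof.
move=> er Nq; apply/eqP; rewrite -subr_eq0; apply/eqP; apply: mbnd_eq0 => d d0.
have sq : 0 < s ^+ q by rewrite exprn_gt0.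
have [k hk] := half_pow_small (2 * B) (mulr_gt0 d0 sq).
have e1 : tailsol e q - solve e (tailsol e) q =
   (tailsol e q - picard k.+1 e q) - (solve e (tailsol e) q - solve e (picard k e) q).
  have -> : picard k.+1 e q = solve e (picard k e) q by rewrite /= leqNgt Nq.
  by rewrite opprB addrA subrK.
rewrite e1 -[solve e (tailsol e) q - _]solvedB.
have B2 : 0 <= 2 * B / 2 ^+ k by rewrite divr_ge0 ?mulr_ge0 // exprn_ge0.
have h1 := @tailsol_picard k.+1 e er q.
have h2 := half er Nq B2 (@tailsol_picard k e er).
apply: mbnd_le (mbndB h1 h2).
rewrite -mulrDl ler_pdivrMr //; apply: le_trans hk.
rewrite exprS le_eqVlt; apply/orP; left; apply/eqP; field.
by rewrite !expf_neq0 // pnatr_eq0.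
Qed.

Lemma holmx_tailsol m : holmx rho (tailsol^~ m).
Proof.
have hk k : forall m, holmx rho (fun e => picard k e m).
  elim: k => [|k IH] {}m /=; case: leqP => mN; try exact: holmx_cst.
  exact: (holmx_solve (P := picard k)).
move=> i j; apply: weierstrass => d d0.
have sm : 0 < s ^+ m by rewrite exprn_gt0.
have [k hk'] := half_pow_small (2 * B) (mulr_gt0 d0 sm).
exists (fun e => picard k e m i j); first exact: hk.
move=> e er; rewrite cmBC; have := @tailsol_picard k e er m i j; rewrite !mxE => h.
by apply: le_trans h _; rewrite ler_pdivrMr.
Qed.

End Tails.

(** * Germs in one variable and row reduction *)

Section KernelSection.
Variable R : realType.
Local Notation C := R[i].

Definition germ (f : C -> C) := exists2 r : R, 0 < r & hol r f.

Lemma germD f g : germ f -> germ g -> germ (fun z => f z + g z).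
Proof.
move=> [r r0 h] [r' r'0 h']; exists (Num.min r r'); first by rewrite lt_min r0.
by apply: holD; [apply: hol_le h|apply: hol_le h']; rewrite ge_min lexx ?orbT.
Qed.

Lemma germM f g : germ f -> germ g -> germ (fun z => f z * g z).
Proof.
move=> [r r0 h] [r' r'0 h']; exists (Num.min r r'); first by rewrite lt_min r0.
by apply: holM; [apply: hol_le h|apply: hol_le h']; rewrite ge_min lexx ?orbT.
Qed.

Lemma germN f : germ f -> germ (fun z => - f z).
Proof. by move=> [r r0 h]; exists r => //; apply: holN. Qed.

Lemma germ_cst c : germ (fun=> c).
Proof. by exists 1 => //; apply: hol_cst. Qed.

Lemma germ_sum (I : Type) (s : seq I) (P : pred I) (F : I -> C -> C) :
  (forall i, P i -> germ (F i)) -> germ (fun z => \sum_(i <- s | P i) F i z).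
Proof.
move=> h; elim: s => [|i s IH].
  by have [r r0 h0] := germ_cst 0; exists r => //; apply: hol_ext h0 => z _; rewrite big_nil.
case Pi : (P i).
  have [r r0 h0] := germD (h i Pi) IH; exists r => //.
  by apply: hol_ext h0 => z _; rewrite big_cons Pi.
by case: IH => r r0 h0; exists r => //; apply: hol_ext h0 => z _; rewrite big_cons Pi.
Qed.

Lemma germ_cts f : germ f -> cts f 0.
Proof. by move=> [r r0 h]; have [b hb] := h 0 ltac:(by rewrite cm0); apply: hasd_cts hb. Qed.

Definition null_germ (f : C -> C) := zero_near f 0.

Definition factor (f : C -> C) (m : nat) (g : C -> C) :=
  germ g /\ exists2 r : R, 0 < r & forall z, cm z < r -> f z = z ^+ m * g z.

Lemma germ_div f : germ f -> f 0 = 0 -> exists2 g, germ g & exists2 r : R, 0 < r & forall z, cm z < r -> f z = z * g z.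
Proof.
move=> [r r0 hf] f0; have [b hb] := hf 0 ltac:(by rewrite cm0).
pose g z := if z == 0 then b else f z / z.
have fg z : f z = z * g z.
  by rewrite /g; case: eqVneq => [->|z0]; rewrite ?mul0r // mulrC divfK.
exists g; last by exists 1.
exists r => // z zr; have [->|z0] := eqVneq z 0.
  apply: (@removable_singularity _ r g 0 r0) => [w|e e0].
    rewrite subr0 => wr w0; have [c hc] := hf w wr.
    have hd : exists c, hasd (fun w => f w * w^-1) w c.
      by eexists; apply: hasdM hc (hasdV w0 (hasd_id w)).
    case: hd => d hd; exists d; apply: hasd_near hd.
    exists (cm w); first by rewrite cm_gt0.
    move=> q qw; rewrite /g; case: eqVneq => // q0; move: qw; rewrite q0 sub0r cmN ltxx //.
  have [d d0 hd] := hb (e / 2) ltac:(by lra).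
  exists d => // h hh; rewrite add0r /g eqxx; case: eqVneq => [h0|h0]; first by rewrite subrr cm0.
  have := hd h hh; rewrite add0r f0 subr0.
  rewrite (_ : f h - b * h = (f h / h - b) * h); last by rewrite mulrBl divfK.
  by rewrite cmM ler_pM2r ?cm_gt0 // => hx; lra.
have [c hc] := hf z zr.
have hd : exists c, hasd (fun w => f w * w^-1) z c.
  by eexists; apply: hasdM hc (hasdV z0 (hasd_id z)).
case: hd => d hd; exists d; apply: hasd_near hd.
exists (cm z); first by rewrite cm_gt0.
by move=> q qw; rewrite /g; case: eqVneq => // q0; move: qw; rewrite q0 sub0r cmN ltxx.
Qed.

Lemma factor_iter f m : germ f -> (forall k g, (k < m)%N -> factor f k g -> g 0 = 0) -> exists g, factor f m g.
Proof.
move=> hf; elim: m => [|m IH] h.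
  by exists f; split => //; exists 1 => // z _; rewrite mul1r.
have [k g km|g [hg [r r0 fg]]] := IH; first by apply: h; rewrite ltnS ltnW.
have g0 : g 0 = 0 by apply: (h m g) => //; split => //; exists r.
have [g' hg' [r' r'0 gg']] := germ_div hg g0.
exists g'; split => //; exists (Num.min r r'); first by rewrite lt_min r0.
by move=> z; rewrite lt_min => /andP[z1 z2]; rewrite fg // gg' // exprSr mulrA.
Qed.

(** Otherwise [f] could be divided by every power of [z], its expansion would be 0, and
    [hol_expands0] would make it a null germ. *)
Lemma germ_order f : germ f -> ~ null_germ f -> exists m g, factor f m g /\ g 0 != 0.
Proof.
move=> hf nf; apply: contrapT => no; apply: nf.
have h m : exists g, factor f m g.
  apply: factor_iter => // k g _ hg; apply/eqP; apply/negPn/negP => g0.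
  by apply: no; exists k, g.
have hfr := hf; case: hfr => r r0 hr.
exists r => // z; rewrite subr0; apply: (hol_expands0 hr) => J.
have [g [hg [d d0 fg]]] := h J.
have [d' d'0 hd'] := germ_cts hg (@ltr01 R).
exists (Num.min d d'), (1 + cm (g 0)); split.
- by rewrite lt_min d0.
- by rewrite addr_ge0 ?cm_ge0.
move=> w; rewrite lt_min => /andP[w1 w2].
rewrite big1 => [|i _]; last by rewrite mul0r.
rewrite subr0 fg // cmM cmX mulrC ler_wpM2r ?exprn_ge0 ?cm_ge0 //.
have := hd' w w2; rewrite add0r => hx.
by have := cmD (g w - g 0) (g 0); rewrite subrK; lra.
Qed.

Lemma germ_inv f : germ f -> f 0 != 0 -> germ (fun z => (f z)^-1).
Proof.
move=> hf f0; have k : 0 < cm (f 0) by rewrite cm_gt0.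
have [d d0 hd] := germ_cts hf k; case: hf => r r0 hr.
exists (Num.min r d); first by rewrite lt_min r0.
move=> z; rewrite lt_min => /andP[z1 z2]; have [b hb] := hr z z1.
exists (- b / f z ^+ 2); apply: hasdV hb; rewrite -cm_gt0.
have := hd z z2; rewrite add0r => hx.
by have := cm_sub (f 0) (f 0 - f z); rewrite subKr; move: hx; rewrite cmBC; lra.
Qed.

Lemma factor_le f m m' g : (m' <= m)%N -> factor f m g -> exists g', factor f m' g'.
Proof.
move=> mm [[r r0 hg] [d d0 fg]]; exists (fun z => z ^+ (m - m') * g z); split.
  exists r => //; apply: holM hg => z _; eexists; exact: hasdX (hasd_id z).
by exists d => // z zd; rewrite fg // mulrA -exprD subnKC.
Qed.

Lemma fin_radius (T : finType) (P : T -> R -> Prop) :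
  (forall x r r', 0 < r' <= r -> P x r -> P x r') ->
  (forall x, exists2 r : R, 0 < r & P x r) -> exists2 r : R, 0 < r & forall x, P x r.
Proof.
move=> mono h.
suff [r r0 hr] : exists2 r : R, 0 < r & forall x, x \in enum T -> P x r.
  by exists r => // x; apply: hr; rewrite mem_enum.
elim: (enum T) => [|x s [r r0 IH]]; first by exists 1.
have [r' r'0 h'] := h x; exists (Num.min r r'); first by rewrite lt_min r0.
move=> y; rewrite inE => /orP[/eqP ->|ys].
  by apply: mono h'; rewrite lt_min r0 r'0 ge_min lexx orbT.
by apply: mono (IH y ys); rewrite lt_min r0 r'0 ge_min lexx.
Qed.

Lemma prop_min (Q : nat -> Prop) : (exists m, Q m) -> exists2 m, Q m & forall k, (k < m)%N -> ~ Q k.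
Proof.
move=> [m]; elim/ltn_ind: m => m IH Qm.
have [[k km Qk]|no] := pselect (exists2 k, (k < m)%N & Q k); first exact: IH km Qk.
by exists m => // k km Qk; apply: no; exists k.
Qed.

(* Row reduction over the discrete valuation ring of germs: the equations are
   divided by a power of [e] and one unknown is eliminated through an entry of
   least order. *)
Theorem kernel_section (I J : finType) (M : R) (K : {set J}) :
  forall (A : I -> J -> C -> C) (eta d0 : R) (Sol : C -> (J -> C) -> Prop),
  (forall i j, germ (A i j)) -> 0 <= M -> 0 < eta -> 0 < d0 ->
  (forall d : R, 0 < d -> exists e v, [/\ 0 < cm e, cm e < d & Sol e v]) ->
  (forall e v, Sol e v -> forall j, cm (v j) <= M) ->
  (forall e v, Sol e v -> forall i, \sum_(j in K) A i j e * v j = 0) ->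
  exists v1 : J -> C -> C,
    [/\ forall j, germ (v1 j),
        exists2 d : R, 0 < d & forall e, cm e < d -> forall i, \sum_(j in K) A i j e * v1 j e = 0 &
        exists e v, [/\ 0 < cm e, cm e < d0, Sol e v &
           forall j, j \in K -> cm (v1 j 0 - v j) <= eta]].
Proof.
(* Induction on the number of unknowns still present. [Sol] is generalized, because each elimination
   shrinks the admissible [e]. *)
move: {2}#|K| (leqnn #|K|) => k; elim: k K => [|k IH] K hK A eta d0 Sol hA M0 eta0 d00 acc hM heq.
  have K0 : K = finset.set0 by apply/eqP; rewrite -cards_eq0 -leqn0.
  exists (fun _ _ => 0); split => [j||]; first exact: germ_cst.
    by exists 1 => // e _ i; rewrite big1 // => j; rewrite K0 inE.
  by have [e [v [e0 ed hs]]] := acc d0 d00; exists e, v; split => // j; rewrite K0 inE.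
have [null|nnull] := pselect (forall i j, j \in K -> null_germ (A i j)).
  (* No equation is left near 0, so a sampled solution, kept constant in [e], is a section. *)
  have [e [v [e0 ed hs]]] := acc d0 d00.
  exists (fun j _ => v j); split => [j||]; first exact: germ_cst.
    have [r r0 hr] : exists2 r : R, 0 < r &
        forall p : I * J, forall e, cm e < r -> p.2 \in K -> A p.1 p.2 e = 0.
      apply: fin_radius => [p r r' /andP[_ rr] h e' er|[i j] /=].
        by apply: h; apply: lt_le_trans er rr.
      case jK : (j \in K); last by exists 1.
      have [r r0 hr] := null i j jK.
      by exists r => // e' er _; apply: hr; rewrite subr0.
    exists r => // e' er i; rewrite big1 // => j jK.
    by rewrite (hr (i, j)) // mul0r.
  by exists e, v; split => // j _; rewrite subrr cm0 ltW.
(* With a pivot of least order [m], all entries are divisible by [e^m], and the quotient of the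
   pivot is a unit among the germs. *)
have [m [i0 [j0 [g [j0K fg g0]]]] mmin] : exists2 m,
    (exists i j g, [/\ j \in K, factor (A i j) m g & g 0 != 0]) &
    forall k, (k < m)%N -> ~ exists i j g, [/\ j \in K, factor (A i j) k g & g 0 != 0].
  apply: prop_min.
  have /existsNP [i /existsNP [j /not_implyP [jK nn]]] := nnull.
  have [m [g [fg g0]]] := germ_order (hA i j) nn.
  by exists m, i, j, g.
have hb (p : I * J) : exists b, (p.2 \in K -> factor (A p.1 p.2) m b) /\ (p = (i0, j0) -> b 0 != 0).
  case: p => i j /=; have [[-> ->]|ne] := eqVneq (i, j) (i0, j0).
    by exists g; split.
  case jK : (j \in K); last by exists (fun=> 0); split => // e; rewrite e eqxx in ne.
  have [[r r0 hr]|nn] := pselect (null_germ (A i j)).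
    exists (fun=> 0); split => [_|e]; last by rewrite e eqxx in ne.
    split; first exact: germ_cst.
    by exists r => // z zr; rewrite mulr0; apply: hr; rewrite subr0.
  have [m' [g' [fg' g'0]]] := germ_order (hA i j) nn.
  have mm : (m <= m')%N.
    by rewrite leqNgt; apply/negP => /mmin; apply; exists i, j, g'.
  by have [b hb] := factor_le mm fg'; exists b; split => // e; rewrite e eqxx in ne.
have [b0 hb0] := choice hb.
pose b i j := b0 (i, j); pose u := b i0 j0.
have hbf i j : j \in K -> factor (A i j) m (b i j) by case: (hb0 (i, j)).
have u0 : u 0 != 0 by case: (hb0 (i0, j0)) => _; apply.
have bg i j : j \in K -> germ (b i j) by move=> jK; case: (hbf i j jK).
have ug : germ u by apply: bg.
pose c j e := if j \in K then b i0 j e * (u e)^-1 else 0.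
have cg j : germ (c j).
  rewrite /c; case jK: (j \in K); last exact: germ_cst.
  by apply: germM; [apply: bg | apply: germ_inv].
(* The equations after elimination of the unknown [j0]. *)
pose A' i j e := if j \in K then b i j e - b i j0 e * c j e else 0.
have A'g i j : germ (A' i j).
  rewrite /A'; case jK: (j \in K); last exact: germ_cst.
  by apply: germD; [apply: bg | apply: germN; apply: germM => //; apply: bg].
have [r1 r10 hr1] : exists2 r : R, 0 < r & forall p : I * J, forall e, cm e < r -> p.2 \in K ->
     A p.1 p.2 e = e ^+ m * b p.1 p.2 e.
  apply: fin_radius => [p r r' /andP[_ rr] h e er|[i j] /=].
    by apply: h; apply: lt_le_trans er rr.
  case jK : (j \in K); last by exists 1.
  by have [_ [r r0 hr]] := hbf i j jK; exists r => // e er _; apply: hr.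
have [r2 r20 hr2] : exists2 r : R, 0 < r & forall e, cm e < r -> u e != 0.
  have k0 : 0 < cm (u 0) by rewrite cm_gt0.
  have [d d1 hd] := germ_cts ug k0; exists d => // e ed; rewrite -cm_gt0.
  have := hd e ed; rewrite add0r => hx.
  by have := cm_sub (u 0) (u 0 - u e); rewrite subKr; move: hx; rewrite cmBC; lra.
(* Recovering the unknown [j0] costs an error of at most [S0 * eta' + #|K :\ j0| * k1 * M]: the
   first term from the other unknowns, the second from replacing [c j e] by [c j 0]. Both [eta'] and
   [k1] are chosen to make their term at most [eta / 2]. *)
pose S0 := \sum_(j in K :\ j0) cm (c j 0).
have S00 : 0 <= S0 by apply: sumr_ge0 => j _; apply: cm_ge0.
pose T0 : R := #|K|%:R + 1.
have T00 : 0 < T0 by rewrite ltr_wpDl.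
pose k1 := eta / 2 / (1 + M) / T0.
have k10 : 0 < k1 by rewrite !divr_gt0 //; lra.
have [r3 r30 hr3] : exists2 r : R, 0 < r & forall j : J, forall e, cm e < r -> cm (c j e - c j 0) < k1.
  apply: fin_radius => [j r r' /andP[_ rr] h e er|j].
    by apply: h; apply: lt_le_trans er rr.
  have [d d1 hd] := germ_cts (cg j) k10; exists d => // e ed.
  by have := hd e ed; rewrite add0r.
pose d1 := Num.min (Num.min r1 r2) (Num.min r3 d0).
have d10 : 0 < d1 by rewrite !lt_min r10 r20 r30.
have elim_eq e w i : cm e < d1 -> w j0 = - \sum_(j in K :\ j0) c j e * w j ->
    \sum_(j in K) b i j e * w j = \sum_(j in K :\ j0) A' i j e * w j.
  move=> ed hw; rewrite (big_setD1 j0) //= hw mulrN mulr_sumr addrC -sumrB.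
  apply: eq_bigr => j; rewrite in_setD1 => /andP[_ jK]; rewrite /A' jK; ring.
pose eta' := Num.min eta (eta / 2 / (1 + S0)).
have eta'0 : 0 < eta' by rewrite lt_min eta0 !divr_gt0 //; lra.
pose Sol' e v := [/\ 0 < cm e, cm e < d1 & Sol e v].
have solve_j0 e v : Sol' e v -> (forall i, \sum_(j in K) b i j e * v j = 0) /\
    v j0 = - \sum_(j in K :\ j0) c j e * v j.
  move=> [e0 ed hs]; move: (ed); rewrite !lt_min => /andP[/andP[ed1 ed2] _].
  have en : e != 0 by rewrite -cm_gt0.
  have hz i : \sum_(j in K) b i j e * v j = 0.
    have := heq e v hs i; rewrite (eq_bigr (fun j => e ^+ m * (b i j e * v j))); last first.
      by move=> j jK; rewrite (hr1 (i, j)) //= mulrA.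
    rewrite -mulr_sumr => /eqP; rewrite mulf_eq0 expf_eq0 (negPf en) andbF /= => /eqP //.
  split => //; have := hz i0; rewrite (big_setD1 j0) //= -/u => /eqP.
  rewrite addr_eq0 => /eqP h; have un := hr2 e ed2.
  apply: (mulfI un); rewrite h mulrN mulr_sumr; congr (- _); apply: eq_bigr => j.
  rewrite in_setD1 => /andP[_ jK]; rewrite /c jK mulrA; congr (_ * _).
  by rewrite mulrCA divff ?mulr1.
have K'k : (#|K :\ j0| <= k)%N by move: hK; rewrite (cardsD1 j0) j0K.
have acc' d : 0 < d -> exists e v, [/\ 0 < cm e, cm e < d & Sol' e v].
  move=> dp; have [e [v [h1 h2 h3]]] := acc (Num.min d d1) ltac:(by rewrite lt_min dp).
  by move: h2; rewrite lt_min => /andP[h2 h2']; exists e, v.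
have hM' e v : Sol' e v -> forall j, cm (v j) <= M by move=> [_ _]; apply: hM.
have heq' e v : Sol' e v -> forall i, \sum_(j in K :\ j0) A' i j e * v j = 0.
  by move=> hs i; have [hz hv] := solve_j0 e v hs; rewrite -elim_eq //; case: hs.
have [v1 [v1g [dd dd0 hdd] [e [v [e0 ed hs' close]]]]] :=
  IH (K :\ j0) K'k A' eta' d1 Sol' A'g M0 eta'0 d10 acc' hM' heq'.
pose w j e := if j == j0 then - \sum_(j' in K :\ j0) c j' e * v1 j' e else v1 j e.
have wv j e' : j \in K :\ j0 -> w j e' = v1 j e'.
  by rewrite in_setD1 /w => /andP[/negPf ->].
have ww e' : w j0 e' = - \sum_(j in K :\ j0) c j e' * w j e'.
  by rewrite {1}/w eqxx; congr (- _); apply: eq_bigr => j jK; rewrite wv.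
exists w; split => [j||].
- rewrite /w; case: eqP => _ //; apply: germN; apply: germ_sum => j' _.
  exact: germM.
- exists (Num.min dd d1); first by rewrite lt_min dd0.
  move=> e'; rewrite lt_min => /andP[e'1 e'2] i.
  rewrite (eq_bigr (fun j => e' ^+ m * (b i j e' * w j e'))); last first.
    move=> j jK; rewrite (hr1 (i, j)) //= ?mulrA //.
    by apply: lt_le_trans e'2 _; rewrite !ge_min lexx.
  rewrite -mulr_sumr (elim_eq e' (w^~ e')) //.
  rewrite (eq_bigr (fun j => A' i j e' * v1 j e')) ?hdd ?mulr0 //.
  by move=> j jK; rewrite wv.
have [_ hv] := solve_j0 e v hs'; case: hs' => _ _ hs.
exists e, v; split => //; first by apply: lt_le_trans ed _; rewrite !ge_min lexx !orbT.
have close' j : j \in K :\ j0 -> cm (w j 0 - v j) <= eta'.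
  by move=> jK; rewrite wv // close.
move=> j jK; have [->|jj0] := eqVneq j j0; last first.
  by apply: le_trans (close' j _) _; rewrite ?in_setD1 ?jj0 // ge_min lexx.
rewrite ww hv -opprD cmN -sumrB; apply: le_trans (cm_sum _ _ _) _.
apply: (@le_trans _ _ (\sum_(j' in K :\ j0) (cm (c j' 0) * eta' + k1 * M))).
  apply: ler_sum => j' jK'.
  rewrite (_ : _ - _ = c j' 0 * (w j' 0 - v j') - (c j' e - c j' 0) * v j'); last by ring.
  apply: le_trans (cmB _ _) _; rewrite !cmM lerD //.
    by rewrite ler_wpM2l ?cm_ge0 ?close'.
  rewrite ler_pM ?cm_ge0 //; last exact: hM hs j'.
  by apply: ltW; apply: hr3; apply: lt_le_trans ed _; rewrite !ge_min lexx !orbT.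
rewrite big_split /= -mulr_suml -/S0 sumr_const -[_ *+ _]mulr_natr.
have e1 : S0 * eta' <= eta / 2.
  have : eta' <= eta / 2 / (1 + S0) by rewrite ge_min lexx orbT.
  rewrite ler_pdivlMr; last by lra.
  by have := ltW eta'0; nra.
have e2 : k1 * M * #|K :\ j0|%:R <= eta / 2.
  have kM : k1 * M <= eta / 2 / T0.
    rewrite /k1 mulrAC ler_pM2r ?invr_gt0 // mulrAC ler_pdivrMr; last by lra.
    by rewrite ler_wpM2l; lra.
  have kK : #|K :\ j0|%:R <= T0.
    by rewrite /T0 -[1]/(1%:R) -natrD ler_nat addn1 ltnW // ltnS subset_leq_card // subsetDl.
  apply: (@le_trans _ _ (eta / 2 / T0 * T0)); last by rewrite divfK // gt_eqF.
  by rewrite ler_pM // mulr_ge0 // ltW.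
lra.
Qed.

End KernelSection.

(** * Functions of two variables *)

Section Bridges.
Variable R : realType.
Local Notation C := R[i].

Lemma norm_pair_lt (p : C * C) (d : R) : `|p| < d%:C <-> cm p.1 < d /\ cm p.2 < d.
Proof.
rewrite prod_normE /= !normE /Num.max; case: ifP; rewrite !ltcR => h; split.
- by move=> h'; split=> //; apply: lt_trans h h'.
- by case.
- move=> h'; split=> //; apply: le_lt_trans h'.
  by rewrite leNgt h.
- by case.
Qed.

Lemma norm_mx_lt m n (M : 'M[C]_(m, n)) (d : R) : 0 < d ->
  `|M| < d%:C <-> forall i j, cm (M i j) < d.
Proof.
move=> d0.
have -> : (`|M| < d%:C : Prop) = ball (0 : 'M[C]_(m, n)) d%:C M.
  by rewrite -ball_normE /ball_ /= sub0r normrN.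
split.
  by case=> _ h i j; have := h i j; rewrite -ball_normE /ball_ /= mxE sub0r normrN normE ltcR.
move=> h; split; first by rewrite ltcR.
by move=> i j; rewrite -ball_normE /ball_ /= mxE sub0r normrN normE ltcR.
Qed.

Lemma nbhs_pairP (p : C * C) (P : set (C * C)) :
  nbhs p P <-> exists2 d : R, 0 < d & forall e x, cm (e - p.1) < d -> cm (x - p.2) < d -> P (e, x).
Proof.
split=> [/nbhsCP [d d0 h]|[d d0 h]].
  by exists d => // e x he hx; apply: h; apply/norm_pair_lt.
by apply/nbhsCP; exists d => // -[e x] /norm_pair_lt [] /=; apply: h.
Qed.

Lemma nbhs_mxP m n (M : 'M[C]_(m, n)) (P : set 'M[C]_(m, n)) :
  nbhs M P <-> exists2 d : R, 0 < d & forall N : 'M[C]_(m, n), (forall i j, cm (N i j - M i j) < d) -> P N.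
Proof.
split=> [/nbhsCP [d d0 h]|[d d0 h]].
  by exists d => // N hN; apply: h; apply/norm_mx_lt => // i j; rewrite !mxE.
apply/nbhsCP; exists d => // N /norm_mx_lt hN; apply: h => i j.
by have := hN d0 i j; rewrite !mxE.
Qed.

Lemma derivable_mx_hasd m n (W : C -> 'M[C]_(m, n)) x i j : derivable W x (1 : C) ->
  hasd (fun z => W z i j) x ('D_(1 : C) W x i j).
Proof.
move=> dW; apply/hasdP.
have cv : (fun h : C => h^-1 *: (W (h *: (1 : C) + x) i j - W x i j)) @ 0^' --> 'D_(1 : C) W x i j.
  have c := @coord_continuous C m n i j ('D_(1 : C) W x).
  have h := cvg_comp _ _ dW c.
  apply: cvg_trans h; apply: near_eq_cvg; apply: nearW => h /=.
  by rewrite /= !mxE.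
split; first by apply/cvg_ex; exists ('D_(1 : C) W x i j).
by rewrite /derive; apply/cvg_lim.
Qed.

Lemma derivable_slice1 (f : C -> C -> C) e x :
  differentiable (fun p : C * C => f p.1 p.2) (e, x) -> exists b, hasd (f^~ x) e b.
Proof.
move=> /(@diff_derivable _ _ _ _ (e, x) ((1, 0) : C * C)) h.
suff H : derivable (f^~ x) e (1 : C) by exists ('D_(1 : C) (f^~ x) e); apply: derivable_hasd.
move: h; pose Q (G : C -> C) := cvg (G @ 0^').
rewrite -[derivable _ _ _]/(Q (fun h : C => h^-1 *: (((fun p : C * C => f p.1 p.2) \o shift (e, x)) (h *: ((1, 0) : C * C)) - f e x))).
rewrite -[X in _ -> X]/(Q (fun h : C => h^-1 *: (((f^~ x) \o shift e) (h *: (1 : C)) - f e x))).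
suff -> : (fun h : C => h^-1 *: (((fun p : C * C => f p.1 p.2) \o shift (e, x)) (h *: ((1, 0) : C * C)) - f e x)) =
  (fun h : C => h^-1 *: (((f^~ x) \o shift e) (h *: (1 : C)) - f e x)) by [].
by apply/funext => h /=; rewrite scaler0 add0r.
Qed.

Lemma derivable_slice2 (f : C -> C -> C) e x :
  differentiable (fun p : C * C => f p.1 p.2) (e, x) -> exists b, hasd (f e) x b.
Proof.
move=> /(@diff_derivable _ _ _ _ (e, x) ((0, 1) : C * C)) h.
suff H : derivable (f e) x (1 : C) by exists ('D_(1 : C) (f e) x); apply: derivable_hasd.
move: h; pose Q (G : C -> C) := cvg (G @ 0^').
rewrite -[derivable _ _ _]/(Q (fun h : C => h^-1 *: (((fun p : C * C => f p.1 p.2) \o shift (e, x)) (h *: ((0, 1) : C * C)) - f e x))).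
rewrite -[X in _ -> X]/(Q (fun h : C => h^-1 *: (((f e) \o shift x) (h *: (1 : C)) - f e x))).
suff -> : (fun h : C => h^-1 *: (((fun p : C * C => f p.1 p.2) \o shift (e, x)) (h *: ((0, 1) : C * C)) - f e x)) =
  (fun h : C => h^-1 *: (((f e) \o shift x) (h *: (1 : C)) - f e x)) by [].
by apply/funext => h /=; rewrite scaler0 add0r.
Qed.

Lemma derivable_slice2_mx m n (f : C -> C -> 'M[C]_(m, n)) e x :
  differentiable (fun p : C * C => f p.1 p.2) (e, x) -> derivable (f e) x (1 : C).
Proof.
move=> /(@diff_derivable _ _ _ _ (e, x) ((0, 1) : C * C)).
pose Q (G : C -> 'M[C]_(m, n)) := cvg (G @ 0^').
rewrite -[derivable _ _ _]/(Q (fun h : C => h^-1 *: (((fun p : C * C => f p.1 p.2) \o shift (e, x)) (h *: ((0, 1) : C * C)) - f e x))).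
rewrite -[X in _ -> X]/(Q (fun h : C => h^-1 *: (((f e) \o shift x) (h *: (1 : C)) - f e x))).
suff -> : (fun h : C => h^-1 *: (((fun p : C * C => f p.1 p.2) \o shift (e, x)) (h *: ((0, 1) : C * C)) - f e x)) =
  (fun h : C => h^-1 *: (((f e) \o shift x) (h *: (1 : C)) - f e x)) by [].
by apply/funext => h /=; rewrite scaler0 add0r.
Qed.

Lemma differentiable_entry (V : normedModType C) m n (f : V -> 'M[C]_(m, n)) p i j :
  differentiable f p -> differentiable (fun q => f q i j) p.
Proof.
move=> h; apply: (@differentiable_comp _ _ _ _ f (fun N : 'M[C]_(m, n) => N i j)) => //.
exact: differentiable_coord.
Qed.

Lemma differentiable_mx (V : normedModType C) m n (f : V -> 'M[C]_(m, n)) p :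
  (forall i j, differentiable (fun q => f q i j) p) -> differentiable f p.
Proof.
move=> h.
have -> : f = \sum_(i < m) \sum_(j < n) (fun q => f q i j *: (delta_mx i j : 'M[C]_(m, n))).
  apply/funext => q; rewrite {1}(matrix_sum_delta (f q)) fct_sumE.
  by apply: eq_bigr => i _; rewrite fct_sumE.
apply: differentiable_sum => i; apply: differentiable_sum => j.
exact: differentiableZl.
Qed.

Lemma quadratic_differentiable (V : normedModType C) (f : V -> C) (df : {linear V -> C}) p (K d : R) :
  continuous df -> 0 <= K -> 0 < d ->
  (forall h t, `|h| = t%:C -> t < d -> cm (f (p + h) - f p - df h) <= K * t ^+ 2) ->
  differentiable f p.
Proof.
move=> dfc K0 d0 H; apply/diffP.
have key : f = cst (f p) + (df \o center p) +o_p (center p).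
  apply/eqaddoP => _ /gt0_realC [e e0 ->].
  apply/nbhsCP; exists (Num.min d (e / (K + 1))).
    by rewrite lt_min d0 divr_gt0 // ltr_wpDl.
  move=> q hq.
  have [t nt] : exists t, `|q - p| = t%:C.
    have := normr_ge0 (q - p); case: (`|q - p|) => a b; rewrite lecE /= => /andP[/eqP -> _].
    by exists a.
  have t0 : 0 <= t by rewrite -lecR -nt normr_ge0.
  move: hq; rewrite nt ltcR lt_min => /andP[td te].
  have := H _ _ nt td; rewrite addrCA subrr addr0.
  rewrite /= -[X in `|X|]/(f q - (f p + df (q - p))) opprD addrA normE -rmorphM lecR.
  move=> h; apply: le_trans h _; rewrite expr2 mulrA ler_wpM2r //.
  move: te; rewrite ltr_pdivlMr ?ltr_wpDl // => te.
  apply: le_trans (ltW te); rewrite mulrC; by apply: ler_wpM2l => //; rewrite lerDl ler01.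
(* The differential is a chosen linear map with this property, so exhibiting one candidate
   suffices. *)
apply: (@getPex _ (fun (df : {linear V -> C}) => continuous df /\
  forall y, f y = f (lim (nbhs p)) + df (y - lim (nbhs p))
                  +o_(y \near p) (y - lim (nbhs p)))).
exists df; split=> // y; rewrite lim_id //.
by move: key; rewrite funeqE => /(_ y).
Qed.

(** The increment splits into the two partial increments and a mixed difference. The function
    [z |-> f z (x + k) - f z x] is [O(k)] uniformly in [z], so [hol_quadratic] applied to it makes
    the mixed difference quadratic. *)
Lemma osgood (r s M : R) (f : C -> C -> C) : 0 < s < r -> 0 <= M ->
  (forall x, cm x < r -> hol r (f^~ x)) -> (forall e, cm e < r -> hol r (f e)) ->
  (forall e x, cm e < r -> cm x < r -> cm (f e x) <= M) ->
  forall e x, cm e < s -> cm x < s -> differentiable (fun p : C * C => f p.1 p.2) (e, x).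
Proof.
move=> /andP[s0 sr] M0 h1 h2 hM e x he hx.
have [K K0 HK] := hol_quadratic (introT andP (conj (ltW s0) sr)).
have [r0] : 0 <= r by apply: ltW; apply: lt_trans s0 sr.
have xr : cm x < r by apply: lt_trans hx sr.
have er : cm e < r by apply: lt_trans he sr.
have [fx [bx qx]] := HK _ _ (h2 e er) (fun x hx => hM e x er hx).
have [fe [be qe]] := HK _ _ (h1 x xr) (fun e he => hM e x he xr).
pose df (p : C * C) : C := p.1 * fe e + p.2 * fx x.
have lindf : linear df.
  move=> a [u1 u2] [v1 v2]; rewrite /df /= -[a *: u1]/(a * u1) -[a *: u2]/(a * u2).
  by rewrite -[a *: (_ + _)]/(a * _); ring.
pose dfL := GRing.isLinear.Build _ _ _ _ df lindf.
pose dff : {linear (C * C)%type -> C} := HB.pack df dfL.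
pose d := Num.min (s - cm e) (s - cm x).
have d0 : 0 < d by rewrite lt_min !subr_gt0 he.
apply: (@quadratic_differentiable _ _ dff (e, x) (K * M + K * M + K * (K * M * (1 + s)) + K * (K * M * (1 + s)) * s) d) => //.
- move=> q; rewrite /continuous_at.
  have -> : (dff : C * C -> C) = fun p : C * C => p.1 * fe e + p.2 * fx x by [].
  by apply: cvgD; apply: cvgMl; [exact: cvg_fst|exact: cvg_snd].
- have KM : 0 <= K * M by rewrite mulr_ge0.
  have KMs : 0 <= K * (K * M * (1 + s)) by apply: mulr_ge0 => //; apply: mulr_ge0 => //; rewrite addr_ge0 // ltW.
  by rewrite !addr_ge0 //; apply: mulr_ge0 => //; apply: ltW.
move=> [h k] t nt td.
have t0 : 0 <= t by rewrite -lecR -nt normr_ge0.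
have [hs ks] : cm h <= t /\ cm k <= t.
  have H u : t < u -> cm h < u /\ cm k < u.
    by move=> tu; apply/(norm_pair_lt (h, k)); rewrite nt ltcR.
  split; rewrite leNgt; apply/negP => /H []; first by rewrite ltxx.
  by rewrite ltxx.
move: td; rewrite lt_min => /andP[te tx].
have ehs : cm (e + h) <= s by have := cmD e h; move: te hs; lra.
have xks : cm (x + k) <= s by have := cmD x k; move: tx ks; lra.
have ts : t <= s by have := cm_ge0 e; move: te; lra.
pose B := K * M * (1 + s) * t.
have KM0 : 0 <= K * M by rewrite mulr_ge0.
have gB z : cm z < r -> cm (f z (x + k) - f z x) <= B.
  move=> zr; have [f' [b1 b2]] := HK _ _ (h2 z zr) (fun x hx => hM z x zr hx).
  have := b2 x k (ltW hx) xks; have := b1 x (ltW hx).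
  have E : f z (x + k) - f z x = (f z (x + k) - f z x - k * f' x) + k * f' x by rewrite subrK.
  move: E; move: (_ - k * f' x) => u -> hf hu; have := cmD u (k * f' x); rewrite cmM /B => D1.
  apply: le_trans D1 _; have -> : K * M * (1 + s) * t = K * M * (s * t) + t * (K * M) by ring.
  apply: lerD; last by apply: ler_pM => //; exact: cm_ge0.
  apply: le_trans hu _; apply: ler_wpM2l => //; rewrite expr2.
  by apply: ler_pM => //; rewrite ?cm_ge0 //; apply: le_trans ks ts.
have [|g' [bg qg]] := HK (fun z => f z (x + k) - f z x) B _ gB.
  by apply: holD; [apply: h1; apply: le_lt_trans sr|apply: holN; apply: h1].
have G1 := qg e h (ltW he) ehs.
have G2 := qe e h (ltW he) ehs.
have G3 := qx x k (ltW hx) xks.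
have G4 := bg e (ltW he).
have -> : f (((e, x) : C * C) + (h, k)).1 (((e, x) : C * C) + (h, k)).2 - f (e, x).1 (e, x).2 - dff (h, k)
    = (f (e + h) (x + k) - f (e + h) x - (f e (x + k) - f e x) - h * g' e) + h * g' e
      + (f (e + h) x - f e x - h * fe e) + (f e (x + k) - f e x - k * fx x).
  by rewrite -[dff (h, k)]/(h * fe e + k * fx x) /=; ring.
move: G1 G2 G3; move: (_ - h * g' e) (_ - h * fe e) (_ - k * fx x) => u1 u2 u3 G1 G2 G3.
have := cmD (u1 + h * g' e + u2) u3; have := cmD (u1 + h * g' e) u2; have := cmD u1 (h * g' e).
rewrite cmM; rewrite /B in G1 G4.
have B1 : cm h * cm (g' e) <= K * (K * M * (1 + s)) * t ^+ 2.
  have -> : K * (K * M * (1 + s)) * t ^+ 2 = t * (K * (K * M * (1 + s) * t)) by ring.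
  by apply: ler_pM => //; exact: cm_ge0.
have sq u : 0 <= u -> u <= t -> u ^+ 2 <= t ^+ 2 by move=> u0 ut; rewrite lerXn2r ?nnegrE.
have B2 : cm u1 <= K * (K * M * (1 + s)) * s * t ^+ 2.
  apply: le_trans G1 _.
  have -> : K * (K * M * (1 + s)) * s * t ^+ 2 = K * (K * M * (1 + s)) * (s * t ^+ 2) by ring.
  have -> : K * (K * M * (1 + s) * t) * cm h ^+ 2 = K * (K * M * (1 + s)) * (t * cm h ^+ 2) by ring.
  apply: ler_wpM2l; first by rewrite mulr_ge0 // mulr_ge0 // addr_ge0 // ltW.
  by apply: ler_pM => //; rewrite ?exprn_ge0 ?cm_ge0 // sq // cm_ge0.
have B3 : cm u2 <= K * M * t ^+ 2.
  by apply: le_trans G2 _; apply: ler_wpM2l => //; apply: sq => //; exact: cm_ge0.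
have B4 : cm u3 <= K * M * t ^+ 2.
  by apply: le_trans G3 _; apply: ler_wpM2l => //; apply: sq => //; exact: cm_ge0.
by move: B1 B2 B3 B4; lra.
Qed.

End Bridges.

(** * Taylor coefficients and sums of power series depending on a parameter *)

Section Coefficients.
Variable R : realType.
Local Notation C := R[i].

(** By induction on the index: at a fixed small [x], subtracting the earlier terms from [f e x] and
    dividing by [x^a] gives a function holomorphic in [e]; it tends to the coefficient uniformly in
    [e] as [x] tends to 0. *)
Lemma coef_hol (r0 r s M : R) (f : C -> C -> C) : 0 < s < r -> 0 <= M ->
  (forall x, cm x < r -> hol r0 (f^~ x)) -> (forall e, cm e < r0 -> hol r (f e)) ->
  (forall e x, cm e < r0 -> cm x < r -> cm (f e x) <= M) ->
  forall a, hol r0 (fun e => tcoef (f e) s a).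
Proof.
move=> sr M0 h1 h2 hM a; have /andP[s0 s1] := sr.
elim/ltn_ind: a => a IH; apply: weierstrass => d d0.
have sa : 0 < s ^+ a by rewrite exprn_gt0.
(* With [|x| = q * s] the Taylor remainder divided by [|x|^a] is at most [2 * M * q / s^a], hence at
   most [d]. *)
pose q := Num.min (1 / 2) (d * s ^+ a / (2 * (M + 1))).
have M1 : 0 < 2 * (M + 1) by rewrite mulr_gt0 // ltr_wpDl.
have q0 : 0 < q by rewrite lt_min divr_gt0 // divr_gt0 // mulr_gt0.
have q2 : q <= 1 / 2 by rewrite ge_min lexx.
have qd : 2 * M * q <= d * s ^+ a.
  have : q <= d * s ^+ a / (2 * (M + 1)) by rewrite ge_min lexx orbT.
  by rewrite ler_pdivlMr // => h; apply: le_trans h; have := ltW q0; nra.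
pose x : C := (q * s)%:C.
have cx : cm x = q * s by rewrite cmR ger0_norm // mulr_ge0 // ltW.
have xs : cm x < s by rewrite cx gtr_pMl //; move: q2; lra.
have x0 : x != 0 by rewrite -cm_gt0 cx mulr_gt0.
exists (fun e => (f e x - \sum_(j < a) tcoef (f e) s j * x ^+ j) * (x ^+ a)^-1).
  apply: holM; last exact: hol_cst.
  apply: holD; first by apply: h1; apply: lt_trans s1.
  by apply: holN; apply: hol_sum => j _; apply: holM; [apply: IH|apply: hol_cst].
move=> e er.
have B01 : bnd01 (fun t => f e (ctr s t)) M by move=> t _; apply: hM => //; rewrite cm_ctr.
have := hol_taylor a.+1 sr (h2 e er) B01 xs.
rewrite cx big_ord_recr /=; set S := \sum_(_ < a) _.
have -> : q * s / s = q by rewrite mulfK // gt_eqF.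
have -> : (f e x - S) * (x ^+ a)^-1 - tcoef (f e) s a = (f e x - (S + tcoef (f e) s a * x ^+ a)) / x ^+ a.
  by rewrite opprD addrA [in RHS]mulrBl mulfK // expf_neq0.
rewrite cmM cmV cmX cx; move: (cm (_ - _)) => u hu.
rewrite ler_pdivrMr ?exprn_gt0 ?mulr_gt0 //.
apply: le_trans hu _; rewrite ler_pdivrMr; last by move: q2; lra.
have qa : 0 < q ^+ a by rewrite exprn_gt0.
rewrite [(q * s) ^+ a]exprMn exprSr.
have -> : M * (q ^+ a * q) = q ^+ a * (M * q) by ring.
have -> : d * (q ^+ a * s ^+ a) * (1 - q) = q ^+ a * (d * s ^+ a * (1 - q)) by ring.
apply: ler_wpM2l; first exact: ltW.
have : 0 <= d * s ^+ a by rewrite mulr_ge0 // ltW.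
by move: (d * s ^+ a) qd => D; nra.
Qed.

Definition psum (a : nat -> C) (z : C) : C := ulim (fun J => \sum_(j < J) a j * z ^+ j).

Lemma partial_tail (s M : R) (a : nat -> C) z J n : 0 < s -> (forall j, cm (a j) <= M / s ^+ j) ->
  cm z < s -> (J <= n)%N ->
  cm (\sum_(j < n) a j * z ^+ j - \sum_(j < J) a j * z ^+ j) <= M * (cm z / s) ^+ J / (1 - cm z / s).
Proof.
move=> s0 ha zs; set q := cm z / s => Jn.
have M0 : 0 <= M by have := le_trans (cm_ge0 _) (ha 0%N); rewrite expr0 divr1.
have q0 : 0 <= q by rewrite divr_ge0 ?cm_ge0 // ltW.
have q1 : q < 1 by rewrite ltr_pdivrMr // mul1r.
have q10 : 0 < 1 - q by rewrite subr_gt0.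
apply: (@le_trans _ _ (M * (q ^+ J - q ^+ n) / (1 - q))); last first.
  rewrite ler_wpM2r ?invr_ge0 ?(ltW q10) // ler_wpM2l // gerBl exprn_ge0 //.
elim: n Jn => [|n IH]; first by rewrite leqn0 => /eqP ->; rewrite !subrr cm0 mulr0 mul0r.
rewrite leq_eqVlt => /orP[/eqP ->|]; first by rewrite !subrr cm0 mulr0 mul0r.
rewrite ltnS => /IH {}IH; rewrite big_ord_recr /= addrAC.
apply: le_trans (cmD _ _) _.
have -> : M * (q ^+ J - q ^+ n.+1) / (1 - q) = M * (q ^+ J - q ^+ n) / (1 - q) + M * q ^+ n.
  by rewrite exprSr; field; rewrite gt_eqF.
apply: lerD => //; rewrite cmM cmX /q expr_div_n mulrA mulrAC.
by rewrite ler_wpM2r ?exprn_ge0 ?cm_ge0.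
Qed.

Lemma psum_taylor (s M : R) (a : nat -> C) z J : 0 < s -> (forall j, cm (a j) <= M / s ^+ j) ->
  cm z < s -> cm (psum a z - \sum_(j < J) a j * z ^+ j) <= M * (cm z / s) ^+ J / (1 - cm z / s).
Proof. by move=> s0 ha zs; apply: (@ulim_le _ _ _ _ J) => n Jn; apply: partial_tail. Qed.

(** [J] is chosen before the coefficients and the point, so the same truncation serves [weierstrass]
    both in [x] and in the parameter. *)
Lemma psum_small (s M d : R) : 0 < s -> 0 <= M -> 0 < d ->
  exists J, forall a : nat -> C, (forall j, cm (a j) <= M / s ^+ j) -> forall z, cm z <= s / 2 ->
  cm (psum a z - \sum_(j < J) a j * z ^+ j) <= d.
Proof.
move=> s0 M0 d0.
have [|J hJ] := @geom_small _ (1 / 2) (2 * M) d _ d0; first by apply/andP; split; lra.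
exists J => a ha z zs; have zs' : cm z < s by move: zs; lra.
apply: le_trans (psum_taylor J s0 ha zs') _; apply: le_trans (hJ J (leqnn J)).
have q0 : 0 <= cm z / s by rewrite divr_ge0 ?cm_ge0 // ltW.
have q2 : cm z / s <= 1 / 2 by rewrite ler_pdivrMr //; move: zs; lra.
move: (cm z / s) q0 q2 => q q0 q2.
rewrite ler_pdivrMr; last by move: q2; lra.
have H : q ^+ J <= (1 / 2) ^+ J by rewrite lerXn2r ?nnegrE //; lra.
have H0 : 0 <= (1 / 2 : R) ^+ J by rewrite exprn_ge0 //; lra.
apply: (@le_trans _ _ (M * (1 / 2) ^+ J)); first by rewrite ler_wpM2l.
have : 0 <= M * (1 / 2) ^+ J by rewrite mulr_ge0.
by rewrite -[2 * M * _]mulrA; move: (M * _) => u; nra.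
Qed.

Lemma psum_hol (s M : R) (a : nat -> C) : 0 < s -> (forall j, cm (a j) <= M / s ^+ j) ->
  hol (s / 2) (psum a).
Proof.
move=> s0 ha; have M0 : 0 <= M by have := le_trans (cm_ge0 _) (ha 0%N); rewrite expr0 divr1.
apply: weierstrass => d d0; have [J hJ] := psum_small s0 M0 d0.
exists (fun z => \sum_(j < J) a j * z ^+ j); last by move=> z /ltW zs; rewrite cmBC; apply: hJ.
apply: hol_sum => j _; apply: holM; first exact: hol_cst.
by move=> z _; eexists; apply: hasdX; apply: hasd_id.
Qed.

Lemma psum_hol_param (r0 s M : R) (a : nat -> C -> C) z : 0 < s -> 0 <= M ->
  (forall j e, cm e < r0 -> cm (a j e) <= M / s ^+ j) -> (forall j, hol r0 (a j)) -> cm z <= s / 2 ->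
  hol r0 (fun e => psum (a^~ e) z).
Proof.
move=> s0 M0 ha hola zs; apply: weierstrass => d d0; have [J hJ] := psum_small s0 M0 d0.
exists (fun e => \sum_(j < J) a j e * z ^+ j).
  by apply: hol_sum => j _; apply: holM; [apply: hola|apply: hol_cst].
by move=> e er; rewrite cmBC; apply: hJ => // j; apply: ha.
Qed.

Lemma psum_expands (s M : R) (a : nat -> C) : 0 < s -> (forall j, cm (a j) <= M / s ^+ j) ->
  expands (psum a) a.
Proof.
move=> s0 ha J; have M0 : 0 <= M by have := le_trans (cm_ge0 _) (ha 0%N); rewrite expr0 divr1.
exists (s / 2), (2 * M / s ^+ J); split; first by rewrite divr_gt0.
  by rewrite divr_ge0 ?exprn_ge0 ?mulr_ge0 // ltW.
move=> z zs; have zs' : cm z < s by move: zs; lra.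
apply: le_trans (psum_taylor J s0 ha zs') _.
have q2 : cm z / s <= 1 / 2 by rewrite ler_pdivrMr //; move: zs; lra.
rewrite expr_div_n mulrA ler_pdivrMr; last by move: q2; lra.
have : 0 <= M * cm z ^+ J / s ^+ J by rewrite divr_ge0 ?mulr_ge0 ?exprn_ge0 ?cm_ge0 // ltW.
have -> : 2 * M / s ^+ J * cm z ^+ J * (1 - cm z / s) = 2 * (1 - cm z / s) * (M * cm z ^+ J / s ^+ J).
  by ring.
move: (_ / s ^+ J) => u u0; rewrite -[X in X <= _]mul1r; apply: ler_wpM2r => //.
by move: q2; lra.
Qed.

Lemma psum_bound (s M : R) (a : nat -> C) z : 0 < s -> (forall j, cm (a j) <= M / s ^+ j) ->
  cm z <= s / 2 -> cm (psum a z) <= 2 * M.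
Proof.
move=> s0 ha zs; have M0 : 0 <= M by have := le_trans (cm_ge0 _) (ha 0%N); rewrite expr0 divr1.
have zs' : cm z < s by move: zs; lra.
have := psum_taylor 0 s0 ha zs'; rewrite big_ord0 subr0 expr0 mulr1 => h; apply: le_trans h _.
have q2 : cm z / s <= 1 / 2 by rewrite ler_pdivrMr //; move: zs; lra.
by rewrite ler_pdivrMr; [nra|move: q2; lra].
Qed.

Lemma psum0 (a : nat -> C) : psum a 0 = a 0%N.
Proof.
apply: ulim_eq => d d0; exists 1%N => -[//|n] _.
rewrite big_ord_recl expr0 mulr1 big1 ?addr0 ?subrr ?cm0 ?ltW // => i _.
by rewrite expr0n /= mulr0.
Qed.

End Coefficients.

(** * Analytic families of transformations *)

Section GermSolution.
Variables (R : realType) (n : nat).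
Local Notation C := R[i].

Section Linearity.
Variables (e : C) (l0 l1 : 'rV[C]_n) (r1 r2 : nat -> 'M[C]_n).

Lemma adlP (l : 'rV[C]_n) c (X Y : 'M[C]_n) : adl l (c *: X + Y) = c *: adl l X + adl l Y.
Proof. by rewrite /adl mulmxDr mulmxDl -scalemxAr -scalemxAl opprD scalerBr addrACA. Qed.

Lemma conSP c (P Q : nat -> 'M[C]_n) m :
  conS r1 r2 (fun k => c *: P k + Q k) m = c *: conS r1 r2 P m + conS r1 r2 Q m.
Proof.
rewrite /conS scaler_sumr -big_split /=; apply: eq_bigr => a _.
rewrite mulmxDr mulmxDl -scalemxAr -scalemxAl opprD scalerBr.
by rewrite addrACA.
Qed.

Lemma shP c (P Q : nat -> 'M[C]_n) m : sh (fun k => c *: P k + Q k) m = c *: sh P m + sh Q m.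
Proof. by case: m => [|m] //=; rewrite scaler0 addr0. Qed.

Lemma sh_ext (P Q : nat -> 'M[C]_n) m : (forall k, P k = Q k) -> sh P m = sh Q m.
Proof. by case: m => [|m] //=. Qed.

Lemma coefeqP c (P Q : nat -> 'M[C]_n) m :
  coefeq e l0 l1 r1 r2 (fun k => c *: P k + Q k) m =
  c *: coefeq e l0 l1 r1 r2 P m + coefeq e l0 l1 r1 r2 Q m.
Proof.
rewrite /coefeq adlP conSP.
have -> : sh (fun k => adl l1 (c *: P k + Q k) - k%:R *: (c *: P k + Q k)) m =
   c *: sh (fun k => adl l1 (P k) - k%:R *: P k) m + sh (fun k => adl l1 (Q k) - k%:R *: Q k) m.
  rewrite -shP; apply: sh_ext => k; rewrite adlP.
  move: (adl l1 (P k)) (adl l1 (Q k)) => U V.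
  by apply/matrixP => i j; rewrite !mxE; ring.
have -> : sh (sh (conS r1 r2 (fun k => c *: P k + Q k))) m =
   c *: sh (sh (conS r1 r2 P)) m + sh (sh (conS r1 r2 Q)) m.
  by rewrite -shP; apply: sh_ext => k; rewrite -shP; apply: sh_ext => k'; exact: conSP.
move: (sh _ m) (sh _ m) (sh (sh _) m) (sh (sh _) m) (conS _ _ P m) (conS _ _ Q m) (adl _ _) (adl _ _)
  (P m.+1) (Q m.+1) => u1 u2 u3 u4 u5 u6 u7 u8 u9 u10.
by apply/matrixP => i j; rewrite !mxE; ring.
Qed.

Lemma coefeq_ext (P Q : nat -> 'M[C]_n) m : (forall k, P k = Q k) ->
  coefeq e l0 l1 r1 r2 P m = coefeq e l0 l1 r1 r2 Q m.
Proof. by move=> /funext ->. Qed.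

Lemma coefeq_lincomb (J : finType) (v : J -> C) (Y : J -> nat -> 'M[C]_n) m :
  coefeq e l0 l1 r1 r2 (fun k => \sum_a v a *: Y a k) m = \sum_a v a *: coefeq e l0 l1 r1 r2 (Y a) m.
Proof.
elim: (index_enum J) => [|a s IH].
  rewrite big_nil (@coefeq_ext _ (fun k => (-1) *: (0 : 'M[C]_n) + 0)); last first.
    by move=> k; rewrite big_nil scaler0 addr0.
  by rewrite coefeqP [(-1) *: coefeq _ _ _ _ _ _ _]scaleN1r addNr.
rewrite big_cons -IH -coefeqP; apply: coefeq_ext => k.
by rewrite big_cons.
Qed.

Lemma conS_trunc (P Q : nat -> 'M[C]_n) m : (forall k, (k <= m)%N -> P k = Q k) ->
  conS r1 r2 P m = conS r1 r2 Q m.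
Proof. by move=> h; apply: eq_bigr => a _; rewrite h // leq_subr. Qed.

End Linearity.

(* Off-diagonal entries of [P m] come from equation [m], the diagonal ones from equation [m+1]. *)
Lemma low_bound (A s g0 : R) m : 0 <= A -> 0 < s <= 1 -> 0 < g0 -> exists2 c, 0 <= c &
  forall (e : C) (l0 l1 : 'rV[C]_n) (r1 r2 P : nat -> 'M[C]_n) (b d t : R),
  mbnd l1 A ->
  (forall a, mbnd (r1 a) (A / (2 * s) ^+ a)) -> (forall a, mbnd (r2 a) (A / (2 * s) ^+ a)) ->
  (forall i j, i != j -> g0 <= cm (l0 ord0 i - l0 ord0 j)) ->
  (forall m, coefeq e l0 l1 r1 r2 P m = 0) ->
  0 <= b -> wbnd s P b -> mbnd (P 0%N) d -> 0 <= d -> cm e <= t ->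
  mbnd (P m) (c * (d + t * b)).
Proof.
move=> A0 /andP[s0 s1] g00.
elim/ltn_ind: m => -[|m] IH.
  exists 1 => // e l0 l1 r1 r2 P b d t _ _ _ _ _ b0 _ hd _ ht; rewrite mul1r.
  by apply: mbnd_le hd; rewrite lerDl mulr_ge0 // (le_trans _ ht) ?cm_ge0.
have [c0 c00 hc0] : exists2 c, 0 <= c & forall k, (k <= m)%N ->
  forall (e : C) (l0 l1 : 'rV[C]_n) (r1 r2 P : nat -> 'M[C]_n) (b d t : R),
  mbnd l1 A ->
  (forall a, mbnd (r1 a) (A / (2 * s) ^+ a)) -> (forall a, mbnd (r2 a) (A / (2 * s) ^+ a)) ->
  (forall i j, i != j -> g0 <= cm (l0 ord0 i - l0 ord0 j)) ->
  (forall m, coefeq e l0 l1 r1 r2 P m = 0) ->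
  0 <= b -> wbnd s P b -> mbnd (P 0%N) d -> 0 <= d -> cm e <= t ->
  mbnd (P k) (c * (d + t * b)).
  have [c hc] := choice (fun k : 'I_m.+1 => let: ex_intro2 x h1 h2 := IH k (ltn_ord k) in ex_intro _ x (conj h1 h2)).
  exists (\sum_k c k); first by apply: sumr_ge0 => k _; have [] := hc k.
  move=> k km e l0 l1 r1 r2 P b d t h1 h2 h3 h4 h5 b0 h6 h7 d0 ht.
  have [ck h] := hc (Ordinal (km : (k < m.+1)%N)).
  apply: mbnd_le (h e l0 l1 r1 r2 P b d t h1 h2 h3 h4 h5 b0 h6 h7 d0 ht).
  have t0 : 0 <= t by apply: le_trans ht; exact: cm_ge0.
  apply: ler_wpM2r; first by rewrite addr_ge0 // mulr_ge0.
  rewrite (bigD1 (Ordinal (km : (k < m.+1)%N))) //= lerDl sumr_ge0 // => k' _; by have [] := hc k'.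
(* [c1] collects the terms of equation [m + 1] divided by the eigenvalue gap, for the off-diagonal
   entries of [P m.+1]; [c2] those of equation [m + 2], for the diagonal ones. Terms with
   coefficients of higher index carry a factor [e] and enter through [t * b]. *)
pose c1 := g0^-1 * (m.+2%:R / s ^+ m.+2 + (2 * A + m%:R) * c0 + 4 * n%:R * A * c0 / s ^+ m + 4 * n%:R * A / s ^+ m.+1).
pose c2 := m.+3%:R / s ^+ m.+3 + 4 * n%:R * A * c0 / s ^+ m + 4 * n%:R * A / s ^+ m.+2.
have s0' k : 0 <= (s ^+ k)^-1 by rewrite invr_ge0 exprn_ge0 // ltW.
have nA0 : 0 <= 4 * n%:R * A by rewrite mulr_ge0 // mulr_ge0.
have c10 : 0 <= c1.
  apply: mulr_ge0; first by rewrite invr_ge0 ltW.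
  rewrite !addr_ge0 //; [exact: mulr_ge0|apply: mulr_ge0 => //|apply: mulr_ge0 => //|exact: mulr_ge0].
    by rewrite addr_ge0 // mulr_ge0.
  exact: mulr_ge0.
have c20 : 0 <= c2.
  by rewrite !addr_ge0 //; apply: mulr_ge0 => //; exact: mulr_ge0.
exists (c1 + c2); first exact: addr_ge0.
move=> e l0 l1 r1 r2 P b d t hl1 hr1 hr2 hg hP b0 hb hd d0 ht.
have t0 : 0 <= t by apply: le_trans ht; exact: cm_ge0.
pose X := d + t * b; have X0 : 0 <= X by rewrite addr_ge0 // mulr_ge0.
have tX : t * b <= X by rewrite lerDr.
rewrite -/X.
have low k : (k <= m)%N -> mbnd (P k) (c0 * X).
  by move=> km; exact: (hc0 k km e l0 l1 r1 r2 P b d t).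
have cS k : (k <= m)%N -> mbnd (conS r1 r2 P k) (4 * n%:R * A * c0 / s ^+ m * X).
  (* Truncation replaces the weighted bound [b] by the inductive bound [c0 * X] on the first
     coefficients; [s <= 1] turns the latter into a weighted bound. *)
  move=> km; rewrite (@conS_trunc _ _ _ (fun j => if (j <= k)%N then P j else 0)); last by move=> j ->.
  have -> : 4 * n%:R * A * c0 / s ^+ m * X = 4 * n%:R * A * (c0 * X) / s ^+ m by ring.
  apply: (@mbnd_le _ _ _ _ (4 * n%:R * A * (c0 * X) / s ^+ k)).
    apply: ler_wpM2l; first by apply: mulr_ge0 => //; apply: mulr_ge0.
    by rewrite lef_pV2 ?posrE ?exprn_gt0 // ler_wiXn2l // ltW.
  apply: (conS_bnd A0 s0 hr1 hr2); first exact: mulr_ge0.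
  move=> j; have W : 0 <= c0 * X / s ^+ j by apply: mulr_ge0 => //; exact: mulr_ge0.
  case: ifP => jk; last exact: mbnd0.
  apply: (@mbnd_le _ _ _ _ (c0 * X)); last by apply: low; apply: leq_trans km.
  rewrite -[X in X <= _]mulr1; apply: ler_wpM2l; first exact: mulr_ge0.
  by rewrite invf_ge1 ?exprn_gt0 // exprn_ile1 // ltW.
have eS k : mbnd (e *: conS r1 r2 P k) (4 * n%:R * A / s ^+ k * X).
  apply: mbnd_le (mbndZ e (conS_bnd A0 s0 hr1 hr2 k b0 hb)).
  have -> : cm e * (4 * n%:R * A * b / s ^+ k) = 4 * n%:R * A / s ^+ k * (cm e * b) by ring.
  apply: ler_wpM2l; first exact: mulr_ge0.
  by apply: le_trans tX; apply: ler_wpM2r.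
have eP k : mbnd ((e * k%:R) *: P k) (k%:R / s ^+ k * X).
  apply: mbnd_le (mbndZ (e * k%:R) (hb k)); rewrite cmM cm_nat.
  have -> : cm e * k%:R * (b / s ^+ k) = k%:R / s ^+ k * (cm e * b) by ring.
  apply: ler_wpM2l; first exact: mulr_ge0.
  by apply: le_trans tX; apply: ler_wpM2r.
move=> i j.
have [eij|nij] := eqVneq i j.
  apply: (@le_trans _ _ (c2 * X)); last by rewrite [(c1 + c2) * X]mulrDl lerDr mulr_ge0.
  (* On the diagonal both commutators vanish, and [x^2 P'] contributes [(m + 1) P_(m+1)] here. *)
  have := congr1 (fun M : 'M[C]_n => M i j) (hP m.+2).
  rewrite /coefeq /= !(adlE, mxE) eij !subrr !mul0r addr0.
  have := cS m (leqnn m) j j; have := eS m.+2 j j; have := eP m.+3 j j.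
  rewrite !mxE; move: (conS r1 r2 P m j j) (e * conS r1 r2 P m.+2 j j) (e * m.+3%:R * P m.+3 j j).
  move=> u1 u2 u3 h3 h2 h1 E.
  have -> : P m.+1 j j = m.+1%:R^-1 * (u3 + u1 - u2).
    apply: (@mulfI _ (m.+1%:R : C)); first by rewrite pnatr_eq0.
    rewrite mulrA divff ?pnatr_eq0 // mul1r; apply/esym/eqP; rewrite -subr_eq0 -E.
    by apply/eqP; ring.
  rewrite cmM cmV cm_nat.
  apply: (@le_trans _ _ (cm (u3 + u1 - u2))).
    by rewrite -[X in _ <= X]mul1r ler_wpM2r ?cm_ge0 // invf_le1 ?ltr0n // ler1n.
  have := cmB (u3 + u1) u2; have := cmD u3 u1; rewrite /c2 2!mulrDl; move: h1 h2 h3.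
  by move: (_ * X) (_ * X) (_ * X) => y1 y2 y3; lra.
apply: (@le_trans _ _ (c1 * X)); last by rewrite [(c1 + c2) * X]mulrDl lerDl mulr_ge0.
have gg := hg i j nij; set g := l0 ord0 i - l0 ord0 j in gg.
have g0' : g != 0 by rewrite -cm_gt0; apply: lt_le_trans gg.
have hS : mbnd (sh (conS r1 r2 P) m) (4 * n%:R * A * c0 / s ^+ m * X).
  case: (m) cS => [|k] cS /=; last by apply: cS.
  by apply: mbnd0; apply: mulr_ge0 => //; apply: mulr_ge0 => //; exact: mulr_ge0.
have := congr1 (fun M : 'M[C]_n => M i j) (hP m.+1).
rewrite /coefeq /= !(adlE, mxE) -/g.
have h4 : cm ((l1 ord0 i - l1 ord0 j) * P m i j - m%:R * P m i j) <= (2 * A + m%:R) * c0 * X.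
  have -> : (2 * A + m%:R) * c0 * X = (2 * A) * (c0 * X) + m%:R * (c0 * X) by ring.
  apply: le_trans (cmB _ _) _; rewrite !cmM cm_nat; have hp := low m (leqnn m) i j.
  apply: lerD; last by apply: ler_wpM2l.
  apply: ler_pM => //; rewrite ?cm_ge0 //; apply: le_trans (cmB _ _) _.
  by have := hl1 ord0 i; have := hl1 ord0 j; lra.
have := hS i j; have := eS m.+1 i j; have := eP m.+2 i j.
rewrite !mxE; move: (sh (conS r1 r2 P) m i j) (e * conS r1 r2 P m.+1 i j) (e * m.+2%:R * P m.+2 i j) h4.
move: (_ * P m i j - _) => u4 u1 u2 u3 h4 h3 h2 h1 E.
have -> : P m.+1 i j = - (g^-1 * (u3 + u4 + u1 - u2)).
  apply: (@mulfI _ g) => //; rewrite mulrN mulrA divff // mul1r.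
  by apply/eqP; rewrite -subr_eq0 opprK -E; apply/eqP; ring.
rewrite cmN cmM cmV /c1 -mulrA; apply: ler_pM; rewrite ?invr_ge0 ?cm_ge0 //.
  by rewrite lef_pV2 ?posrE // (lt_le_trans g00).
have := cmB (u3 + u4 + u1) u2; have := cmD (u3 + u4) u1; have := cmD u3 u4; rewrite 3!mulrDl; move: h1 h2 h3 h4.
by move: (_ * X) (_ * X) (_ * X) (_ * X) => y1 y2 y3 y4; lra.
Qed.

(** [tail_control] bounds the whole sequence by its first [N + 1] coefficients, and [low_bound]
    bounds these by the value at [x = 0] up to a multiple of [t * b]. For small [t] this multiple
    can be absorbed, so that P(eps, 0) controls everything. *)
Lemma total_bound (A s g0 : R) N : 0 <= A -> 0 < s <= 1 -> 0 < g0 ->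
  4 * (2 * A / s + 2 * A + 8 * n%:R * A * s) <= N%:R ->
  exists2 c, 0 <= c &
  forall (e : C) (l0 l1 : 'rV[C]_n) (r1 r2 P : nat -> 'M[C]_n) (B : R),
  mbnd l0 A -> mbnd l1 A ->
  (forall a, mbnd (r1 a) (A / (2 * s) ^+ a)) -> (forall a, mbnd (r2 a) (A / (2 * s) ^+ a)) ->
  (forall i j, i != j -> g0 <= cm (l0 ord0 i - l0 ord0 j)) ->
  (forall m, coefeq e l0 l1 r1 r2 P m = 0) ->
  cm e <= s ^+ 2 / 12 -> 0 <= B -> wbnd s P B ->
  exists b, [/\ 0 <= b, wbnd s P b & forall d t, mbnd (P 0%N) d -> 0 <= d -> cm e <= t -> b <= c * (d + t * b)].
Proof.
move=> A0 s01 g00 hN; have /andP[s0 s1] := s01.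
have [c hc] := choice (fun m : nat => let: ex_intro2 x h1 h2 := low_bound m A0 s01 g00 in ex_intro _ x (conj h1 h2)).
exists (\sum_(m < N.+1) \sum_(i < n) \sum_(j < n) s ^+ m * c m).
  apply: sumr_ge0 => m _; do 2!(apply: sumr_ge0 => ? _); have [? _] := hc m; by apply: mulr_ge0 => //; apply/exprn_ge0/ltW.
move=> e l0 l1 r1 r2 P B hl0 hl1 hr1 hr2 hg hP he B0 hB.
pose b := \sum_(m < N.+1) \sum_(i < n) \sum_(j < n) s ^+ m * cm (P m i j).
have t0 (m : nat) i j : 0 <= s ^+ m * cm (P m i j) by rewrite mulr_ge0 ?cm_ge0 // exprn_ge0 // ltW.
have b0 : 0 <= b by do 3!(apply: sumr_ge0 => ? _).
have hb : wbnd s P b.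
  apply: (tail_control A0 s0 hl0 hl1 hr1 hr2 he hN b0 B0 hB).
    move=> m mN i j; rewrite ler_pdivlMr ?exprn_gt0 // mulrC /b.
    rewrite (bigD1 (Ordinal (mN : (m < N.+1)%N))) //= (bigD1 i) //= (bigD1 j) //= -!addrA lerDl.
    by rewrite !addr_ge0 //; do ?[apply: sumr_ge0 => ? _].
  by move=> q Nq; apply/coefeq_solved => //; apply: leq_ltn_trans Nq.
exists b; split => // d t hd d0 ht.
rewrite mulr_suml; apply: ler_sum => m _; rewrite mulr_suml; apply: ler_sum => i _.
rewrite mulr_suml; apply: ler_sum => j _; rewrite -mulrA; apply: ler_wpM2l; first by rewrite exprn_ge0 // ltW.
by have [_ h] := hc m; apply: (h e l0 l1 r1 r2 P b d t).
Qed.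

End GermSolution.

(** * Replacing bounded solutions by one holomorphic in eps *)

Section Perturbation.
Variables (R : realType) (n : nat).
Local Notation C := R[i].

(** A row vector killed by [M] satisfies [v = - v (M - D) D^-1]; for this [eta] each substitution at
    least halves a bound on [v], so [v = 0]. *)
Lemma unit_perturb (D : 'M[C]_n) : D \in unitmx ->
  exists2 eta : R, 0 < eta & forall M : 'M[C]_n, mbnd (M - D) eta -> M \in unitmx.
Proof.
move=> uD; have [K K0 hK] := mbnd_ex (invmx D).
have c0 : 0 < 2 * n%:R * n%:R * K + 1 by rewrite ltr_wpDl // !mulr_ge0.
exists (2 * n%:R * n%:R * K + 1)^-1; first by rewrite invr_gt0.
move=> M hM; rewrite -row_free_unit; apply: inj_row_free => v vM.
have E : v = - (v *m (M - D) *m invmx D).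
  by rewrite mulmxBr vM sub0r mulNmx opprK mulmxK.
have [B B0 hB] := mbnd_ex v.
apply: mbnd_eq0 => d d0; have [k hk] := half_pow_small B d0.
apply: mbnd_le hk _; elim: k => [|k IH]; first by rewrite expr0 divr1.
rewrite E; apply: mbndN; apply: mbnd_le (mbndM (mbndM IH hM) hK).
have -> : n%:R * (n%:R * (B / 2 ^+ k / (2 * n%:R * n%:R * K + 1)) * K) =
  B / 2 ^+ k.+1 * (2 * n%:R * n%:R * K / (2 * n%:R * n%:R * K + 1)).
  by rewrite exprS; field; rewrite expf_neq0 //= gt_eqF.
rewrite -[X in _ <= X]mulr1; apply: ler_wpM2l; first by rewrite divr_ge0 // exprn_ge0.
by rewrite ler_pdivrMr // mul1r lerDl.
Qed.

Variables (l0 l1 : C -> 'rV[C]_n) (r1 r2 : nat -> C -> 'M[C]_n).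
Variables (A s rho : R) (N : nat).
Hypotheses (A0 : 0 <= A) (s0 : 0 < s) (s1 : s <= 1) (rho0 : 0 < rho) (rhos : rho <= s ^+ 2 / 12).
Hypothesis hN : 4 * (2 * A / s + 2 * A + 8 * n%:R * A * s) <= N%:R.
Hypotheses (hl0 : forall e, cm e < rho -> mbnd (l0 e) A) (hl1 : forall e, cm e < rho -> mbnd (l1 e) A).
Hypotheses (hr1 : forall e, cm e < rho -> forall a, mbnd (r1 a e) (A / (2 * s) ^+ a)).
Hypotheses (hr2 : forall e, cm e < rho -> forall a, mbnd (r2 a e) (A / (2 * s) ^+ a)).
Hypotheses (ol0 : holmx rho l0) (ol1 : holmx rho l1).
Hypotheses (or1 : forall a, holmx rho (r1 a)) (or2 : forall a, holmx rho (r2 a)).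

Let coefs e := coefeq e (l0 e) (l1 e) (r1^~ e) (r2^~ e).
(** [J] indexes the entries of the coefficients up to [N]. The [Y a] extend the unit vectors [V a]
    to solutions of the equations of large index and form a basis of the bounded ones. *)
Let J := ('I_N.+1 * ('I_n * 'I_n))%type.
Let V (a : J) (m : nat) : 'M[C]_n := if m == a.1 then delta_mx a.2.1 a.2.2 else 0.
Let Y (a : J) := tailsol l0 l1 r1 r2 N (V a).

Let hV a m : (m <= N)%N -> mbnd (V a m) (1 / s ^+ m).
Proof.
move=> mN i j; have sm : 1 <= 1 / s ^+ m by rewrite div1r invf_ge1 ?exprn_gt0 // exprn_ile1 // ltW.
rewrite /V; case: ifP => _; rewrite mxE; last by rewrite cm0 (le_trans _ sm).
by rewrite cm_nat; case: (_ && _) => //=; rewrite (le_trans _ sm).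
Qed.

Let V_sum (v : J -> C) (m : nat) i j (mN : (m <= N)%N) :
  (\sum_a v a *: V a m) i j = v (Ordinal (mN : (m < N.+1)%N), (i, j)).
Proof.
rewrite summxE (bigD1 (Ordinal (mN : (m < N.+1)%N), (i, j))) //= !mxE /V /= eqxx mxE !eqxx mulr1.
rewrite big1 ?addr0 // => -[m' [i' j']] /= ne; rewrite mxE.
case: ifP => [/eqP mm|_]; last by rewrite mxE mulr0.
rewrite mxE; have [ei|] := eqVneq i i'; last by rewrite mulr0.
have [ej|] := eqVneq j j'; last by rewrite mulr0.
case/negP: ne; rewrite ei ej /=; apply/eqP; congr (_, _); exact/val_inj.
Qed.

(** In the basis [Y] only finitely many equations remain, with coefficients [AA] that are germs in
    [e]. [kernel_section] provides coordinates holomorphic at 0, within [eta] of those of a sampled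
    solution. *)
Lemma germ_solution (D0 : 'M[C]_n) (b0 eta : R) : 0 <= b0 -> 0 < eta ->
  (forall d, 0 < d -> exists e P, [/\ 0 < cm e, cm e < d, wbnd s P b0, (forall m, coefs e P m = 0) &
     mbnd (P 0%N - D0) eta]) ->
  exists (P1 : nat -> C -> 'M[C]_n) (rho' B : R),
   [/\ 0 < rho', 0 <= B, (forall m, holmx rho' (P1 m)),
       (forall e, cm e < rho' -> wbnd s (P1^~ e) B /\ forall m, coefs e (P1^~ e) m = 0) &
       mbnd (P1 0%N 0 - D0) (eta + eta)].
Proof.
move=> b00 eta0 H.
pose Sol (e : C) (v : J -> C) := cm e < rho /\ exists P, [/\ wbnd s P b0, (forall m, coefs e P m = 0),
  mbnd (P 0%N - D0) eta & forall a : J, v a = P (nat_of_ord a.1) a.2.1 a.2.2].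
(* Equation [q + 1] determines the coefficient [q > N], so the equations still to be solved have the
   indices 0 to [N + 1]. *)
pose AA (i : 'I_N.+2 * ('I_n * 'I_n)) (a : J) (e : C) : C := coefs e (Y a e) i.1 i.2.1 i.2.2.
have hY a e : cm e < rho -> wbnd s (Y a e) 1.
  by move=> er; apply: (tailsol_bnd A0 s0 rhos hN hl0 hl1 hr1 hr2 ler01 (hV a)).
have sY a e q : cm e < rho -> (N < q)%N -> coefs e (Y a e) q.+1 = 0.
  move=> er Nq; apply/coefeq_solved; first by apply: leq_ltn_trans Nq.
  exact: (tailsol_solved A0 s0 rhos hN hl0 hl1 hr1 hr2 ler01 (hV a) er Nq).
have oY a m : holmx rho (fun e => Y a e m).
  exact: (holmx_tailsol A0 s0 rhos hN hl0 hl1 hr1 hr2 ol0 ol1 or1 or2 ler01 (hV a)).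
have gA i a : germ (AA i a).
  by exists rho => //; apply: (holmx_coefs ol0 ol1 or1 or2) => k; exact: oY.
have e3 : 0 <= b0 / s ^+ N by rewrite divr_ge0 // exprn_ge0 // ltW.
have [|||v1 [gv1 [d1 d10 hd1] [ee [v [_ _ [er [P [bP cP hP vP]]] hv1]]]]] :=
  @kernel_section R _ _ (b0 / s ^+ N) [set: J] AA eta 1 Sol gA e3 eta0 ltr01.
- move=> d d0; have dr0 : 0 < Num.min d rho by rewrite lt_min d0.
  have [e [P [h1 h2 h3 h4 h5]]] := H _ dr0; move: h2; rewrite lt_min => /andP[h2 h2'].
  by exists e, (fun a : J => P (nat_of_ord a.1) a.2.1 a.2.2); split=> //; split=> //; exists P.
- move=> e v [er [P [bP cP hP vP]]] a; rewrite vP; apply: le_trans (bP _ _ _) _.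
  apply: ler_wpM2l => //; rewrite lef_pV2 ?posrE ?exprn_gt0 //.
  by apply: ler_wiXn2l => //; [exact: ltW|rewrite -ltnS].
- move=> e v [er [P [bP cP hP vP]]] i.
  (* Both sides are bounded solutions of the equations of large index with the same first
     coefficients. *)
  have PE : forall m, P m = \sum_a v a *: Y a e m.
    have er2 : cm e <= s ^+ 2 / 12 by apply: le_trans rhos; exact: ltW.
    apply: (tail_unique A0 s0 (hl0 er) (hl1 er) (hr1 er) (hr2 er) er2 hN (B := b0 + \sum_a cm (v a))).
    + by rewrite addr_ge0 // sumr_ge0 // => a _; exact: cm_ge0.
    + move=> m; apply: mbnd_le (bP m); apply: ler_wpM2r; first by rewrite invr_ge0 exprn_ge0 // ltW.
      by rewrite lerDl sumr_ge0 // => a _; exact: cm_ge0.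
    + move=> m i' j'; rewrite summxE; apply: le_trans (cm_sum _ _ _) _.
      rewrite mulrDl mulr_suml; apply: (@le_trans _ _ (\sum_(a : J) cm (v a) / s ^+ m)); last first.
        by rewrite lerDr divr_ge0 // exprn_ge0 // ltW.
      apply: ler_sum => a _; rewrite mxE cmM; apply: ler_wpM2l; first exact: cm_ge0.
      by rewrite -div1r; apply: hY.
    + move=> m mN; apply/matrixP => i' j'.
      transitivity ((\sum_a v a *: V a m) i' j'); first by rewrite (V_sum _ _ _ mN) vP.
      by congr (fun_of_matrix _ i' j'); apply: eq_bigr => a _; rewrite /Y tailsol_low.
    + by move=> q Nq; apply/coefeq_solved => //; [exact: leq_ltn_trans Nq|exact: cP].
    + move=> q Nq; apply/coefeq_solved => //; first exact: leq_ltn_trans Nq.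
      by rewrite coefeq_lincomb big1 // => a _; have := sY a e q er Nq; rewrite /coefs => ->; rewrite scaler0.
  have := cP i.1; rewrite /coefs (coefeq_ext _ _ _ _ _ _ PE) coefeq_lincomb.
  move=> /(congr1 (fun M : 'M[C]_n => M i.2.1 i.2.2)); rewrite summxE mxE => S0.
  rewrite (eq_bigl xpredT) => [|a]; last by rewrite inE.
  by rewrite -[RHS]S0; apply: eq_bigr => a _; rewrite mxE mulrC.
have [r0 r00 hr0] := fin_radius (fun (a : J) r r' h => hol_le (f := v1 a) (proj2 (andP h))) gv1.
have r02 : 0 <= r0 / 2 < r0 by apply/andP; split; lra.
have [M hM] := choice (fun a => let: ex_intro2 x h1 h2 := hol_bound r02 (hr0 a) in ex_intro _ x (conj h1 h2)).
pose rho' := Num.min rho (Num.min d1 (r0 / 2)).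
have [q1 [q2 q3]] : rho' <= rho /\ rho' <= d1 /\ rho' <= r0 / 2.
  by rewrite /rho' !ge_min !lexx !orbT.
exists (fun m e => \sum_a v1 a e *: Y a e m), rho', (\sum_a M a); split.
- by rewrite !lt_min rho0 d10 divr_gt0.
- by apply: sumr_ge0 => a _; have [] := hM a.
- move=> m i j; apply: (@hol_ext _ _ (fun e => \sum_a v1 a e * Y a e m i j)).
    by move=> e _; rewrite [RHS]summxE; apply: eq_bigr => a _; rewrite [RHS]mxE.
  apply: hol_sum => a _; apply: holM.
    by apply: hol_le (hr0 a); apply: le_trans q3 _; rewrite ler_pdivrMr // ler_pMr // ler1n.
  by apply: hol_le (oY a m i j).
- move=> e er'; have er2 : cm e < rho by apply: lt_le_trans er' q1.
  split.
    move=> m i j; rewrite summxE mulr_suml; apply: le_trans (cm_sum _ _ _) _.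
    apply: ler_sum => a _; rewrite mxE cmM; have [M0 hM'] := hM a.
    apply: ler_pM; rewrite ?cm_ge0 //; last by rewrite -div1r; apply: hY.
    by apply: hM'; apply: le_trans q3; exact: ltW.
  move=> m; rewrite /coefs coefeq_lincomb.
  have [mN|Nm] := ltnP m N.+2; last first.
    case: m Nm => [//|m]; rewrite ltnS => Nm.
    by rewrite big1 // => a _; have := sY a e m er2 Nm; rewrite /coefs => ->; rewrite scaler0.
  apply/matrixP => i j; rewrite summxE mxE.
  have := hd1 e (lt_le_trans er' q2) (Ordinal mN, (i, j)).
  rewrite (eq_bigl xpredT) => [h|a]; last by rewrite inE.
  by rewrite -[RHS]h; apply: eq_bigr => a _; rewrite mxE mulrC.
- have hv2 i j : cm (v1 (ord0, (i, j)) 0 - v (ord0, (i, j))) <= eta by apply: hv1; rewrite inE.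
  move=> i j; rewrite !mxE.
  have -> : (\sum_a v1 a 0 *: Y a 0 0%N) i j = v1 (ord0, (i, j)) 0.
    transitivity ((\sum_a v1 a 0 *: V a 0%N) i j); last first.
      by rewrite (V_sum _ _ _ (leq0n N)); congr (v1 (_, _) 0); apply: val_inj.
    by congr (fun_of_matrix _ i j); apply: eq_bigr => a _; rewrite /Y tailsol_low.
  have := hP i j; have := hv2 i j; rewrite vP /= !mxE => h1 h2.
  rewrite -(subrK (P 0%N i j) (v1 _ 0)) -addrA.
  by apply: le_trans (cmD _ _) _; apply: lerD.
Qed.

End Perturbation.

(** * The differential equation in terms of Taylor coefficients *)

Section FormalEquation.
Variables (R : realType).
Local Notation C := R[i].

(** By [hol_quadratic], difference quotients with a fixed small increment approach the derivative
    uniformly, so [weierstrass] applies. *)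
Lemma hol_derivative (r s : R) (f : C -> C) : 0 <= s < r -> hol r f ->
  exists2 f', hol s f' & forall z, cm z < s -> hasd f z (f' z).
Proof.
move=> /andP[s0 sr] hf.
pose t := s + (r - s) / 3; pose u := s + (r - s) / 3 * 2.
have [st tu ur] : [/\ s < t, t < u & u < r] by split; rewrite /t /u; lra.
have u0 : 0 <= u < r by rewrite ur andbT; move: st tu; lra.
have [M M0 hM] := hol_bound u0 hf.
have t0 : 0 <= t < u by rewrite tu andbT; move: st; lra.
have [K K0 HK] := hol_quadratic t0.
have [f' [_ q]] := HK f M (hol_le (ltW ur) hf) (fun z h => hM z (ltW h)).
have hd z : cm z < s -> hasd f z (f' z).
  move=> zs e e0; have KM0 : 0 <= K * M by rewrite mulr_ge0.
  exists (Num.min (t - s) (e / (K * M + 1))); first by rewrite lt_min subr_gt0 st divr_gt0 // ltr_wpDl.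
  move=> h; rewrite lt_min => /andP[h1 h2]; rewrite [f' z * h]mulrC.
  apply: le_trans (q z h _ _) _; [by move: zs st; lra|by have := cmD z h; move: zs h1; lra|].
  rewrite expr2 mulrA; apply: ler_wpM2r; first exact: cm_ge0.
  have h3 : cm h * (K * M + 1) <= e by rewrite -ler_pdivlMr ?ltr_wpDl // ltW.
  by have := cm_ge0 h; move: h3; nra.
exists f' => //; apply: weierstrass => e e0.
have KM0 : 0 <= K * M by rewrite mulr_ge0.
pose h : R := Num.min (t - s) (e / (K * M + 1)).
have h0 : 0 < h by rewrite lt_min subr_gt0 st divr_gt0 // ltr_wpDl.
have ch : cm h%:C = h by rewrite cmR ger0_norm // ltW.
have hts : h <= t - s by rewrite ge_min lexx.
exists (fun z => (f (z + h%:C) - f z) * (h%:C)^-1).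
  apply: holM; last exact: hol_cst.
  apply: holD.
    move=> z zs; have zr : cm (z + h%:C) < r.
      by have := cmD z h%:C; rewrite ch; move: zs hts tu ur; lra.
    have [b hb] := hf _ zr; exists (b * 1).
    apply: (hasd_comp (f := f) (g := fun z => z + h%:C)) => //.
    by apply: hasd_eq (hasdD (hasd_id z) (hasd_cst h%:C z)) _; rewrite addr0.
  by apply: holN; apply: hol_le hf; move: st tu ur; lra.
move=> z zs; have := q z h%:C.
have hn0 : h%:C != 0 :> C by rewrite -cm_gt0 ch.
have -> : (f (z + h%:C) - f z) / h%:C - f' z = (f (z + h%:C) - f z - h%:C * f' z) / h%:C.
  by rewrite [in RHS]mulrBl [h%:C * _]mulrC mulfK.
rewrite cmM cmV ch => Q; rewrite ler_pdivrMr //; apply: le_trans (Q _ _) _.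
- by move: zs st; lra.
- by have := cmD z h%:C; rewrite ch; move: zs hts; lra.
rewrite expr2 mulrA; apply: ler_wpM2r; first exact: ltW.
have h3 : h * (K * M + 1) <= e by rewrite -ler_pdivlMr ?ltr_wpDl // ge_min lexx orbT.
by have := ltW h0; move: h3; nra.
Qed.

Lemma hol_psum (r s : R) (f : C -> C) z : 0 < s < r -> hol r f -> cm z <= s / 2 ->
  f z = psum (tcoef f s) z.
Proof.
move=> sr hf zs; have /andP[s0 s1] := sr.
have [M M0 hM] := hol_bound (introT andP (conj (ltW s0) s1)) hf.
have B : bnd01 (fun t => f (ctr s t)) M by move=> t _; apply: hM; rewrite cm_ctr.
have ha j : cm (tcoef f s j) <= M / s ^+ j by apply: ccoef_le.
have zs' : cm z < s by move: zs; lra.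
apply: cm_eq => d d0.
have q01 : 0 <= cm z / s < 1.
  by rewrite divr_ge0 ?cm_ge0 ?(ltW s0) //= ltr_pdivrMr // mul1r.
have [J hJ] := geom_small (2 * (M / (1 - cm z / s))) q01 d0.
have h1 := hol_taylor J sr hf B zs'; have h2 := psum_taylor J s0 ha zs'.
set S := \sum_(j < J) _ in h1 h2.
have -> : f z - psum (tcoef f s) z = (f z - S) - (psum (tcoef f s) z - S) by ring.
apply: le_trans (cmB _ _) _; apply: le_trans (hJ J (leqnn J)).
have -> : 2 * (M / (1 - cm z / s)) * (cm z / s) ^+ J = M * (cm z / s) ^+ J / (1 - cm z / s) + M * (cm z / s) ^+ J / (1 - cm z / s).
  by ring.
exact: lerD.
Qed.

Variable n : nat.

Definition mexpands (F : C -> 'M[C]_n) (p : nat -> 'M[C]_n) :=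
  forall i j, expands (fun x => F x i j) (fun m => p m i j).

Lemma mexpandsD F G p q : mexpands F p -> mexpands G q ->
  mexpands (fun x => F x + G x) (fun m => p m + q m).
Proof.
move=> hF hG i j; apply: (expands_ext (f := fun x => F x i j + G x i j)).
  by exists 1 => // z _; rewrite mxE.
by apply: (expands_coef (a := fun m => p m i j + q m i j)) (expandsD (hF i j) (hG i j)) => m; rewrite mxE.
Qed.

Lemma mexpandsZ c F p : mexpands F p -> mexpands (fun x => c *: F x) (fun m => c *: p m).
Proof.
move=> hF i j; apply: (expands_ext (f := fun x => c * F x i j)).
  by exists 1 => // z _; rewrite mxE.
by apply: (expands_coef (a := fun m => c * p m i j)) (expandsZ c (hF i j)) => m; rewrite mxE.
Qed.

Lemma mexpandsB F G p q : mexpands F p -> mexpands G q ->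
  mexpands (fun x => F x - G x) (fun m => p m - q m).
Proof.
move=> hF hG; have h := mexpandsD hF (mexpandsZ (-1) hG) => i j.
apply: (expands_ext (f := fun x => (F x + (-1) *: G x) i j)).
  by exists 1 => // z _; rewrite scaleN1r.
by apply: expands_coef (h i j) => m; rewrite scaleN1r.
Qed.

Lemma mexpands_X F p : mexpands F p -> mexpands (fun x => x *: F x) (sh p).
Proof.
move=> hF i j; apply: (expands_ext (f := fun x => x * F x i j)).
  by exists 1 => // z _; rewrite mxE.
by apply: expands_coef (expands_X (hF i j)) => -[|m] //=; rewrite mxE.
Qed.

Lemma mexpandsM F G p q : mexpands F p -> mexpands G q ->
  mexpands (fun x => F x *m G x) (fun m => \sum_(a < m.+1) p a *m q (m - a)%N).
Proof.
move=> hF hG i j; apply: (expands_ext (f := fun x => \sum_k F x i k * G x k j)).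
  by exists 1 => // z _; rewrite mxE.
have h := expands_sum (fun k => expandsM (hF i k) (hG k j)).
apply: expands_coef h => m; rewrite summxE.
rewrite (eq_bigr (fun a : 'I_m.+1 => \sum_k p a i k * q (m - a)%N k j)); last by move=> a _; rewrite mxE.
by rewrite exchange_big.
Qed.

Lemma mexpands_adl l F p : mexpands F p -> mexpands (fun x => adl l (F x)) (fun m => adl l (p m)).
Proof.
move=> hF i j; apply: (expands_ext (f := fun x => (l ord0 i - l ord0 j) * F x i j)).
  by exists 1 => // z _; rewrite adlE.
by apply: expands_coef (expandsZ _ (hF i j)) => m; rewrite adlE.
Qed.

Lemma mexpands_coef F p q : (forall m, p m = q m) -> mexpands F p -> mexpands F q.
Proof. by move=> /funext ->. Qed.

(** Difference of the two sides of the equation for a transformation [P], with the derivative as a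
    separate argument, so that asymptotic expansions apply to it. *)
Definition defect e l0 l1 (R1 R2 P P' : C -> 'M[C]_n) (x : C) : 'M[C]_n :=
  adl (l0 + x *: l1) (P x) + (x ^+ 2 - e) *: (R2 x *m P x - P x *m R1 x) - (x ^+ 2 - e) *: P' x.

Lemma defect_expands e l0 l1 R1 R2 P P' r1 r2 p : mexpands R1 r1 -> mexpands R2 r2 -> mexpands P p ->
  mexpands P' (fun m => m.+1%:R *: p m.+1) ->
  mexpands (defect e l0 l1 R1 R2 P P') (coefeq e l0 l1 r1 r2 p).
Proof.
move=> h1 h2 hP hP'.
have hS : mexpands (fun x => R2 x *m P x - P x *m R1 x) (conS r1 r2 p).
  apply: mexpands_coef (mexpandsB (mexpandsM h2 hP) (mexpandsM hP h1)) => m.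
  rewrite /conS sumrB; congr (_ - _).
  rewrite (reindex_inj rev_ord_inj) /=; apply: eq_bigr => a _.
  by rewrite subSS subKn // -ltnS.
have hA : mexpands (fun x => adl l1 (P x) - x *: P' x) (fun m => adl l1 (p m) - m%:R *: p m).
  apply: mexpandsB; first exact: mexpands_adl.
  apply: mexpands_coef (mexpands_X hP') => -[|m] //=; by rewrite scale0r.
have h := mexpandsB (mexpandsD (mexpandsD (mexpandsD (mexpandsZ (- (- e)) hP') (mexpands_adl l0 hP)) (mexpands_X hA))
  (mexpands_X (mexpands_X hS))) (mexpandsZ e hS).
move=> i j; move: (h i j) => {}h.
have := expands_ext _ h => H; apply: (expands_coef (a := _)) (H _ _) => [m|].
  by rewrite /coefeq opprK scalerA.
exists 1 => // x _; rewrite /defect; move: (R2 x *m P x - P x *m R1 x) => S.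
by rewrite !(adlE, mxE); ring.
Qed.

Definition mcoef (F : C -> 'M[C]_n) (s : R) m : 'M[C]_n := \matrix_(i, j) tcoef (fun x => F x i j) s m.

Lemma mcoef_expands r s F : 0 < s < r -> holmx r F -> mexpands F (mcoef F s).
Proof.
by move=> sr hF i j; apply: expands_coef (hol_expands sr (hF i j)) => m; rewrite mxE.
Qed.

Lemma mcoef_expands' r s (F F' : C -> 'M[C]_n) : 0 < s < r -> (forall i j z, cm z < r -> hasd (fun x => F x i j) z (F' z i j)) ->
  mexpands F' (fun m => m.+1%:R *: mcoef F s m.+1).
Proof.
by move=> sr hF i j; apply: expands_coef (hol_expands' sr (hF i j)) => m; rewrite !mxE.
Qed.

Definition dmx (F : C -> 'M[C]_n) (x : C) : 'M[C]_n := \matrix_(i, j) 'D_(1 : C) (fun z => F z i j) x.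

Lemma dmx_hasd r F : holmx r F -> forall i j z, cm z < r -> hasd (fun x => F x i j) z (dmx F z i j).
Proof.
move=> hF i j z zr; have [b hb] := hF i j z zr.
by rewrite mxE; apply: derivable_hasd; apply: hasd_derivable hb.
Qed.

Lemma dmxE (F : C -> 'M[C]_n) x (Q : 'M[C]_n) : (forall i j, hasd (fun x => F x i j) x (Q i j)) -> dmx F x = Q.
Proof.
move=> h; apply/matrixP => i j; rewrite mxE; apply: (hasd_uniq _ (h i j)).
by apply: derivable_hasd; apply: hasd_derivable (h i j).
Qed.

Lemma mcoef_solution e l0 l1 r s R1 R2 P r1 r2 : 0 < s < r -> holmx r P ->
  mexpands R1 r1 -> mexpands R2 r2 ->
  (exists2 d : R, 0 < d & forall x, cm x < d -> defect e l0 l1 R1 R2 P (dmx P) x = 0) ->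
  forall m, coefeq e l0 l1 r1 r2 (mcoef P s) m = 0.
Proof.
move=> sr hP h1 h2 [d d0 hd] m; apply/matrixP => i j; rewrite [RHS]mxE.
have h := defect_expands e l0 l1 h1 h2 (mcoef_expands sr hP) (mcoef_expands' sr (dmx_hasd hP)).
apply: (expands_uniq (f := fun x => defect e l0 l1 R1 R2 P (dmx P) x i j) (h i j) (b := fun=> 0)).
apply: (expands_ext (f := fun=> 0)); first by exists d => // x xd; rewrite hd // mxE.
by apply: expands_coef (expands_cst 0) => k; case: ifP.
Qed.

(** The defect is holomorphic in [x] and its expansion is [coefeq], hence 0. *)
Lemma series_solution e l0 l1 (r t : R) R1 R2 P r1 r2 p : 0 < t < r -> holmx r P -> holmx r R1 -> holmx r R2 ->
  mexpands R1 r1 -> mexpands R2 r2 -> mexpands P p ->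
  (forall m, coefeq e l0 l1 r1 r2 p m = 0) ->
  forall x, cm x < t -> defect e l0 l1 R1 R2 P (dmx P) x = 0.
Proof.
move=> tr hP o1 o2 h1 h2 hp hc x xt; apply/matrixP => i j; rewrite [RHS]mxE.
have /andP[t0 tr'] := tr.
have hd := dmx_hasd hP.
have od : holmx t (dmx P).
  move=> i' j'; have [f' hol_f' hf] := hol_derivative (introT andP (conj (ltW t0) tr')) (hP i' j').
  apply: hol_ext hol_f' => z zt; apply: (hasd_uniq (hf z zt)); apply: hd; exact: lt_trans tr'.
have pE m : p m = mcoef P t m.
  by apply/matrixP => i' j'; apply: (expands_uniq (hp i' j') (mcoef_expands tr hP i' j')).
have h := defect_expands e l0 l1 h1 h2 (mcoef_expands tr hP) (mcoef_expands' tr hd).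
have lt F : holmx r F -> holmx t F by move=> oF i' j'; apply: hol_le (ltW tr') (oF i' j').
have oq : hol t (fun x : C => x ^+ 2 - e).
  by apply: holD; [apply: holM; exact: hol_id|exact: hol_cst].
apply: (hol_expands0 (r := t) (f := fun x => defect e l0 l1 R1 R2 P (dmx P) x i j)) => //.
  have H : holmx t (defect e l0 l1 R1 R2 P (dmx P)).
    apply: holmxD; last by apply: holmxN; apply: holmxZ.
    apply: holmxD.
      have ol : holmx t (fun x => l0 + x *: l1).
        apply: holmxD; first exact: holmx_cst.
        by apply: holmxZ; [exact: hol_id|exact: holmx_cst].
      by apply: holmxD; [|apply: holmxN]; apply: holmxM => //; try exact: holmx_diag; exact: lt.
    by apply: holmxZ => //; apply: holmxD; [|apply: holmxN]; apply: holmxM; exact: lt.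
  exact: H.
apply: expands_coef (h i j) => m.
rewrite -[mcoef P t]/(fun k => mcoef P t k); have -> : mcoef P t = p by apply/funext => k; rewrite pE.
by rewrite hc mxE.
Qed.

End FormalEquation.

(** * From transformations at isolated parameters to an analytic equivalence *)

Section Extension.
Variables (R : realType) (n : nat).
Local Notation C := R[i].

Lemma min_gt0 (a b : R) : 0 < a -> 0 < b -> 0 < Num.min a b.
Proof. by move=> ? ?; rewrite lt_min; apply/andP. Qed.

Lemma hol_bound_mx m r (F : C -> 'M[C]_(m, n)) : 0 < r -> holmx r F ->
  exists M : R, 0 <= M /\ forall e, cm e <= r / 2 -> mbnd (F e) M.
Proof.
move=> r0 hF; have r2 : 0 <= r / 2 < r by apply/andP; split; lra.
have H (a : 'I_m * 'I_n) : exists M, 0 <= M /\ forall e, cm e <= r / 2 -> cm (F e a.1 a.2) <= M.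
  by have [M M0 hM] := hol_bound r2 (hF a.1 a.2); exists M.
have [M hM] := choice H.
exists (\sum_a M a); split; first by apply: sumr_ge0 => a _; have [] := hM a.
move=> e er i j; have [_ /(_ e er) /= h] := hM (i, j); apply: le_trans h _.
by rewrite (bigD1 (i, j)) //= lerDl sumr_ge0 // => a _; have [] := hM a.
Qed.

Lemma analytic_row (L : C -> 'rV[C]_n) : analytic_at L 0 -> exists2 r : R, 0 < r & holmx r L.
Proof.
move=> /nbhs_cmP [r r0 h]; exists r => // i j z zr.
exists ('D_(1 : C) L z i j); apply: derivable_mx_hasd; apply: diff_derivable.
by apply: h; rewrite subr0.
Qed.

Lemma germ2_entries (F : C -> C -> 'M[C]_n) : analytic_germ2 F ->
  exists r M : R, [/\ 0 < r, 0 <= M, (forall x, cm x < r -> holmx r (F^~ x)),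
    (forall e, cm e < r -> holmx r (F e)) & forall e x, cm e < r -> cm x < r -> mbnd (F e x) M].
Proof.
move=> H; have [r1 r10 h1] := (nbhs_pairP _ _).1 H.
have d0 : differentiable (fun p : C * C => F p.1 p.2) ((0, 0) : C * C).
  by apply: (h1 0 0); rewrite subrr cm0.
have [K K0 hK] := mbnd_ex (F 0 0).
have : nbhs ((0, 0) : C * C) [set p | mbnd (F p.1 p.2 - F 0 0) 1].
  have h : (fun p : C * C => F p.1 p.2) @ ((0, 0) : C * C) --> F 0 0 := differentiable_continuous d0.
  apply: (h [set N | mbnd (N - F 0 0) 1]); apply/nbhs_mxP; exists 1 => // N hN i j.
  by rewrite !mxE; apply: ltW; exact: hN.
move=> /nbhs_pairP [r2 r20 h2]; exists (Num.min r1 r2), (K + 1).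
have df e x : cm e < Num.min r1 r2 -> cm x < Num.min r1 r2 -> differentiable (fun p : C * C => F p.1 p.2) (e, x).
  by rewrite !lt_min => /andP[e1 _] /andP[x1 _]; apply: h1; rewrite subr0.
split; rewrite ?lt_min ?r10 ?addr_ge0 //.
- move=> x hx i j e he; have := differentiable_entry i j (df e x he hx).
  exact: (derivable_slice1 (f := fun e x => F e x i j)).
- move=> e he i j x hx; have := differentiable_entry i j (df e x he hx).
  exact: (derivable_slice2 (f := fun e x => F e x i j)).
- move=> e x; rewrite !lt_min => /andP[_ e2] /andP[_ x2].
  have := h2 e x; rewrite !subr0 => /(_ e2 x2) /= h i j.
  rewrite -(subrK (F 0 0 i j) (F e x i j)) addrC; apply: le_trans (cmD _ _) _.
  by apply: lerD; [exact: hK|have := h i j; rewrite !mxE].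
Qed.

Lemma gap_lower (L0 L1 : C -> 'rV[C]_n) (r : R) : prenormal_model L0 L1 -> 0 < r -> holmx r L0 ->
  exists2 g0 : R, 0 < g0 & forall e, cm e < g0 -> forall i j, i != j -> g0 <= cm (L0 e ord0 i - L0 e ord0 j).
Proof.
move=> [_ _ hg] r0 hL.
have [||g0 g00 h] := @fin_radius R ('I_n * 'I_n)%type (fun a g => a.1 != a.2 -> forall e, cm e < g ->
  g <= cm (L0 e ord0 a.1 - L0 e ord0 a.2)).
- by move=> a g g' /andP[g0 gg] h ne e eg; apply: (le_trans gg); apply: h => //; apply: lt_le_trans gg.
- move=> [i j] /=; have [eij|ne] := eqVneq i j; first by exists 1.
  have u0 : 0 < cm (L0 0 ord0 i - L0 0 ord0 j).
    have H (q p : 'I_n) : (q < p)%N -> L0 0 ord0 q - L0 0 ord0 p != 0.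
      move=> /hg; rewrite /gap0 /lam scale0r addr0; apply: contraTneq => ->.
      by rewrite /= ltxx.
    rewrite cm_gt0; case: (ltngtP i j) => [/H //|/H|/val_inj /eqP]; last by rewrite (negbTE ne).
    by rewrite -oppr_eq0 opprB.
  have [b hb] : exists b, hasd (fun e => L0 e ord0 i - L0 e ord0 j) 0 b.
    have [b1 h1] := hL ord0 i 0 ltac:(by rewrite cm0); have [b2 h2] := hL ord0 j 0 ltac:(by rewrite cm0).
    by exists (b1 - b2); apply: hasdB.
  have [d d0 hd] := hasd_cts hb (divr_gt0 u0 (ltr0Sn R 1)).
  exists (Num.min d (cm (L0 0 ord0 i - L0 0 ord0 j) / 2)); first by rewrite lt_min d0 divr_gt0.
  move=> _ e; rewrite lt_min => /andP[ed _]; have := hd e ed; rewrite add0r => h.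
  rewrite ge_min; apply/orP; right.
  have := cm_sub (L0 0 ord0 i - L0 0 ord0 j) (L0 e ord0 i - L0 e ord0 j).
  by move: h; rewrite cmBC; move: (cm (_ - _)) (cm (L0 e _ _ - _)) (cm _) => *; lra.
by exists g0 => // e eg i j ne; apply: (h (i, j)).
Qed.

Lemma prenormal_comm (L0 L1 : C -> 'rV[C]_n) (R1 R2 : C -> C -> 'M[C]_n) (e x : C) (P : 'M[C]_n) :
  prenormal L0 L1 R2 e x *m P - P *m prenormal L0 L1 R1 e x =
  adl (L0 e + x *: L1 e) P + (x ^+ 2 - e) *: (R2 e x *m P - P *m R1 e x).
Proof.
rewrite /prenormal /model_system /lam /adl mulmxDl mulmxDr -scalemxAl -scalemxAr scalerBr.
by rewrite opprD addrACA.
Qed.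

(* The Taylor coefficients in [x] of large index are linear functions of the first ones, holomorphic
   in eps. What remains is a finite linear system over the ring of germs in eps, with bounded solutions
   along a sequence tending to 0; [kernel_section] then provides a holomorphic solution. *)
Theorem extend_equivalence (L0 L1 : C -> 'rV[C]_n) (R1 R2 : C -> C -> 'M[C]_n) (r : R) (D0 : 'rV[C]_n) :
  prenormal_model L0 L1 -> analytic_germ2 R1 -> analytic_germ2 R2 -> 0 < r -> diag_mx D0 \in unitmx ->
  (forall d : R, 0 < d -> exists (e x0 : C) (P : C -> 'M[C]_n) (D : 'rV[C]_n),
     [/\ 0 < cm e, cm e < d, x0 ^+ 2 = e, holmx r P & [/\
        (exists2 d' : R, 0 < d' & forall x, cm x < d' ->
           (x ^+ 2 - e) *: dmx P x = prenormal L0 L1 R2 e x *m P x - P x *m prenormal L0 L1 R1 e x),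
        P x0 = diag_mx D & forall j, cm (D ord0 j - D0 ord0 j) <= d]]) ->
  analytically_equivalent (prenormal L0 L1 R1) (prenormal L0 L1 R2).
Proof.
move=> hL aR1 aR2 r0 uD0 H.
have [aL0 aL1 _] := hL.
have [ra ra0 oL0] := analytic_row aL0; have [rb rb0 oL1] := analytic_row aL1.
have [rc [Mc [rc0 Mc0 oc1 oc2 hMc]]] := germ2_entries aR1.
have [rd [Md [rd0 Md0 od1 od2 hMd]]] := germ2_entries aR2.
have [Ma [Ma0 hMa]] := hol_bound_mx ra0 oL0.
have [Mb [Mb0 hMb]] := hol_bound_mx rb0 oL1.
have [g0 g00 hg0] := gap_lower hL ra0 oL0.
pose r' := Num.min (Num.min (ra / 2) (rb / 2)) (Num.min (Num.min rc rd) g0).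
have r'0 : 0 < r' by rewrite !lt_min !divr_gt0 // rc0 rd0.
have [k1 [k2 [k3 [k4 k5]]]] : r' <= ra / 2 /\ r' <= rb / 2 /\ r' <= rc /\ r' <= rd /\ r' <= g0.
  by rewrite /r' !ge_min !lexx !orbT.
pose A := Ma + Mb + Mc + Md.
have A0 : 0 <= A by rewrite !addr_ge0.
pose s := Num.min (1 / 2) (Num.min (r' / 4) (r / 2)).
have s0 : 0 < s by rewrite !lt_min !divr_gt0.
have [s2 [sr' sr]] : s <= 1 / 2 /\ s <= r' / 4 /\ s <= r / 2 by rewrite /s !ge_min !lexx !orbT.
have s1 : s <= 1 by move: s2; clear; lra.
pose rho := Num.min r' (s ^+ 2 / 12).
have rho0 : 0 < rho by rewrite lt_min r'0 divr_gt0 // exprn_gt0.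
have rhos : rho <= s ^+ 2 / 12 by rewrite ge_min lexx orbT.
have rhor : rho <= r' by rewrite ge_min lexx.
pose T := 4 * (2 * A / s + 2 * A + 8 * n%:R * A * s).
have T0 : 0 <= T.
  have h1 : 0 <= 2 * A by exact: mulr_ge0.
  have h2 : 0 <= 8 * n%:R * A by apply: mulr_ge0 => //; exact: mulr_ge0.
  apply: mulr_ge0 => //; apply: addr_ge0; last by apply: mulr_ge0 => //; exact: ltW.
  by apply: addr_ge0 => //; rewrite divr_ge0 // ltW.
pose N := Num.bound T.
have hN : T <= N%:R by apply/ltW/archi_boundP.
have s2r : 0 < 2 * s < r' by apply/andP; split; [rewrite mulr_gt0|move: sr' r'0; clear; lra].
have s20 : 0 < 2 * s by case/andP: s2r.
(* Taken on the circle of radius [2 * s], these coefficients gain [2 ^- a] over the weight [s ^- a],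
   which makes the convolutions in [conS] summable. *)
pose r1 (a : nat) (e : C) := mcoef (R1 e) (2 * s) a.
pose r2 (a : nat) (e : C) := mcoef (R2 e) (2 * s) a.
have cr' e : cm e < rho -> cm e < r' by move=> h; apply: lt_le_trans rhor.
have hl0 e : cm e < rho -> mbnd (L0 e) A.
  move=> /cr' er; have e1 : cm e <= ra / 2 by apply: le_trans k1; exact: ltW.
  by apply: mbnd_le (hMa e e1); rewrite /A -!addrA lerDl !addr_ge0.
have hl1 e : cm e < rho -> mbnd (L1 e) A.
  move=> /cr' er; have e1 : cm e <= rb / 2 by apply: le_trans k2; exact: ltW.
  by apply: mbnd_le (hMb e e1); rewrite /A; move: Ma0 Mc0 Md0; clear; lra.
have c2s t : cm (ctr (2 * s) t) < r' by rewrite cm_ctr //; case/andP: s2r.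
have hr1 e : cm e < rho -> forall a, mbnd (r1 a e) (A / (2 * s) ^+ a).
  move=> /cr' er a i j; rewrite mxE; apply: (ccoef_le s20) => t _.
  have := hMc e (ctr (2 * s) t) (lt_le_trans er k3) (lt_le_trans (c2s t) k3) i j.
  by move=> h; apply: le_trans h _; rewrite /A; move: Ma0 Mb0 Md0; clear; lra.
have hr2 e : cm e < rho -> forall a, mbnd (r2 a e) (A / (2 * s) ^+ a).
  move=> /cr' er a i j; rewrite mxE; apply: (ccoef_le s20) => t _.
  have := hMd e (ctr (2 * s) t) (lt_le_trans er k4) (lt_le_trans (c2s t) k4) i j.
  by move=> h; apply: le_trans h _; rewrite /A; move: Ma0 Mb0 Mc0; clear; lra.
have ol0 : holmx rho L0.
  by move=> i j; apply: hol_le (oL0 i j); move: rhor k1 ra0; clear; lra.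
have ol1 : holmx rho L1.
  by move=> i j; apply: hol_le (oL1 i j); move: rhor k2 rb0; clear; lra.
have or1 a : holmx rho (r1 a).
  move=> i j; apply: (@hol_ext _ _ (fun e => tcoef (fun x => R1 e x i j) (2 * s) a)).
    by move=> e _; rewrite mxE.
  apply: (coef_hol (r := r') (M := Mc)) => //.
  - by move=> x xr; apply: hol_le (oc1 x (lt_le_trans xr k3) i j); apply: le_trans k3.
  - by move=> e er; apply: hol_le (oc2 e (lt_le_trans (cr' _ er) k3) i j).
  - by move=> e x er xr; apply: hMc; [apply: lt_le_trans (cr' _ er) k3|apply: lt_le_trans k3].
have or2 a : holmx rho (r2 a).
  move=> i j; apply: (@hol_ext _ _ (fun e => tcoef (fun x => R2 e x i j) (2 * s) a)).
    by move=> e _; rewrite mxE.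
  apply: (coef_hol (r := r') (M := Md)) => //.
  - by move=> x xr; apply: hol_le (od1 x (lt_le_trans xr k4) i j); apply: le_trans k4.
  - by move=> e er; apply: hol_le (od2 e (lt_le_trans (cr' _ er) k4) i j).
  - by move=> e x er xr; apply: hMd; [apply: lt_le_trans (cr' _ er) k4|apply: lt_le_trans k4].
have o1' e : cm e < rho -> holmx r' (R1 e).
  by move=> er i j; apply: hol_le k3 (oc2 e (lt_le_trans (cr' _ er) k3) i j).
have o2' e : cm e < rho -> holmx r' (R2 e).
  by move=> er i j; apply: hol_le k4 (od2 e (lt_le_trans (cr' _ er) k4) i j).
have x1 e : cm e < rho -> mexpands (R1 e) (r1^~ e).
  by move=> er; apply: (mcoef_expands s2r); exact: o1'.
have x2 e : cm e < rho -> mexpands (R2 e) (r2^~ e).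
  by move=> er; apply: (mcoef_expands s2r); exact: o2'.
have [eta eta0 heta] := unit_perturb uD0.
have s01 : 0 < s <= 1 by rewrite s0.
have [c c0 hc] := total_bound A0 s01 g00 hN.
have [K0 K00 hK0] := mbnd_ex (diag_mx D0).
(* For small [t], [total_bound] gives [b <= c * (K0 + 1) + b / 2], that is [b <= b0], independently
   of the sample. *)
pose b0 := 2 * c * (K0 + 1).
have b00 : 0 <= b0 by rewrite !mulr_ge0 // addr_ge0.
have eta20 : 0 < eta / 2 by rewrite divr_gt0.
have low : forall d, 0 < d -> exists e P, [/\ 0 < cm e, cm e < d, wbnd s P b0,
    (forall m, coefeq e (L0 e) (L1 e) (r1^~ e) (r2^~ e) P m = 0) & mbnd (P 0%N - diag_mx D0) (eta / 2)].
  move=> d d0.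
  (* Constraints on [t = |x0|]: [t <= 1] gives [|e| = t^2 <= t]; [t <= s / 2] puts [x0] where the
     Taylor series is controlled; the third absorbs the terms in [t * b]; the last makes
     [2 * b * t / s], the distance from [p 0] to the diagonal value at [x0], at most [eta / 4]. *)
  pose t0 := Num.min (Num.min 1 (s / 2)) (Num.min (1 / (2 * (c + 1) * (2 / s + 1))) (eta * s / (8 * (b0 + 1)))).
  have z1 : 0 < 2 * (c + 1) * (2 / s + 1).
    by rewrite mulr_gt0 ?ltr_wpDl ?divr_ge0 ?(ltW s0) // mulr_gt0 // ltr_wpDl.
  have z2 : 0 < 8 * (b0 + 1) by rewrite mulr_gt0 // ltr_wpDl.
  have t00 : 0 < t0.
    by rewrite !lt_min ltr01 !divr_gt0 // mulr_gt0.
  pose d' := Num.min (Num.min d rho) (Num.min (t0 ^+ 2) (Num.min 1 (eta / 4))).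
  have d'0 : 0 < d' by exact: (min_gt0 (min_gt0 d0 rho0) (min_gt0 (exprn_gt0 2 t00) (min_gt0 ltr01 (divr_gt0 eta0 (ltr0Sn R 3))))).
  have [e [x0 [P [D [e0 ed' xe oP [[d2 d20 hode] Px0 hD]]]]]] := H d' d'0.
  have [m1 [m2 [m3 [m4 m5]]]] : d' <= d /\ d' <= rho /\ d' <= t0 ^+ 2 /\ d' <= 1 /\ d' <= eta / 4.
    have G (x y u v z : R) (m := Num.min (Num.min x y) (Num.min u (Num.min v z))) :
      m <= x /\ m <= y /\ m <= u /\ m <= v /\ m <= z by rewrite /m !ge_min !lexx !orbT.
    exact: G.
  pose t := cm x0; have t_ge0 : 0 <= t := cm_ge0 x0.
  have te : cm e = t ^+ 2 by rewrite -xe cmX.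
  have tt0 : t <= t0.
    have : t ^+ 2 <= t0 ^+ 2 by rewrite -te; apply: le_trans m3; exact: ltW.
    by rewrite ler_pXn2r ?nnegrE // ltW.
  have [t1 [ts [tc tb]]] : t <= 1 /\ t <= s / 2 /\ t * (2 * (c + 1) * (2 / s + 1)) <= 1 /\ t * (8 * (b0 + 1)) <= eta * s.
    by move: tt0; rewrite !le_min => /andP[/andP[? ?] /andP[? ?]]; rewrite -ler_pdivlMr // -[_ * (8 * _) <= _]ler_pdivlMr.
  have er : cm e < rho by apply: lt_le_trans m2.
  have ssr : 0 < s < r by rewrite s0 /=; move: sr r0; clear; lra.
  pose p := mcoef P s.
  have hp m : coefeq e (L0 e) (L1 e) (r1^~ e) (r2^~ e) p m = 0.
    apply: (mcoef_solution ssr oP (x1 e er) (x2 e er)); exists d2 => // x xd.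
    by rewrite /defect hode // prenormal_comm subrr.
  have [B [B0 hB]] : exists B, 0 <= B /\ wbnd s p B.
    have [B [B0 hB]] := hol_bound_mx r0 oP; exists B; split=> // m i j; rewrite mxE.
    by apply: (ccoef_le s0) => y _; apply: hB; rewrite cm_ctr.
  have hgap i j : i != j -> g0 <= cm (L0 e ord0 i - L0 e ord0 j).
    by apply: hg0; apply: lt_le_trans k5; exact: cr'.
  have [b [bge hb bb]] := hc e (L0 e) (L1 e) (r1^~ e) (r2^~ e) p B (hl0 e er) (hl1 e er) (hr1 e er) (hr2 e er) hgap hp
     (le_trans (ltW er) rhos) B0 hB.
  have pD : mbnd (p 0%N - diag_mx D) (2 * b * t / s).
    move=> i j; rewrite -Px0 !mxE.
    rewrite (hol_psum ssr (oP i j) (z := x0)) //.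
    have ha k : cm (tcoef (fun x => P x i j) s k) <= b / s ^+ k by have := hb k i j; rewrite mxE.
    have zs : cm x0 < s by move: ts s0; rewrite -/t; clear; lra.
    have := psum_taylor 1 s0 ha zs; rewrite big_ord1 !expr1 expr0 mulr1 cmBC => h; apply: le_trans h _.
    have q0 : 0 <= cm x0 / s by rewrite divr_ge0 // ltW.
    have q2 : cm x0 / s <= 1 / 2 by rewrite ler_pdivrMr //; move: ts; rewrite -/t; clear; lra.
    have -> : 2 * b * t / s = 2 * (b * (cm x0 / s)) by rewrite /t; ring.
    have : 0 <= b * (cm x0 / s) by exact: mulr_ge0.
    move: (b * _) => u u0; rewrite ler_pdivrMr; last by move: q2; clear; lra.
    by move: (cm x0 / s) q0 q2 => q q0 q2; move: u0 q0 q2; clear; nra.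
  have DD : mbnd (diag_mx D - diag_mx D0) d'.
    move=> i j; rewrite !mxE; case: eqP => [->|_]; rewrite ?mulr0n ?subrr ?cm0 ?(ltW d'0) //.
    by rewrite !mulr1n.
  have bt0 : 0 <= 2 * b * t / s by rewrite divr_ge0 ?(ltW s0) // !mulr_ge0.
  have p0 : mbnd (p 0%N) (K0 + d' + 2 * b * t / s).
    have h : mbnd ((diag_mx D0 + (diag_mx D - diag_mx D0)) + (p 0%N - diag_mx D)) (K0 + d' + 2 * b * t / s).
      by apply: mbndD => //; apply: mbndD.
    by move: h; rewrite [diag_mx D0 + _]addrC subrK addrC subrK.
  have bb0 : b <= b0.
    have et : cm e <= t by rewrite te expr2 -[X in _ <= X]mul1r ler_wpM2r.
    have := bb (K0 + d' + 2 * b * t / s) t p0 _ et; rewrite !addr_ge0 ?(ltW d'0) // => /(_ isT) h.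
    have : c * (t * (2 / s + 1)) * b <= b / 2.
      have y0 : 0 <= t * (2 / s + 1) by rewrite mulr_ge0 // addr_ge0 // divr_ge0 // ltW.
      have y1 : t * (2 / s + 1) * (c + 1) <= 1 / 2.
        have E : t * (2 * (c + 1) * (2 / s + 1)) = 2 * (t * (2 / s + 1) * (c + 1)) by ring.
        by move: tc; rewrite E; clear; lra.
      rewrite [b / 2]mulrC; apply: ler_wpM2r => //.
      by move: (t * (2 / s + 1)) c0 y0 y1; clear; move=> y; nra.
    have E : c * (K0 + d' + 2 * b * t / s + t * b) = c * (K0 + d') + c * (t * (2 / s + 1)) * b.
      by field; rewrite gt_eqF.
    have : c * (K0 + d') <= c * (K0 + 1) by apply: ler_wpM2l => //; rewrite lerD2l.
    by move: h; rewrite E /b0; clear; lra.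
  exists e, p; split=> //.
  - exact: lt_le_trans m1.
  - move=> m; apply: mbnd_le (hb m); apply: ler_wpM2r => //.
    by rewrite invr_ge0 exprn_ge0 // ltW.
  - have h : mbnd ((p 0%N - diag_mx D) + (diag_mx D - diag_mx D0)) (2 * b * t / s + d') by apply: mbndD.
    move: h; rewrite addrA subrK; apply: mbnd_le.
    suff : 2 * b * t / s <= eta / 4 by move: m5; clear; lra.
    rewrite ler_pdivrMr //; have : b * t <= b0 * t by apply: ler_wpM2r.
    move: (s0) (t_ge0) (bt0) (eta0) tb; clear; rewrite mulrDr mulrDr; lra.
have [P1 [rho' [B [rho'0 B0 oP1 hP1 P10]]]] := germ_solution A0 s0 s1 rho0 rhos hN hl0 hl1 hr1 hr2 ol0 ol1 or1 or2 b00 eta20 low.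
(* Summing the series gives functions holomorphic in each variable and bounded, hence jointly
   analytic by [osgood]. *)
pose P e x : 'M[C]_n := \matrix_(i, j) psum (fun m => P1 m e i j) x.
pose w := Num.min (Num.min rho rho') (s / 2).
have w0 : 0 < w by exact: (min_gt0 (min_gt0 rho0 rho'0) (divr_gt0 s0 (ltr0Sn R 1))).
have [w1 [w2 w3]] : w <= rho /\ w <= rho' /\ w <= s / 2.
  have G (x y z : R) (m := Num.min (Num.min x y) z) : m <= x /\ m <= y /\ m <= z by rewrite /m !ge_min !lexx !orbT.
  exact: G.
have bP1 i j e : cm e < w -> forall k, cm (P1 k e i j) <= B / s ^+ k.
  by move=> ew k; have [h _] := hP1 e (lt_le_trans ew w2); exact: h.
have oP e : cm e < w -> holmx (s / 2) (P e).
  move=> ew i j; apply: (@hol_ext _ _ (psum (fun m => P1 m e i j))); first by move=> z _; rewrite mxE.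
  by apply: psum_hol s0 (bP1 i j e ew).
have dP e x : cm e < w / 2 -> cm x < w / 2 -> differentiable (fun p : C * C => P p.1 p.2) (e, x).
  move=> ew xw; apply: differentiable_mx => i j.
  have w2w : 0 < w / 2 < w by apply/andP; split; move: w0; clear; lra.
  have B20 : 0 <= 2 * B by rewrite mulr_ge0.
  have := osgood (f := fun e x => psum (fun m => P1 m e i j) x) w2w B20 _ _ _ ew xw.
  have -> : (fun q : C * C => P q.1 q.2 i j) = (fun q => psum (fun m => P1 m q.1 i j) q.2).
    by apply/funext => q; rewrite mxE.
  apply.
  - move=> z zw; apply: (psum_hol_param (a := fun m e => P1 m e i j) s0 B0).
    + by move=> m e' ew'; exact: bP1.
    + by move=> m; apply: hol_le w2 (oP1 m i j).
    + by apply: le_trans w3; exact: ltW.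
  - by move=> e' ew'; apply: hol_le w3 (psum_hol s0 (bP1 i j e' ew')).
  - move=> e' x' ew' xw'; apply: (psum_bound s0 (bP1 i j e' ew')).
    by apply: le_trans w3; exact: ltW.
have uP0 : P 0 0 \in unitmx.
  apply: heta => i j; have := P10 i j; rewrite !mxE psum0 => h; apply: le_trans h _.
  by rewrite -splitr.
exists P; split=> //.
- apply/nbhs_pairP; exists (w / 2); first by rewrite divr_gt0.
  by move=> e x /=; rewrite !subr0; exact: dP.
have [eta' eta'0 heta'] := unit_perturb uP0.
have : nbhs ((0, 0) : C * C) [set p | P p.1 p.2 \in unitmx].
  have w20 : cm (0 : C) < w / 2 by rewrite cm0 divr_gt0.
  have h : (fun p : C * C => P p.1 p.2) @ ((0, 0) : C * C) --> P 0 0 := differentiable_continuous (dP 0 0 w20 w20).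
  apply: (h [set M | M \in unitmx]); apply/nbhs_mxP; exists eta' => // M hM; apply: heta' => i j; rewrite !mxE.
  by have := hM i j; rewrite !mxE => /ltW.
move=> /nbhs_pairP [d d0 hu].
apply/nbhs_pairP; exists (Num.min d (w / 4)); first by rewrite lt_min d0 divr_gt0.
move=> e x /=; rewrite !subr0 !lt_min => /andP[ed ew] /andP[xd xw].
have uP : P e x \in unitmx by apply: (hu e x); rewrite subr0.
have ew2 : cm e < w / 2 by move: ew w0; clear; lra.
have xw2 : cm x < w / 2 by move: xw w0; clear; lra.
have ew1 : cm e < w by move: ew w0; clear; lra.
have er : cm e < rho by apply: lt_le_trans w1.
have DE : 'D_1 (P e) x = dmx (P e) x.
  symmetry; apply: dmxE => i j; apply: derivable_mx_hasd; apply: derivable_slice2_mx; exact: dP.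
have def0 : defect e (L0 e) (L1 e) (R1 e) (R2 e) (P e) (dmx (P e)) x = 0.
  have sw : 0 < s / 4 < s / 2 by apply/andP; split; move: s0; clear; lra.
  have srr : s / 2 <= r' by move: sr' r'0; clear; lra.
  apply: (series_solution sw (oP e ew1) _ _ (x1 e er) (x2 e er) (p := P1^~ e)).
  - by move=> i j; apply: hol_le srr (o1' e er i j).
  - by move=> i j; apply: hol_le srr (o2' e er i j).
  - move=> i j; apply: (expands_ext (f := psum (fun m => P1 m e i j))).
      by exists 1 => // z _; rewrite mxE.
    exact: psum_expands s0 (bP1 i j e ew1).
  - by have [_] := hP1 e (lt_le_trans ew1 w2).
  - by move: xw w3 s0; clear; lra.
rewrite /gauge DE.
have -> : (x ^+ 2 - e) *: dmx (P e) x = prenormal L0 L1 R2 e x *m P e x - P e x *m prenormal L0 L1 R1 e x.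
  by rewrite prenormal_comm; symmetry; apply/eqP; rewrite -subr_eq0 -[X in X == _]/(defect e (L0 e) (L1 e) (R1 e) (R2 e) (P e) (dmx (P e)) x) def0.
by rewrite subrK mulmxK.
Qed.

End Extension.

(** * The time variable *)

Section Logarithm.
Variable R : realType.
Local Notation C := R[i].

Lemma cexp_tpi (m : int) : cexp (m%:~R * tpi R) = 1.
Proof.
have H (n : nat) : cexp (n%:R * tpi R) = 1.
  by rewrite -cexpX -[cexp _]/(cexp (0 +i* (2 * pi))) -[2 * pi]mulr1 -[cexp _]/(circ 1) circ1 expr1n.
by case: m => n; rewrite ?NegzE ?intrN -pmulrn ?mulNr ?cexpN H ?invr1.
Qed.

(** Subtracting the multiple of [tpi] given by [floor] moves the imaginary part into [-pi, pi],
    where cosine takes the value 1 only at 0. *)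
Lemma cexp_eq1 (z : C) : cexp z = 1 -> exists m : int, z = m%:~R * tpi R.
Proof.
move=> h; have p0 : 0 < pi *+ 2 :> R by rewrite mulrn_wgt0 // pi_gt0.
pose m := Num.floor ((complex.Im z + pi) / (pi *+ 2)).
have [m1 m2] := (Num.Theory.floor_le_tmp ((complex.Im z + pi) / (pi *+ 2)), Num.Theory.floorD1_gt ((complex.Im z + pi) / (pi *+ 2))).
exists m; apply/eqP; rewrite -subr_eq0; apply/eqP.
pose y := z - m%:~R * tpi R.
have hy : cexp y = 1 by rewrite /y cexpD cexpN cexp_tpi h invr1 mulr1.
have Iy : complex.Im y = complex.Im z - m%:~R * (pi *+ 2).
  have -> : y = z - (m%:~R : R)%:C * tpi R by rewrite /y rmorph_int.
  by rewrite /tpi; case: (z) => a b /=; rewrite mul0r addr0 mulr_natl.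
have Iy1 : - pi <= complex.Im y <= pi.
  rewrite Iy; move: m1 m2; rewrite -/m ler_pdivlMr // ltr_pdivrMr // intrD mulrDl mul1r.
  by rewrite !mulr2n => ? ?; apply/andP; split; lra.
have Ry : complex.Re y = 0.
  by have := cm_cexp y; rewrite hy cm1 => /esym/eqP; rewrite -expR0 => /eqP /expR_inj.
have : cos (complex.Im y) = 1.
  by have := congr1 (@complex.Re R) hy; rewrite /cexp /= Ry expR0 mul1r.
move=> hc; have Iy0 : `|complex.Im y| = 0.
  apply: cos_inj; rewrite ?in_itv /= ?normr_ge0 ?pi_ge0 ?lexx //.
    by rewrite ler_norml.
  rewrite cos0 -hc; case: (ger0P (complex.Im y)) => // _; by rewrite cosN.
move: Ry Iy0; rewrite -/y; case: (y) => a b /= -> /eqP; rewrite normr_eq0 => /eqP ->.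
by [].
Qed.

Lemma clog (u : C) : u != 0 -> exists z : C, cexp z = u /\ - pi <= complex.Im z <= pi.
Proof.
move=> u0; have m0 : 0 < cm u by rewrite cm_gt0.
have E : cm u ^+ 2 = complex.Re u ^+ 2 + complex.Im u ^+ 2.
  by rewrite /cm; case: (u) => a b /=; rewrite sqr_sqrtr // addr_ge0 ?sqr_ge0.
pose c := complex.Re u / cm u; pose s := complex.Im u / cm u.
have cs : c ^+ 2 + s ^+ 2 = 1.
  by rewrite /c /s !expr_div_n -mulrDl -E divff // expf_neq0 // gt_eqF.
have c1 : -1 <= c <= 1.
  by rewrite -ler_norml -(@ler_pXn2r _ 2) ?nnegrE // expr1n real_normK ?num_real // -cs lerDl sqr_ge0.
have sE : sin (acos c) = `|s|.
  by rewrite sin_acos // -cs addrAC subrr add0r sqrtr_sqr.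
have H b : cos b = c -> sin b = s -> cexp (ln (cm u) +i* b) = u.
  move=> hc hs; rewrite /cexp /= hc hs lnK ?posrE // /c /s.
  by case: (u) m0 => x y m0 /=; rewrite mulrC divfK ?gt_eqF // mulrC divfK ?gt_eqF.
have a0 := acos_ge0 c1; have a1 := acos_lepi c1.
have hk : cos (acos c) = c by apply: acosK; rewrite in_itv.
case: (ger0P s) sE => hs sE.
  exists (ln (cm u) +i* acos c); rewrite H //=; split=> //; rewrite a1 andbT.
  by apply: le_trans a0; rewrite oppr_le0 pi_ge0.
exists (ln (cm u) +i* (- acos c)); rewrite H ?cosN ?sinN ?sE ?opprK //=; split=> //.
by rewrite lerNl opprK a1 /= (le_trans _ (pi_ge0 R)) // oppr_le0.
Qed.

Lemma clog_near (eta : R) : 0 < eta -> exists2 d : R, 0 < d &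
  forall u : C, cm (u - 1) < d -> exists2 z : C, cm z < eta & cexp z = u.
Proof.
move=> eta0; have e2 : 0 < eta / 2 by rewrite divr_gt0.
have [d1 d10 h1] : exists2 d : R, 0 < d & forall x : R, `|x - 1| < d -> `|ln x| < eta / 2.
  have /= := @continuous_ln R 1 ltr01 => /cvgrPdist_lt /(_ _ e2) /nbhs_ballP [d d0 hd].
  exists d => // x xd; have /= := hd x; rewrite /ball /= distrC => /(_ xd).
  by rewrite ln1 sub0r normrN.
have [d2 d20 h2] : exists2 d : R, 0 < d & forall x : R, `|x| < d -> `|asin x| < eta / 2.
  have /= := @continuous_asin R 0 => /(_ _) /cvgrPdist_lt.
  have z1 : (-1 < 0 :> R) && (0 < 1 :> R) by rewrite ltr01 andbT oppr_lt0 ltr01.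
  move=> /(_ z1 _ e2) /nbhs_ballP [d d0 hd].
  exists d => // x xd; have /= := hd x; rewrite /ball /= sub0r normrN => /(_ xd).
  rewrite -{1}sin0 sinK ?sub0r ?normrN // in_itv /= oppr_le0 divr_ge0 ?pi_ge0 //.
exists (Num.min (1 / 2) (Num.min d1 (d2 / 2))); first by rewrite !lt_min d10 !divr_gt0.
move=> u; rewrite !lt_min => /andP[u1 /andP[u2 u3]].
have m1 : `|cm u - 1| <= cm (u - 1).
  rewrite ler_norml; apply/andP; split; last by have := cm_sub u 1; rewrite cm1.
  by have := cm_sub 1 u; rewrite cm1 cmBC; lra.
have m2 : 1 / 2 < cm u by move: (le_lt_trans m1 u1); rewrite ltr_norml => /andP[]; lra.
have m0 : 0 < cm u by lra.
have r0 : 0 < complex.Re u.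
  have := le_lt_trans (Re_le_cm (u - 1)) u1; rewrite ltr_norml => /andP[].
  by case: (u) => a b /=; lra.
pose s := complex.Im u / cm u.
have E : cm u ^+ 2 = complex.Re u ^+ 2 + complex.Im u ^+ 2.
  by rewrite /cm; case: (u) => a b /=; rewrite sqr_sqrtr // addr_ge0 ?sqr_ge0.
have s2 : `|s| <= 2 * cm (u - 1).
  rewrite /s normrM normfV (ger0_norm (ltW m0)) ler_pdivrMr //.
  have i1 : `|complex.Im u| <= cm (u - 1).
    by have := Im_le_cm (u - 1); case: (u) => a b /=; rewrite subr0.
  have := cm_ge0 (u - 1); move: m2 i1; nra.
have s1 : -1 <= s <= 1 by rewrite -ler_norml; move: s2 u1; lra.
exists (ln (cm u) +i* asin s).
  apply: le_lt_trans (cm_le_ReIm _) _; rewrite /= [eta]splitr; apply: ltrD; first by apply: h1; apply: le_lt_trans u2.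
  by apply: h2; apply: le_lt_trans s2 _; move: u3; lra.
rewrite /cexp /= lnK ?posrE // cos_asin // asinK ?in_itv //.
have -> : Num.sqrt (1 - s ^+ 2) = complex.Re u / cm u.
  have -> : 1 - s ^+ 2 = (complex.Re u / cm u) ^+ 2.
    rewrite /s !expr_div_n -[1](@divff _ (cm u ^+ 2)) ?expf_neq0 ?gt_eqF // -mulrBl E.
    by rewrite addrK.
  by rewrite sqrtr_sqr ger0_norm // divr_ge0 // ltW.
rewrite /s; case: (u) m0 => a b m0 /=.
by rewrite [_ * (a / _)]mulrC [_ * (b / _)]mulrC !divfK ?gt_eqF.
Qed.

End Logarithm.

(** * The map from t to x and its fibres *)

Section TimeMap.
Variables (R : realType) (w : R[i]).
Local Notation C := R[i].

Let q : C := sqrt_eps w.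

(** [xt] is a Moebius function of this exponential: poles lie where it is 1, and its limits 0 and
    infinity correspond to x_L and x_R. *)
Definition ee (t : C) : C := cexp (2 * q * t).

Lemma sqrt_eps_neq0 : q != 0.
Proof. exact: cexp_neq0. Qed.

Lemma sqrt_epsX : q ^+ 2 = eps w.
Proof. by rewrite cexpX /eps mulrC divfK // pnatr_eq0. Qed.

Lemma cm_eps : cm (eps w) = abs_eps w.
Proof. exact: cm_cexp. Qed.

Lemma cm_sqrt_epsX : cm q ^+ 2 = abs_eps w.
Proof. by rewrite -cmX sqrt_epsX cm_eps. Qed.

Lemma cm_sqrt_eps_gt0 : 0 < cm q.
Proof. by rewrite cm_gt0 sqrt_eps_neq0. Qed.

Lemma sqrt_abs_eps : Num.sqrt (abs_eps w) = cm q.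
Proof. by rewrite -cm_sqrt_epsX sqrtr_sqr ger0_norm // cm_ge0. Qed.

Lemma ee_sqr t : ee t = cexp (q * t) ^+ 2.
Proof. by rewrite cexpX /ee mulrA. Qed.

Lemma ee_neq0 t : ee t != 0.
Proof. exact: cexp_neq0. Qed.

Lemma csinh_eq0 t : (csinh (q * t) == 0) = (ee t == 1).
Proof.
rewrite /csinh mulf_eq0 invr_eq0 pnatr_eq0 orbF subr_eq0 cexpN ee_sqr.
have u0 := cexp_neq0 (q * t); set u := cexp _ in u0 *.
apply/eqP/eqP => [h|h]; first by rewrite expr2 {2}h divff.
by apply: (mulfI u0); rewrite divff // -expr2.
Qed.

Lemma xtE t : ee t != 1 -> xt w t = - q * ((ee t + 1) / (ee t - 1)).
Proof.
rewrite -csinh_eq0 /csinh mulf_eq0 invr_eq0 pnatr_eq0 orbF.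
rewrite /xt -/q /ccosh /csinh cexpN ee_sqr; have u0 := cexp_neq0 (q * t); set u := cexp _ in u0 *.
move=> d0; congr (_ * _).
have d1 : u ^+ 2 - 1 != 0.
  apply: contraNneq d0 => d1; apply/eqP; apply: (mulfI u0).
  by rewrite mulr0 mulrBr divff // -expr2.
by field; rewrite u0 d1.
Qed.

Lemma xt_subq t : ee t != 1 -> xt w t - q = - 2 * q * ee t / (ee t - 1).
Proof. by move=> h; rewrite xtE //; field; rewrite subr_eq0. Qed.

Lemma xt_addq t : ee t != 1 -> xt w t + q = - 2 * q / (ee t - 1).
Proof. by move=> h; rewrite xtE //; field; rewrite subr_eq0. Qed.

Lemma xt_neq t : ee t != 1 -> xt w t != q /\ xt w t != - q.
Proof.
move=> h; have h1 : ee t - 1 != 0 by rewrite subr_eq0.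
have h2 : (-2 : C) * q != 0 by rewrite mulf_neq0 ?sqrt_eps_neq0 // oppr_eq0 pnatr_eq0.
split; first by rewrite -subr_eq0 (xt_subq h) mulf_neq0 ?invr_eq0 // mulf_neq0 // ee_neq0.
by rewrite -subr_eq0 opprK (xt_addq h) mulf_neq0 // invr_eq0.
Qed.

Lemma xt_sqr t : ee t != 1 -> xt w t ^+ 2 - eps w != 0.
Proof.
move=> h; have [h1 h2] := xt_neq h.
by rewrite -sqrt_epsX subr_sqr mulf_neq0 // ?subr_eq0 // addr_eq0.
Qed.

Lemma ee_hasd t : hasd ee t (2 * q * ee t).
Proof.
rewrite [2 * q * _]mulrC; apply: (hasd_comp (f := @cexp R) (g := fun t => 2 * q * t)).
  by apply: hasd_eq (hasdZ (2 * q) (hasd_id t)) _; rewrite mulr1.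
exact: hasd_cexp.
Qed.

Lemma ee_near t : ee t != 1 -> exists2 d : R, 0 < d & forall t', cm (t' - t) < d -> ee t' != 1.
Proof.
move=> h; have c0 : 0 < cm (ee t - 1) by rewrite cm_gt0 subr_eq0.
have [d d0 hd] := hasd_cts (ee_hasd t) c0; exists d => // t' td.
have := hd (t' - t) td; rewrite addrCA subrr addr0 => h'.
by apply: contraTneq h' => ->; rewrite cmBC ltxx.
Qed.

Lemma xt_hasd t : ee t != 1 -> hasd (xt w) t (xt w t ^+ 2 - eps w).
Proof.
move=> h; have [d d0 hd] := ee_near h.
apply: (hasd_near (f := fun t => - q * ((ee t + 1) * (ee t - 1)^-1))).
  by exists d => // t' td; rewrite xtE // hd.
have h1 : ee t - 1 != 0 by rewrite subr_eq0.
have hp : hasd (fun t => ee t + 1) t (2 * q * ee t + 0) by apply: hasdD (ee_hasd t) (hasd_cst _ _).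
have hm : hasd (fun t => ee t - 1) t (2 * q * ee t - 0) by apply: hasdB (ee_hasd t) (hasd_cst _ _).
apply: (hasd_eq (hasdZ (- q) (hasdM hp (@hasdV _ (fun t => ee t - 1) _ _ h1 hm)))).
by rewrite xtE // -sqrt_epsX; move: (ee t) h1 => u h1; field.
Qed.

Lemma xt_solve x t : x != q -> x != - q -> ee t = (x - q) / (x + q) -> ee t != 1 /\ xt w t = x.
Proof.
move=> x1 x2 h; have h2 : x + q != 0 by rewrite addr_eq0.
have e1 : ee t != 1.
  rewrite h; apply/eqP => /(congr1 (fun z => z * (x + q))); rewrite divfK // mul1r => /eqP.
  by rewrite -subr_eq0 opprD addrACA subrr add0r -opprD oppr_eq0 -mulr2n mulrn_eq0 (negbTE sqrt_eps_neq0).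
split=> //; rewrite xtE // h.
have : (x - q) / (x + q) - 1 != 0 by rewrite -h subr_eq0.
move: sqrt_eps_neq0 => q0 h3; field; rewrite h2 /=.
have -> : x - q + -1 * (x + q) = ((x - q) / (x + q) - 1) * (x + q) by field.
by rewrite mulf_neq0.
Qed.

Lemma ee_xt t : ee t != 1 -> ee t = (xt w t - q) / (xt w t + q).
Proof.
move=> h; rewrite xt_subq // xt_addq //; field; rewrite subr_eq0 h.
by rewrite sqrt_eps_neq0.
Qed.

Lemma period_q : 2 * q * period w = - tpi R.
Proof.
have -> : 2 * q * period w = - (2 * (0 +i* pi)) by rewrite /period -/q; field; exact: sqrt_eps_neq0.
rewrite /tpi; congr (- _); apply/eqP; rewrite eq_complex /=; apply/andP; split; apply/eqP => /=; ring.
Qed.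

Lemma xt_inj t1 t2 : ee t1 != 1 -> ee t2 != 1 -> xt w t1 = xt w t2 -> exists m : int, t2 = t1 + m%:~R * period w.
Proof.
move=> h1 h2 E; have : ee t1 = ee t2 by rewrite (ee_xt h1) E -ee_xt.
rewrite /ee => E2; have : cexp (2 * q * (t1 - t2)) = 1.
  by rewrite mulrBr cexpD cexpN E2 divff // cexp_neq0.
move=> /cexp_eq1 [m hm]; exists m.
have q0 : 2 * q != 0 by rewrite mulf_neq0 ?pnatr_eq0 // sqrt_eps_neq0.
apply: (mulfI q0); rewrite mulrDr mulrCA period_q mulrN -hm; ring.
Qed.

Lemma ee_period t (m : int) : ee (t + m%:~R * period w) = ee t.
Proof. by rewrite /ee mulrDr mulrCA period_q mulrN cexpD cexpN cexp_tpi invr1 mulr1. Qed.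

Lemma xt_period t (m : int) : ee t != 1 -> xt w (t + m%:~R * period w) = xt w t.
Proof. by move=> h; rewrite !xtE ?ee_period. Qed.

(** The quotient of [(x - q) / (x + q)] by its value at [xt w t] is near 1; its small logarithm
    divided by [2 * q] is the displacement in time. *)
Lemma xt_open t (eta : R) : ee t != 1 -> 0 < eta -> exists2 d : R, 0 < d &
  forall x, cm (x - xt w t) < d -> exists2 t', cm (t' - t) < eta & ee t' != 1 /\ xt w t' = x.
Proof.
move=> h eta0; have q0 := sqrt_eps_neq0; have [n1 n2] := xt_neq h.
have c0 : 0 < cm (2 * q) by rewrite cm_gt0 mulf_neq0 // pnatr_eq0.
have [d1 d10 hl] := clog_near (mulr_gt0 c0 eta0).
have [y1 y2] : xt w t - q != 0 /\ xt w t + q != 0 by rewrite subr_eq0 addr_eq0.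
have yq : (xt w t - q) / (xt w t + q) != 0 by rewrite mulf_neq0 // invr_eq0.
pose F := fun x : C => (x - q) / (x + q) * ((xt w t - q) / (xt w t + q))^-1.
have [b hb] : exists b, hasd F (xt w t) b.
  have hp : hasd (fun x => x + q) (xt w t) (1 + 0) by apply: hasdD (hasd_id _) (hasd_cst _ _).
  have hm : hasd (fun x => x - q) (xt w t) (1 - 0) by apply: hasdB (hasd_id _) (hasd_cst _ _).
  by eexists; apply: (hasdM (hasdM hm (@hasdV _ (fun x => x + q) _ _ y2 hp)) (hasd_cst _ _)).
have [d2 d20 h2] := hasd_cts hb d10.
have c1 : 0 < cm (xt w t - q) by rewrite cm_gt0.
have c2 : 0 < cm (xt w t + q) by rewrite cm_gt0.
exists (Num.min d2 (Num.min (cm (xt w t - q)) (cm (xt w t + q)))); first by rewrite !lt_min d20 c1 c2.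
move=> x; rewrite !lt_min => /andP[x1 /andP[x2 x3]].
have := h2 (x - xt w t) x1; rewrite addrCA subrr addr0 {2}/F divff // => /hl [z zs hz].
have q2 : 2 * q != 0 by rewrite -cm_gt0.
exists (t + z / (2 * q)).
  by rewrite addrAC subrr add0r cmM cmV ltr_pdivrMr // mulrC.
apply: xt_solve.
- by apply: contraTneq x2 => ->; rewrite cmBC ltxx.
- by apply: contraTneq x3 => ->; rewrite -opprD cmN addrC ltxx.
- rewrite /ee mulrDr cexpD -/(ee t) [2 * q * (z / _)]mulrC divfK // hz /F (ee_xt h).
  by rewrite mulrCA divff // mulr1.
Qed.

Lemma not_hole (G : geometry R) t : ee t != 1 -> cm (xt w t) < Defs.rad G -> ~ hole G w t.
Proof.
move=> h x0 /connected_component_sub /= [/eqP|]; first by rewrite csinh_eq0 (negbTE h).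
by rewrite normE lecR leNgt x0.
Qed.

End TimeMap.

(** * Derivatives and inverses of matrix functions *)

Section MatrixDerivatives.
Variable R : realType.
Local Notation C := R[i].

Definition mder m n (F : C -> 'M[C]_(m, n)) (x : C) := forall i j, exists b, hasd (fun z => F z i j) x b.

Lemma mderM m n p (F : C -> 'M[C]_(m, n)) (G : C -> 'M[C]_(n, p)) x :
  mder F x -> mder G x -> mder (fun z => F z *m G z) x.
Proof.
move=> hF hG i j.
have [b hb] := choice (fun k => hF i k); have [c hc] := choice (fun k => hG k j).
exists (\sum_k (b k * G x k j + F x i k * c k)).
apply: (hasd_near (f := fun z => \sum_k F z i k * G z k j)).
  by exists 1 => // z _; rewrite mxE.
by apply: hasd_sum => k _; apply: hasdM.
Qed.

Lemma mderD m n (F G : C -> 'M[C]_(m, n)) x : mder F x -> mder G x -> mder (fun z => F z + G z) x.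
Proof.
move=> hF hG i j; have [b hb] := hF i j; have [c hc] := hG i j; exists (b + c).
apply: (hasd_near (f := fun z => F z i j + G z i j)); last exact: hasdD.
by exists 1 => // z _; rewrite mxE.
Qed.

Lemma mder_cst m n (M : 'M[C]_(m, n)) x : mder (fun=> M) x.
Proof. by move=> i j; exists 0; apply: hasd_cst. Qed.

Lemma mder_near m n (F G : C -> 'M[C]_(m, n)) x :
  (exists2 d : R, 0 < d & forall z, cm (z - x) < d -> F z = G z) -> mder F x -> mder G x.
Proof.
move=> [d d0 h] hF i j; have [b hb] := hF i j; exists b.
by apply: hasd_near hb; exists d => // z zd; rewrite h.
Qed.

Lemma mderN m n (F : C -> 'M[C]_(m, n)) x : mder F x -> mder (fun z => - F z) x.
Proof.
move=> hF i j; have [b hb] := hF i j; exists (- b).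
apply: (hasd_near (f := fun z => - F z i j)); last exact: hasdN.
by exists 1 => // z _; rewrite mxE.
Qed.

Lemma mder_comp m n (F : C -> 'M[C]_(m, n)) (f : C -> C) t b : hasd f t b -> mder F (f t) -> mder (fun z => F (f z)) t.
Proof. by move=> hf hF i j; have [c hc] := hF i j; exists (c * b); apply: (hasd_comp (f := fun z => F z i j)). Qed.

Lemma ex_hasd_prod (I : Type) (s : seq I) (F : I -> C -> C) x :
  (forall i, exists b, hasd (F i) x b) -> exists b, hasd (fun z => \prod_(i <- s) F i z) x b.
Proof.
move=> h; elim: s => [|i s [c hc]].
  by exists 0; apply: (hasd_near (f := fun=> 1)); [exists 1 => // z _; rewrite big_nil|exact: hasd_cst].
have [b hb] := h i; exists (b * \prod_(i <- s) F i x + F i x * c).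
by apply: (hasd_near (f := fun z => F i z * \prod_(i <- s) F i z)); [exists 1 => // z _; rewrite big_cons|exact: hasdM].
Qed.

Lemma ex_hasd_det n (F : C -> 'M[C]_n) x : mder F x -> exists b, hasd (fun z => \det (F z)) x b.
Proof.
move=> hF; have H (s : 'S_n) : exists b, hasd (fun z => \prod_i F z i (s i)) x b.
  by apply: (ex_hasd_prod _ (F := fun i z => F z i (s i))) => i; exact: hF.
have [b hb] := choice H; exists (\sum_(s : 'S_n) (-1) ^+ s * b s).
by apply: hasd_sum => s _; apply: hasdZ.
Qed.

Lemma mder_inv n (F : C -> 'M[C]_n) x : mder F x -> F x \in unitmx -> mder (fun z => invmx (F z)) x.
Proof.
move=> hF u; have [d hd] := ex_hasd_det hF.
have d0 : \det (F x) != 0 by move: u; rewrite unitmxE unitfE.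
have [r r0 hr] : exists2 r : R, 0 < r & forall z, cm (z - x) < r -> F z \in unitmx.
  have c0 : 0 < cm (\det (F x)) by rewrite cm_gt0.
  have ct : cts (fun z => \det (F z)) x by apply: hasd_cts hd.
  have [r r0 h] := ct _ c0; exists r; first exact: r0.
  move=> z zr.
  rewrite unitmxE unitfE; have := h (z - x) zr; rewrite addrCA subrr addr0.
  by apply: contraTneq => ->; rewrite sub0r cmN ltxx.
apply: (mder_near (F := fun z => (\det (F z))^-1 *: \adj (F z))).
  by exists r => // z /hr uz; rewrite /invmx uz.
move=> i j; have hm : mder (fun z => row' j (col' i (F z))) x.
  move=> i' j'; have [b hb] := hF (lift j i') (lift i j'); exists b.
  by apply: hasd_near hb; exists 1 => // z _; rewrite !mxE.
have [b hb] := ex_hasd_det hm.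
eexists; apply: (hasd_near (f := fun z => (\det (F z))^-1 * ((-1) ^+ (j + i) * \det (row' j (col' i (F z)))))).
  by exists 1 => // z _; rewrite mxE; congr (_ * _); rewrite mxE.
by apply: hasdM; [apply: hasdV hd|apply: hasdZ hb].
Qed.

(** An arbitrary bound on [invmx M] is improved to [2 * K + B / 2^k] by iterating the identity [E];
    with the resulting uniform bound, [E] gives the Lipschitz estimate. *)
Lemma inv_perturb n (N : 'M[C]_n) : N \in unitmx -> exists eta K : R,
  [/\ 0 < eta, 0 <= K & forall M d, d <= eta -> mbnd (M - N) d ->
    [/\ M \in unitmx, mbnd (invmx M) K & mbnd (invmx M - invmx N) (K * d)]].
Proof.
move=> uN; have [eta eta0 heta] := unit_perturb uN; have [K K0 hK] := mbnd_ex (invmx N).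
have c0 : 0 < 2 * (n%:R * n%:R * K) + 1 by rewrite ltr_wpDl // !mulr_ge0.
pose K1 := 2 * K + 1; pose K2 := n%:R * n%:R * K1 * K.
have K10 : 0 <= K1 by rewrite addr_ge0 // mulr_ge0.
have K20 : 0 <= K2 by rewrite mulr_ge0 // mulr_ge0 // mulr_ge0.
exists (Num.min eta (2 * (n%:R * n%:R * K) + 1)^-1), (K1 + K2); split.
- by rewrite lt_min eta0 invr_gt0.
- exact: addr_ge0.
move=> M d; rewrite le_min => /andP[d1 d2] hM.
have uM : M \in unitmx by apply: heta; apply: mbnd_le hM.
have E : invmx M - invmx N = - (invmx M *m (M - N) *m invmx N).
  by rewrite mulmxBr mulVmx // mulmxBl mul1mx -mulmxA mulmxV // mulmx1 opprB.
have step B : mbnd (invmx M) B -> mbnd (invmx M - invmx N) (n%:R * n%:R * B * K * d).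
  move=> hB; rewrite E; apply: mbndN; apply: mbnd_le (mbndM (mbndM hB hM) hK).
  by rewrite le_eqVlt; apply/orP; left; apply/eqP; ring.
have [B B0 hB] := mbnd_ex (invmx M).
have bK : mbnd (invmx M) K1.
  have it k : mbnd (invmx M) (2 * K + B / 2 ^+ k).
    elim: k => [|k IH]; first by apply: mbnd_le hB; rewrite expr0 divr1 lerDr mulr_ge0.
    have h := mbndD (step _ IH) hK; rewrite subrK in h; apply: mbnd_le h.
    set b := 2 * K + B / 2 ^+ k in IH *.
    have b0 : 0 <= b by rewrite addr_ge0 ?mulr_ge0 // invr_ge0 exprn_ge0.
    have nK : 0 <= n%:R * n%:R * K by rewrite !mulr_ge0.
    have : n%:R * n%:R * K * d <= 1 / 2.
      apply: (@le_trans _ _ (n%:R * n%:R * K * (2 * (n%:R * n%:R * K) + 1)^-1)); first exact: ler_wpM2l.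
      by rewrite ler_pdivrMr //; move: nK; clear; lra.
    have -> : B / 2 ^+ k.+1 = (b - 2 * K) / 2 by rewrite /b exprS invfM; ring.
    have -> : n%:R * n%:R * b * K * d = (n%:R * n%:R * K * d) * b by ring.
    by move: (_ * d) b0; clear; move=> u b0; nra.
  have [k hk] := half_pow_small B (@ltr01 R).
  by apply: mbnd_le (it k); rewrite lerD2l.
split=> //; first by apply: mbnd_le bK; rewrite lerDl.
move=> i j; have dd : 0 <= d by apply: le_trans (hM i j); exact: cm_ge0.
apply: le_trans (step _ bK i j) _; rewrite mulrDl -[X in X <= _]add0r; apply: lerD; first exact: mulr_ge0.
by rewrite le_eqVlt; apply/orP; left; apply/eqP; rewrite /K2; ring.
Qed.

Lemma sandwich_perturb n (N1 N2 K : 'M[C]_n) (e : R) : N1 \in unitmx -> 0 < e -> exists2 d : R, 0 < d &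
  forall M1 M2, mbnd (M1 - N1) d -> mbnd (M2 - N2) d -> mbnd (M2 *m K *m invmx M1 - N2 *m K *m invmx N1) e.
Proof.
move=> u e0; have [eta [A [eta0 A0 h]]] := inv_perturb u.
have [B1 B10 b1] := mbnd_ex (N2 *m K); have [B2 B20 b2] := mbnd_ex K.
pose c := n%:R * n%:R * B2 * A + n%:R * B1 * A.
have c0 : 0 <= c by rewrite addr_ge0 // !mulr_ge0.
exists (Num.min eta (e / (c + 1))); first by rewrite lt_min eta0 divr_gt0 // ltr_wpDl.
set d := Num.min _ _ => M1 M2 h1 h2.
have d0 : 0 <= d by rewrite le_min !ltW // divr_gt0 // ltr_wpDl.
have de : d <= eta by rewrite ge_min lexx.
have dc : d * (c + 1) <= e by rewrite -ler_pdivlMr ?ltr_wpDl // ge_min lexx orbT.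
have [u1 bi bd] := h M1 d de h1.
have -> : M2 *m K *m invmx M1 - N2 *m K *m invmx N1 =
  (M2 - N2) *m K *m invmx M1 + N2 *m K *m (invmx M1 - invmx N1).
  by rewrite mulmxBl mulmxBl mulmxBr addrA subrK.
apply: mbnd_le (mbndD (mbndM (mbndM h2 b2) bi) (mbndM b1 bd)).
have -> : n%:R * (n%:R * (d * B2) * A) + n%:R * (B1 * (A * d)) = d * c by rewrite /c; ring.
by move: dc d0; clear; nra.
Qed.

End MatrixDerivatives.

Section LogDerivative.
Variable R : realType.
Local Notation C := R[i].

(** Continuity makes the increment [k] of [l] small, so [cexp (2 * k) - 1] determines [2 * k] up to
    a quadratic error; without it, [l] could jump by multiples of pi i. *)
Lemma log_hasd (l g : C -> C) (t b : C) : cts l t ->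
  (exists2 d : R, 0 < d & forall t', cm (t' - t) < d -> cexp (2 * l t') = g t') ->
  hasd g t b -> hasd l t (b / (2 * g t)).
Proof.
move=> cl [d1 d10 hl] hg e e0.
have gE : cexp (2 * l t) = g t by apply: hl; rewrite subrr cm0.
have g0 : g t != 0 by rewrite -gE cexp_neq0.
have cg : 0 < cm (g t) by rewrite cm_gt0.
(* For [|k| < 1/48] the error [48 |k|^2] in [2 k = rho + error] is at most [|k|], which gives
   [|k| <= |rho|]. *)
have [d2 d20 h2] := cl (1 / 48) ltac:(by rewrite divr_gt0).
have [d3 d30 h3] := hg (e * cm (g t)) ltac:(by rewrite mulr_gt0).
have [d4 d40 h4] := hasd_lip hg.
set L := (1 + cm b) in h4; have L0 : 0 < L by rewrite ltr_wpDr // cm_ge0.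
pose c := 24 * (L / cm (g t)) ^+ 2; have c0 : 0 <= c by rewrite mulr_ge0 // sqr_ge0.
exists (Num.min (Num.min d1 d2) (Num.min (Num.min d3 d4) (e / (2 * (c + 1))))).
  by rewrite !lt_min d10 d20 d30 d40 divr_gt0 // mulr_gt0 // ltr_wpDl.
move=> h; rewrite !lt_min => /andP[/andP[k1 k2] /andP[/andP[k3 k4] k5]].
have {h2} := h2 h k2; set k := l (t + h) - l t => kk.
have {h3} := h3 h k3; have {h4} := h4 h k4.
set rho := (g (t + h) - g t) / g t.
have hE : cexp (2 * k) - 1 = rho.
  rewrite /k mulrBr cexpD cexpN gE hl; last by rewrite addrAC subrr add0r.
  by rewrite /rho mulrBl divff.
clearbody k.
move=> q1 q2.
have r1 : cm rho <= L / cm (g t) * cm h.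
  by rewrite /rho cmM cmV mulrAC ler_wpM2r // invr_ge0 cm_ge0.
have k0 := cm_ge0 k.
have c2k : cm (2 * k) = 2 * cm k by rewrite cmM cm_nat.
have q3 : cm (2 * k - rho) <= 48 * cm k ^+ 2.
  have := @cexp_sub_le R (2 * k); rewrite hE c2k -cmBC exprMn => H.
  apply: le_trans (H _) _; first by move: kk; clear; lra.
  by move: (cm k ^+ 2); clear; move=> u; lra.
have q4 : cm k <= cm rho.
  have := cm_sub (2 * k) rho; rewrite c2k; move: q3 kk k0; clear; rewrite expr2; nra.
have q5 : cm (k - rho / 2) <= 24 * cm rho ^+ 2.
  have -> : k - rho / 2 = (2 * k - rho) / 2 by field.
  rewrite cmM cmV cm_nat ler_pdivrMr //; apply: le_trans q3 _.
  have : cm k ^+ 2 <= cm rho ^+ 2 by rewrite ler_pXn2r ?nnegrE ?cm_ge0.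
  by move: (cm k ^+ 2) (cm rho ^+ 2); clear; move=> u v; lra.
have -> : k - b / (2 * g t) * h = (k - rho / 2) + (g (t + h) - g t - b * h) / (2 * g t).
  by rewrite /rho; field.
apply: le_trans (cmD _ _) _.
have q6 : cm ((g (t + h) - g t - b * h) / (2 * g t)) <= e / 2 * cm h.
  rewrite cmM cmV cmM cm_nat ler_pdivrMr ?mulr_gt0 //.
  have -> : e / 2 * cm h * (2 * cm (g t)) = e * cm (g t) * cm h by field.
  exact: q2.
have q7 : 24 * cm rho ^+ 2 <= e / 2 * cm h.
  apply: (@le_trans _ _ (c * cm h ^+ 2)).
    rewrite /c -mulrA -exprMn ler_wpM2l // ler_pXn2r ?nnegrE ?cm_ge0 //.
    by rewrite mulr_ge0 ?cm_ge0 // divr_ge0 ?cm_ge0 // ltW.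
  rewrite expr2 mulrA ler_wpM2r ?cm_ge0 //.
  have h0 : cm h * (2 * (c + 1)) <= e by rewrite -ler_pdivlMr ?mulr_gt0 ?ltr_wpDl // ltW.
  by have := cm_ge0 h; move: h0 c0; clear; nra.
have -> : e * cm h = e / 2 * cm h + e / 2 * cm h by field.
by apply: lerD => //; apply: le_trans q5 _.
Qed.

End LogDerivative.

(** * Collections in the time variable *)

Section TimeDomains.
Variables (R : realType) (G : geometry R).
Local Notation C := R[i].
Hypothesis c00 : 0 <= Defs.c0 G.

(** Soft thresholding: [sigma] without its slope. Being 1-Lipschitz, it makes the strict
    inequalities of [Gamma] open conditions. *)
Definition soft (b u : R) : R := if `|u| <= b then 0 else u - Num.sg u * b.

Lemma soft_cases (b u : R) : 0 <= b ->
  [\/ [/\ - b <= u, u <= b & soft b u = 0], b < u /\ soft b u = u - b | u < - b /\ soft b u = u + b].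
Proof.
move=> b0; rewrite /soft ler_norml; case: ifP => [/andP[h1 h2]|/negbT].
  by apply: Or31.
rewrite negb_and -!ltNge => /orP[h|h].
  apply: Or33; split=> //; have u0 : u < 0 by apply: lt_le_trans h _; rewrite oppr_le0.
  by rewrite ltr0_sg // mulN1r opprK.
by apply: Or32; split=> //; rewrite gtr0_sg ?mul1r //; apply: le_lt_trans h.
Qed.

Lemma soft_lip (b u v : R) : 0 <= b -> `|soft b u - soft b v| <= `|u - v|.
Proof.
move=> b0; have h : forall x y : R, (x <= y -> `|x - y| = y - x) /\ (y <= x -> `|x - y| = x - y).
  move=> x y; split=> xy; last by rewrite ger0_norm // subr_ge0.
  by rewrite distrC ger0_norm // subr_ge0.
case: (soft_cases u b0) => [[u1 u2 ->]|[u1 ->]|[u1 ->]];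
case: (soft_cases v b0) => [[v1 v2 ->]|[v1 ->]|[v1 ->]]; rewrite ?subrr ?normr0 ?normr_ge0 //.
- by rewrite (h 0 _).1 ?(h u v).1; lra.
- by rewrite (h 0 _).2 ?(h u v).2; lra.
- by rewrite (h _ 0).2 ?(h u v).2; lra.
- by rewrite opprB addrA subrK.
- by rewrite (h (u - b) _).2 ?(h u v).2; lra.
- by rewrite (h _ 0).1 ?(h u v).1; lra.
- by rewrite (h (u + b) _).1 ?(h u v).1; lra.
- by rewrite opprD addrACA subrr addr0.
Qed.

Lemma sigmaE w u : sigma G w u = soft (Defs.c0 G / cm (sqrt_eps w)) u * tan (theta_hat G w).
Proof. by rewrite /sigma sqrt_abs_eps /soft; case: ifP => _; rewrite ?mul0r. Qed.

(* Points of [Gamma] at which [xt] takes its true value, of modulus below [rad]. *)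
Definition gpt (s : side) (w t : C) : Prop :=
  [/\ Gamma G s w t, ee w t != 1 & cm (xt w t) < Defs.rad G].

Lemma ReB (z u : C) : complex.Re (z - u) = complex.Re z - complex.Re u.
Proof. by case: z => a b; case: u. Qed.

Lemma ImB (z u : C) : complex.Im (z - u) = complex.Im z - complex.Im u.
Proof. by case: z => a b; case: u. Qed.

Lemma lip_pos (f : C -> R) (K : R) (t : C) : 0 <= K -> 0 < f t ->
  (forall t', `|f t' - f t| <= K * cm (t' - t)) -> exists2 d : R, 0 < d & forall t', cm (t' - t) < d -> 0 < f t'.
Proof.
move=> K0 ft hK; have K1 : 0 < K + 1 by rewrite ltr_wpDl.
exists (f t / (K + 1)); first by rewrite divr_gt0.
move=> t'; rewrite ltr_pdivlMr // => ht; have := hK t'; rewrite ler_norml => /andP[h1 _].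
by have := cm_ge0 (t' - t); move: ht h1; clear; lra.
Qed.

(** Nearby points stay out of [hole] because [|xt w t|] stays below [rad]; the two other conditions
    compare Lipschitz functions of [t]. *)
Lemma gpt_open s w t : gpt s w t -> exists2 d : R, 0 < d & forall t', cm (t' - t) < d -> gpt s w t'.
Proof.
move=> [gt et xr].
have [d1 d10 h1] := ee_near et.
have [d2 d20 h2] : exists2 d : R, 0 < d & forall t', cm (t' - t) < d -> cm (xt w t') < Defs.rad G.
  have c0 : 0 < Defs.rad G - cm (xt w t) by rewrite subr_gt0.
  have [d d0 hd] := hasd_cts (xt_hasd et) c0; exists d => // t' td.
  have := hd (t' - t) td; rewrite addrCA subrr addr0 => H.
  by have := cm_sub (xt w t') (xt w t); move: H; lra.
set T := tan (theta_hat G w); pose b := Defs.c0 G / cm (sqrt_eps w).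
have b0 : 0 <= b by rewrite divr_ge0 // cm_ge0.
have T0 := normr_ge0 T.
have main : exists2 d : R, 0 < d & forall t', cm (t' - t) < d -> cm (t' - t) < d1 -> cm (t' - t) < d2 -> Gamma G s w t'.
  have sl t' : `|soft b (complex.Re t') * T - soft b (complex.Re t) * T| <= `|T| * cm (t' - t).
    rewrite -mulrBl normrM mulrC; apply: ler_wpM2l => //; apply: le_trans (soft_lip _ _ b0) _.
    by rewrite -ReB; apply: Re_le_cm.
  have il t' : `|complex.Im t' - complex.Im t| <= cm (t' - t) by rewrite -ImB; apply: Im_le_cm.
  have rl t' : `|T * (complex.Re t' - complex.Re t)| <= `|T| * cm (t' - t).
    by rewrite normrM ler_wpM2l // -ReB; apply: Re_le_cm.
  have K0 : 0 <= 1 + `|T| by rewrite addr_ge0.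
  have bd (x y : R) t' : `|x| <= cm (t' - t) -> `|y| <= `|T| * cm (t' - t) ->
     `|x + y| <= (1 + `|T|) * cm (t' - t) /\ `|x - y| <= (1 + `|T|) * cm (t' - t).
    by move=> hx hy; rewrite mulrDl mul1r; split; [apply: le_trans (ler_normD _ _) _|apply: le_trans (ler_normB _ _) _]; apply: lerD.
  case: s gt => /= [[_ u1 u2]|[_ u1 u2]].
  - have [|t'|e1 e10 k1] := @lip_pos (fun t => Defs.h G + soft b (complex.Re t) * T - complex.Im t) _ t K0.
    + by rewrite subr_gt0 -sigmaE.
    + have := (bd _ _ t' (il t') (sl t')).2; rewrite -normrN; congr (`|_| <= _); ring.
    have [|t'|e2 e20 k2] := @lip_pos (fun t => complex.Im (t - - ((2^-1 + kappa G)%:C * period w)) - T * complex.Re (t - - ((2^-1 + kappa G)%:C * period w))) _ t K0.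
    + by rewrite subr_gt0.
    + have := (bd _ _ t' (il t') (rl t')).2; rewrite !ImB !ReB; congr (`|_| <= _); ring.
    exists (Num.min e1 e2); first by rewrite lt_min e10.
    move=> t'; rewrite lt_min => /andP[q1 q2] q3 q4; split.
    + by apply: not_hole; [apply: h1|apply: h2].
    + by have := k1 _ q1; rewrite subr_gt0 sigmaE.
    + by have := k2 _ q2; rewrite subr_gt0.
  - have [|t'|e1 e10 k1] := @lip_pos (fun t => complex.Im t - (- Defs.h G + soft b (complex.Re t) * T)) _ t K0.
    + by rewrite subr_gt0 -sigmaE.
    + have := (bd _ _ t' (il t') (sl t')).2; congr (`|_| <= _); ring.
    have [|t'|e2 e20 k2] := @lip_pos (fun t => T * complex.Re (t - ((2^-1 + kappa G)%:C * period w)) - complex.Im (t - ((2^-1 + kappa G)%:C * period w))) _ t K0.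
    + by rewrite subr_gt0.
    + have := (bd _ _ t' (il t') (rl t')).2; rewrite -normrN !ImB !ReB; congr (`|_| <= _); ring.
    exists (Num.min e1 e2); first by rewrite lt_min e10.
    move=> t'; rewrite lt_min => /andP[q1 q2] q3 q4; split.
    + by apply: not_hole; [apply: h1|apply: h2].
    + by have := k1 _ q1; rewrite subr_gt0 sigmaE.
    + by have := k2 _ q2; rewrite subr_gt0.
have [d d0 hd] := main.
exists (Num.min d (Num.min d1 d2)); first by rewrite !lt_min d0 d10 d20.
move=> t'; rewrite !lt_min => /andP[q1 /andP[q2 q3]].
by split; [apply: hd|apply: h1|apply: h2].
Qed.

Definition Om s w x := exists2 t, gpt s w t & xt w t = x.

Lemma Om_Omega s w x : Om s w x -> Omega G s w x.
Proof. by move=> [t [gt _ _] <-]; exists t. Qed.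

Lemma Om_open s w x : Om s w x -> exists2 d : R, 0 < d & forall x', cm (x' - x) < d -> Om s w x'.
Proof.
move=> [t gt xE]; have [_ et _] := gt; have [d d0 hd] := gpt_open gt.
have [e e0 he] := xt_open et d0; exists e => // x'; rewrite -xE => /he [t' td [_ xt']].
by exists t' => //; apply: hd.
Qed.

End TimeDomains.

(** * Normalized solutions and model solutions as functions of t *)

Section WeakCollections.
Variables (R : realType) (n : nat) (G : geometry R).
Local Notation C := R[i].
Hypothesis c00 : 0 <= Defs.c0 G.

Lemma S_to0_filter : Filter (S_to0 G).
Proof.
apply: filter_from_filter; first by exists 1 => /=.
move=> d e d0 e0; exists (Num.min d e); first by rewrite /= lt_min d0.
by move=> w [Sw]; rewrite lt_min => /andP[? ?]; split.
Qed.

Lemma norm_mx_real m p (M : 'M[C]_(m, p)) : exists2 t : R, 0 <= t & `|M| = t%:C.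
Proof.
have := normr_ge0 M; case: (`|M|) => a b; rewrite lecE /= => /andP[/eqP -> a0].
by exists a.
Qed.

Lemma norm_mx_mbnd m p (M : 'M[C]_(m, p)) (d : R) : `|M| <= d%:C -> mbnd M d.
Proof.
have [t t0 E] := norm_mx_real M; rewrite E lecR => td i j; rewrite leNgt; apply/negP => dlt.
have := (norm_mx_lt M (le_lt_trans (le_trans t0 td) dlt)).1; rewrite E ltcR (le_lt_trans td dlt).
by move=> /(_ isT i j); rewrite ltxx.
Qed.

Lemma mbnd_norm_mx m p (M : 'M[C]_(m, p)) (d : R) : 0 <= d -> mbnd M d -> `|M| <= d%:C.
Proof.
have [t t0 E] := norm_mx_real M => d0 h; rewrite E lecR leNgt; apply/negP => dt.
have := (norm_mx_lt M (le_lt_trans d0 dt)).2 (fun i j => le_lt_trans (h i j) dt).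
by rewrite E ltxx.
Qed.

Lemma unit_diag (d : 'rV[C]_n) : (diag_mx d \in unitmx) <-> forall j, d ord0 j != 0.
Proof.
rewrite unitmxE det_diag unitfE prodf_seq_neq0; split=> [/allP h j|h].
  by have := h j (mem_index_enum j).
by apply/allP => j _; exact: h.
Qed.

(* What the two implications use of a normalized pair [H] and its Stokes matrices; unlike
   [normalized], it can be checked directly for the model, where [H] and the matrices are 1. *)
Definition weak_collection (B : C -> C -> 'M[C]_n) (F : side -> C -> C -> 'M[C]_n)
    (Cst : node -> C -> 'M[C]_n) (H : side -> C -> C -> 'M[C]_n) : Prop :=
  [/\ (forall s w x, param_sector G w -> Omega G s w x -> H s w x \in unitmx /\ mder (H s w) x),
      (forall w t, param_sector G w -> gpt G Down w t -> forall i j,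
         hasd (fun t => (H Down w (xt w t) *m F Down w (xt w t)) i j) t
              ((B (eps w) (xt w t) *m (H Down w (xt w t) *m F Down w (xt w t))) i j)),
      (forall l, exists2 d : C -> 'rV[C]_n, nonsingular_diag G d & forall s w, param_sector G w ->
         H s w x @[x --> within (Omega G s w) (nbhs (xhat l w))] --> diag_mx (d w)),
      (exists c M : R, [/\ 0 <= c, 0 <= M & forall w, S_cap G w ->
         mbnd (H Down w 0 - H Down (tilde w) 0) (c * abs_eps w) /\
         forall v, v = w \/ v = tilde w -> [/\ H Down v 0 \in unitmx, mbnd (H Down v 0) M & mbnd (invmx (H Down v 0)) M]]) &
      (forall w, param_sector G w ->
        [/\ (forall l, unipotent l (Cst l w)),
      (forall l x, Omega_node G l w x ->
         invmx (H Down w x) *m H Up w x =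
           F Down w x *m Cst l w *m invmx (F Down w x)) &
      (forall x, Omega_center G w x -> invmx (H Down w x) *m H Up w x = 1%:M)])].

Lemma weak_of_stokes B F Cst : stokes_collection G B F Cst -> exists H, weak_collection B F Cst H.
Proof.
move=> [H [hA hF hd hc hM] hC]; exists H; split=> //.
- move=> s w x Sw Ox; split; first by have [] := hF s w Sw x Ox; rewrite unitmx_mul => /andP[].
  have h := hA s (w, x) (conj Sw Ox); have /= dx := nbhs_singleton h.
  by move=> i j; apply: (derivable_slice2 (f := fun w x => H s w x i j)); apply: differentiable_entry dx.
- move=> w t Sw gt i j; have [g1 et _] := gt.
  have Ox : Omega G Down w (xt w t) by exists t.
  have [_ dW oW] := hF Down w Sw _ Ox.
  have := hasd_comp (xt_hasd et) (derivable_mx_hasd i j dW) => h; apply: hasd_eq h _.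
  by rewrite -oW mxE mulrC.
- have [c c0 hc'] := hc Down; have [M hM'] := hM Down; exists c, (Num.max M 0); split=> //.
    by rewrite le_max lexx orbT.
  move=> w Sw; split; first by apply: norm_mx_mbnd; exact: hc'.
  move=> v hv; have [u [m1 m2]] := hM' w v Sw hv.
  by split=> //; apply: (@mbnd_le _ _ _ _ M); rewrite ?le_max ?lexx //; exact: norm_mx_mbnd.
Qed.

Variables (L0 L1 : C -> 'rV[C]_n) (F : side -> C -> C -> 'M[C]_n).

Definition frow (l : C -> C -> C) (w t : C) : 'rV[C]_n :=
  \row_j cexp (t * L0 (eps w) ord0 j + l w t * L1 (eps w) ord0 j).

Definition log_in_time (l : C -> C -> C) : Prop :=
  (forall w t, param_sector G w -> gpt G Down w t -> hasd (l w) t (xt w t)) /\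
  (forall w t, param_sector G w -> Gamma G Down w t -> F Down w (xt w t) = diag_mx (frow l w t)).

(** Along dx/dt = x^2 - eps, half the logarithm of x^2 - eps has derivative x; [log_hasd] needs only
    the continuity of the branch. *)
Lemma model_log : model_solutions G L0 L1 F -> exists l, log_in_time l.
Proof.
move=> [l [[cl el _] hF _]]; exists l; split=> // w t Sw gt.
have [g1 et _] := gt; have [d d0 hd] := gpt_open c00 gt.
have ct : cts (l w) t.
  move=> e e0; move: cl => /subspace_continuousP /(_ (w, t) (conj Sw g1)).
  move=> /cvgrPdist_lt /(_ e%:C); rewrite ltcR => /(_ e0); rewrite near_withinE => /nbhs_pairP [d' d'0 hd'].
  exists (Num.min d d'); first by rewrite lt_min d0.
  move=> k; rewrite lt_min => /andP[k1 k2].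
  have [g2 _ _] : gpt G Down w (t + k) by apply: hd; rewrite addrAC subrr add0r.
  have := hd' w (t + k); rewrite /= subrr cm0 addrAC subrr add0r => /(_ d'0 k2 (conj Sw g2)).
  by rewrite normE ltcR cmBC.
have hg : hasd (fun t => xt w t ^+ 2 - eps w) t (2 * xt w t * (xt w t ^+ 2 - eps w)).
  apply: hasd_eq (hasdB (hasdX 2 (xt_hasd et)) (hasd_cst (eps w) t)) _.
  by rewrite /= expr1 subr0.
have hl : exists2 d : R, 0 < d & forall t', cm (t' - t) < d -> cexp (2 * l w t') = xt w t' ^+ 2 - eps w.
  by exists d => // t' /hd [g2 _ _]; apply: el.
apply: hasd_eq (log_hasd ct hl hg) _.
by have := xt_sqr et; move: (_ - eps w) => u u0; field.
Qed.

Lemma frow_neq0 l w t j : frow l w t ord0 j != 0.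
Proof. by rewrite mxE cexp_neq0. Qed.

Lemma frow_hasd l w t j : log_in_time l -> param_sector G w -> gpt G Down w t ->
  hasd (fun t => frow l w t ord0 j) t (lam L0 L1 (eps w) (xt w t) ord0 j * frow l w t ord0 j).
Proof.
move=> [hl _] Sw gt; have h := hl w t Sw gt.
apply: (hasd_near (f := fun t => cexp (t * L0 (eps w) ord0 j + l w t * L1 (eps w) ord0 j))).
  by exists 1 => // t' _; rewrite mxE.
have hs := hasdD (hasdM (hasd_id t) (hasd_cst (L0 (eps w) ord0 j) t)) (hasdM h (hasd_cst (L1 (eps w) ord0 j) t)).
apply: hasd_eq (hasd_comp hs (hasd_cexp _)) _.
by rewrite /lam !mxE; ring.
Qed.

Lemma nonsingular_cst : nonsingular_diag G (fun=> const_mx 1 : 'rV[C]_n).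
Proof.
have u1 : diag_mx (const_mx 1 : 'rV[C]_n) \in unitmx by apply/unit_diag => j; rewrite mxE oner_neq0.
have FS := S_to0_filter; split=> //; last by exists (const_mx 1) => //; apply: cvg_cst.
by move=> w _; apply/nbhsCP; exists 1 => // v _; apply: differentiable_cst.
Qed.

Lemma weak_model : model_solutions G L0 L1 F ->
  weak_collection (prenormal L0 L1 (fun _ _ => 0)) F (fun _ _ => 1%:M) (fun _ _ _ => 1%:M).
Proof.
move=> /model_log [l hl]; have [hl1 hl2] := hl; split.
- by move=> s w x _ _; split; [exact: unitmx1|exact: mder_cst].
- move=> w t Sw gt i j; have [d d0 hd] := gpt_open c00 gt; have [g1 _ _] := gt.
  apply: (hasd_near (f := fun t' => frow l w t' ord0 i *+ (i == j))).
    by exists d => // t' /hd [g2 _ _]; rewrite mul1mx hl2 // [RHS]mxE.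
  rewrite mul1mx hl2 // /prenormal scaler0 addr0 /model_system mul_diag_mx !mxE.
  case: eqP => [_|_]; last by rewrite mulr0; apply: hasd_cst.
  by have := frow_hasd i hl Sw gt; rewrite !mxE.
- move=> k; exists (fun=> const_mx 1); first exact: nonsingular_cst.
  by move=> s w _; rewrite diag_const_mx; apply: cvg_cst.
- exists 0, 1; split=> // w _; split; first by rewrite subrr mul0r; apply: mbnd0.
  have b1 : mbnd (1%:M : 'M[C]_n) 1.
    by move=> i j; rewrite mxE; case: eqP => _; rewrite ?cm1 ?cm0.
  by move=> v _; rewrite invmx1; split=> //; exact: unitmx1.
- move=> w Sw; split.
  + by move=> k; split=> [i|i j]; rewrite mxE ?eqxx //; case: k => ij; rewrite (_ : (i == j) = false) //;
      apply/eqP => e; move: ij; rewrite e ltnn.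
  + move=> k x [t [[g1 _] _] <-]; rewrite invmx1 !mulmx1 hl2 // mulmxV //.
    by apply/unit_diag => j; exact: frow_neq0.
  + by move=> x _; rewrite invmx1 mulmx1.
Qed.

End WeakCollections.

(** * From equivalent collections to equivalent families *)

Section ProductRule.
Variable R : realType.
Local Notation C := R[i].

Definition mhasd m n (F : C -> 'M[C]_(m, n)) (x : C) (D : 'M[C]_(m, n)) :=
  forall i j, hasd (fun z => F z i j) x (D i j).

Lemma mhasdM m n p (A : C -> 'M[C]_(m, n)) (B : C -> 'M[C]_(n, p)) x A' B' :
  mhasd A x A' -> mhasd B x B' -> mhasd (fun z => A z *m B z) x (A' *m B x + A x *m B').
Proof.
move=> hA hB i j.
apply: (hasd_near (f := fun z => \sum_k A z i k * B z k j)).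
  by exists 1 => // z _; rewrite mxE.
apply: (hasd_eq (b := \sum_k (A' i k * B x k j + A x i k * B' k j))).
  by apply: hasd_sum => k _; apply: hasdM.
by rewrite !mxE big_split.
Qed.

Lemma mhasd_cst m n (M : 'M[C]_(m, n)) x : mhasd (fun=> M) x 0.
Proof. by move=> i j; rewrite mxE; apply: hasd_cst. Qed.

Lemma mhasd_uniq m n (A : C -> 'M[C]_(m, n)) x D D' : mhasd A x D -> mhasd A x D' -> D = D'.
Proof. by move=> h h'; apply/matrixP => i j; apply: hasd_uniq (h i j) (h' i j). Qed.

Lemma mhasd_near m n (A B : C -> 'M[C]_(m, n)) x D :
  (exists2 d : R, 0 < d & forall z, cm (z - x) < d -> A z = B z) -> mhasd A x D -> mhasd B x D.
Proof. by move=> [d d0 h] hA i j; apply: hasd_near (hA i j); exists d => // z /h ->. Qed.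

Lemma mhasd_comp n (P : C -> 'M[C]_n) (f : C -> C) t b : hasd f t b ->
  (forall i j, hasd (fun z => P z i j) (f t) (dmx P (f t) i j)) -> mhasd (fun z => P (f z)) t (b *: dmx P (f t)).
Proof.
move=> hf hP i j; rewrite mxE mulrC.
exact: (hasd_comp (f := fun z => P z i j) hf (hP i j)).
Qed.

Lemma diag_comm n (a b : 'rV[C]_n) : diag_mx a *m diag_mx b = diag_mx b *m diag_mx a.
Proof. by rewrite !mul_diag_mx; apply/matrixP => i j; rewrite !mxE; case: eqP => [->|_]; rewrite ?mulr0n ?mulr0 // !mulr1n mulrC. Qed.

Lemma diag_quot n (a k b : 'rV[C]_n) : diag_mx b \in unitmx ->
  diag_mx a *m diag_mx k *m invmx (diag_mx b) = diag_mx (\row_j (a ord0 j * k ord0 j / b ord0 j)).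
Proof.
move=> ub; have h := (unit_diag b).1 ub.
apply: (canLR (mulmxK ub)); rewrite !mul_diag_mx; apply/matrixP => i j; rewrite !mxE.
by case: eqP => [->|_]; rewrite ?mulr0n ?mulr0 // !mulr1n divfK.
Qed.

End ProductRule.

(** * The domains when arg eps = 2 pi *)

Section SpecialParameters.
Variables (R : realType) (G : geometry R) (a : R).
Local Notation C := R[i].
Hypotheses (a0 : 0 < a) (g0 : 0 < gamma G) (r0 : 0 < Defs.rad G) (k0 : 0 < kappa G < 2^-1).
Hypotheses (h0 : 0 < Defs.h G < (Defs.rad G)^-1) (arho : a ^+ 2 < Defs.rho G).
Hypotheses (ah : 2 * Defs.h G < pi / a) (ahr : a * (4 * Defs.h G) <= 1 - Defs.h G * Defs.rad G).

(* For arg eps = 2 pi the lines bounding [Gamma] are horizontal. *)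
Definition wpi : C := (2 * ln a) +i* (2 * pi).

Let q := sqrt_eps wpi.

Lemma sqrt_wpi : q = (- a)%:C.
Proof.
have E : wpi / 2 = ln a +i* pi.
  apply: (@mulIf _ (2 : C)); first by rewrite pnatr_eq0.
  rewrite divfK ?pnatr_eq0 //; apply/eqP; rewrite eq_complex /=; apply/andP; split; apply/eqP; ring.
by rewrite /q /sqrt_eps E /cexp /= cospi sinpi lnK ?posrE // mulr0 mulrN1.
Qed.

Lemma eps_wpi : eps wpi = (a ^+ 2)%:C.
Proof. by rewrite -sqrt_epsX -/q sqrt_wpi rmorphN sqrrN -rmorphXn. Qed.

Lemma abs_wpi : abs_eps wpi = a ^+ 2.
Proof. by rewrite -cm_eps eps_wpi cmR ger0_norm // sqr_ge0. Qed.

Lemma sector_wpi : param_sector G wpi.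
Proof.
split; first by rewrite abs_wpi.
rewrite /arg_eps /=; have := @pi_gt0 R; move: g0 => *; apply/andP; split; lra.
Qed.

Lemma theta_wpi : theta_hat G wpi = 0.
Proof. by rewrite /theta_hat /arg_sqrt_eps /arg_eps /= [2 * pi]mulrC mulfK ?subrr ?mulr0 // pnatr_eq0. Qed.

Lemma period_wpi : period wpi = 0 +i* (pi / a).
Proof.
have an0 : a != 0 by rewrite gt_eqF.
have q0 : q != 0 by exact: sqrt_eps_neq0.
apply: (mulIf q0); rewrite /period -/q divfK // sqrt_wpi.
by apply/eqP; rewrite eq_complex /=; apply/andP; split; apply/eqP; field.
Qed.

Lemma Gamma_down t : Gamma G Down wpi t <->
  [/\ ~ hole G wpi t, complex.Im t < Defs.h G & - ((2^-1 + kappa G) * (pi / a)) < complex.Im t].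
Proof.
rewrite /Gamma /= /above sigmaE theta_wpi tan0 mulr0 addr0 mul0r period_wpi opprK.
have -> : complex.Im (t + (2^-1 + kappa G)%:C * (0 +i* (pi / a))) = complex.Im t + (2^-1 + kappa G) * (pi / a).
  by case: t => x y /=; ring.
by split=> -[h1 h2 h3]; split=> //; move: h3; lra.
Qed.

Lemma Gamma_up t : Gamma G Up wpi t <->
  [/\ ~ hole G wpi t, - Defs.h G < complex.Im t & complex.Im t < (2^-1 + kappa G) * (pi / a)].
Proof.
rewrite /Gamma /= /below sigmaE theta_wpi tan0 mulr0 addr0 mul0r period_wpi.
have -> : complex.Im (t - (2^-1 + kappa G)%:C * (0 +i* (pi / a))) = complex.Im t - (2^-1 + kappa G) * (pi / a).
  by case: t => x y /=; ring.
by split=> -[h1 h2 h3]; split=> //; move: h3; lra.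
Qed.

(** The logarithm with imaginary part in [-pi, pi] gives a time [t] with [|Im t| <= pi / (2 a)],
    half a period; the sign of [Im t] decides between the two strips, whose margin is [kappa]. *)
Lemma sectors_cover x : cm x < Defs.rad G -> x != q -> x != - q -> Om G Down wpi x \/ Om G Up wpi x.
Proof.
move=> xr x1 x2.
have u0 : (x - q) / (x + q) != 0 by rewrite mulf_neq0 ?invr_eq0 ?subr_eq0 ?addr_eq0.
have [z [zE /andP[z1 z2]]] := clog u0.
have q2 : 2 * q != 0 by rewrite mulf_neq0 ?pnatr_eq0 ?sqrt_eps_neq0.
pose t := z / (2 * q).
have [et xE] : ee wpi t != 1 /\ xt wpi t = x by apply: xt_solve => //; rewrite /ee -/q /t [2 * q * _]mulrC divfK.
have nh : ~ hole G wpi t by apply: not_hole; rewrite ?xE.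
have It : complex.Im t = - (complex.Im z / (2 * a)).
  have an0 : a != 0 by rewrite gt_eqF.
  have -> : t = (- (2 * a)^-1)%:C * z.
    apply: (mulIf q2); rewrite /t divfK // sqrt_wpi.
    by case: (z) => u v; apply/eqP; rewrite eq_complex /=; apply/andP; split; apply/eqP; field.
  by case: (z) => u v /=; rewrite mul0r addr0 mulNr mulrC.
have a2 : 0 < 2 * a by rewrite mulr_gt0.
have [hh _] := andP h0; have [kk _] := andP k0; have p0 := @pi_gt0 R.
have pa : 0 < pi / a :> R by rewrite divr_gt0.
have kpa : 0 < kappa G * (pi / a) by rewrite mulr_gt0.
have pE : 2^-1 * (pi / a) = pi / (2 * a) :> R by field; rewrite gt_eqF.
have i1 : complex.Im z / (2 * a) <= pi / (2 * a) by rewrite ler_wpM2r // invr_ge0 ltW.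
have i2 : - (pi / (2 * a)) <= complex.Im z / (2 * a) by rewrite -mulNr ler_wpM2r // invr_ge0 ltW.
case: (lerP (complex.Im t) 0) => It0.
  left; exists t => //; split; rewrite ?xE //; apply/Gamma_down; split=> //; first exact: le_lt_trans hh.
  by rewrite mulrDl pE It; move: i1 kpa; lra.
right; exists t => //; split; rewrite ?xE //; apply/Gamma_up; split=> //.
  by apply: lt_trans It0; rewrite oppr_lt0.
by rewrite mulrDl pE It; move: i2 kpa; lra.
Qed.

(** [x = 0] is reached half a period below [t = 0], where the exponential is -1. *)
Lemma origin_down : Om G Down wpi 0.
Proof.
have an0 : a != 0 by rewrite gt_eqF.
pose t : C := 0 +i* (- (pi / (2 * a))).
have q0 : q != 0 by exact: sqrt_eps_neq0.
have eE : ee wpi t = -1.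
  have -> : ee wpi t = cexp (0 +i* pi).
    rewrite /ee -/q sqrt_wpi; congr cexp; apply/eqP; rewrite eq_complex /=.
    by apply/andP; split; apply/eqP; field.
  rewrite /cexp /= expR0 cospi sinpi; apply/eqP; rewrite eq_complex /=; apply/andP; split; apply/eqP; ring.
have [et xE] : ee wpi t != 1 /\ xt wpi t = 0.
  by apply: xt_solve; rewrite -/q; rewrite ?(eq_sym 0) ?oppr_eq0 // sub0r add0r mulNr divff.
exists t => //; split; rewrite ?xE ?cm0 //; apply/Gamma_down; split.
- by apply: not_hole; rewrite ?xE ?cm0.
- rewrite /=; apply: (@lt_trans _ _ 0); last by case/andP: h0.
  by rewrite oppr_lt0 divr_gt0 ?pi_gt0 // mulr_gt0.
- have [kk _] := andP k0; have kpa : 0 < kappa G * (pi / a) by rewrite mulr_gt0 // divr_gt0 // pi_gt0.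
  have pE : 2^-1 * (pi / a) = pi / (2 * a) :> R by field.
  by rewrite /= mulrDl pE; move: kpa; lra.
Qed.

(* On this segment [|x(t)| > 1/h > rad]. *)
Lemma axis_in_hole (y : R) : `|y| < Defs.h G -> hole G wpi (0 +i* y).
Proof.
move=> yh; have [hh hr] := andP h0.
have hr1 : Defs.h G * Defs.rad G < 1 by rewrite -ltr_pdivlMr // div1r.
(* A connected set through 0 on which [xt] is large or has its pole lies in the component that
   defines [hole]. *)
pose A := [set (0 +i* v : C) | v in `[- `|y|, `|y|]%classic].
have cA : connected A.
  apply: connected_continuous_connected; first exact: segment_connected.
  apply: continuous_subspaceT => v; apply/cvg_cmP => e e0.
  apply/nbhs_ballP; exists e => //= u; rewrite /ball /= distrC => uv.
  by rewrite subrr expr0n /= add0r sqrtr_sqr.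
have inA v : `|v| <= `|y| -> A (0 +i* v).
  by rewrite ler_norml => h; exists v => //=; rewrite in_itv.
have A0 : A 0 by apply: inA; rewrite normr0.
suff AE : A `<=` [set t | csinh (sqrt_eps wpi * t) = 0 \/ (Defs.rad G)%:C <= `|xt wpi t|].
  by apply: (connected_component_max A0 AE cA); exact: inA.
move=> x0 [v /=]; rewrite in_itv /= -ler_norml => vy <-.
  have [/eqP|et] := boolP (ee wpi (0 +i* v) == 1).
    by move=> /eqP; rewrite -csinh_eq0 => /eqP; left.
  right; rewrite normE lecR xtE // cmM cmN -/q sqrt_wpi cmR normrN (ger0_norm (ltW a0)) cmM cmV.
  set f := 2 * a * v.
  have fE : ee wpi (0 +i* v) = cos f +i* (- sin f).
    rewrite /ee -/q sqrt_wpi; have -> : 2 * (- a)%:C * (0 +i* v) = 0 +i* (- f).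
      by apply/eqP; rewrite eq_complex /= /f; apply/andP; split; apply/eqP; ring.
    by rewrite /cexp /= expR0 !mul1r cosN sinN.
  have f0 := normr_ge0 f.
  have d1 : cm (ee wpi (0 +i* v) - 1) <= `|f| + `|f| ^+ 2.
    rewrite fE; apply: le_trans (cm_le_ReIm _) _; rewrite /= subr0 normrN addrC.
    by apply: lerD; [exact: sin_le|rewrite real_normK ?num_real // cos_sub1_le].
  have d2 : 2 - cm (ee wpi (0 +i* v) - 1) <= cm (ee wpi (0 +i* v) + 1).
    have -> : ee wpi (0 +i* v) + 1 = 2 + (ee wpi (0 +i* v) - 1) by ring.
    have := cm_sub 2 (- (ee wpi (0 +i* v) - 1)); by rewrite opprK cmN cm_nat.
  have d0 : 0 < cm (ee wpi (0 +i* v) - 1) by rewrite cm_gt0 subr_eq0.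
  have fv : `|f| = 2 * a * `|v| by rewrite /f normrM ger0_norm // mulr_ge0 // ltW.
  have fh : `|f| <= (1 - Defs.h G * Defs.rad G) / 2.
    rewrite fv ler_pdivlMr //; apply: le_trans ahr.
    have : `|v| <= Defs.h G by apply: le_trans vy _; exact: ltW.
    by move: a0; nra.
  have f1 : `|f| <= 1 / 2 by have : 0 <= Defs.h G * Defs.rad G by [rewrite mulr_ge0 // ltW]; move: fh; lra.
  rewrite mulrA ler_pdivlMr //.
  apply: (@le_trans _ _ (Defs.rad G * (`|f| * (1 + `|f|)))).
    by apply: ler_wpM2l; [exact: ltW|rewrite mulrDr mulr1 -expr2].
  apply: (@le_trans _ _ (a * (2 - (`|f| + `|f| ^+ 2)))); last first.
    by apply: ler_wpM2l; [exact: ltW|move: d1 d2; lra].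
  have -> : Defs.rad G * (`|f| * (1 + `|f|)) = a * (2 * (`|v| * Defs.rad G) * (1 + `|f|)) by rewrite {1}fv; ring.
  apply: ler_wpM2l; first exact: ltW.
  have vr : `|v| * Defs.rad G <= Defs.h G * Defs.rad G.
    by apply: ler_wpM2r; [exact: ltW|apply: le_trans vy _; exact: ltW].
  move: (`|v| * _) (_ * Defs.rad G) vr hr1 fh f1 f0; rewrite expr2 => s u; move: (`|f|) => z; nra.
Qed.

End SpecialParameters.

Section Limits.
Variables (R : realType) (n : nat).
Local Notation C := R[i].

Lemma within_mbnd (M : C -> 'M[C]_n) (U : set C) (x0 : C) (N : 'M[C]_n) (e : R) :
  M x @[x --> within U (nbhs x0)] --> N -> 0 < e ->
  exists2 d : R, 0 < d & forall x, U x -> cm (x - x0) < d -> mbnd (M x - N) e.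
Proof.
move=> hc e0; have nb : nbhs N [set A : 'M[C]_n | mbnd (A - N) e].
  by apply/nbhs_mxP; exists e => // A hA i j; have := hA i j; rewrite [(A - _) i j]mxE [(- _ : 'M[C]_n) i j]mxE => /ltW.
have := hc _ nb => /nbhs_cmP [d d0 hd]; exists d => // x Ux xd; exact: hd.
Qed.

Lemma mder_mhasd (F : C -> 'M[C]_n) x : mder F x -> mhasd F x (dmx F x).
Proof. by move=> h i j; have [b hb] := h i j; rewrite mxE; apply: derivable_hasd; exact: hasd_derivable hb. Qed.

Lemma mhasd_mbnd (F : C -> 'M[C]_n) x D (e : R) : mhasd F x D -> 0 < e ->
  exists2 d : R, 0 < d & forall y, cm (y - x) < d -> mbnd (F y - F x) e.
Proof.
move=> h e0.
have H (a : 'I_n * 'I_n) : exists2 d : R, 0 < d & forall y, cm (y - x) < d -> cm (F y a.1 a.2 - F x a.1 a.2) <= e.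
  have [d d0 hd] := hasd_cts (h a.1 a.2) e0; exists d => // y yd.
  by have := hd (y - x) yd; rewrite [x + _]addrC subrK => /ltW.
have [|d d0 hd] := @fin_radius R ('I_n * 'I_n)%type (fun a d => forall y, cm (y - x) < d -> cm (F y a.1 a.2 - F x a.1 a.2) <= e) _ H.
  by move=> a r r' /andP[r'0 rr] hr y yr; apply: hr; apply: lt_le_trans rr.
by exists d => // y yd i j; have := hd (i, j) y yd; rewrite !mxE.
Qed.

End Limits.

Lemma int_01 (R : realType) (m : int) : -1 < (m%:~R : R) < 2 -> m = 0 \/ m = 1.
Proof.
have -> : (-1 : R) = (-1)%:~R by rewrite rmorphN1.
have -> : (2 : R) = 2%:~R by [].
by rewrite !ltr_int; lia.
Qed.

Lemma sqr_lt (R : realType) (a x : R) : 0 < a -> 2 * a <= 1 -> 2 * a <= x -> a ^+ 2 < x.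
Proof. by rewrite expr2; nra. Qed.

(** * Gluing a transformation from the two sectors *)

Section Sufficiency.
Variables (R : realType) (n : nat) (G : geometry R).
Local Notation C := R[i].
Variables (L0 L1 : C -> 'rV[C]_n) (R1 R2 : C -> C -> 'M[C]_n).
Variables (F H1 H2 : side -> C -> C -> 'M[C]_n) (C1 C2 : node -> C -> 'M[C]_n) (l : C -> C -> C).
Variable (k : C -> 'rV[C]_n).
Hypotheses (c00 : 0 <= Defs.c0 G) (g0 : 0 < gamma G) (r0 : 0 < Defs.rad G) (k0 : 0 < kappa G < 2^-1).
Hypotheses (h0 : 0 < Defs.h G < (Defs.rad G)^-1) (rho0 : 0 < Defs.rho G).
Hypotheses (hl : log_in_time G L0 L1 F l) (nk : nonsingular_diag G k).
Hypotheses (w1 : weak_collection G (prenormal L0 L1 R1) F C1 H1)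
           (w2 : weak_collection G (prenormal L0 L1 R2) F C2 H2).
Hypothesis hC : forall l w, param_sector G w ->
  C2 l w = diag_mx (k w) *m C1 l w *m invmx (diag_mx (k w)).

Definition glued (w : C) (s : side) (x : C) : 'M[C]_n := H2 s w x *m diag_mx (k w) *m invmx (H1 s w x).

Lemma Gamma_frow w t : param_sector G w -> Gamma G Down w t -> F Down w (xt w t) = diag_mx (frow L0 L1 l w t).
Proof. by case: hl => _; apply. Qed.

Lemma unit_frow w t : diag_mx (frow L0 L1 l w t) \in unitmx.
Proof. by apply/unit_diag => j; exact: frow_neq0. Qed.

Lemma unit_k w : param_sector G w -> diag_mx (k w) \in unitmx.
Proof. by case: nk => _ + _; apply. Qed.

Lemma glued_center w x : param_sector G w -> Omega G Down w x -> Omega G Up w x -> Omega_center G w x ->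
  glued w Down x = glued w Up x.
Proof.
move=> Sw OD OU Ox.
have [hA1 _ _ _ /(_ w Sw) [_ _ hC1]] := w1; have [hA2 _ _ _ /(_ w Sw) [_ _ hC2]] := w2.
have e1 := hC1 x Ox; have e2 := hC2 x Ox.
have [u1 _] := hA1 Down w x Sw OD; have [u2 _] := hA2 Down w x Sw OD.
have E1 : H1 Up w x = H1 Down w x by rewrite -[LHS]mul1mx -(mulmxV u1) -mulmxA e1 mulmx1.
have E2 : H2 Up w x = H2 Down w x by rewrite -[LHS]mul1mx -(mulmxV u2) -mulmxA e2 mulmx1.
by rewrite /glued E1 E2.
Qed.

(** On both sides [H Up = H Down F C F^-1]. Since [F] and [K] are diagonal they commute, and
    conjugation of [C1] by [K] is exactly what makes the two products equal. *)
Lemma glued_node w m t : param_sector G w -> Gamma G Down w t -> Gamma G Up w t ->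
  Omega_node G m w (xt w t) -> glued w Down (xt w t) = glued w Up (xt w t).
Proof.
move=> Sw gD gU Ox.
have OD : Omega G Down w (xt w t) by exists t.
have OU : Omega G Up w (xt w t) by exists t.
have [hA1 _ _ _ /(_ w Sw) [_ hN1 _]] := w1; have [hA2 _ _ _ /(_ w Sw) [_ hN2 _]] := w2.
have e1 := hN1 m _ Ox; have e2 := hN2 m _ Ox.
have [u1 _] := hA1 Down w _ Sw OD; have [u2 _] := hA2 Down w _ Sw OD.
have [v1 _] := hA1 Up w _ Sw OU.
have FE := Gamma_frow Sw gD; have uF := unit_frow w t; have uK := unit_k Sw.
have cKF := diag_comm (k w) (frow L0 L1 l w t).
rewrite FE in e1 e2; rewrite (hC m Sw) in e2.
move: e1 e2 u1 u2 v1 uF uK cKF; rewrite /glued; move: (H1 Down w _) (H2 Down w _) (H1 Up w _) (H2 Up w _) (C1 m w) => hD1 hD2 hU1 hU2 c.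
move: (diag_mx (k w)) (diag_mx (frow _ _ _ _ _)) => K f e1 e2 u1 u2 v1 uF uK cKF.
have E1 : hU1 = hD1 *m (f *m c *m invmx f) by rewrite -e1 mulKVmx.
have E2 : hU2 = hD2 *m (f *m (K *m c *m invmx K) *m invmx f) by rewrite -e2 mulKVmx.
have cV : invmx K *m invmx f *m K = invmx f.
  have Kf : K *m invmx f = invmx f *m K.
    have := congr1 (fun M => invmx f *m M *m invmx f) cKF.
    by rewrite (mulKmx uF) mulmxA mulmxK.
  by rewrite -mulmxA -Kf mulmxA mulVmx // mul1mx.
have Z1 Z : K *m (f *m Z) = f *m (K *m Z) by rewrite !mulmxA cKF.
have Z2 : invmx K *m (invmx f *m K) = invmx f by rewrite mulmxA cV.
apply: (can_inj (mulmxK v1)); rewrite (mulmxKV v1) E1 E2.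
by rewrite -!mulmxA (mulKmx u1) Z2 Z1.
Qed.

Section Special.
Variable a : R.
Hypotheses (a0 : 0 < a) (arho : a ^+ 2 < Defs.rho G) (ar : a < Defs.rad G).
Hypotheses (ah : 2 * Defs.h G < pi / a) (ahr : a * (4 * Defs.h G) <= 1 - Defs.h G * Defs.rad G).

Let w := wpi a.
Let q := sqrt_eps w.
Let Sw : param_sector G w. Proof. exact: sector_wpi. Qed.

(** Two preimages of [x] differ by [m] periods, and the heights of the strips leave [m = 0] or
    [m = 1]. The latter is the central component; for [m = 0] the sign of [Re t] tells the node, and
    [Re t = 0] is excluded by [axis_in_hole]. *)
Lemma glued_agree x : Om G Down w x -> Om G Up w x -> glued w Down x = glued w Up x.
Proof.
move=> oD oU; have OD := Om_Omega oD; have OU := Om_Omega oU.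
case: oD => t1 [g1 et1 xr] x1; case: oU => t2 [g2 et2 _] x2.
have [m t2E] := xt_inj et1 et2 (etrans x1 (esym x2)).
have [n1 i1 j1] := (Gamma_down G a0 t1).1 g1; have [n2 i2 j2] := (Gamma_up G a0 t2).1 g2.
have pa : 0 < pi / a :> R by rewrite divr_gt0 // pi_gt0.
have iE : complex.Im t2 = complex.Im t1 + m%:~R * (pi / a).
  rewrite t2E (period_wpi a0).
  have -> : (m%:~R : C) = (m%:~R : R)%:C by rewrite rmorph_int.
  by case: (t1) => u v /=; rewrite mul0r addr0.
have [kk1 kk2] := andP k0; have kp : kappa G * (pi / a) < 2^-1 * (pi / a) by rewrite ltr_pM2r.
have [mE|mE] : m = 0 \/ m = 1.
  apply: (@int_01 R); apply/andP; split; rewrite -(ltr_pM2r pa).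
    by move: i1 i2 ah; rewrite iE; lra.
  by move: j1 j2 kp; rewrite iE !mulrDl; lra.
- have t12 : t2 = t1 by rewrite t2E mE mul0r addr0.
  rewrite t12 in g2 i2; rewrite -x1.
  have [t0|t0|t0] := ltrgt0P (complex.Re t1).
  + by apply: (glued_node (m := Left)) => //; exists t1.
  + by apply: (glued_node (m := Right)) => //; exists t1.
  + case: n1; have -> : t1 = 0 +i* complex.Im t1 by rewrite -t0; case: (t1).
    by apply: axis_in_hole => //; rewrite ltr_norml i2.
- apply: glued_center => //; exists t1 => //; split=> //=.
  have -> : t1 + period w = t2 by rewrite t2E mE mul1r.
  by [].
Qed.

Lemma glued_mder s x : Om G s w x -> mder (glued w s) x.
Proof.
move=> /Om_Omega Ox; have [hA1 _ _ _ _] := w1; have [hA2 _ _ _ _] := w2.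
have [u1 d1] := hA1 s w x Sw Ox; have [u2 d2] := hA2 s w x Sw Ox.
by apply: mderM; [apply: mderM => //; exact: mder_cst|exact: mder_inv].
Qed.

Variables (dL dR : 'rV[C]_n).
Hypotheses (limL : forall s e, 0 < e -> exists2 d : R, 0 < d &
    forall x, Om G s w x -> cm (x - q) < d -> mbnd (glued w s x - diag_mx dL) e).
Hypotheses (limR : forall s e, 0 < e -> exists2 d : R, 0 < d &
    forall x, Om G s w x -> cm (x + q) < d -> mbnd (glued w s x - diag_mx dR) e).

(** Inside the disc of radius [rad] the last branch is taken only at [- q], by [sectors_cover]. *)
Definition transform (x : C) : 'M[C]_n :=
  if `[< Om G Down w x >] then glued w Down x else
  if `[< Om G Up w x >] then glued w Up x else
  if x == q then diag_mx dL else diag_mx dR.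

Lemma transformE s x : Om G s w x -> transform x = glued w s x.
Proof.
rewrite /transform; case: asboolP => [hD|nD]; case: s => // h; first exact: glued_agree.
by case: asboolP.
Qed.

Lemma not_Om_nodes s x : Om G s w x -> x != q /\ x != - q.
Proof. by move=> [t [_ et _] <-]; exact: xt_neq. Qed.

Lemma transform_nodes : transform q = diag_mx dL /\ transform (- q) = diag_mx dR.
Proof.
have nO s : ~ Om G s w q by move=> /not_Om_nodes []; rewrite eqxx.
have nO' s : ~ Om G s w (- q) by move=> /not_Om_nodes [_]; rewrite eqxx.
rewrite /transform; do 4 (case: asboolP => [/nO //|_] || case: asboolP => [/nO' //|_]).
rewrite eqxx; split=> //; rewrite ifF //; apply/negP => /eqP h.
have := sqrt_eps_neq0 w; rewrite -/q; move: h => /esym/eqP; rewrite -addr_eq0 -mulr2n mulrn_eq0 /=.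
by move=> ->.
Qed.

(** Away from the nodes the two sectors cover the disc. At a node both pieces have the same limit,
    so the extension is continuous and the singularity removable. *)
Lemma transform_hol : holmx (Defs.rad G) transform.
Proof.
have cov x : cm x < Defs.rad G -> x != q -> x != - q -> exists s, Om G s w x.
  by move=> h1 h2 h3; have [] := sectors_cover a0 k0 h0 h1 h2 h3; [exists Down|exists Up].
have mo x : cm x < Defs.rad G -> x != q -> x != - q -> mder transform x.
  move=> h1 h2 h3; have [s os] := cov x h1 h2 h3; have [d d0 hd] := Om_open c00 os.
  apply: (mder_near (F := glued w s)); last exact: glued_mder.
  by exists d => // z /hd oz; rewrite (transformE oz).
have qr : cm q < Defs.rad G by rewrite /q /w (sqrt_wpi a0) cmR normrN gtr0_norm.
have qq : 0 < cm (2 * q) by rewrite cm_gt0 mulf_neq0 ?pnatr_eq0 ?sqrt_eps_neq0.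
have node (p : C) (D : 'M[C]_n) : (p = q \/ p = - q) -> transform p = D ->
  (forall s e, 0 < e -> exists2 d : R, 0 < d & forall x, Om G s w x -> cm (x - p) < d -> mbnd (glued w s x - D) e) ->
  mder transform p.
  move=> pq pD hlim i j.
  have pr : cm p < Defs.rad G by case: pq => ->; rewrite ?cmN.
  pose rr := Num.min (Defs.rad G - cm p) (cm (2 * q)).
  have rr0 : 0 < rr by rewrite lt_min subr_gt0 pr.
  have away z : cm (z - p) < rr -> z != p -> [/\ cm z < Defs.rad G, z != q & z != - q].
    rewrite lt_min => /andP[z1 z2] zp; split.
    - by have := cm_sub z p; move: z1; lra.
    - case: pq z2 zp => -> // z2 _; apply: contraTneq z2 => ->.
      by rewrite opprK -mulr2n mulr_natl ltxx.
    - case: pq z2 zp => -> // z2 _; apply: contraTneq z2 => ->.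
      by rewrite -opprD cmN -mulr2n mulr_natl ltxx.
  apply: (removable_singularity rr0).
    by move=> z zr zp; have [z1 z2 z3] := away z zr zp; exact: mo.
  move=> e e0; have e2 : 0 < e / 2 by rewrite divr_gt0.
  have [d1 d10 hd1] := hlim Down _ e2; have [d2 d20 hd2] := hlim Up _ e2.
  exists (Num.min rr (Num.min d1 d2)); first by rewrite !lt_min d10 d20 subr_gt0 pr qq.
  move=> x; rewrite !lt_min => /andP[xr /andP[x1 x2]]; rewrite pD.
  have [->|x0] := eqVneq x 0; first by rewrite addr0 pD subrr cm0.
  have xp : p + x - p = x by rewrite addrAC subrr add0r.
  have [z1 z2 z3] : [/\ cm (p + x) < Defs.rad G, p + x != q & p + x != - q].
    apply: away; first by rewrite xp lt_min.
    by rewrite -subr_eq0 xp.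
  have [s os] := cov _ z1 z2 z3; rewrite (transformE os).
  have : mbnd (glued w s (p + x) - D) (e / 2).
    by case: s os => os; [apply: hd1|apply: hd2]; rewrite ?xp.
  by move=> /(_ i j); rewrite !mxE => h; apply: le_lt_trans h _; move: e0; lra.
have [nL nR] := transform_nodes.
move=> i j x xr.
have [xq|xq] := eqVneq x q; first by rewrite xq; apply: (node q (diag_mx dL)) => //; left.
have [xq'|xq'] := eqVneq x (- q); last exact: mo.
rewrite xq'; apply: (node (- q) (diag_mx dR)) => //; first by right.
by move=> s e e0; have [d d0 hd] := limR s e0; exists d => // z oz; rewrite opprK; exact: hd.
Qed.

(** Differentiating [transform * W1 = W2 * K] in [t], for solutions [W1], [W2] of the two systems,
    gives the equation. Near 0, where Taylor coefficients are taken, only the lower sector is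
    involved. *)
Lemma transform_ode : exists2 d : R, 0 < d & forall x, cm x < d ->
  (x ^+ 2 - eps w) *: dmx transform x =
  prenormal L0 L1 R2 (eps w) x *m transform x - transform x *m prenormal L0 L1 R1 (eps w) x.
Proof.
have O0 := origin_down a0 r0 k0 h0.
have [d d0 hd] := Om_open c00 O0.
exists d => // x xd; have [t gt xE] : Om G Down w x by apply: hd; rewrite subr0.
have [g1 et xr] := gt.
have [hA1 hW1 _ _ _] := w1; have [_ hW2 _ _ _] := w2.
have m1 := hW1 w t Sw gt; have m2 := hW2 w t Sw gt.
have xr' : cm x < Defs.rad G by rewrite -xE.
have hT : mhasd (fun t => transform (xt w t)) t ((xt w t ^+ 2 - eps w) *: dmx transform (xt w t)).
  apply: mhasd_comp; first exact: xt_hasd.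
  by move=> i j; apply: (dmx_hasd transform_hol).
have hL := mhasdM hT m1; have hR := mhasdM m2 (mhasd_cst (diag_mx (k w)) t).
have [e e0 he] := gpt_open c00 gt.
have E t' : gpt G Down w t' ->
  transform (xt w t') *m (H1 Down w (xt w t') *m F Down w (xt w t')) =
  H2 Down w (xt w t') *m F Down w (xt w t') *m diag_mx (k w).
  move=> gt'; have [g' _ _] := gt'; rewrite (@transformE Down); last by exists t'.
  have [u1 _] : H1 Down w (xt w t') \in unitmx /\ mder (H1 Down w) (xt w t') by apply: hA1 => //; exists t'.
  rewrite /glued mulmxA mulmxKV // -mulmxA Gamma_frow // diag_comm mulmxA //.
have := mhasd_uniq (mhasd_near _ hL) hR => /(_ _) EQ.
have {EQ} := EQ ltac:(exists e => // t' /he gt'; exact: E).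
rewrite xE mulmx0 addr0 -[X in _ = X]mulmxA -xE -(E t gt).
move: (transform _) (dmx _ _) => T T' EQ.
have uW : H1 Down w (xt w t) *m F Down w (xt w t) \in unitmx.
  have [u1 _] : H1 Down w (xt w t) \in unitmx /\ mder (H1 Down w) (xt w t) by apply: hA1 => //; exists t.
  by rewrite unitmx_mul u1 Gamma_frow // unit_frow.
apply: (can_inj (mulmxK uW)); rewrite mulmxBl -[X in _ = X - _]mulmxA -EQ.
by rewrite -[X in _ = _ - X]mulmxA addrK.
Qed.

End Special.

Lemma S_entry (d : C -> 'rV[C]_n) (d0 : 'rV[C]_n) j : d w @[w --> S_to0 G] --> d0 -> d w ord0 j @[w --> S_to0 G] --> d0 ord0 j.
Proof. move=> hd.
exact: (@cvg_comp C 'rV[C]_n C d (fun M => M ord0 j) (S_to0 G) (nbhs d0) (nbhs (d0 ord0 j)) hd (@coord_continuous C 1 n ord0 j d0)). Qed.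

Theorem equivalent_of_collections : prenormal_model L0 L1 -> analytic_germ2 R1 -> analytic_germ2 R2 ->
  analytically_equivalent (prenormal L0 L1 R1) (prenormal L0 L1 R2).
Proof.
move=> hL aR1 aR2; have FS := @S_to0_filter R G.
have [hA1 _ hD1 _ _] := w1; have [hA2 _ hD2 _ _] := w2.
have [[d1L [_ ud1L [e1 ue1 le1]] hd1L] [d2L [_ ud2L [e2 ue2 le2]] hd2L]] := (hD1 Left, hD2 Left).
have [[d1R [_ ud1R _] hd1R] [d2R [_ ud2R _] hd2R]] := (hD1 Right, hD2 Right).
have [_ uk [e3 ue3 le3]] := nk.
(* The limit, as eps tends to 0, of the diagonal value of the glued matrix at x_L. *)
pose D0 : 'rV[C]_n := \row_j (e2 ord0 j * e3 ord0 j / e1 ord0 j).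
have uD0 : diag_mx D0 \in unitmx.
  have h1 := (unit_diag _).1 ue1; have h2 := (unit_diag _).1 ue2; have h3 := (unit_diag _).1 ue3.
  by apply/unit_diag => j; rewrite mxE !mulf_neq0 // invr_eq0.
apply: (extend_equivalence hL aR1 aR2 r0 uD0) => d d0.
pose D (v : C) : 'rV[C]_n := \row_j (d2L v ord0 j * k v ord0 j / d1L v ord0 j).
have [t t0 ht] : S_to0 G [set v | forall j, cm (D v ord0 j - D0 ord0 j) < d].
  apply: (@filter_forall C 'I_n (fun j v => cm (D v ord0 j - D0 ord0 j) < d) (S_to0 G) FS) => j.
  have : D v ord0 j @[v --> S_to0 G] --> D0 ord0 j.
    rewrite mxE; have -> : (fun v => D v ord0 j) = (fun v => d2L v ord0 j * k v ord0 j * (d1L v ord0 j)^-1).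
      by apply/funext => v; rewrite mxE.
    apply: cvgM; first by apply: cvgM; exact: S_entry.
    by apply: cvgV; [exact: (unit_diag _).1 ue1 j|exact: S_entry].
  by move=> /cvg_cmP /(_ _ d0).
have [hh hr] := andP h0; have p0 := @pi_gt0 R.
have hr1 : 0 < 1 - Defs.h G * Defs.rad G by rewrite subr_gt0 -ltr_pdivlMr // div1r.
(* The division by 2 lets [sqr_lt] bound [a ^+ 2], which is eps. The other entries give [a < rad],
   [2 * h < pi / a], and the condition under which the segment near [t = 0] lies in [hole]. *)
pose a := Num.min (Num.min (Num.min 1 d) (Num.min t (Defs.rho G)) / 2)
   (Num.min (Defs.rad G / 2) (Num.min (pi / (4 * Defs.h G)) ((1 - Defs.h G * Defs.rad G) / (4 * Defs.h G)))).
have h4 : 0 < 4 * Defs.h G by rewrite mulr_gt0.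
have a0 : 0 < a.
  exact: (min_gt0 (divr_gt0 (min_gt0 (min_gt0 ltr01 d0) (min_gt0 t0 rho0)) (ltr0Sn R 1))
    (min_gt0 (divr_gt0 r0 (ltr0Sn R 1)) (min_gt0 (divr_gt0 p0 h4) (divr_gt0 hr1 h4)))).
have [a1 [a2 [a3 a4]]] : a <= Num.min (Num.min 1 d) (Num.min t (Defs.rho G)) / 2 /\
   a <= Defs.rad G / 2 /\ a <= pi / (4 * Defs.h G) /\ a <= (1 - Defs.h G * Defs.rad G) / (4 * Defs.h G).
  have M (x y z u : R) (m := Num.min x (Num.min y (Num.min z u))) : m <= x /\ m <= y /\ m <= z /\ m <= u.
    by rewrite /m !ge_min !lexx !orbT.
  exact: M.
have asq : [/\ a ^+ 2 < 1, a ^+ 2 < d, a ^+ 2 < t & a ^+ 2 < Defs.rho G].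
  have [b1 b2 b3 b4] : [/\ 2 * a <= 1, 2 * a <= d, 2 * a <= t & 2 * a <= Defs.rho G].
    have : 2 * a <= Num.min (Num.min 1 d) (Num.min t (Defs.rho G)) by move: a1; rewrite ler_pdivlMr // mulrC.
    by rewrite !le_min => /andP[/andP[-> ->] /andP[-> ->]].
  by split; apply: sqr_lt.
have [s1 s2 s3 s4] := asq.
have ar : a < Defs.rad G by move: a2 r0; lra.
have ah : 2 * Defs.h G < pi / a.
  rewrite ltr_pdivlMr //; move: a3; rewrite ler_pdivlMr // => a3.
  by have : 0 < Defs.h G * a by [rewrite mulr_gt0]; move: a3; lra.
have ahr : a * (4 * Defs.h G) <= 1 - Defs.h G * Defs.rad G by rewrite -ler_pdivlMr.
pose w := wpi a; pose q := sqrt_eps w.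
have Sw : param_sector G w by apply: sector_wpi.
have lims (m : node) (f1 f2 : C -> 'rV[C]_n) :
  (forall s w, param_sector G w -> H1 s w x @[x --> within (Omega G s w) (nbhs (xhat m w))] --> diag_mx (f1 w)) ->
  (forall s w, param_sector G w -> H2 s w x @[x --> within (Omega G s w) (nbhs (xhat m w))] --> diag_mx (f2 w)) ->
  diag_mx (f1 w) \in unitmx ->
  forall s e, 0 < e -> exists2 d : R, 0 < d & forall x, Om G s w x -> cm (x - xhat m w) < d ->
    mbnd (glued w s x - diag_mx (\row_j (f2 w ord0 j * k w ord0 j / f1 w ord0 j))) e.
  move=> hf1 hf2 uf s e e0; rewrite -diag_quot //.
  have [dd dd0 hdd] := sandwich_perturb (diag_mx (f2 w)) (diag_mx (k w)) uf e0.
  have [q1 q10 hq1] := within_mbnd (hf1 s w Sw) dd0; have [q2 q20 hq2] := within_mbnd (hf2 s w Sw) dd0.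
  exists (Num.min q1 q2); first by rewrite lt_min q10.
  move=> x /Om_Omega Ox; rewrite lt_min => /andP[x1 x2].
  by apply: hdd; [apply: hq1|apply: hq2].
have limL := lims Left d1L d2L hd1L hd2L (ud1L w Sw).
have limR : forall s e, 0 < e -> exists2 d : R, 0 < d & forall x, Om G s w x -> cm (x + q) < d ->
    mbnd (glued w s x - diag_mx (\row_j (d2R w ord0 j * k w ord0 j / d1R w ord0 j))) e.
  move=> s e e0; have [d' d'0 hd'] := lims Right d1R d2R hd1R hd2R (ud1R w Sw) s e e0.
  by exists d' => // x Ox xd; apply: hd' => //; rewrite /= opprK.
exists (eps w), q, (transform a (D w) (\row_j (d2R w ord0 j * k w ord0 j / d1R w ord0 j))), (D w); split.
- by rewrite cm_eps (abs_wpi a0) exprn_gt0.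
- by rewrite cm_eps (abs_wpi a0).
- exact: sqrt_epsX.
- exact: transform_hol.
split.
- exact: transform_ode.
- by have [] := transform_nodes a (D w) (\row_j (d2R w ord0 j * k w ord0 j / d1R w ord0 j)).
- move=> j; apply: ltW; apply: (ht w); split=> //; by rewrite (abs_wpi a0).
Qed.

End Sufficiency.

(** * From equivalent families to equivalent collections *)

Section LineGeometry.
Variables (R : realType) (G : geometry R) (w : R[i]).
Local Notation C := R[i].
Local Notation g := (gamma G).
Hypotheses (g0 : 0 < g) (gpi : g * (1 + 2 * g / pi) < pi / 2) (Sw : param_sector G w).

Let q := sqrt_eps w.
Let th := theta_hat G w.

(** [sqrt_eps w * dir] has argument [pi - slant], so [cos slant] is the rate, up to the factor
    [2 |sqrt_eps w|], at which [|ee|] decays in the direction [dir]. *)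
Definition slant : R := pi - arg_sqrt_eps w - th.

Let p0 := @pi_gt0 R.
Let pn0 : (pi : R) != 0. Proof. by rewrite gt_eqF // pi_gt0. Qed.

Lemma gamma_pi : 2 * g / pi < 1.
Proof.
rewrite ltr_pdivrMr // mul1r; move: gpi; rewrite mulrDr mulr1.
have : 0 <= g * (2 * g / pi) by rewrite mulr_ge0 ?divr_ge0 ?mulr_ge0 // ltW.
by lra.
Qed.

Lemma beta_bound : `|pi - arg_sqrt_eps w| < pi / 2 + g.
Proof.
have [_] := Sw; rewrite /arg_sqrt_eps; move: (arg_eps w) => A /andP[A1 A2].
by rewrite ltr_norml; apply/andP; split; lra.
Qed.

Lemma theta_bound : `|th| <= g * (1 + 2 * g / pi).
Proof.
have gp : 0 <= 2 * g / pi by rewrite divr_ge0 ?mulr_ge0 ?ltW.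
rewrite /th /theta_hat normrM (ger0_norm gp).
have E (x p : R) : p != 0 -> x * (1 + 2 * x / p) = 2 * x / p * (p / 2 + x) by move=> h; field.
rewrite (E _ _ pn0).
by apply: ler_wpM2l => //; apply: ltW; exact: beta_bound.
Qed.

Lemma cos_theta_gt0 : 0 < cos th.
Proof.
apply: cos_gt0_pihalf; have := le_lt_trans theta_bound gpi.
by rewrite ltr_norml.
Qed.

(** A lower bound of [cos slant], uniform in eps: [slant] is [1 - 2 g / pi] times
    [pi - arg sqrt eps], and (1 - 2 g / pi) (pi / 2 + g) = pi / 2 - 2 g^2 / pi. *)
Definition slope : R := sin (2 * g ^+ 2 / pi).

Lemma slope_arg : 0 < 2 * g ^+ 2 / pi < pi / 2.
Proof.
apply/andP; split; first by rewrite divr_gt0 // mulr_gt0 // exprn_gt0.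
have -> : 2 * g ^+ 2 / pi = g * (2 * g / pi) by ring.
by move: gpi; rewrite mulrDr mulr1; move: g0; lra.
Qed.

Lemma slope_gt0 : 0 < slope.
Proof. exact: sin_gt0_pihalf slope_arg. Qed.

Lemma cos_slant : slope <= cos slant.
Proof.
have [s1 s2] := andP slope_arg.
have E : slant = (1 - 2 * g / pi) * (pi - arg_sqrt_eps w) by rewrite /slant /th /theta_hat; ring.
have gp := gamma_pi.
have b : `|slant| <= pi / 2 - 2 * g ^+ 2 / pi.
  have E' (x p : R) : p != 0 -> p / 2 - 2 * x ^+ 2 / p = (1 - 2 * x / p) * (p / 2 + x) by move=> h; field.
  rewrite (E' _ _ pn0).
  have g1 : 0 <= 1 - 2 * g / pi by rewrite subr_ge0 ltW.
  rewrite E normrM (ger0_norm g1); apply: ler_wpM2l => //.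
  by apply: ltW; exact: beta_bound.
have -> : cos slant = cos `|slant| by case: (ger0P slant) => // _; rewrite cosN.
have -> : slope = cos (pi / 2 - 2 * g ^+ 2 / pi) by rewrite cosB cos_pihalf sin_pihalf mul0r add0r mul1r.
move: b; move: `|slant| (normr_ge0 slant) => y y0 b.
have i1 : y \in `[0, pi]%R by rewrite in_itv /= y0 /=; move: b s1 p0; lra.
have i2 : pi / 2 - 2 * g ^+ 2 / pi \in `[0, pi]%R.
  by rewrite in_itv /=; apply/andP; split; move: s1 s2 p0; lra.
rewrite leNgt; apply/negP; rewrite (ltr_cos i2 i1); by rewrite ltNge b.
Qed.

Lemma cos_slant_gt0 : 0 < cos slant.
Proof. exact: lt_le_trans slope_gt0 cos_slant. Qed.

Definition dir : C := cos th +i* sin th.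

(* Oblique coordinates: [u] runs along the boundary lines of [Gamma], [m] counts periods of [xt];
   on the line [m = -1/2], [xt] goes from [xhat Right] to [xhat Left]. *)
Definition lin (m u : R) : C := m%:C * period w + u%:C * dir.

(** The component of [period] orthogonal to [dir], that is the distance between the lines [m] and
    [m + 1]. *)
Definition height : R := pi / cm q * cos slant.

Lemma height_gt0 : 0 < height.
Proof. by rewrite mulr_gt0 ?cos_slant_gt0 // divr_gt0 // cm_sqrt_eps_gt0. Qed.

Lemma cm_dir : cm dir = 1.
Proof. by rewrite /dir /cm /= cos2Dsin2 sqrtr1. Qed.

Lemma sqrt_polar : q = (cm q)%:C * (cos (arg_sqrt_eps w) +i* sin (arg_sqrt_eps w)).
Proof.
have E : w / 2 = (complex.Re w / 2) +i* arg_sqrt_eps w.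
  apply: (@mulIf _ (2 : C)); first by rewrite pnatr_eq0.
  rewrite divfK ?pnatr_eq0 // /arg_sqrt_eps /arg_eps; case: (w) => a b.
  by apply/eqP; rewrite eq_complex /=; apply/andP; split; apply/eqP; field.
rewrite /q /sqrt_eps cm_cexp {1}E /cexp /= E /=.
by apply/eqP; rewrite eq_complex /=; apply/andP; split; apply/eqP; ring.
Qed.

Lemma q_dir : q * dir = (cm q)%:C * ((- cos slant) +i* sin slant).
Proof.
have E : slant = pi - (arg_sqrt_eps w + th) by rewrite /slant; ring.
rewrite {1}sqrt_polar -mulrA; congr (_ * _); rewrite E cosB sinB cospi sinpi !mul0r addr0 sub0r !mulN1r !opprK.
rewrite cosD sinD /dir; apply/eqP; rewrite eq_complex /=; apply/andP; split; apply/eqP; ring.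
Qed.

Lemma period_dir : period w = dir * ((- (pi / cm q * sin slant)) +i* height).
Proof.
have cq : cm q != 0 by rewrite gt_eqF // cm_sqrt_eps_gt0.
have q0 : q != 0 := sqrt_eps_neq0 w.
apply: (mulfI q0); rewrite [RHS]mulrA q_dir /period -/q mulrCA divff // mulr1 /height.
have := cos2Dsin2 slant; move: (cos slant) (sin slant) => c s cs; move: (cm q) cq => r rn0.
apply/eqP; rewrite eq_complex /=; apply/andP; split; apply/eqP.
  by field.
transitivity (- (pi * (c ^+ 2 + s ^+ 2))); last by field.
by rewrite cs mulr1; ring.
Qed.

Definition abscissa (m u : R) : R := u - m * (pi / cm q * sin slant).

Lemma lin_dir m u : lin m u = dir * (abscissa m u +i* (m * height)).
Proof.
rewrite /lin period_dir /abscissa; apply/eqP; rewrite eq_complex /=; apply/andP; split; apply/eqP; ring.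
Qed.

Lemma Re_lin m u : complex.Re (lin m u) = cos th * abscissa m u - sin th * (m * height).
Proof. by rewrite lin_dir. Qed.

Lemma Im_lin m u : complex.Im (lin m u) = tan th * complex.Re (lin m u) + m * height / cos th.
Proof.
have c0 := cos_theta_gt0; rewrite lin_dir /= /tan.
have E : sin th ^+ 2 = 1 - cos th ^+ 2 by rewrite -(cos2Dsin2 th) addrAC subrr add0r.
have -> : m * height / cos th = m * height * (cos th ^+ 2 + sin th ^+ 2) / cos th by rewrite cos2Dsin2 mulr1.
by field; rewrite gt_eqF.
Qed.

Lemma lin_addP m u k : lin m u + k%:C * period w = lin (m + k) u.
Proof. by rewrite /lin rmorphD mulrDl addrAC. Qed.

Lemma cm_ee_lin m u : cm (ee w (lin m u)) = expR (- (2 * u * cm q * cos slant)).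
Proof.
rewrite /ee cm_cexp; congr expR.
have -> : 2 * q * lin m u = m%:C * (2 * q * period w) + (2 * u)%:C * (q * dir).
  by rewrite /lin rmorphM; ring.
by rewrite period_q q_dir /tpi /=; ring.
Qed.

Definition clamp (b u : R) : R := u - soft b u.

Lemma clampP (b u : R) : 0 <= b -> [/\ `|clamp b u| <= b, b <= u -> clamp b u = b & u <= - b -> clamp b u = - b].
Proof.
move=> b0; rewrite /clamp; case: (soft_cases u b0) => [[u1 u2 ->]|[u1 ->]|[u1 ->]]; split.
- by rewrite subr0 ler_norml u1.
- by move=> h; rewrite subr0; apply/eqP; rewrite eq_le u2.
- by move=> h; rewrite subr0; apply/eqP; rewrite eq_le u1 h.
- by rewrite opprB addrC subrK ger0_norm.
- by move=> _; rewrite opprB addrC subrK.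
- by move: u1 b0; lra.
- by rewrite opprD addrA subrr sub0r normrN ger0_norm.
- by move: u1 b0; lra.
- by move=> _; rewrite opprD addrA subrr sub0r.
Qed.

Let b := Defs.c0 G / cm q.

(** [sigma] is the tangent times [Re t] minus its clamped part, so in the comparison with [Im t] the
    linear parts cancel and only the clamped part remains. *)
Lemma Gamma_down_lin m u : 0 <= b -> ~ hole G w (lin m u) -> - (2^-1 + kappa G) < m ->
  m * height / cos th + tan th * clamp b (complex.Re (lin m u)) < Defs.h G -> Gamma G Down w (lin m u).
Proof.
move=> b0 nh hm hc; split=> //.
  by rewrite sigmaE Im_lin -/b -/th; move: hc; rewrite /clamp mulrBr; lra.
rewrite /above opprK lin_addP Im_lin -/th ltrDl mulr_gt0 ?invr_gt0 ?cos_theta_gt0 // mulr_gt0 ?height_gt0 //.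
by move: hm; lra.
Qed.

Lemma Gamma_up_lin m u : 0 <= b -> ~ hole G w (lin m u) -> m < 2^-1 + kappa G ->
  - Defs.h G < m * height / cos th + tan th * clamp b (complex.Re (lin m u)) -> Gamma G Up w (lin m u).
Proof.
move=> b0 nh hm hc; split=> //.
  by rewrite sigmaE Im_lin -/b -/th; move: hc; rewrite /clamp mulrBr; lra.
rewrite /below; have -> : lin m u - (2^-1 + kappa G)%:C * period w = lin (m - (2^-1 + kappa G)) u.
  by rewrite -lin_addP rmorphN mulNr.
rewrite Im_lin -/th gtrDl pmulr_llt0 ?invr_gt0 ?cos_theta_gt0 // pmulr_llt0 ?height_gt0 //.
by move: hm; lra.
Qed.

Lemma far_left m u : cm (ee w (lin m u)) <= 1 / 2 ->
  [/\ ee w (lin m u) != 1, cm (xt w (lin m u)) <= 3 * cm q &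
      cm (xt w (lin m u) - q) <= 4 * cm q * cm (ee w (lin m u))].
Proof.
move=> h; set E := ee w (lin m u) in h *.
have h1 : E != 1 by apply: contraTneq h => ->; rewrite cm1; apply/negP; lra.
have c0 := cm_ge0 E.
have d1 : 1 / 2 <= cm (E - 1) by have := cm_sub 1 E; rewrite cm1 cmBC; move: h; lra.
have d2 : cm (E + 1) <= 3 / 2 by have := cmD E 1; rewrite cm1; move: h; lra.
have d0 : 0 < cm (E - 1) by move: d1; lra.
have cq := cm_ge0 q.
split=> //.
  rewrite xtE // cmM cmN cmM cmV -/E -/q mulrC ler_wpM2r //.
  by rewrite ler_pdivrMr //; move: d1 d2; lra.
rewrite xt_subq // cmM cmV -/E -/q cmM cmM cmN cm_nat ler_pdivrMr //.
have : 0 <= cm q * cm E by rewrite mulr_ge0.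
have -> : 2 * cm q * cm E = 2 * (cm q * cm E) by ring.
have -> : 4 * cm q * cm E * cm (E - 1) = 4 * (cm q * cm E) * cm (E - 1) by ring.
by move: (cm q * cm E) d1 => y; nra.
Qed.

Lemma far_right m u : 2 <= cm (ee w (lin m u)) ->
  [/\ ee w (lin m u) != 1, cm (xt w (lin m u)) <= 3 * cm q &
      cm (xt w (lin m u) + q) <= 4 * cm q / cm (ee w (lin m u))].
Proof.
move=> h; set E := ee w (lin m u) in h *.
have h1 : E != 1 by apply: contraTneq h => ->; rewrite cm1; apply/negP; lra.
have d1 : cm E / 2 <= cm (E - 1) by have := cm_sub E 1; rewrite cm1; move: h; lra.
have d2 : cm (E + 1) <= cm E * (3 / 2) by have := cmD E 1; rewrite cm1; move: h; lra.
have d0 : 0 < cm (E - 1) by move: d1 h; lra.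
have e0 : 0 < cm E by move: h; lra.
have cq := cm_ge0 q.
split=> //.
  rewrite xtE // cmM cmN cmM cmV -/E -/q mulrC ler_wpM2r //.
  by rewrite ler_pdivrMr //; move: d1 d2; lra.
rewrite xt_addq // cmM cmV -/E -/q cmM cmN cm_nat ler_pdivrMr // mulrAC ler_pdivlMr //.
by move: cq d1 => ? ?; nra.
Qed.

(** Bound of the exponential in [middle_line] once its parameter exceeds pi / 2; [spread] is the
    resulting bound of |x| / |sqrt eps|. *)
Definition zeta : R := expR (- (pi / 2 * slope)).

Lemma zeta_bound : 0 < zeta < 1.
Proof. by rewrite expR_gt0 /= expR_lt1 oppr_lt0 mulr_gt0 ?slope_gt0 // divr_gt0. Qed.

Definition spread : R := (1 + zeta) / (1 - zeta).

Lemma spread_ge1 : 1 <= spread.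
Proof. by have [z0 z1] := andP zeta_bound; rewrite ler_pdivlMr ?subr_gt0 // mul1r; lra. Qed.

Lemma ee_half u : ee w (lin (- 2^-1) u) = - cexp ((2 * u)%:C * (q * dir)).
Proof.
have -> : ee w (lin (- 2^-1) u) = cexp (0 +i* pi) * cexp ((2 * u)%:C * (q * dir)).
  rewrite -cexpD /ee; congr cexp.
  have -> : 2 * q * lin (- 2^-1) u = (- 2^-1)%:C * (2 * q * period w) + (2 * u)%:C * (q * dir).
    by rewrite /lin [(2 * u)%:C]rmorphM; ring.
  rewrite period_q; congr (_ + _); apply/eqP; rewrite eq_complex /=; apply/andP; split; apply/eqP; first by ring.
  by field.
rewrite -mulN1r; congr (_ * _); rewrite /cexp /= expR0 cospi sinpi.
by apply/eqP; rewrite eq_complex /=; apply/andP; split; apply/eqP; ring.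
Qed.

(** Half a period turns the exponential into [- Z], so that [|x| = |q| |1 - Z| / |1 + Z|]. For
    [|v| <= pi / 2] the real part of [Z] is nonnegative and the quotient at most 1; for larger
    [|v|], [|Z|] is at most [zeta] or at least its inverse. The bound does not depend on eps. *)
Lemma middle_line u : ee w (lin (- 2^-1) u) != 1 /\ cm (xt w (lin (- 2^-1) u)) <= spread * cm q.
Proof.
have [z0 z1] := andP zeta_bound.
set Z := cexp ((2 * u)%:C * (q * dir)); have eE : ee w (lin (- 2^-1) u) = - Z := ee_half u.
have cZ : cm Z = expR (- (2 * u * cm q * cos slant)) by rewrite -(cm_ee_lin (- 2^-1)) eE cmN.
suff [h1 h2] : 1 + Z != 0 /\ cm (1 - Z) <= spread * cm (1 + Z).
  have e1 : ee w (lin (- 2^-1) u) != 1 by rewrite eE; apply: contraNneq h1 => h; rewrite -h addNr.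
  split=> //; rewrite xtE // eE cmM cmN cmM cmV -/q mulrC ler_wpM2r ?cm_ge0 //.
  have -> : cm (- Z - 1) = cm (1 + Z) by rewrite -cmN opprB opprK addrC.
  by rewrite ler_pdivrMr ?cm_gt0 // addrC.
have s1 := spread_ge1; have s0 : 0 <= spread by move: s1; lra.
have zz : 0 < 1 - zeta by rewrite subr_gt0.
pose v := 2 * u * cm q.
have [vs|vl] := lerP `|v| (pi / 2).
  have ReZ : 0 <= complex.Re Z.
    have -> : Z = cexp ((- (v * cos slant)) +i* (v * sin slant)).
      rewrite /Z q_dir /v; congr cexp; apply/eqP; rewrite eq_complex /=; apply/andP; split; apply/eqP; ring.
    rewrite /= mulr_ge0 ?expR_ge0 // cos_ge0_pihalf // -ler_norml normrM.
    have : `|sin slant| <= 1 by rewrite ler_norml sin_geN1 sin_le1.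
    by have := normr_ge0 v; have := normr_ge0 (sin slant); move: vs; nra.
  have sq (x y : R) : cm (x +i* y) = Num.sqrt (x ^+ 2 + y ^+ 2) by [].
  have h : cm (1 - Z) <= cm (1 + Z).
    case: (Z) ReZ => x y /= x0; rewrite /cm /= ler_sqrt ?addr_ge0 ?sqr_ge0 //.
    by rewrite sub0r sqrrN add0r lerD2r !expr2; move: x0; nra.
  have h1 : 1 + Z != 0.
    apply/eqP => /(congr1 (@complex.Re R)); case: (Z) ReZ => x y /= x0; move: x0; lra.
  by split=> //; apply: le_trans h _; rewrite -[X in X <= _]mul1r ler_wpM2r ?cm_ge0.
have vc : pi / 2 * slope <= `|v| * cos slant.
  by apply: ler_pM => //; [rewrite divr_ge0 // ltW|exact: ltW slope_gt0|exact: ltW|exact: cos_slant].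
have spE : spread * (1 - zeta) = 1 + zeta by rewrite /spread divfK // gt_eqF.
have a1 := cmB 1 Z; have a2 := cm_sub 1 (- Z); have a3 := cm_sub Z (- 1).
rewrite cm1 in a1 a2 a3; rewrite opprK cmN in a2; rewrite opprK cmN cm1 [Z + 1]addrC in a3.
have nz : 0 < cm (1 + Z) -> 1 + Z != 0 by rewrite cm_gt0.
have [v0|v0] := lerP 0 v.
  have Zz : cm Z <= zeta.
    by rewrite cZ ler_expR lerNl opprK -/v; move: vc; rewrite ger0_norm.
  split; first by apply: nz; move: a2 Zz z1; lra.
  apply: le_trans a1 _; apply: (@le_trans _ _ (spread * (1 - zeta))); first by rewrite spE; move: Zz; lra.
  by apply: ler_wpM2l => //; move: a2 Zz; lra.
have Zz : 1 <= cm Z * zeta.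
  rewrite cZ -expRD -[X in X <= _]expR0 ler_expR -/v; move: vc; rewrite ltr0_norm //.
  by rewrite mulNr; lra.
have cZ0 := cm_ge0 Z.
split.
  by apply: nz; move: a3 Zz z1 z0 cZ0; nra.
apply: le_trans a1 _; apply: (@le_trans _ _ (spread * (cm Z * (1 - zeta)))).
  have -> : spread * (cm Z * (1 - zeta)) = cm Z * (1 + zeta) by rewrite mulrCA spE.
  by move: Zz; lra.
by apply: ler_wpM2l => //; move: a3 Zz; lra.
Qed.

Lemma ee_far e : 0 < e -> exists2 U : R, 0 <= U & forall m u,
  (U <= u -> cm (ee w (lin m u)) <= e) /\ (u <= - U -> e^-1 <= cm (ee w (lin m u))).
Proof.
move=> e0; have k0 : 0 < 2 * cm q * cos slant by rewrite mulr_gt0 ?cos_slant_gt0 // mulr_gt0 ?cm_sqrt_eps_gt0.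
have U0 : 0 < (e * (2 * cm q * cos slant))^-1 by rewrite invr_gt0 mulr_gt0.
exists (e * (2 * cm q * cos slant))^-1; first exact: ltW.
have H u : (e * (2 * cm q * cos slant))^-1 <= u -> e^-1 <= expR (2 * u * cm q * cos slant).
  move=> hu; apply: le_trans (expR_ge1Dx _).
  have -> : 2 * u * cm q * cos slant = u * (2 * cm q * cos slant) by ring.
  move: hu; rewrite invfM ler_pdivrMr // => h; move: h; lra.
move=> m u; rewrite cm_ee_lin; split=> hu.
  by rewrite expRN invf_ple ?posrE ?expR_gt0 //; exact: H.
have := H (- u); rewrite lerNr => /(_ hu); congr (_ <= expR _); ring.
Qed.

End LineGeometry.

Section MatrixIdentity.
Variables (R : realType) (n : nat).
Local Notation C := R[i].

Definition mzero_near (Z : C -> 'M[C]_n) (c : C) := exists2 d : R, 0 < d & forall z, cm (z - c) < d -> Z z = 0.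

Lemma identity_segment_mx (Z : C -> 'M[C]_n) (p q : C) :
  (forall t : R, 0 <= t <= 1 -> exists2 r : R, 0 < r & forall z, cm (z - (p + t%:C * (q - p))) < r -> mder Z z) ->
  mzero_near Z p -> mzero_near Z q.
Proof.
move=> hol [d d0 hd].
have H (a : 'I_n * 'I_n) : exists2 r : R, 0 < r & forall z, cm (z - q) < r -> Z z a.1 a.2 = 0.
  apply: (@identity_segment R (fun z => Z z a.1 a.2) p q).
    move=> t ht; have [r r0 hr] := hol t ht; exists r => // z zr; exact: hr.
  by exists d => // z zd; rewrite hd // mxE.
have [|r r0 hr] := @fin_radius R ('I_n * 'I_n)%type (fun a r => forall z, cm (z - q) < r -> Z z a.1 a.2 = 0) _ H.
  by move=> a r r' /andP[r'0 rr] h z zr; apply: h; apply: lt_le_trans rr.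
by exists r => // z zr; apply/matrixP => i j; rewrite mxE; apply: (hr (i, j)).
Qed.

Lemma mzero_of_derivative (Z : C -> 'M[C]_n) (c : C) (r : R) : 0 < r ->
  (forall z, cm (z - c) < r -> mhasd Z z 0) -> Z c = 0 -> mzero_near Z c.
Proof.
move=> r0 h Zc; exists r => // z zr; apply/matrixP => i j.
rewrite -[in RHS]Zc; apply: (zero_derivative (r := r) (f := fun z => Z z i j)) => // z' z'r.
by have := h z' z'r i j; rewrite mxE.
Qed.

End MatrixIdentity.

Section RealBounds.
Variable R : realType.
Local Notation C := R[i].

Lemma Re_derive (S : C -> C) (p d b : C) (u : R) :
  hasd S (p + u%:C * d) b -> is_derive u (1 : R) (fun u => complex.Re (S (p + u%:C * d))) (complex.Re (d * b)).
Proof.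
move=> h.
have cv : (fun k : R => k^-1 *: (complex.Re (S (p + (k *: (1 : R) + u)%:C * d)) - complex.Re (S (p + u%:C * d)))) @ 0^' --> complex.Re (d * b).
  apply/cvgrPdist_lt => e e0; have D1 : 0 < cm d + 1 by rewrite ltr_wpDl ?cm_ge0.
  have [r r0 hr] := h (e / (2 * (cm d + 1))) ltac:(by rewrite divr_gt0 ?mulr_gt0).
  apply/nbhs_ballP; exists (r / (cm d + 1)); first by rewrite /= divr_gt0.
  move=> k /=; rewrite /ball /= sub0r normrN ltr_pdivlMr // => kr kn0.
  have kd : cm (k%:C * d) < r.
    by rewrite cmM cmR; apply: le_lt_trans kr; rewrite mulrDr mulr1 lerDl.
  have H := hr _ kd; rewrite cmM cmR in H.
  have E : p + u%:C * d + k%:C * d = p + (k + u)%:C * d by rewrite rmorphD; ring.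
  rewrite E in H.
  have -> : k *: (1 : R) = k by rewrite -[_ *: _]/(k * 1) mulr1.
  rewrite -[k^-1 *: _]/(k^-1 * _).
  have -> : complex.Re (d * b) - k^-1 * (complex.Re (S (p + (k + u)%:C * d)) - complex.Re (S (p + u%:C * d))) =
     - (k^-1 * complex.Re (S (p + (k + u)%:C * d) - S (p + u%:C * d) - b * (k%:C * d))).
    have -> : complex.Re (S (p + (k + u)%:C * d) - S (p + u%:C * d) - b * (k%:C * d)) =
       complex.Re (S (p + (k + u)%:C * d)) - complex.Re (S (p + u%:C * d)) - k * complex.Re (d * b).
      by rewrite !ReB; congr (_ - _); case: (b) => b1 b2; case: (d) => d1 d2 /=; ring.
    by rewrite [in RHS]mulrBr mulKf // opprB.
  rewrite normrN normrM normfV mulrC ltr_pdivrMr ?normr_gt0 //.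
  apply: le_lt_trans (Re_le_cm _) _; apply: le_lt_trans H _.
  rewrite mulrA [X in _ < X]mulrC [X in X < _]mulrAC [X in X < _]mulrC ltr_pM2l ?normr_gt0 //.
  rewrite mulrAC ltr_pdivrMr ?mulr_gt0 //; have := cm_ge0 d; move: e0; clear; nra.
split; first by apply/cvg_ex; exists (complex.Re (d * b)).
by rewrite /derive; apply/cvg_lim.
Qed.

Lemma real_MVT (f df : R -> R) (a b : R) : (forall x : R, is_derive x (1 : R) f (df x)) -> a <= b ->
  exists2 c, a <= c <= b & f b - f a = df c * (b - a).
Proof.
move=> hf ab.
have cf : continuous f.
  by move=> x; apply: differentiable_continuous; apply/derivable1_diffP; have [] := hf x.
have [c ci e] := MVT_segment ab (fun z _ => hf z) (continuous_subspaceT cf).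
by exists c => //; move: ci; rewrite in_itv.
Qed.

Lemma decay_right (f df : R -> R) (U c : R) : 0 < c -> (forall x : R, is_derive x (1 : R) f (df x)) ->
  (forall u, U <= u -> df u <= - c) -> forall e, 0 < e -> exists2 V, U <= V & forall u, V <= u -> expR (f u) <= e.
Proof.
move=> c0 h hd e e0; exists (U + `|ln e - f U| / c); first by rewrite lerDl divr_ge0 // ltW.
move=> u hu; have Uu : U <= u by apply: le_trans hu; rewrite lerDl divr_ge0 // ltW.
have [x /andP[x1 x2] E] := real_MVT h Uu.
have d1 : f u - f U <= - c * (u - U) by rewrite E ler_wpM2r ?subr_ge0 // hd.
have d2 : `|ln e - f U| <= c * (u - U) by rewrite mulrC -ler_pdivrMr // lerBrDl.
rewrite -[e]lnK ?posrE // ler_expR.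
have := ler_norm (- (ln e - f U)); rewrite normrN; move: d1 d2; clear; rewrite mulNr; lra.
Qed.

(** The two extreme rotations force [Re z > 0] and bound [cos a * x - sin a * |y|] below; smaller
    angles only increase the cosine and decrease the sine. *)
Lemma rotate_bound (a t c : R) (z : C) : 0 < a < pi / 2 -> `|t| <= a -> 0 < c ->
  c < complex.Re (polar 1 a * z) -> c < complex.Re (polar 1 (- a) * z) ->
  c < complex.Re ((cos t +i* sin t) * z).
Proof.
move=> /andP[a0 ap] ta c0; case: z => x y; rewrite /polar /= !mul1r cosN sinN => h1 h2.
have p0 := @pi_gt0 R.
have ca : 0 < cos a by apply: cos_gt0_pihalf; apply/andP; split; lra.
have sa : 0 < sin a by apply: sin_gt0_pihalf; apply/andP; split.
have t0 := normr_ge0 t.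
have ct : cos a <= cos t.
  have -> : cos t = cos `|t| by case: (ger0P t) => // _; rewrite cosN.
  rewrite leNgt; apply/negP; rewrite ltr_cos ?in_itv /=; first by rewrite ltNge ta.
    by apply/andP; split; lra.
  by rewrite t0 /=; lra.
have st : `|sin t| <= sin a.
  have E : `|sin t| = sin `|t|.
    case: (ger0P t) => ht.
      rewrite ger0_norm //; apply: sin_ge0_pi; rewrite ht /=; move: ta; rewrite ger0_norm //; lra.
    have s0 : 0 <= sin (- t) by apply: sin_ge0_pi; move: ta; rewrite ltr0_norm // => ta; apply/andP; split; lra.
    by rewrite -[LHS]normrN -sinN ger0_norm.
  rewrite E leNgt; apply/negP; rewrite ltr_sin ?in_itv /=; first by rewrite ltNge ta.
    by apply/andP; split; lra.
  by apply/andP; split; lra.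
have x0 : 0 < x by nra.
have h3 : c < cos a * x - sin a * `|y| by case: (ger0P y) => _; nra.
have h4 : sin t * y <= sin a * `|y|.
  apply: le_trans (ler_norm _) _; rewrite normrM; apply: ler_wpM2r => //; exact: normr_ge0.
have h5 : cos a * x <= cos t * x by rewrite ler_wpM2r // ltW.
by lra.
Qed.

End RealBounds.

(** * The line and its two ends inside the sectors *)

Section LinePoints.
Variables (R : realType) (G : geometry R) (w : R[i]).
Local Notation C := R[i].
Hypotheses (g0 : 0 < gamma G) (gpi : gamma G * (1 + 2 * gamma G / pi) < pi / 2) (Sw : param_sector G w).
Hypotheses (c00 : 0 <= Defs.c0 G) (c01 : Defs.c0 G <= pi * slope G / 4) (k0 : 0 < kappa G) (h0 : 0 < Defs.h G).
Hypotheses (r3 : 3 * cm (sqrt_eps w) < Defs.rad G) (rs : spread G * cm (sqrt_eps w) < Defs.rad G).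

Let q := sqrt_eps w.
Let th := theta_hat G w.
Let b := Defs.c0 G / cm q.
Let qp : 0 < cm q := cm_sqrt_eps_gt0 w.
Let cth : 0 < cos th := cos_theta_gt0 g0 gpi Sw.
Let hp : 0 < height G w := height_gt0 g0 gpi Sw.

Lemma b_ge0 : 0 <= b. Proof. by rewrite divr_ge0 // ltW. Qed.

(** This is where [c0 <= pi * slope / 4] is spent: the flat part of the boundary of [Gamma] shifts
    it by at most a quarter of a period, so the lines [m = -1/2] and [m = 1/2] are not reached. *)
Lemma b_height : b <= height G w / 4.
Proof.
rewrite /b /height -/q ler_pdivrMr //.
have -> : pi / cm q * cos (slant G w) / 4 * cm q = pi * cos (slant G w) / 4.
  by move: (gt_eqF qp); move: (cm q) (pi : R) => x y x0; field; rewrite x0.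
apply: le_trans c01 _; rewrite ler_pM2r ?invr_gt0 // ler_pM2l ?pi_gt0 //; exact: cos_slant.
Qed.

Lemma tan_clamp u : `|tan th * clamp b u| <= height G w / 4 / cos th.
Proof.
have [cb _ _] := clampP u b_ge0.
rewrite normrM /tan normrM normfV (gtr0_norm cth) mulrAC ler_pM2r ?invr_gt0 //.
rewrite -[leRHS]mul1r; apply: ler_pM => //; first exact: sin_max.
by apply: le_trans cb b_height.
Qed.

Lemma ee_lin_shift u : ee w (lin G w 2^-1 u) = ee w (lin G w (- 2^-1) u) /\
  (ee w (lin G w (- 2^-1) u) != 1 -> xt w (lin G w 2^-1 u) = xt w (lin G w (- 2^-1) u)).
Proof.
have -> : lin G w 2^-1 u = lin G w (- 2^-1) u + 1%:~R * period w.
  rewrite -[1%:~R * _]/(1%:C * _) lin_addP; congr lin; lra.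
by split=> [|e1]; [exact: ee_period|exact: xt_period].
Qed.

Lemma middle_down u : gpt G Down w (lin G w (- 2^-1) u).
Proof.
have [e1 x1] := middle_line g0 gpi Sw u; have xr := le_lt_trans x1 rs.
split=> //; apply: (Gamma_down_lin g0 gpi Sw b_ge0); first exact: not_hole.
  by rewrite ltrN2 ltrDl.
have := tan_clamp (complex.Re (lin G w (- 2^-1) u)); rewrite ler_norml => /andP[_ hu].
apply: le_lt_trans h0; rewrite -/th -/q -/b.
apply: (@le_trans _ _ (- 2^-1 * height G w / cos th + height G w / 4 / cos th)); first by rewrite lerD2l.
by rewrite -mulrDl pmulr_lle0 ?invr_gt0 //; move: hp; lra.
Qed.

Lemma middle_up u : gpt G Up w (lin G w 2^-1 u).
Proof.
have [e1 x1] := middle_line g0 gpi Sw u; have xr := le_lt_trans x1 rs.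
have [e2 x2] := ee_lin_shift u.
have e3 : ee w (lin G w 2^-1 u) != 1 by rewrite e2.
have xr2 : cm (xt w (lin G w 2^-1 u)) < Defs.rad G by rewrite x2.
split=> //; apply: (Gamma_up_lin g0 gpi Sw b_ge0); first exact: not_hole.
  by rewrite ltrDl.
have := tan_clamp (complex.Re (lin G w 2^-1 u)); rewrite ler_norml => /andP[hu _].
apply: (@lt_le_trans _ _ 0); first by rewrite oppr_lt0.
rewrite -/th -/q -/b.
apply: (@le_trans _ _ (2^-1 * height G w / cos th - height G w / 4 / cos th)); last by rewrite lerD2l.
by rewrite -mulrBl pmulr_lge0 ?invr_gt0 //; move: hp; lra.
Qed.

Definition orient (nd : node) : R := if nd is Left then 1 else -1.

Lemma orient_sqr nd : orient nd * orient nd = 1. Proof. by case: nd; rewrite /orient; ring. Qed.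

(** [|ee|] on [lin m u] does not depend on [m], so one [U] serves all lines. The 5 in [e1] leaves
    room for the factor 4 of [far_left] and [far_right]. *)
Lemma far_node (e : R) : 0 < e -> exists2 U : R, 0 <= U & forall nd m u, U <= orient nd * u ->
  [/\ ee w (lin G w m u) != 1, cm (xt w (lin G w m u)) < Defs.rad G & cm (xt w (lin G w m u) - xhat nd w) < e].
Proof.
move=> e0; pose e1 := Num.min (1 / 2) (e / (5 * cm q)).
have q5 : 0 < 5 * cm q by rewrite mulr_gt0.
have e10 : 0 < e1 by apply: min_gt0; apply: divr_gt0.
have [e12 e1e] : e1 <= 1 / 2 /\ e1 <= e / (5 * cm q) by rewrite /e1 !ge_min !lexx orbT.
have sm x : x <= e1 -> 4 * cm q * x < e.
  move=> xe; apply: (@le_lt_trans _ _ (4 * cm q * (e / (5 * cm q)))).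
    by rewrite ler_pM2l ?mulr_gt0 // (le_trans xe).
  rewrite mulrA ltr_pdivrMr // mulrC ltr_pM2l // ltr_pM2r //; lra.
have [U U0 hU] := ee_far g0 gpi Sw e10; exists U => // -[] m u; rewrite /orient => hu.
  have [+ _] := hU m u; rewrite -[u]mul1r => /(_ hu) {}hu.
  rewrite mul1r in hu *; have [a1 a2 a3] := far_left (le_trans hu e12).
  split=> //; first exact: le_lt_trans r3.
  by apply: le_lt_trans a3 _; exact: sm.
have [_ hu'] := hU m u; have {}hu' := hu' ltac:(by rewrite lerNr -mulN1r).
have e2 : 2 <= e1^-1 by rewrite -[2]invrK lef_pV2 ?posrE ?invr_gt0 //; move: e12; rewrite div1r.
have [a1 a2 a3] := far_right (le_trans e2 hu').
split=> //; first exact: le_lt_trans r3.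
rewrite /xhat opprK; apply: le_lt_trans a3 _; apply: sm.
by rewrite -[e1]invrK lef_pV2 ?posrE ?invr_gt0 // cm_gt0 ee_neq0.
Qed.

Lemma far_Re : exists2 U : R, 0 <= U & forall nd m u, `|m| <= 2^-1 -> U <= orient nd * u ->
  b < orient nd * complex.Re (lin G w m u).
Proof.
have [k kE] : exists k, k = pi / cm q * sin (slant G w) by eexists.
pose U := (b + `|k| + height G w + 1) / cos th.
have U0 : 0 <= U by rewrite divr_ge0 ?ltW // ltr_wpDl // ?addr_ge0 ?b_ge0 // ltW.
exists U => // nd m u m2 hu; rewrite Re_lin -/th /abscissa -/q -kE.
move: hu; rewrite /U ler_pdivrMr // => hu.
have cN : `|cos th| <= 1 by exact: cos_max.
have sN : `|sin th| <= 1 by exact: sin_max.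
have h1 : `|cos th * (m * k)| <= `|k|.
  rewrite !normrM -[leRHS]mul1r; apply: ler_pM => //; first by rewrite mulr_ge0.
  by rewrite ler_piMl //; move: m2; lra.
have h2 : `|sin th * (m * height G w)| <= height G w.
  rewrite 2!normrM (gtr0_norm hp) -[leRHS]mul1r; apply: ler_pM => //; first by rewrite mulr_ge0 // ltW.
  by rewrite ler_piMl ?ltW //; move: m2; lra.
have h3 : `|orient nd| = 1 by case: (nd); rewrite /orient ?normrN normr1.
have h4 : orient nd * (cos th * (u - m * k) - sin th * (m * height G w)) =
   orient nd * u * cos th - orient nd * (cos th * (m * k)) - orient nd * (sin th * (m * height G w)) by ring.
rewrite h4; move: h1 h2; rewrite -[`|cos th * _|]mul1r -[`|sin th * _|]mul1r -h3 -!normrM.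
move: (ler_norm (orient nd * (cos th * (m * k)))) (ler_norm (orient nd * (sin th * (m * height G w)))); lra.
Qed.

(* Far out on the side of [nd], [Gamma Down] lies below this value of [m], up to the overlap [h],
   and [Gamma Up] above it. *)
Definition crossing nd : R := - (orient nd * b * sin th / height G w).

Lemma crossing_small nd : `|crossing nd| <= 4^-1.
Proof.
have h3 : `|orient nd| = 1 by case: (nd); rewrite /orient ?normrN normr1.
rewrite /crossing normrN 3!normrM h3 mul1r normfV (gtr0_norm hp) ler_pdivrMr // (ger0_norm b_ge0).
apply: (@le_trans _ _ (b * 1)); first by rewrite ler_wpM2l ?b_ge0 // sin_max.
by rewrite mulr1 mulrC; exact: b_height.
Qed.

Lemma clamp_crossing nd m u : b < orient nd * complex.Re (lin G w m u) ->
  m * height G w / cos th + tan th * clamp b (complex.Re (lin G w m u)) = (m - crossing nd) * (height G w / cos th).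
Proof.
move=> hu; have [_ c1 c2] := clampP (complex.Re (lin G w m u)) b_ge0.
have -> : clamp b (complex.Re (lin G w m u)) = orient nd * b.
  move: hu; case: (nd); rewrite /orient ?mul1r ?mulN1r => hu; first by rewrite c1 // ltW.
  by rewrite c2 // lerNr ltW.
rewrite /crossing /tan.
by move: (gt_eqF hp) (gt_eqF cth); move: (height G w) (cos th) (orient nd) (sin th) b => x y z s c x0 y0; field; rewrite x0 y0.
Qed.

(** Far out, the segment from [m = -1/2] to the crossing stays in [Gamma Down] and the one from the
    crossing to [m = 1/2] in [Gamma Up]; the crossing point is in both, thanks to [h > 0]. *)
Lemma far_gpt : exists2 U : R, 0 <= U & forall nd m u, U <= orient nd * u ->
  (- 2^-1 <= m <= crossing nd -> gpt G Down w (lin G w m u)) /\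
  (crossing nd <= m <= 2^-1 -> gpt G Up w (lin G w m u)) /\
  (`|m| <= 2^-1 -> 0 < orient nd * complex.Re (lin G w m u)).
Proof.
have [U1 U10 h1] := far_node ltr01; have [U2 U20 h2] := far_Re.
exists (Num.max U1 U2); first by rewrite le_max U10.
move=> nd m u; rewrite ge_max => /andP[u1 u2].
have [e1 xr _] := h1 nd m u u1; have [cr1 cr2] : - 4^-1 <= crossing nd /\ crossing nd <= 4^-1.
  by have := crossing_small nd; rewrite ler_norml => /andP.
have nh := not_hole e1 xr.
have hc : 0 < height G w / cos th by rewrite divr_gt0.
split; [move=> /andP[m1 m2]|split; [move=> /andP[m1 m2]|]].
- have hb : b < orient nd * complex.Re (lin G w m u) by apply: h2 => //; rewrite ler_norml m1 /=; lra.
  split=> //; apply: (Gamma_down_lin g0 gpi Sw b_ge0) => //; first by move: m1 k0; lra.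
  rewrite -/th -/q -/b (clamp_crossing hb); apply: le_lt_trans h0.
  by rewrite pmulr_lle0 // subr_le0.
- have hb : b < orient nd * complex.Re (lin G w m u) by apply: h2 => //; rewrite ler_norml m2 andbT; lra.
  split=> //; apply: (Gamma_up_lin g0 gpi Sw b_ge0) => //; first by move: m2 k0; lra.
  rewrite -/th -/q -/b (clamp_crossing hb); apply: (@lt_le_trans _ _ 0); first by rewrite oppr_lt0.
  by rewrite pmulr_lge0 // subr_ge0.
- by move=> m2; apply: le_lt_trans b_ge0 _; apply: h2.
Qed.

End LinePoints.

(** * The connection matrix for one value of eps-hat *)

Section Necessity.
Variables (R : realType) (n : nat) (G : geometry R) (w : R[i]).
Local Notation C := R[i].
Hypotheses (g0 : 0 < gamma G) (gpi : gamma G * (1 + 2 * gamma G / pi) < pi / 2) (Sw : param_sector G w).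
Hypotheses (c00 : 0 <= Defs.c0 G) (c01 : Defs.c0 G <= pi * slope G / 4) (k0 : 0 < kappa G) (h0 : 0 < Defs.h G).
Hypotheses (r3 : 3 * cm (sqrt_eps w) < Defs.rad G) (rs : spread G * cm (sqrt_eps w) < Defs.rad G).
Variables (L0 L1 : C -> 'rV[C]_n) (B1 B2 : C -> C -> 'M[C]_n).
Variables (F H1 H2 : side -> C -> C -> 'M[C]_n) (C1 C2 : node -> C -> 'M[C]_n) (l : C -> C -> C).
Hypotheses (hl : log_in_time G L0 L1 F l).
Hypotheses (w1 : weak_collection G B1 F C1 H1) (w2 : weak_collection G B2 F C2 H2).
Hypothesis sep : Defs.separated L0 L1 G.
Variables (T : C -> 'M[C]_n) (MT : R).
Hypotheses (hT : holmx (Defs.rad G) T) (bT : forall x, cm x < Defs.rad G -> mbnd (T x) MT).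
Hypothesis odeT : forall x, cm x < Defs.rad G ->
  (x ^+ 2 - eps w) *: dmx T x = B2 (eps w) x *m T x - T x *m B1 (eps w) x.

Let q := sqrt_eps w.
Let line u := lin G w (- 2^-1) u.
Let f t := diag_mx (frow L0 L1 l w t).
Let W1 t := H1 Down w (xt w t) *m F Down w (xt w t).
Let W2 t := H2 Down w (xt w t) *m F Down w (xt w t).

Definition connection t := invmx (W2 t) *m (T (xt w t) *m W1 t).

Let lineP u : gpt G Down w (line u). Proof. exact: middle_down. Qed.
Let Fdown t : gpt G Down w t -> F Down w (xt w t) = f t. Proof. by move=> [gt _ _]; case: hl => _; apply. Qed.
Let uf t : f t \in unitmx. Proof. by apply/unit_diag => j; exact: frow_neq0. Qed.

Lemma unit_down (B : C -> C -> 'M[C]_n) (H : side -> C -> C -> 'M[C]_n) (Cs : node -> C -> 'M[C]_n) s t :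
  weak_collection G B F Cs H -> gpt G s w t -> H s w (xt w t) \in unitmx /\ mder (H s w) (xt w t).
Proof. by move=> [hA _ _ _ _] [gt _ _]; apply: hA => //; exists t. Qed.

Lemma unit_W2 t : gpt G Down w t -> W2 t \in unitmx.
Proof. by move=> gt; rewrite unitmx_mul (unit_down w2 gt).1 Fdown // uf. Qed.

(** [T W1] and [W2] solve the same second system, so differentiating [W2 * connection = T W1] leaves
    [W2 * connection' = 0]. *)
Lemma connection_hasd t : gpt G Down w t -> mhasd connection t 0.
Proof.
move=> gt; have [g1 et xr] := gt.
have [_ hW1 _ _ _] := w1; have [_ hW2 _ _ _] := w2.
have m1 : mhasd W1 t (B1 (eps w) (xt w t) *m W1 t) := hW1 w t Sw gt.
have m2 : mhasd W2 t (B2 (eps w) (xt w t) *m W2 t) := hW2 w t Sw gt.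
have mT : mhasd (fun t => T (xt w t)) t ((xt w t ^+ 2 - eps w) *: dmx T (xt w t)).
  by apply: mhasd_comp; [exact: xt_hasd|move=> i j; exact: (dmx_hasd hT)].
have mTW := mhasdM mT m1.
have mc : mder connection t.
  apply: mderM; first apply: mder_inv (unit_W2 gt) => i j; first by eexists; exact: m2.
  by move=> i j; eexists; exact: mTW.
have hc := mder_mhasd mc; have mWc := mhasdM m2 hc.
have [d d0 hd] := gpt_open c00 gt.
have E t' : gpt G Down w t' -> W2 t' *m connection t' = T (xt w t') *m W1 t'.
  by move=> gt'; rewrite mulmxA mulmxV ?mul1mx // unit_W2.
have := mhasd_uniq (mhasd_near _ mWc) mTW => /(_ ltac:(by exists d => // t' /hd; exact: E)).
rewrite odeT // -mulmxA E // => EQ.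
suff -> : 0 = dmx connection t by [].
apply: (can_inj (mulKmx (unit_W2 gt))); rewrite mulmx0.
move: EQ; rewrite mulmxBl -!mulmxA subrK => EQ.
by apply: (addrI (B2 (eps w) (xt w t) *m (T (xt w t) *m W1 t))); rewrite EQ addr0.
Qed.

Lemma line_seg (t u v : R) : line u + t%:C * (line v - line u) = line (u + t * (v - u)).
Proof. by rewrite /line /lin !rmorphD rmorphM rmorphB; ring. Qed.

Let K := connection (line 0).

Lemma connection_line u : connection (line u) = K.
Proof.
pose Z t := connection t - K.
have hZ t : gpt G Down w t -> exists2 d : R, 0 < d & forall z, cm (z - t) < d -> mhasd Z z 0.
  move=> gt; have [d d0 hd] := gpt_open c00 gt; exists d => // z /hd gz.
  move=> i j; have := connection_hasd gz i j; rewrite !mxE => hh.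
  apply: hasd_near; last first.
    have := hasdB hh (hasd_cst (K i j) z); rewrite subr0; exact.
  by exists 1 => // x _; rewrite /Z [RHS]mxE [(- K) i j]mxE.
have [e e0 he] : mzero_near Z (line u).
  apply: (@identity_segment_mx R n Z (line 0)).
    move=> t _; rewrite line_seg; have [r r0 hr] := hZ _ (lineP (0 + t * (u - 0))).
    by exists r => // z /hr h i j; eexists; exact: h.
  have [r r0 hr] := hZ _ (lineP 0); apply: (mzero_of_derivative r0) => //; first by rewrite /Z subrr.
by apply/eqP; rewrite -subr_eq0; apply/eqP; apply: he; rewrite subrr cm0.
Qed.

(** A full neighbourhood is needed, because continuation off the line starts from a function
    vanishing on a disc. *)
Lemma connection_near u : exists2 d : R, 0 < d & forall t, cm (t - line u) < d -> gpt G Down w t /\ connection t = K.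
Proof.
have [d d0 hd] := gpt_open c00 (lineP u); exists d; first exact: d0.
move=> t td; split; first exact: hd.
rewrite -(connection_line u).
apply/matrixP => a b; have hz z : cm (z - line u) < d -> hasd (fun z => connection z a b) z 0.
  by move=> zr; have := connection_hasd (hd z zr) a b; rewrite mxE.
exact: (@zero_derivative R d (fun z => connection z a b) (line u) hz t td).
Qed.

Lemma intertwining t : gpt G Down w t -> connection t = K ->
  T (xt w t) *m H1 Down w (xt w t) *m f t = H2 Down w (xt w t) *m f t *m K.
Proof.
move=> gt <-; rewrite /connection /W1 /W2 mulmxA mulmxA -Fdown // mulmxV ?mul1mx ?mulmxA //.
exact: unit_W2.
Qed.

Lemma phase_hasd i j t : gpt G Down w t ->
  hasd (fun t => t * (L0 (eps w) ord0 j - L0 (eps w) ord0 i) + l w t * (L1 (eps w) ord0 j - L1 (eps w) ord0 i)) t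
    (lam L0 L1 (eps w) (xt w t) ord0 j - lam L0 L1 (eps w) (xt w t) ord0 i).
Proof.
move=> gt; have [hd _] := hl; have h := hd w t Sw gt.
apply: hasd_eq; first apply: hasdD; [exact: hasdM (hasd_id t) (hasd_cst _ t)|exact: hasdM h (hasd_cst _ t)|].
by rewrite !mxE /=; ring.
Qed.

Lemma connection_entry i j u : gpt G Down w (line u) ->
  K i j = (invmx (H2 Down w (xt w (line u))) *m (T (xt w (line u)) *m H1 Down w (xt w (line u)))) i j *
    cexp (line u * (L0 (eps w) ord0 j - L0 (eps w) ord0 i) + l w (line u) * (L1 (eps w) ord0 j - L1 (eps w) ord0 i)).
Proof.
move=> gt; have E := intertwining gt (connection_line u).
have {E} : f (line u) *m K = invmx (H2 Down w (xt w (line u))) *m (T (xt w (line u)) *m H1 Down w (xt w (line u))) *m f (line u).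
  by rewrite -[RHS]mulmxA E -mulmxA mulKmx // (unit_down w2 gt).1.
move=> /(congr1 (fun M : 'M[C]_n => M i j)).
rewrite mul_diag_mx mul_mx_diag mxE [RHS]mxE => E.
have fi := frow_neq0 L0 L1 l w (line u) i.
apply: (mulfI fi); rewrite E [RHS]mulrCA; congr (_ * _).
rewrite !mxE -cexpD; congr cexp; ring.
Qed.

(** The expression is the derivative, along the line towards [nd], of the logarithm of the modulus
    of a ratio of model solutions. At the node [separated] and the bound on [theta_hat] make it
    negative; in [x] it is affine, so half of the gap persists nearby. *)
Lemma gap_near nd (i j : 'I_n) : (if nd is Left then (i < j)%N else (j < i)%N) -> exists c eta : R,
  [/\ 0 < c, 0 < eta & forall x, cm (x - xhat nd w) < eta ->
    complex.Re ((orient R nd)%:C * dir G w * (lam L0 L1 (eps w) x ord0 j - lam L0 L1 (eps w) x ord0 i)) <= - c].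
Proof.
move=> ij; have [c cp hc] := sep.
pose D := L1 (eps w) ord0 j - L1 (eps w) ord0 i.
have D1 : 0 < cm D + 1 by rewrite ltr_wpDl ?cm_ge0.
exists (c / 2), (c / 2 / (cm D + 1)); split; [by rewrite divr_gt0|by rewrite !divr_gt0|].
move=> x xe; pose a := gamma G * (1 + 2 * gamma G / pi).
have a2 : 0 < a < pi / 2.
  by rewrite gpi andbT mulr_gt0 // addr_gt0 // !divr_gt0 ?mulr_gt0 // pi_gt0.
pose xh := xhat nd w.
have hg : c < complex.Re ((orient R nd)%:C * dir G w * (lam L0 L1 (eps w) xh ord0 i - lam L0 L1 (eps w) xh ord0 j)).
  have tb := theta_bound g0 Sw.
  rewrite /xh; move: ij; case: (nd) => ij.
    by have [s1 s2] := hc w Sw Left i j ij; rewrite /orient mul1r; exact: (rotate_bound a2 tb cp s1 s2).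
  have [s1 s2] := hc w Sw Right j i ij.
  have -> : (orient R Right)%:C = -1 by rewrite /orient rmorphN.
  rewrite mulN1r mulNr -mulrN opprB; exact: (rotate_bound a2 tb cp s1 s2).
have E : (orient R nd)%:C * dir G w * (lam L0 L1 (eps w) x ord0 j - lam L0 L1 (eps w) x ord0 i) =
   (orient R nd)%:C * dir G w * ((x - xh) * D)
   - (orient R nd)%:C * dir G w * (lam L0 L1 (eps w) xh ord0 i - lam L0 L1 (eps w) xh ord0 j).
  by rewrite !mxE /D; ring.
rewrite E ReB.
have h1 : complex.Re ((orient R nd)%:C * dir G w * ((x - xh) * D)) <= c / 2.
  apply: le_trans (le_trans (ler_norm _) (Re_le_cm _)) _.
  have o1 : `|orient R nd| = 1 by case: (nd); rewrite /orient ?normrN normr1.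
  rewrite 3!cmM cmR o1 cm_dir !mul1r.
  have xe' : cm (x - xh) * (cm D + 1) < c / 2 by rewrite -ltr_pdivlMr.
  by apply: le_trans (ltW xe'); rewrite ler_wpM2l ?cm_ge0 // lerDl.
apply: le_trans (lerB h1 (ltW hg)) _; rewrite [X in _ - X]splitr opprD addrA subrr add0r //.
Qed.

Lemma connection_bounded nd : exists (M eta : R),
  [/\ 0 <= M, 0 < eta & forall t, gpt G Down w t -> cm (xt w t - xhat nd w) < eta ->
   mbnd (invmx (H2 Down w (xt w t)) *m (T (xt w t) *m H1 Down w (xt w t))) M].
Proof.
have [_ _ /(_ nd) [d1 [_ u1 _] l1] _ _] := w1; have [_ _ /(_ nd) [d2 [_ u2 _] l2] _ _] := w2.
have [eta [K2 [eta0 K20 hp]]] := inv_perturb (u2 w Sw).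
have [e1 e10 he1] := within_mbnd (l1 Down w Sw) ltr01.
have [e2 e20 he2] := within_mbnd (l2 Down w Sw) eta0.
have [m1 m10 hm1] := mbnd_ex (diag_mx (d1 w)).
exists `|n%:R * (K2 * (n%:R * (MT * (m1 + 1))))|, (Num.min e1 e2); split => //; first exact: min_gt0.
move=> t gt; rewrite lt_min => /andP[x1 x2]; have [g1 _ xr] := gt.
have Ot : Omega G Down w (xt w t) by exists t.
apply: mbnd_le (ler_norm _) _; apply: mbndM; first by have [] := hp _ _ (lexx _) (he2 _ Ot x2).
apply: mbndM; first exact: bT.
have -> : H1 Down w (xt w t) = diag_mx (d1 w) + (H1 Down w (xt w t) - diag_mx (d1 w)) by rewrite addrC subrK.
by apply: mbndD => //; exact: he1.
Qed.

(* The entry is a bounded function times a ratio of model solutions that decays towards [nd]. *)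
Lemma connection_offdiag nd (i j : 'I_n) : (if nd is Left then (i < j)%N else (j < i)%N) -> K i j = 0.
Proof.
move=> ij; have [c [e1 [cp e10 hg]]] := gap_near ij.
have [M [e2 [M0 e20 hM]]] := connection_bounded nd.
have [U U0 hU] := far_node g0 gpi Sw r3 (min_gt0 e10 e20).
have M1 : 0 < M + 1 by rewrite ltr_wpDl.
have pt (v : R) : (- 2^-1)%:C * period w + v%:C * ((orient R nd)%:C * dir G w) = line (orient R nd * v).
  by rewrite /line /lin rmorphM; ring.
apply: cm_le0 => e e0.
pose S t := t * (L0 (eps w) ord0 j - L0 (eps w) ord0 i) + l w t * (L1 (eps w) ord0 j - L1 (eps w) ord0 i).
pose X v := xt w (line (orient R nd * v)).
have near v : U <= v -> cm (X v - xhat nd w) < Num.min e1 e2.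
  by move=> Uv; have [|_ _ //] := hU nd (- 2^-1) (orient R nd * v); rewrite mulrA orient_sqr mul1r.
pose df v := complex.Re ((orient R nd)%:C * dir G w * (lam L0 L1 (eps w) (X v) ord0 j - lam L0 L1 (eps w) (X v) ord0 i)).
have hd v : is_derive v (1 : R) (fun v => complex.Re (S ((- 2^-1)%:C * period w + v%:C * ((orient R nd)%:C * dir G w)))) (df v).
  by apply: Re_derive; rewrite pt; exact: phase_hasd.
have hb v : U <= v -> df v <= - c.
  by move=> /near; rewrite lt_min => /andP[x1 _]; exact: hg.
have [V UV hV] := decay_right cp hd hb (divr_gt0 e0 M1).
have := near V UV; rewrite lt_min => /andP[_ x2].
have := hV V (lexx _); rewrite pt => hr.
rewrite (connection_entry i j (lineP (orient R nd * V))) cmM cm_cexp.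
apply: (@le_trans _ _ (M * (e / (M + 1)))).
  by apply: ler_pM => //; [exact: cm_ge0|exact: expR_ge0|exact: (hM _ (lineP _) x2)].
by rewrite mulrCA ger_pMr // ler_pdivrMr // mul1r lerDl.
Qed.

Lemma connection_diag : K = diag_mx (\row_j K j j).
Proof.
have hK := connection_offdiag; move: K hK => k hK.
apply/matrixP => i j; rewrite !mxE; case: (ltngtP i j) => [ij|ji|/val_inj ->].
- by rewrite (hK Left) // -val_eqE /= (ltn_eqF ij) mulr0n.
- by rewrite (hK Right) // -val_eqE /= (gtn_eqF ji) mulr0n.
- by rewrite eqxx mulr1n.
Qed.

Lemma connection_comm t : f t *m K = K *m f t.
Proof. by have [k ->] : exists k, K = diag_mx k; [eexists; exact: connection_diag|exact: diag_comm]. Qed.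

Lemma transport t : gpt G Down w t -> connection t = K -> T (xt w t) *m H1 Down w (xt w t) = H2 Down w (xt w t) *m K.
Proof.
move=> gt /(intertwining gt); rewrite -[RHS]mulmxA connection_comm mulmxA => E.
exact: (can_inj (mulmxK (uf t))).
Qed.

Lemma origin_line : xt w (line 0) = 0.
Proof.
have E : ee w (line 0) = -1 by rewrite ee_half mulr0 mul0r cexp0.
have [_ e1 _] := lineP 0; rewrite xtE //; by rewrite E addNr mul0r mulr0.
Qed.

Lemma connection_origin : K = invmx (H2 Down w 0) *m (T 0 *m H1 Down w 0).
Proof.
have := transport (lineP 0) (connection_line 0); rewrite origin_line => ->.
by rewrite mulKmx // -origin_line; exact: (unit_down w2 (lineP 0)).1.
Qed.

(** [T H1 = H2 K] holds along the whole line, at whose end x tends to x_L; [T] is continuous there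
    and [K] is constant. *)
Lemma connection_limit (d1 d2 : 'rV[C]_n) : diag_mx d1 \in unitmx ->
  H1 Down w x @[x --> within (Omega G Down w) (nbhs (xhat Left w))] --> diag_mx d1 ->
  H2 Down w x @[x --> within (Omega G Down w) (nbhs (xhat Left w))] --> diag_mx d2 ->
  T q *m diag_mx d1 = diag_mx d2 *m K.
Proof.
move=> u1 l1 l2.
suff E : T q - diag_mx d2 *m K *m invmx (diag_mx d1) = 0.
  by rewrite -(subrK (diag_mx d2 *m K *m invmx (diag_mx d1)) (T q)) E add0r mulmxKV.
apply: mbnd_eq0 => e e0; have e20 : 0 < e / 2 by rewrite divr_gt0.
have [d d0 hd] := sandwich_perturb (diag_mx d2) K u1 e20.
have [e1 e10 he1] := within_mbnd l1 d0; have [e2 e2p he2] := within_mbnd l2 d0.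
have qr : cm q < Defs.rad G by have := cm_ge0 q; move: r3; rewrite -/q; lra.
have [e3 e30 he3] := mhasd_mbnd (fun i j => dmx_hasd hT i j qr) e20.
have [U U0 hU] := far_node g0 gpi Sw r3 (min_gt0 e10 (min_gt0 e2p e30)).
have [|_ _] := hU Left (- 2^-1) U; first by rewrite /orient mul1r.
rewrite !lt_min => /andP[x1 /andP[x2 x3]].
have gt := lineP U; have [gt1 _ _] := gt; have Ot : Omega G Down w (xt w (line U)) by exists (line U).
have ht := transport gt (connection_line U); have uH := (unit_down w1 gt).1.
have hx := hd _ _ (he1 _ Ot x1) (he2 _ Ot x2); rewrite -ht mulmxK // in hx.
have := mbndB hx (he3 _ x3); rewrite -splitr.
by congr mbnd; rewrite opprB addrC addrA subrK.
Qed.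

(** The failure of the transport identity on the sheet [s]: holomorphic in [t], so its vanishing
    propagates inside [Gamma s]. *)
Let Z s t := T (xt w t) *m H1 s w (xt w t) - H2 s w (xt w t) *m K.

Lemma Z_mder s t : gpt G s w t -> exists2 d : R, 0 < d & forall z, cm (z - t) < d -> mder (Z s) z.
Proof.
move=> gt; have [d d0 hd] := gpt_open c00 gt; exists d => // z /hd gz; have [_ ez xz] := gz.
have hx := xt_hasd ez.
apply: mderD; [apply: mderM; [apply: mder_comp hx _|apply: mder_comp hx _]|apply/mderN/mderM; [apply: mder_comp hx _|exact: mder_cst]].
- by move=> i j; eexists; exact: (dmx_hasd hT).
- exact: (unit_down w1 gz).2.
- exact: (unit_down w2 gz).2.
Qed.

Lemma Z_down u : mzero_near (Z Down) (lin G w (- 2^-1) u).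
Proof.
have [d d0 hd] := connection_near u; exists d => // t /hd [gt kt].
by rewrite /Z transport // subrr.
Qed.

(* [Z Up] on the line [m = 1/2] is [Z Down] on [m = -1/2], by the gluing on [Omega_center]. *)
Lemma Z_up u : mzero_near (Z Up) (lin G w 2^-1 u).
Proof.
have [d d0 hd] := connection_near u.
have [d' d'0 hd'] := gpt_open c00 (middle_up g0 gpi Sw c00 c01 k0 h0 rs u).
exists (Num.min d d'); first exact: min_gt0.
move=> t; rewrite lt_min => /andP[t1 t2].
have gt := hd' t t2.
have E : t = (t - period w) + 1%:~R * period w by rewrite -[1%:~R]/(1 : C) mul1r subrK.
have [gt' kt'] : gpt G Down w (t - period w) /\ connection (t - period w) = K.
  apply: hd; have -> // : t - period w - line u = t - lin G w 2^-1 u.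
  have -> : lin G w 2^-1 u = line u + 1%:C * period w by rewrite lin_addP; congr lin; lra.
  by rewrite rmorph1 mul1r; ring.
have [_ e' x'] := gt'.
have xE : xt w t = xt w (t - period w) by rewrite {1}E xt_period.
have Oc : Omega_center G w (xt w (t - period w)).
  exists (t - period w); last by [].
  by split; [case: gt'|rewrite /= subrK; case: gt].
have same (B : C -> C -> 'M[C]_n) (H : side -> C -> C -> 'M[C]_n) (Cs : node -> C -> 'M[C]_n) :
    weak_collection G B F Cs H -> H Up w (xt w (t - period w)) = H Down w (xt w (t - period w)).
  move=> hw; have [uH _] := unit_down hw gt'; have [_ _ _ _ /(_ w Sw) [_ _ /(_ _ Oc)]] := hw => e1.
  by rewrite -[LHS]mul1mx -(mulmxV uH) -mulmxA e1 mulmx1.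
by rewrite /Z xE (same _ _ _ w1) (same _ _ _ w2) transport // subrr.
Qed.

(** Far out towards [nd] the two sheets meet at the crossing, where [T H1 = H2 K] holds for both
    [H Down] and [H Up]. Eliminating [T] and writing [H Up] as [H Down F C F^-1] leaves the
    relation, since [K] commutes with [F]. *)
Lemma connection_stokes nd : C2 nd w *m K = K *m C1 nd w.
Proof.
have [U U0 hU] := far_gpt g0 gpi Sw c00 c01 k0 h0 r3.
have [u hu] : exists u, U <= orient R nd * u by exists (orient R nd * U); rewrite mulrA orient_sqr mul1r.
have seg (m m' t : R) : lin G w m u + t%:C * (lin G w m' u - lin G w m u) = lin G w (m + t * (m' - m)) u.
  by rewrite /lin !rmorphD rmorphM rmorphB; ring.
have [cr1 cr2] : - 4^-1 <= crossing G w nd /\ crossing G w nd <= 4^-1.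
  by have := crossing_small g0 gpi Sw c00 c01 nd; rewrite ler_norml => /andP.
have gD m : - 2^-1 <= m <= crossing G w nd -> gpt G Down w (lin G w m u) by have [] := hU nd m u hu.
have gU m : crossing G w nd <= m <= 2^-1 -> gpt G Up w (lin G w m u) by have [_ []] := hU nd m u hu.
set tc := lin G w (crossing G w nd) u.
have c2 : - 2^-1 <= crossing G w nd <= 2^-1 by apply/andP; split; lra.
have [c3 c4] := andP c2.
have zD : mzero_near (Z Down) tc.
  apply: (@identity_segment_mx R n _ (lin G w (- 2^-1) u)); last exact: Z_down.
  move=> t /andP[t0 t1]; rewrite seg; apply: Z_mder; apply: gD; apply/andP; split; nra.
have zU : mzero_near (Z Up) tc.
  apply: (@identity_segment_mx R n _ (lin G w 2^-1 u)); last exact: Z_up.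
  move=> t /andP[t0 t1]; rewrite seg; apply: Z_mder; apply: gU; apply/andP; split; nra.
have gDc : gpt G Down w tc by apply: gD; rewrite c3 lexx.
have gUc : gpt G Up w tc by apply: gU; rewrite c4 lexx.
have at0 s : mzero_near (Z s) tc -> T (xt w tc) *m H1 s w (xt w tc) = H2 s w (xt w tc) *m K.
  by move=> [e e0 he]; apply/eqP; rewrite -subr_eq0; apply/eqP; apply: he; rewrite subrr cm0.
have EU := at0 _ zU; have ED := at0 _ zD.
have On : Omega_node G nd w (xt w tc).
  exists tc => //; split; first by split; [case: gDc|case: gUc].
  have [_ [_]] := hU nd (crossing G w nd) u hu => /(_ ltac:(by rewrite ler_norml)).
  by rewrite /tc; case: (nd); rewrite /orient /= ?mul1r ?mulN1r ?oppr_gt0.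
have [_ _ _ _ /(_ w Sw) [_ /(_ nd _ On) e1 _]] := w1; have [_ _ _ _ /(_ w Sw) [_ /(_ nd _ On) e2 _]] := w2.
have uh1 := (unit_down w1 gDc).1; have uh2 := (unit_down w2 gDc).1; have ufc := uf tc.
have cKf : K *m f tc = f tc *m K by rewrite connection_comm.
rewrite Fdown // in e1 e2.
move: EU ED e1 e2 uh1 uh2 ufc cKf; move: (T _) (H1 Down _ _) (H1 Up _ _) (H2 Down _ _) (H2 Up _ _) K (f tc) (C1 nd w) (C2 nd w).
move=> t d1 u1 d2 u2 k ft c1 c2' EU ED e1 e2 uh1 uh2 ufc cKf.
have E1 : u1 = d1 *m (ft *m c1 *m invmx ft) by rewrite -e1 mulKVmx.
have E2 : u2 = d2 *m (ft *m c2' *m invmx ft) by rewrite -e2 mulKVmx.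
have cV : invmx ft *m k = k *m invmx ft.
  have := congr1 (fun M => invmx ft *m M *m invmx ft) cKf.
  by rewrite mulmxA mulmxK // mulKmx.
move: EU; rewrite E1 E2 mulmxA ED -!mulmxA => /(can_inj (mulKmx uh2)).
rewrite cV !mulmxA cKf -!mulmxA => /(can_inj (mulKmx ufc)).
have ui : invmx ft \in unitmx by rewrite unitmx_inv.
by rewrite !mulmxA => /(can_inj (mulmxK ui)) ->.
Qed.

Lemma connection_summary : exists k : 'rV[C]_n,
  [/\ diag_mx k = invmx (H2 Down w 0) *m (T 0 *m H1 Down w 0),
      (forall nd, C2 nd w *m diag_mx k = diag_mx k *m C1 nd w) &
      forall d1 d2 : 'rV[C]_n, diag_mx d1 \in unitmx ->
        H1 Down w x @[x --> within (Omega G Down w) (nbhs (xhat Left w))] --> diag_mx d1 ->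
        H2 Down w x @[x --> within (Omega G Down w) (nbhs (xhat Left w))] --> diag_mx d2 ->
        forall j, T q j j * d1 ord0 j = d2 ord0 j * k ord0 j].
Proof.
exists (\row_j K j j); rewrite -connection_diag; split; [exact: connection_origin|exact: connection_stokes|].
move=> d1 d2 u1 l1 l2 j; have := connection_limit u1 l1 l2.
move=> /(congr1 (fun M : 'M[C]_n => M j j)); rewrite mul_mx_diag mul_diag_mx mxE [RHS]mxE => ->.
by rewrite [in RHS]mxE.
Qed.

End Necessity.

(** * Analytic equivalences on a fixed polydisc *)

Section EquivalenceData.
Variables (R : realType) (n : nat).
Local Notation C := R[i].

Definition equivalence_on (B1 B2 P : C -> C -> 'M[C]_n) (r M : R) :=
  [/\ 0 < r, 0 <= M, (forall e, cm e < r -> holmx r (P e)) & forall e x, cm e < r -> cm x < r ->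
   [/\ P e x \in unitmx, mbnd (P e x) M,
     (x ^+ 2 - e) *: dmx (P e) x = B2 e x *m P e x - P e x *m B1 e x &
     differentiable (fun p : C * C => P p.1 p.2) (e, x)]].

Lemma equivalence_data (B1 B2 : C -> C -> 'M[C]_n) : analytically_equivalent B1 B2 ->
  exists P r M, equivalence_on B1 B2 P r M.
Proof.
move=> [P [aP u0 hg]]; exists P.
have [r1 [M [r10 M0 _ hol2 bnd]]] := germ2_entries aP.
have [r2 r20 h2] := (nbhs_pairP _ _).1 aP.
have [r3 r30 h3] := (nbhs_pairP _ _).1 hg.
have [eta [K [eta0 K0 hu]]] := inv_perturb u0.
have d0 : differentiable (fun p : C * C => P p.1 p.2) (0, 0) by apply: h2; rewrite subrr cm0.
have nb : nbhs (P 0 0) [set N : 'M[C]_n | mbnd (N - P 0 0) eta].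
  apply/nbhs_mxP; exists eta => // N hN i j.
  by have := hN i j; rewrite [(N - _) i j]mxE [(- _ : 'M[C]_n) i j]mxE => /ltW.
have [r4 r40 h4] := (nbhs_pairP _ _).1 (differentiable_continuous d0 nb).
pose r := Num.min (Num.min r1 r2) (Num.min r3 r4).
exists r, M; split; [exact: (min_gt0 (min_gt0 r10 r20) (min_gt0 r30 r40))|exact: M0| |].
  move=> e; rewrite /r !lt_min => /andP[/andP[e1 _] _] i j.
  by apply: hol_le (hol2 e e1 i j); rewrite !ge_min lexx.
move=> e x; rewrite /r !lt_min => /andP[/andP[e1 e2] /andP[e3 e4]] /andP[/andP[x1 x2] /andP[x3 x4]].
have ue : P e x \in unitmx by have [] := hu (P e x) eta (lexx _) (h4 e x ltac:(by rewrite subr0) ltac:(by rewrite subr0)).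
split; [exact: ue|exact: bnd| |].
  have := h3 e x ltac:(by rewrite subr0) ltac:(by rewrite subr0); rewrite /= /gauge => <-.
  rewrite mulmxKV // addrK; congr (_ *: _); apply: dmxE => i j.
  by apply: derivable_mx_hasd; apply: derivable_slice2_mx; apply: h2; rewrite subr0.
by apply: h2; rewrite subr0.
Qed.

(** At the origin the equation degenerates to [[Lambda(0,0), P(0,0)] = 0]; distinct eigenvalues make
    [P(0,0)] diagonal, and it is invertible. *)
Lemma equivalence_diag (L0 L1 : C -> 'rV[C]_n) (R1 R2 P : C -> C -> 'M[C]_n) r M : prenormal_model L0 L1 ->
  equivalence_on (prenormal L0 L1 R1) (prenormal L0 L1 R2) P r M -> forall j, P 0 0 j j != 0.
Proof.
move=> [_ _ hgap] [r0 _ _ /(_ 0 0)]; rewrite cm0 => /(_ r0 r0) [u0 _ ode _].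
have D i j : i != j -> P 0 0 i j = 0.
  move=> ij; move: ode; rewrite prenormal_comm expr0n subr0 !scale0r !addr0.
  move=> /(congr1 (fun N : 'M[C]_n => N i j)); rewrite adlE mxE => /esym/eqP; rewrite mulf_eq0 => /orP[|/eqP//].
  have gE (a b : 'I_n) : (a < b)%N -> L0 0 ord0 a - L0 0 ord0 b != 0.
    move=> ab; have := hgap a b ab; rewrite /gap0 /lam scale0r addr0; apply: contraTneq => ->; by rewrite ltxx.
  case: (ltngtP i j) => [lij|lji|/val_inj E]; [by rewrite (negbTE (gE _ _ lij))| |by rewrite E eqxx in ij].
  by rewrite -oppr_eq0 opprB (negbTE (gE _ _ lji)).
have E : P 0 0 = diag_mx (\row_j P 0 0 j j).
  apply/matrixP => i j; rewrite !mxE; case: (eqVneq i j) => [->|ij]; first by rewrite mulr1n.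
  by rewrite mulr0n D.
have u1 : diag_mx (\row_j P 0 0 j j) \in unitmx by rewrite -E.
by move=> j; have := (unit_diag _).1 u1 j; rewrite mxE.
Qed.

End EquivalenceData.

Section ParameterSector.
Variables (R : realType) (G : geometry R).
Local Notation C := R[i].

Lemma sector_open w : param_sector G w -> \forall v \near w, param_sector G v.
Proof.
move=> [h1 /andP[h2 h3]]; apply/nbhs_cmP.
have rp : 0 < Defs.rho G by apply: lt_trans h1; exact: expR_gt0.
have h1' : complex.Re w < ln (Defs.rho G) by rewrite -ltr_expR lnK ?posrE.
exists (Num.min (ln (Defs.rho G) - complex.Re w)
  (Num.min (arg_eps w - (pi - 2 * gamma G)) (3 * pi + 2 * gamma G - arg_eps w))).
  by apply: min_gt0; [|apply: min_gt0]; rewrite subr_gt0.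
move=> v; rewrite !lt_min => /andP[v1 /andP[v2 v3]].
have a1 := le_lt_trans (le_trans (ler_norm _) (Re_le_cm (v - w))) v1; rewrite ReB in a1.
have a2 := le_lt_trans (Im_le_cm (v - w)) v2; rewrite ImB in a2.
have a3 := le_lt_trans (Im_le_cm (v - w)) v3; rewrite ImB in a3.
split; first by rewrite /abs_eps -[ltRHS]lnK ?posrE // ltr_expR; move: a1; lra.
move: a2 a3; rewrite /arg_eps !ltr_norml => /andP[a2 _] /andP[_ a3]; apply/andP; split; lra.
Qed.

Lemma eps_tilde (w : C) : eps (tilde w) = eps w.
Proof. by rewrite /eps /tilde cexpD -[X in _ * cexp X](_ : 1%:~R * tpi R = _) ?cexp_tpi ?mulr1 // mul1r. Qed.

End ParameterSector.

Section CollectionEquivalence.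
Variables (R : realType) (n : nat) (G : geometry R).
Local Notation C := R[i].
Variables (L0 L1 : C -> 'rV[C]_n) (R1 R2 : C -> C -> 'M[C]_n).
Variables (F H1 H2 : side -> C -> C -> 'M[C]_n) (C1 C2 : node -> C -> 'M[C]_n) (l : C -> C -> C).
Variables (P : C -> C -> 'M[C]_n) (r M : R).
Hypotheses (g0 : 0 < gamma G) (gpi : gamma G * (1 + 2 * gamma G / pi) < pi / 2).
Hypotheses (c00 : 0 <= Defs.c0 G) (c01 : Defs.c0 G <= pi * slope G / 4) (k0 : 0 < kappa G) (h0 : 0 < Defs.h G).
Hypotheses (r0 : 0 < Defs.rad G) (rr : Defs.rad G <= r).
Hypotheses (rhor : Defs.rho G <= r) (rhos : Defs.rho G <= (Defs.rad G / (3 + spread G)) ^+ 2).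
Hypotheses (hL : prenormal_model L0 L1) (hl : log_in_time G L0 L1 F l) (sep : Defs.separated L0 L1 G).
Hypotheses (w1 : weak_collection G (prenormal L0 L1 R1) F C1 H1)
           (w2 : weak_collection G (prenormal L0 L1 R2) F C2 H2).
Hypothesis hP : equivalence_on (prenormal L0 L1 R1) (prenormal L0 L1 R2) P r M.

Let sp : 0 < 3 + spread G. Proof. have := spread_ge1 g0 gpi; lra. Qed.

Lemma sector_small w : param_sector G w ->
  [/\ cm (eps w) < r, cm (sqrt_eps w) < r, 3 * cm (sqrt_eps w) < Defs.rad G & spread G * cm (sqrt_eps w) < Defs.rad G].
Proof.
move=> [wr _]; have q0 := cm_sqrt_eps_gt0 w.
have q1 : cm (sqrt_eps w) < Defs.rad G / (3 + spread G).
  rewrite -(@ltr_pXn2r R 2) ?nnegrE ?(ltW q0) //; last by rewrite divr_ge0 // ltW.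
  by rewrite cm_sqrt_epsX; apply: lt_le_trans wr rhos.
move: q1; rewrite ltr_pdivlMr // => q1; have s1 := spread_ge1 g0 gpi.
have sq : cm (sqrt_eps w) <= spread G * cm (sqrt_eps w) by rewrite ler_peMl // ltW.
split; first by rewrite cm_eps; apply: lt_le_trans wr rhor.
- by apply: lt_le_trans rr; move: q1 sq q0; lra.
- by move: q1 sq q0; lra.
- by move: q1 q0; lra.
Qed.

Lemma connection_at w : param_sector G w -> exists k : 'rV[C]_n,
  [/\ diag_mx k = invmx (H2 Down w 0) *m (P (eps w) 0 *m H1 Down w 0),
      (forall nd, C2 nd w *m diag_mx k = diag_mx k *m C1 nd w) &
      forall d1 d2 : 'rV[C]_n, diag_mx d1 \in unitmx ->
        H1 Down w x @[x --> within (Omega G Down w) (nbhs (xhat Left w))] --> diag_mx d1 ->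
        H2 Down w x @[x --> within (Omega G Down w) (nbhs (xhat Left w))] --> diag_mx d2 ->
        forall j, P (eps w) (sqrt_eps w) j j * d1 ord0 j = d2 ord0 j * k ord0 j].
Proof.
move=> Sw; have [s1 s2 s3 s4] := sector_small Sw; have [_ _ hol hp] := hP.
have hx x : cm x < Defs.rad G -> cm x < r by move=> xr; apply: lt_le_trans rr.
apply: (connection_summary g0 gpi Sw c00 c01 k0 h0 s3 s4 hl w1 w2 sep (T := P (eps w)) (MT := M)).
- by move=> i j; apply: hol_le rr (hol _ s1 i j).
- by move=> x /hx xr; have [] := hp _ _ s1 xr.
- by move=> x /hx xr; have [] := hp _ _ s1 xr.
Qed.

(** The two expressions for [k] serve different conditions: the quotient of limits at x_L is visibly
    analytic with a nonsingular limit at eps = 0, while the product of values at [x = 0] gives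
    invertibility and the estimate over [S_cap]. *)
Theorem collections_of_equivalent : equivalent_collections G C1 C2.
Proof.
have FS := @S_to0_filter R G.
have [hA1 _ /(_ Left) [d1 [a1 u1 [e1 ue1 c1]] l1] A1 _] := w1.
have [hA2 _ /(_ Left) [d2 [a2 u2 [e2 ue2 c2]] l2] A2 _] := w2.
have [rp M0 hol hp] := hP.
pose k w : 'rV[C]_n := \row_j (P (eps w) (sqrt_eps w) j j * d1 w ord0 j / d2 w ord0 j).
have kE w : param_sector G w -> [/\ diag_mx (k w) = invmx (H2 Down w 0) *m (P (eps w) 0 *m H1 Down w 0),
    (forall nd, C2 nd w *m diag_mx (k w) = diag_mx (k w) *m C1 nd w) & diag_mx (k w) \in unitmx].
  move=> Sw; have [K [K1 K2 K3]] := connection_at Sw.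
  have -> : k w = K.
    apply/rowP => j; rewrite mxE (K3 _ _ (u1 w Sw) (l1 Down w Sw) (l2 Down w Sw) j).
    by rewrite mulrAC mulfV ?mul1r //; exact: (unit_diag _).1 (u2 w Sw) j.
  split=> //; have [s1 s2 s3 s4] := sector_small Sw.
  have gt := middle_down g0 gpi Sw c00 c01 k0 h0 s4 0.
  have O0 : Omega G Down w 0.
    by exists (lin G w (- 2^-1) 0); [case: gt|exact: (origin_line g0 gpi Sw c00 c01 k0 h0 s4)].
  have v1 := (hA1 Down w 0 Sw O0).1; have v2 := (hA2 Down w 0 Sw O0).1.
  have [v3 _ _ _] := hp (eps w) 0 s1 ltac:(by rewrite cm0).
  by rewrite K1 !unitmx_mul unitmx_inv v1 v2 v3.
exists k; split.
- split.
  + move=> w Sw; apply: filterS (sector_open Sw) => v Sv.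
    apply: differentiable_mx => i j; rewrite ord1.
    have [s1 s2 _ _] := sector_small Sv.
    have df (d : C -> 'rV[C]_n) : analytic_on (param_sector G) d -> exists b, hasd (fun w => d w ord0 j) v b.
      move=> /(_ v Sv) /nbhs_singleton dv; eexists; apply: derivable_hasd.
      by apply/derivable1_diffP; exact: differentiable_entry.
    have [b1 hb1] := df d1 a1; have [b2 hb2] := df d2 a2.
    have [_ _ _ dP] := hp _ _ s1 s2.
    have cq : exists b, hasd (@sqrt_eps R) v b.
      by eexists; apply: (hasd_comp (f := @cexp R) (g := fun w => w / 2)); [exact: hasdM (hasd_id v) (hasd_cst 2^-1 v)|exact: hasd_cexp].
    have [b3 hb3] := cq.
    have dE : derivable (fun w : C => P (eps w) (sqrt_eps w) j j) v (1 : C).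
      apply/derivable1_diffP.
      apply: (differentiable_comp (f := fun w : C => (eps w, sqrt_eps w)) (g := fun p : C * C => P p.1 p.2 j j)).
        by apply: differentiable_pair; apply/derivable1_diffP; apply: hasd_derivable; [exact: hasd_cexp|exact: hb3].
      exact: differentiable_entry dP.
    have nz : d2 v ord0 j != 0 := (unit_diag _).1 (u2 v Sv) j.
    apply/derivable1_diffP; apply: hasd_derivable.
    apply: hasd_near (hasdM (hasdM (derivable_hasd dE) hb1) (hasdV nz hb2)).
    by exists 1 => // z _; rewrite mxE.
  + by move=> w Sw; have [] := kE w Sw.
  + exists (\row_j (P 0 0 j j * e1 ord0 j / e2 ord0 j)).
      have p0 := equivalence_diag hL hP.
      apply/unit_diag => j; rewrite mxE !mulf_neq0 ?invr_eq0 //.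
        exact: (unit_diag _).1 ue1 j.
      exact: (unit_diag _).1 ue2 j.
    have dP0 : differentiable (fun p : C * C => P p.1 p.2) (0, 0) by have [] := hp 0 0; rewrite ?cm0.
    have cP j : P (eps w) (sqrt_eps w) j j @[w --> S_to0 G] --> P 0 0 j j.
      apply/cvg_cmP => e e0.
      have nb : nbhs (P 0 0 j j) [set z : C | cm (z - P 0 0 j j) < e] by apply/nbhs_cmP; exists e.
      have [d dp hd] := (nbhs_pairP _ _).1 (differentiable_continuous (differentiable_entry j j dP0) nb).
      (* The square accounts for [sqrt_eps], whose modulus must be below [d] as well. *)
      exists (Num.min d (d ^+ 2)); first by apply: min_gt0 => //; rewrite exprn_gt0.
      move=> w [_]; rewrite lt_min => /andP[wd1 wd2]; apply: (hd (eps w) (sqrt_eps w)).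
        by rewrite subr0 cm_eps.
      rewrite subr0 -(@ltr_pXn2r R 2) ?nnegrE ?cm_ge0 ?(ltW dp) //; by rewrite cm_sqrt_epsX.
    have ce j : k w ord0 j @[w --> S_to0 G] --> P 0 0 j j * e1 ord0 j / e2 ord0 j.
      have -> : (fun w => k w ord0 j) = (fun w => P (eps w) (sqrt_eps w) j j * d1 w ord0 j * (d2 w ord0 j)^-1).
        by apply/funext => w; rewrite mxE.
      apply: cvgM; first by apply: cvgM; [exact: cP|exact: S_entry].
      by apply: cvgV; [exact: (unit_diag _).1 ue2 j|exact: S_entry].
    move=> A /nbhs_mxP [d dp hd].
    have [t t0 ht] : S_to0 G [set v | forall j, cm (k v ord0 j - P 0 0 j j * e1 ord0 j / e2 ord0 j) < d].
      apply: (@filter_forall C 'I_n (fun j v => cm (k v ord0 j - P 0 0 j j * e1 ord0 j / e2 ord0 j) < d) (S_to0 G) FS) => j.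
      by have /cvg_cmP /(_ d dp) := ce j.
    exists t => // w hw; apply: hd => i j; rewrite ord1 [X in _ - X]mxE; exact: ht.
- have [m1 [M1 [m10 M10 b1]]] := A1; have [m2 [M2 [m20 M20 b2]]] := A2.
  exists (n%:R * (n%:R * (n%:R * (M2 * m2) * M2) * (n%:R * (M * M1))) + n%:R * (M2 * (n%:R * (M * m1)))).
    by rewrite addr_ge0 // !mulr_ge0 ?ler0n.
  move=> w Sc; have [Sw St] := Sc.
  have [x1 y1] := b1 w Sc; have [x2 y2] := b2 w Sc.
  have [_ p1 _] := y1 w (or_introl erefl); have [_ p1' _] := y1 _ (or_intror erefl).
  have [v2 _ p2] := y2 w (or_introl erefl); have [v2' _ p2'] := y2 _ (or_intror erefl).
  (* [P (eps w) 0] is the same at both points of the covering, so only the values of [H1] and [H2]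
     at 0 differ, by [O(abs_eps w)]. *)
  have [-> _ _] := kE w Sw; have [-> _ _] := kE _ St; rewrite eps_tilde.
  have [s1 _ _ _] := sector_small Sw; have [_ pX _ _] := hp (eps w) 0 s1 ltac:(by rewrite cm0).
  have a0 : 0 <= abs_eps w by rewrite expR_ge0.
  apply: mbnd_norm_mx; first by rewrite mulr_ge0 // addr_ge0 // !mulr_ge0 ?ler0n.
  move: x1 x2 p1 v2 p2 v2' p2' pX.
  move: (H1 Down w 0) (H1 Down (tilde w) 0) (H2 Down w 0) (H2 Down (tilde w) 0) (P _ _) => B B' A A' X x1 x2 p1 v2 p2 v2' p2' pX.
  have -> : invmx A *m (X *m B) - invmx A' *m (X *m B') =
     - (invmx A *m (A - A') *m invmx A' *m (X *m B)) + invmx A' *m (X *m (B - B')).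
    rewrite mulmxBr mulVmx // mulmxBl mul1mx mulmxK // mulmxBl opprB !mulmxBr.
    by rewrite addrA subrK.
  have := mbndD (mbndN (mbndM (mbndM (mbndM p2 x2) p2') (mbndM pX p1))) (mbndM p2' (mbndM pX x1)).
  by congr mbnd; ring.
- move=> nd w Sw; have [_ /(_ nd) E u] := kE w Sw.
  by rewrite -E mulmxK.
Qed.

End CollectionEquivalence.

(** * The equivalence criterion *)

Section SmallConstants.
Variables (R : realType) (n : nat) (L0 L1 : R[i] -> 'rV[R[i]]_n) (g : R).
Local Notation C := R[i].

Lemma theta0_le : theta0 L0 L1 <= pi / 2.
Proof.
rewrite /theta0; set A := (X in sup X); have [ne|no] := pselect (A !=set0).
  by apply: sup_le_ub => // b [/andP[_ /ltW]].
have -> : A = set0 by apply/seteqP; split=> // a Aa; case: no; exists a.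
by rewrite sup0 divr_ge0 // pi_ge0.
Qed.

Lemma small_constants_mono (Phi Psi : geometry R -> Prop) :
  (forall G, 0 <= Defs.c0 G -> Phi G -> Psi G) -> for_small_constants L0 L1 g Phi -> for_small_constants L0 L1 g Psi.
Proof.
move=> h [r0 r00 hr]; exists r0; first exact: r00.
move=> r rr d d0 ns k kk; have [c1 c10 hc] := hr r rr d d0 ns k kk; exists c1; first exact: c10.
move=> c cc hh hhh; have [rho0 rho00 hrho] := hc c cc hh hhh; exists rho0; first exact: rho00.
move=> rho rr' G sep; apply: h; first by have [/ltW] := andP cc.
exact: hrho.
Qed.

Theorem equivalence_criterion (R1 R2 : C -> C -> 'M[C]_n) : prenormal_model L0 L1 -> 0 < g -> g * (1 + 2 * g / pi) < theta0 L0 L1 ->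
  analytic_germ2 R1 -> analytic_germ2 R2 ->
  for_small_constants L0 L1 g (fun G => forall F l, log_in_time G L0 L1 F l -> forall C1 C2 H1 H2,
    weak_collection G (prenormal L0 L1 R1) F C1 H1 -> weak_collection G (prenormal L0 L1 R2) F C2 H2 ->
    (analytically_equivalent (prenormal L0 L1 R1) (prenormal L0 L1 R2) <-> equivalent_collections G C1 C2)).
Proof.
move=> hL g0 gth aR1 aR2; have gpi := lt_le_trans gth theta0_le.
(* The bound on [r] has to be fixed before it is known whether the families are equivalent: by
   excluded middle it is the radius of some equivalence, or 1. *)
have [rP rP0 hP] : exists2 rP : R, 0 < rP & analytically_equivalent (prenormal L0 L1 R1) (prenormal L0 L1 R2) ->
    exists P M, equivalence_on (prenormal L0 L1 R1) (prenormal L0 L1 R2) P rP M.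
  have [e|ne] := pselect (analytically_equivalent (prenormal L0 L1 R1) (prenormal L0 L1 R2)); last by exists 1.
  have [P [rP [M hP]]] := equivalence_data e; exists rP; first by case: hP.
  by move=> _; exists P, M.
exists rP; first exact: rP0.
move=> r /andP[r0 rr] d d0 _ k kk.
(* [slope] and [spread] depend on [gamma] alone, so placeholders stand for the constants still to be
   chosen. *)
pose G0 := Geometry g r d k 0 0 0.
have s0 : 0 < slope G0 := slope_gt0 (G := G0) g0 gpi.
have sp : 1 <= spread G0 := spread_ge1 (G := G0) g0 gpi.
exists (pi * slope G0 / 4); first by rewrite divr_gt0 // mulr_gt0 // pi_gt0.
move=> c /andP[c0 c1] h hh.
exists (Num.min rP ((r / (3 + spread G0)) ^+ 2)).
  by apply: min_gt0; rewrite // exprn_gt0 // divr_gt0 // addr_gt0 // (lt_le_trans ltr01).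
move=> rho /andP[rho0]; rewrite lt_min => /andP[rho1 rho2] G sep F l hl C1 C2 H1 H2 w1 w2.
have [k0 k1] := andP kk; have [h0 h1] := andP hh.
split=> [/hP[P [M eP]]|[K [nk _ hC]]].
  exact: (@collections_of_equivalent R n G L0 L1 R1 R2 F H1 H2 C1 C2 l P rP M g0 gpi (ltW c0) (ltW c1) k0 h0 r0 (ltW rr)
    (ltW rho1) (ltW rho2) hL hl sep w1 w2 eP).
exact: (@equivalent_of_collections R n G L0 L1 R1 R2 F H1 H2 C1 C2 l K (ltW c0) g0 r0 kk hh rho0 hl nk w1 w2 hC hL aR1 aR2).
Qed.

Lemma equivalent_to_identity (G : geometry R) (C1 : node -> C -> 'M[C]_n) :
  equivalent_collections G C1 (fun _ _ => 1%:M) <-> forall l w, param_sector G w -> C1 l w = 1%:M.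
Proof.
split=> [[k [[_ uk _] _ hC]] l w Sw|hC].
  have u := uk w Sw; have := hC l w Sw => /(congr1 (fun A => invmx (diag_mx (k w)) *m A *m diag_mx (k w))).
  by rewrite mulmx1 mulVmx // -!mulmxA mulVmx // mulmx1 mulKmx.
exists (fun=> const_mx 1); split; first exact: nonsingular_cst.
  by exists 0 => // w _; rewrite subrr normr0 mul0r.
by move=> l w Sw; rewrite hC // diag_const_mx mul1mx mulmxV // unitmx1.
Qed.

End SmallConstants.

Theorem theorem4p62 (R : realType) (n : nat) (hn : (2 <= n)%N)
    (L0 L1 : R[i] -> 'rV[R[i]]_n) (hL : prenormal_model L0 L1)
    (g : R) (hg0 : 0 < g) (hg : g * (1 + 2 * g / pi) < theta0 L0 L1) :
  (forall R1 R2 : R[i] -> R[i] -> 'M[R[i]]_n,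
     analytic_germ2 R1 -> analytic_germ2 R2 ->
     for_small_constants L0 L1 g (fun G =>
       forall F, model_solutions G L0 L1 F ->
       forall C1 C2 : node -> R[i] -> 'M[R[i]]_n,
       stokes_collection G (prenormal L0 L1 R1) F C1 ->
       stokes_collection G (prenormal L0 L1 R2) F C2 ->
       (analytically_equivalent (prenormal L0 L1 R1) (prenormal L0 L1 R2) <->
        equivalent_collections G C1 C2)))
  /\
  (forall R1 : R[i] -> R[i] -> 'M[R[i]]_n,
     analytic_germ2 R1 ->
     for_small_constants L0 L1 g (fun G =>
       forall F, model_solutions G L0 L1 F ->
       forall C1 : node -> R[i] -> 'M[R[i]]_n,
       stokes_collection G (prenormal L0 L1 R1) F C1 ->
       (analytically_equivalent (prenormal L0 L1 R1) (model_system L0 L1) <->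
        forall l w, param_sector G w -> C1 l w = 1%:M))).
Proof.
split=> [R1 R2 aR1 aR2|R1 aR1].
  apply: small_constants_mono (equivalence_criterion hL hg0 hg aR1 aR2) => G c00 hG F hF C1 C2.
  move=> /weak_of_stokes [H1 w1] /weak_of_stokes [H2 w2]; have [l hl] := model_log c00 hF.
  exact: (hG F l hl C1 C2 H1 H2).
(* The model is the family with [R = 0]; by [weak_model] its matrices [H] and Stokes matrices may be
   taken to be the identity, and only the identity is conjugate to the identity. *)
have aR2 : analytic_germ2 (fun _ _ : R[i] => 0 : 'M[R[i]]_n).
  by apply/nbhs_pairP; exists 1 => // e x _ _; exact: differentiable_cst.
have mE : prenormal L0 L1 (fun _ _ => 0) = model_system L0 L1.
  by apply/funext => e; apply/funext => x; rewrite /prenormal scaler0 addr0.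
apply: small_constants_mono (equivalence_criterion hL hg0 hg aR1 aR2) => G c00 hG F hF C1.
move=> /weak_of_stokes [H1 w1]; have [l hl] := model_log c00 hF.
by rewrite -mE (hG F l hl C1 _ H1 _ w1 (weak_model c00 hF)) equivalent_to_identity.
Qed.
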